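(* Let $L$ be a homogeneous Lévy basis on $\mathbb{R}^2$ with characteristic triplet $(\gamma,b,\nu)$, $\nu\neq0$, seed $L'$ and Blumenthal–Getoor index $\beta_\nu$, and let $X$ be the trawl process with trawl function $a$. Assume that there are $2<\kappa<3$, $c_a>0$ and a strictly positive continuous function $a'$ with $y^\kappa a'(y)\to c_a$ as $y\to\infty$ such that $a(s)=\int_s^\infty a'(y)\,\mathrm{d}y$ for all $s\ge0$. Suppose that $b=0$, $\mathbb E(|L'|^2)<\infty$, $\Delta_n\downarrow0$ and $n\Delta_n\to+\infty$. The following holds as $n\uparrow\infty$. (i) If $\beta_\nu<\kappa-1$, then $$\frac{\Delta_n}{(c_an\Delta_n)^{\frac1{\kappa-1}}}\,\mathbf S^n\ \overset{fd}{\rightarrow}\ Y,$$ where $Y$ is a strictly $(\kappa-1)$-stable Lévy process with $$\log\mathbb E(e^{izY_1})=\psi(z;\kappa-1,K_{+,\kappa},K_{-,\kappa}),\qquad z\in\mathbb R,$$ $K_{+,\kappa}=\int_0^\infty x^{\kappa-1}\nu(\mathrm{d}x)$ and $K_{-,\kappa}=\int_{-\infty}^0|x|^{\kappa-1}\nu(\mathrm{d}x)$. (ii) If $2>\beta_\nu>\kappa-1>1$, assume further that for some $\tilde K_\pm\geq 0$ with $\tilde K_++\tilde K_->0$, $x^{\beta_\nu}\nu^\pm(x)\to\tilde K_\pm$ as $x\to0^+$. Then $$\frac{1}{n\big(a(n\Delta_n)n\Delta_n\big)^{1/\beta_\nu}}\,\mathbf S^n_1\ \overset{d}{\rightarrow}\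 \xi,$$ where $\xi$ is a strictly $\beta_\nu$-stable random variable with $$\log\mathbb E(e^{iz\xi})=\psi(z;\beta_\nu,K_{+,\kappa,\beta_\nu},K_{-,\kappa,\beta_\nu}),\qquad z\in\mathbb R,$$ in which $K_{\pm,\kappa,\beta_\nu}=\varrho_a\beta_\nu\tilde K_\pm$ and $$\varrho_a=\frac1{\kappa-2}+(\kappa-1)\int_0^1(1-s)s^{\beta_\nu-\kappa}\,\mathrm{d}s+2\int_0^1s^{\beta_\nu-\kappa+1}\,\mathrm{d}s.$$
   Context: $[\cdot]$ denotes the integer part; $\mathbb{R}^+=[0,\infty)$; $\overset{d}{\rightarrow}$ is convergence in distribution and $\overset{fd}{\rightarrow}$ is convergence in distribution of all finite-dimensional distributions. Lévy basis. A homogeneous Lévy basis on $\mathbb{R}^2$ with characteristic triplet $(\gamma,b,\nu)$ ($\gamma\in\mathbb R$, $b\ge0$, $\nu$ a Lévy measure on $\mathbb R$) is a family $L=\{L(A)\}$ of real random variables, indexed by Borel sets $A\subset\mathbb{R}^2$ of finite Lebesgue measure, that is a.s. $\sigma$-additive, takes independent values on disjoint sets, and satisfies $\log\mathbb{E}e^{izL(A)}=\mathrm{Leb}(A)\psi(z)$ with $\psi(z)=i\gamma z-\frac12b^2z^2+\int_{\mathbb{R}\setminus\{0\}}(e^{izx}-1-izx\mathbf 1_{|x|\le1})\nu(\mathrm{d}x)$. The seed $L'$ is a random variable with $\log\mathbb{E}e^{izL'}=\psi(z)$. The Blumenthal–Getoor index is $\beta_\nu=\inf\{\beta>0:\int_{|x|\le1}|x|^\beta\nu(\mathrm{d}x)<\infty\}$.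 Put $\nu^+(x)=\nu((x,\infty))$ and $\nu^-(x)=\nu((-\infty,-x))$ for $x>0$. Trawl process. The trawl function $a:\mathbb{R}^+\to\mathbb{R}^+$ is non-increasing, integrable and continuous on $[0,\infty)$; $A=\{(r,y):r\le0,\ 0\le y\le a(-r)\}$, $A_t=A+(t,0)$, and $X_t=L(A_t)$, $t\in\mathbb R$. Write $\mathbf S^n=(\mathbf S^n_t)_{t\ge0}$ with $\mathbf S^n_t=\sum_{k=0}^{[nt]-1}\big(X_{k\Delta_n}-\mathbb{E}(X_{k\Delta_n})\big)$. Strictly stable exponents. For $\beta\in(0,2)$, $\beta\neq1$, $K_\pm\ge0$, $K_++K_->0$: $\psi(z;\beta,K_+,K_-)=-\varsigma|z|^\beta\big(1-i\rho\,\mathrm{sign}(z)\tan(\pi\beta/2)\big)$, where $\varsigma=\frac{\Gamma(2-\beta)}{\beta(1-\beta)}\cos(\pi\beta/2)(K_++K_-)$ and $\rho=\frac{K_+-K_-}{K_++K_-}$. This is the exponent of the strictly $\beta$-stable law with Lévy density $K_+|x|^{-1-\beta}\mathbf 1_{x>0}+K_-|x|^{-1-\beta}\mathbf 1_{x<0}$. *)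

(* Defs.v *)
From HB Require Import structures.
From mathcomp Require Export all_boot all_order all_algebra.
From mathcomp Require Export all_classical all_reals all_analysis.
From mathcomp.real_closed Require Export complex.

Set Implicit Arguments.
Unset Strict Implicit.
Unset Printing Implicit Defensive.

Export Order.TTheory GRing.Theory Num.Theory.
Export numFieldNormedType.Exports.

Local Open Scope classical_set_scope.
Local Open Scope ring_scope.
Local Open Scope complex_scope.

Section ComplexTools.
Context {R : realType}.

Definition cexp (w : R[i]) : R[i] :=
  (expR (complex.Re w))%:C *
    (cos (complex.Im w) +i* sin (complex.Im w)).

Definition cintegral d (T : measurableType d) (mu : {measure set T -> \bar R})
    (D : set T) (f : T -> R[i]) : R[i] :=
  (\int[mu]_(x in D) complex.Re (f x)) +i* (\int[mu]_(x in D) complex.Im (f x)).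

Definition charfun d (T : measurableType d) (P : probability T R)
    (X : T -> R) (z : R) : R[i] :=
  cintegral P setT (fun w => cexp (0 +i* (z * X w))).

(* The "log" in log E exp(izX) = psi(z) is the distinguished logarithm (the
   continuous branch vanishing at z = 0); for psi continuous with psi(0) = 0
   the identity says exactly that E exp(izX) = exp(psi(z)). *)
Definition has_log_charfun d (T : measurableType d) (P : probability T R)
    (X : T -> R) (psi : R -> R[i]) : Prop :=
  forall z : R, charfun P X z = cexp (psi z).

Definition Gamma (s : R) : R :=
  \int[lebesgue_measure]_(t in `]0, +oo[) (t `^ (s - 1) * expR (- t)).

End ComplexTools.

Section Independence.
Context {R : realType} {d : measure_display} {T : measurableType d}.

(* Subfamilies are covered by taking some of the B i equal to setT. *)
Definition mutually_independent (P : probability T R) n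
    (X : 'I_n -> T -> R) : Prop :=
  forall B : 'I_n -> set R, (forall i, measurable (B i)) ->
    P (\bigcap_(i in [set: 'I_n]) (X i @^-1` B i)) =
    (\prod_(i < n) P (X i @^-1` B i))%E.

End Independence.

Section ConvergenceInDistribution.
Context {R : realType}.
Context {d : measure_display} {T : measurableType d} (P : probability T R).
Context {d' : measure_display} {T' : measurableType d'} (Q : probability T' R).

Definition cvg_in_distribution (V : topologicalType)
    (X : nat -> T -> V) (Y : T' -> V) : Prop :=
  forall f : V -> R, continuous f -> (exists M : R, forall v, `|f v| <= M) ->
    ('E_P[f \o X n])%E @[n --> \oo] --> ('E_Q[f \o Y])%E.

Definition cvg_fd (X : nat -> R -> T -> R) (Y : R -> T' -> R) : Prop :=
  forall (k : nat) (t : 'I_k -> R), (forall i, 0 <= t i) ->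
    cvg_in_distribution
      (fun n w => \row_(i < k) X n (t i) w : 'rV[R]_k)
      (fun w => \row_(i < k) Y (t i) w : 'rV[R]_k).

End ConvergenceInDistribution.

Section LevyBasis.
Context {R : realType}.

Record levy_measure (nu : {measure set R -> \bar R}) : Prop := LevyMeasure {
  levy_measure_0 : nu [set 0] = 0%E ;
  levy_measure_fin :
    (\int[nu]_x (Num.min 1 (x ^+ 2))%R%:E < +oo)%E }.

Definition levy_exponent (gamma b : R) (nu : {measure set R -> \bar R})
    (z : R) : R[i] :=
  (0 +i* (gamma * z)) - (2^-1 * b ^+ 2 * z ^+ 2)%:C +
  cintegral nu [set~ 0] (fun x =>
    cexp (0 +i* (z * x)) - 1 -
    (0 +i* (z * x * \1_[set y : R | `|y| <= 1] x))).

Definition Leb2 : set (R * R) -> \bar R :=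
  (lebesgue_measure \x lebesgue_measure)%E.

Definition fin_borel (A : set (R * R)) : Prop :=
  measurable A /\ (Leb2 A < +oo)%E.

(* L is indexed by all subsets of the plane for convenience: only its values on
   Borel sets of finite Lebesgue measure are constrained (or ever used). *)
Record levy_basis d (T : measurableType d) (P : probability T R)
    (gamma b : R) (nu : {measure set R -> \bar R})
    (L : set (R * R) -> {RV P >-> R}) : Prop := LevyBasis {
  levy_basis_b_ge0 : 0 <= b ;
  levy_basis_nu : levy_measure nu ;
  levy_basis_additive : forall A : nat -> set (R * R),
    (forall i, fin_borel (A i)) -> trivIset setT A ->
    fin_borel (\bigcup_i A i) ->
    {ae P, forall w, series (fun i => L (A i) w) n @[n --> \oo] -->
                     L (\bigcup_i A i) w} ;
  levy_basis_indep : forall n (A : 'I_n -> set (R * R)),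
    (forall i, fin_borel (A i)) -> trivIset setT A ->
    mutually_independent P (fun i => L (A i)) ;
  levy_basis_law : forall A, fin_borel A ->
    has_log_charfun P (L A)
      (fun z => (fine (Leb2 A))%:C * levy_exponent gamma b nu z) }.

Definition blumenthal_getoor (nu : {measure set R -> \bar R}) : R :=
  inf [set beta : R | 0 < beta /\
    (\int[nu]_(x in [set x : R | (`|x| <= 1)%R]) (`|x| `^ beta)%R%:E < +oo)%E].

End LevyBasis.

Section Trawl.
Context {R : realType}.

Record trawl_function (a : R -> R) : Prop := TrawlFunction {
  trawl_ge0 : forall s : R, 0 <= s -> 0 <= a s ;
  trawl_nonincreasing : forall s t : R, 0 <= s -> s <= t -> a t <= a s ;
  trawl_integrable : lebesgue_measure.-integrable `[0, +oo[ (EFin \o a) ;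
  trawl_continuous : {within `[0, +oo[, continuous a} }.

Definition trawl_set (a : R -> R) : set (R * R) :=
  [set p | p.1 <= 0 /\ 0 <= p.2 <= a (- p.1)].

Definition trawl_set_at (a : R -> R) (t : R) : set (R * R) :=
  [set (p.1 + t, p.2) | p in trawl_set a].

Context {d : measure_display} {T : measurableType d} {P : probability T R}.

Definition trawl_process (a : R -> R) (L : set (R * R) -> {RV P >-> R})
    (t : R) : {RV P >-> R} := L (trawl_set_at a t).

Definition partial_sum (X : R -> {RV P >-> R}) (Delta : nat -> R)
    (n : nat) (t : R) (w : T) : R :=
  \sum_(0 <= k < Num.truncn (n%:R * t))
    (X (k%:R * Delta n) w - fine ('E_P[X (k%:R * Delta n)%R])%E).

End Trawl.

Section Stable.
Context {R : realType}.

Definition stable_scale (beta Kp Km : R) : R :=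
  Gamma (2 - beta) / (beta * (1 - beta)) * cos (pi * beta / 2) * (Kp + Km).

Definition stable_skewness (Kp Km : R) : R := (Kp - Km) / (Kp + Km).

(* Meaningful for 0 < beta < 2, beta != 1, Kp, Km >= 0 and Kp + Km > 0. *)
Definition stable_exponent (beta Kp Km z : R) : R[i] :=
  - (stable_scale beta Kp Km * `|z| `^ beta)%:C *
  (1 -i* (stable_skewness Kp Km * Num.sg z * tan (pi * beta / 2))).

Context {d : measure_display} {T : measurableType d} (Q : probability T R).

(* A Levy process indexed by [0, +oo[; the values Y t for t < 0 are junk. *)
Record levy_process (Y : R -> {RV Q >-> R}) : Prop := LevyProcess {
  levy_process_0 : {ae Q, forall w, Y 0 w = 0} ;
  levy_process_indep : forall n (t : nat -> R), t 0%N = 0 ->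
    (forall i, t i <= t i.+1) ->
    mutually_independent Q
      (fun (i : 'I_n) w => Y (t i.+1) w - Y (t i) w) ;
  levy_process_stationary : forall s t : R, 0 <= s -> 0 <= t ->
    forall B : set R, measurable B ->
    Q ((fun w => Y (s + t) w - Y s w) @^-1` B) = Q (Y t @^-1` B) ;
  levy_process_stoch_cont : forall t e : R, 0 <= t -> 0 < e ->
    Q [set w | e < `|Y s w - Y t w|] @[s --> within `[0, +oo[ (nbhs t)]
      --> 0%E ;
  levy_process_cadlag : {ae Q, forall w, forall t : R, 0 <= t ->
    (Y s w @[s --> t^'+] --> Y t w) /\
    (0 < t -> exists l : R, Y s w @[s --> t^'-] --> l)} }.

End Stable.

(* Main.v *)
From HB Require Import structures.
Require Import Defs.
From mathcomp Require Import ring lra zify measurable_realfun.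

(** Put [C z = \int (1 - cos (z x)) nu(dx)] and [D z = \int (sin (z x) - z x) nu(dx)].
    A linear combination of centred partial sums is the integral against [L] of a weighted
    count of the grid points [k Delta_n] whose trawl set contains [(r, y)]; cutting the union
    of the trawl sets into its atoms, its characteristic function is [exp (- \int C + i \int D)]
    of this count, integrated over the plane. At height [y] the trawl sets are intervals of
    length [g y], where [g] is the inverse of [a] and [g y] is of order [y^(-1/al)],
    [al = kappa - 1]. Rescaling time by [T = n Delta_n] and height by [rho], the count
    converges on almost every slice, and dominated convergence applies since [C] and [D] are
    dominated by powers on both sides of [al].

    In (i) the counts are of order [T^(1/al)], much smaller than [T]: a slice at rescaled
    height [eta] tends to the step function of the times [t_i], multiplied by
    [(al eta)^(-1/al)], and the mixture over [eta] of [C] and [D] is homogeneous of degree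
    [al]. In (ii) the relevant heights are of order [a T] and the counts of order [T], a slice
    tends to the length of an overlap of two intervals, and the power behaviour of [nu] near
    [0] makes [C] and [D] homogeneous of degree [beta_nu] in the limit. *)

Set Implicit Arguments.
Unset Strict Implicit.
Unset Printing Implicit Defensive.

Local Open Scope classical_set_scope.
Local Open Scope ring_scope.

(** * Real integrals *)

(** The slice lengths decay like a power [1 / al] of the height with [1 < al < 2], and a bound
    [K |x|^r] on [C] or [D] becomes a bound of order [eta^(- r / al)] on the slice at rescaled
    height [eta]. Hence one exponent below [al] has to control small [eta] and one above [al] large
    [eta]. In (i) the lower one is the order of a moment of [nu] close to the Blumenthal-Getoor
    index, the upper one is 2. In (ii) the upper one is [beta_nu]; no lower power bounds [C], but
    the normalised count is at most 1, and truncating the argument there yields the exponent 1. The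
    stable constants are integrals of [sin y] and [1 - cos y] against [y^(- a)], found by rotating
    the Gamma integral. Other integrals are reduced to them by integrating tails instead of
    densities, so that [nu] enters only through tail functions and power moments. Convergence of
    characteristic functions yields convergence in distribution because a bounded continuous
    function is close, on a large cube, to a trigonometric polynomial with the same bound. *)

Section Integration.
Context {R : realType}.
Local Notation leb := (@lebesgue_measure R).

Lemma Rintegral_dominated_cvg d (T : measurableType d)
    (mu : {measure set T -> \bar R}) (D : set T) (f_ : nat -> T -> R)
    (f g : T -> R) : measurable D ->
  (forall n, measurable_fun D (f_ n)) -> measurable_fun D f ->
  {ae mu, forall x, D x -> f_ n x @[n --> \oo] --> f x} ->
  mu.-integrable D (EFin \o g) ->
  (forall n x, D x -> `|f_ n x| <= g x) ->
  mu.-integrable D (EFin \o f) /\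
  \int[mu]_(x in D) f_ n x @[n --> \oo] --> \int[mu]_(x in D) f x.
Proof.
move=> mD mf_ mf ff ig fg.
have [||||If _ cf] := @dominated_convergence _ _ _ mu D mD (fun n => EFin \o f_ n)
    (EFin \o f) (EFin \o g) _ _ _ ig _.
- by move=> n; exact/measurable_EFinP.
- exact/measurable_EFinP.
- apply: filterS ff => x ff Dx; apply: cvg_EFin; first exact: nearW.
  exact: ff.
- by apply: aeW => x n Dx; rewrite lee_fin fg.
split=> //; apply: fine_cvg; rewrite fineK//.
exact: integrable_fin_num.
Qed.

Lemma le_integrable_real d (T : measurableType d)
    (mu : {measure set T -> \bar R}) (D : set T) (f g : T -> R) :
  measurable D -> measurable_fun D f -> mu.-integrable D (EFin \o g) ->
  (forall x, D x -> `|f x| <= g x) -> mu.-integrable D (EFin \o f).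
Proof.
move=> mD mf ig fg; apply: le_integrable ig => //; first exact/measurable_EFinP.
move=> x Dx /=; rewrite lee_fin (le_trans (fg x Dx))// ler_norm//.
Qed.

Lemma eq_integrable_real d (T : measurableType d)
    (mu : {measure set T -> \bar R}) (D : set T) (f g : T -> R) :
  measurable D -> {in D, f =1 g} -> mu.-integrable D (EFin \o f) ->
  mu.-integrable D (EFin \o g).
Proof.
by move=> mD fg; apply: eq_integrable => // x xD; rewrite /= fg.
Qed.

Lemma integrableZl_real d (T : measurableType d)
    (mu : {measure set T -> \bar R}) (D : set T) (f : T -> R) (c : R) :
  measurable D -> mu.-integrable D (EFin \o f) ->
  mu.-integrable D (EFin \o (fun x => c * f x)).
Proof.
move=> mD If; have := integrableZl mD c If.
by apply: eq_integrable => // x _ /=; rewrite EFinM.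
Qed.

Lemma integrableZr_real d (T : measurableType d)
    (mu : {measure set T -> \bar R}) (D : set T) (f : T -> R) (c : R) :
  measurable D -> mu.-integrable D (EFin \o f) ->
  mu.-integrable D (EFin \o (fun x => f x * c)).
Proof.
move=> mD If; apply: eq_integrable_real (integrableZl_real c mD If) => // x _ /=.
exact: mulrC.
Qed.

Lemma integrableD_real d (T : measurableType d)
    (mu : {measure set T -> \bar R}) (D : set T) (f g : T -> R) :
  measurable D -> mu.-integrable D (EFin \o f) -> mu.-integrable D (EFin \o g) ->
  mu.-integrable D (EFin \o (fun x => f x + g x)).
Proof.
move=> mD If Ig; have := integrableD mD If Ig.
by apply: eq_integrable => // x _ /=; rewrite EFinD.
Qed.

Lemma integrableB_real d (T : measurableType d)
    (mu : {measure set T -> \bar R}) (D : set T) (f g : T -> R) :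
  measurable D -> mu.-integrable D (EFin \o f) -> mu.-integrable D (EFin \o g) ->
  mu.-integrable D (EFin \o (fun x => f x - g x)).
Proof.
move=> mD If Ig; have := integrableB mD If Ig.
by apply: eq_integrable => // x _ /=; rewrite EFinB.
Qed.

Lemma Rintegral_sum d (T : measurableType d)
    (mu : {measure set T -> \bar R}) (D : set T) (I : Type) (s : seq I) (F : I -> T -> R) :
  measurable D -> (forall i, mu.-integrable D (EFin \o F i)) ->
  mu.-integrable D (EFin \o (fun x => \sum_(i <- s) F i x)) /\
  \int[mu]_(x in D) (\sum_(i <- s) F i x) = \sum_(i <- s) \int[mu]_(x in D) F i x.
Proof.
move=> mD IF; elim: s => [|i s [I1 I2]].
  rewrite (_ : (fun x => _) = cst 0); last by apply/funext => x; rewrite big_nil.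
  split; first exact: integrable0.
  by rewrite big_nil /Rintegral integral0.
rewrite (_ : (fun x => _) = (fun x => F i x + \sum_(j <- s) F j x)); last first.
  by apply/funext => x; rewrite big_cons.
split; first exact: integrableD_real.
by rewrite RintegralD// I2 big_cons.
Qed.

(** Lebesgue measure is [c] times its own image under multiplication by [c], since both give []a,
    b]] the mass [b - a]; what remains is the change of variables for an image measure. *)
Lemma ge0_lebesgue_scale (c : R) (D : set R) (f : R -> \bar R) : 0 < c ->
  measurable D -> measurable_fun D f -> (forall x, D x -> (0 <= f x)%E) ->
  (\int[leb]_(x in [set x | D (c * x)%R]) f (c * x)%R =
   c^-1%:E * \int[leb]_(x in D) f x)%E.
Proof.
move=> c0 mD mf f0.
have mc : measurable_fun [set: measurableTypeR R] ( *%R c : _ -> measurableTypeR R).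
  by apply: (@measurable_funM _ R R).
have ci0 : 0 <= c^-1 by rewrite invr_ge0 ltW.
have ci1 : 0 <= c by rewrite ltW.
pose phi : measurableTypeR R -> measurableTypeR R := *%R c.
pose m0 := mscale (NngNum ci1) (pushforward leb phi).
pose m1 : {measure set (measurableTypeR R) -> \bar R} := m0 mc.
have E : forall A : set (measurableTypeR R), measurable A -> leb A = m1 A.
  apply: lebesgue_measure_unique => X [[a b]] _ <-.
  rewrite /m1 /m0 /= /mscale /= /pushforward.
  have -> : phi @^-1` `]a, b]%classic = `]a / c, b / c]%classic.
    apply/seteqP; split=> x /=; rewrite !in_itv/= ltr_pdivrMr// ler_pdivlMr//;
     by rewrite ![_ * c]mulrC.
  rewrite !lebesgue_measure_itv/= !lte_fin ltr_pM2r ?invr_gt0//.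
  case: ifPn => _; last by rewrite mule0.
  by rewrite -!EFinB -EFinM; congr EFin; field; rewrite gt_eqF.
have <- : (c^-1%:E * \int[m1]_(x in D) f x)%E = (c^-1%:E * \int[leb]_(x in D) f x)%E.
  by congr (_ * _)%E; apply: eq_measure_integral => A mA _; exact/esym/E.
rewrite ge0_integral_mscale//= muleA -EFinM mulVf ?gt_eqF// mul1e.
rewrite (ge0_integral_pushforward mc)//.
by move=> y /set_mem Dy; exact: f0.
Qed.

Lemma integrable_lebesgue_scale (c : R) (D : set R) (f : R -> R) : 0 < c ->
  measurable D -> leb.-integrable D (EFin \o f) ->
  leb.-integrable [set x | D (c * x)] (EFin \o (fun x => f (c * x))).
Proof.
move=> c0 mD /integrableP[mf lf].
have mc : measurable_fun [set: R] ( *%R c) by apply: measurable_funM.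
have mD' : measurable [set x | D (c * x)].
  by rewrite -[X in measurable X]setTI; exact: mc.
apply/integrableP; split.
  apply: (@measurable_comp _ _ _ _ _ _ D (EFin \o f) _ ( *%R c)) => //.
  by move=> x [y] Dy <-.
rewrite (ge0_lebesgue_scale (f := abse \o (EFin \o f)) c0)//=; last exact: measurableT_comp.
by rewrite lte_mul_pinfty// lee_fin invr_ge0 ltW.
Qed.

Lemma Rintegral_lebesgue_scale (c : R) (D : set R) (f : R -> R) : 0 < c ->
  measurable D -> leb.-integrable D (EFin \o f) ->
  \int[leb]_(x in [set x | D (c * x)]) f (c * x) =
  c^-1 * \int[leb]_(x in D) f x.
Proof.
move=> c0 mD If.
have mf := measurable_int _ If.
have IS := integrable_lebesgue_scale c0 mD If.
rewrite /Rintegral [in LHS]integralE [in RHS]integralE.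
have -> : (\int[leb]_(x in [set x | D (c * x)%R]) (fun x => (f (c * x)%R)%:E)^\+ x =
    c^-1%:E * \int[leb]_(x in D) (EFin \o f)^\+ x)%E.
  rewrite -ge0_lebesgue_scale//; last exact: measurable_funepos.
  by apply: eq_integral => x _; rewrite ?funeposE ?funenegE.
have -> : (\int[leb]_(x in [set x | D (c * x)%R]) (fun x => (f (c * x)%R)%:E)^\- x =
    c^-1%:E * \int[leb]_(x in D) (EFin \o f)^\- x)%E.
  rewrite -ge0_lebesgue_scale//; last exact: measurable_funeneg.
  by apply: eq_integral => x _; rewrite ?funeposE ?funenegE.
have Ip : (\int[leb]_(x in D) (EFin \o f)^\+ x)%E \is a fin_num.
  exact: integrable_pos_fin_num.
have In : (\int[leb]_(x in D) (EFin \o f)^\- x)%E \is a fin_num.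
  exact: integrable_neg_fin_num.
transitivity (c^-1 * fine (\int[leb]_(x in D) (EFin \o f)^\+ x -
    \int[leb]_(x in D) (EFin \o f)^\- x)%E); last by [].
by rewrite -(fineK Ip) -(fineK In)/= mulrBr.
Qed.

Lemma continuous_powR_gt0 (p x : R) : 0 < x -> {for x, continuous (fun y : R => y `^ p)}.
Proof.
move=> x0; apply: differentiable_continuous; apply/derivable1_diffP.
by apply: derivable_powR; rewrite in_itv/= x0.
Qed.

Lemma is_derive_powR (p x : R) : 0 < x ->
  is_derive x 1 (fun y : R => y `^ p) (p * x `^ (p - 1)).
Proof.
move=> x0; split; first by apply: derivable_powR; rewrite in_itv/= x0.
by rewrite -derive1E powR_derive1// in_itv/= x0.
Qed.

Lemma powR_cvgy0 (p : R) : p < 0 -> x `^ p @[x --> +oo] --> (0 : R).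
Proof.
move=> p0; apply/cvgrPdist_le => e e0.
exists (Num.max 1 (e `^ p^-1)); split=> // x; rewrite gt_max => /andP[x1 xe].
have x0 : 0 < x by rewrite (lt_trans _ x1).
rewrite sub0r normrN ger0_norm ?powR_ge0//.
have -> : e = (e `^ p^-1) `^ p by rewrite -powRrM mulVf ?lt_eqF// powRr1// ltW.
have H (q : R) : q `^ p = (q `^ (- p))^-1 by rewrite -powRN opprK.
rewrite (H x) (H (e `^ _)) lef_pV2 ?posrE ?powR_gt0//.
by rewrite ge0_ler_powR ?nnegrE ?powR_ge0//; lra.
Qed.

Lemma integral_powR_tail (p s : R) : p < -1 -> 0 < s ->
  (\int[leb]_(x in `[s, +oo[) (x `^ p)%:E = (s `^ (p + 1) / - (p + 1))%:E)%E.
Proof.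
move=> p1 s0.
have p10 : p + 1 != 0 by rewrite lt_eqF//; lra.
pose F (x : R) := x `^ (p + 1) / (p + 1).
have dF (x : R) : 0 < x -> is_derive x 1 F (x `^ p).
  move=> x0; have D := is_derive_powR (p + 1) x0.
  have -> : F = (p + 1)^-1 *: (fun y : R => y `^ (p + 1)).
    by apply/funext => y; rewrite /F /= mulrC.
  apply: is_derive_eq; rewrite addrK /GRing.scale/= mulrA mulVf// mul1r//.
rewrite (@ge0_continuous_FTC2y _ (fun x => x `^ p) F s 0).
- by rewrite sub0e; congr EFin; rewrite /F invrN mulrN.
- by move=> x _; exact: powR_ge0.
- apply: continuous_in_subspaceT => x /set_mem/=; rewrite in_itv/= andbT => sx.
  exact/continuous_powR_gt0/(lt_le_trans s0).
- rewrite /F -[X in _ --> X](mul0r (p + 1)^-1); apply: cvgMl.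
  by apply: powR_cvgy0; lra.
- by move=> x sx; have [] := dF _ (lt_trans s0 sx).
- apply: cvg_at_right_filter; apply: differentiable_continuous.
  by apply/derivable1_diffP; have [] := dF _ s0.
- move=> x; rewrite in_itv/= andbT => sx.
  by rewrite derive1E; have [_] := dF _ (lt_trans s0 sx).
Qed.

Lemma integral_powR_01 (p : R) : -1 < p ->
  (\int[leb]_(x in `]0%R, 1%R]) (x `^ p)%:E = ((p + 1)^-1)%:E)%E.
Proof.
move=> p1.
have p10 : p + 1 != 0 by rewrite gt_eqF//; lra.
have pp : 0 < p + 1 by lra.
pose F (x : R) := x `^ (p + 1) / (p + 1).
have dF (x : R) : 0 < x -> is_derive x 1 F (x `^ p).
  move=> x0; have D := is_derive_powR (p + 1) x0.
  have -> : F = (p + 1)^-1 *: (fun y : R => y `^ (p + 1)).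
    by apply/funext => y; rewrite /F /= mulrC.
  apply: is_derive_eq; rewrite addrK /GRing.scale/= mulrA mulVf// mul1r//.
have cF (x : R) : 0 < x -> {for x, continuous F}.
  by move=> x0; apply: differentiable_continuous; apply/derivable1_diffP; have [] := dF _ x0.
(* The possible pole at 0 is approached by intervals on which the fundamental theorem of calculus
   applies; [n.+2] keeps the left end strictly below 1. *)
pose A n : set R := `[n.+2%:R^-1, 1%R]%classic.
have An n : 0 < n.+2%:R^-1 :> R by rewrite invr_gt0.
have An1 n : n.+2%:R^-1 < 1 :> R by rewrite invf_lt1// ltr1n.
have UA : `]0, 1%R]%classic = \bigcup_n A n.
  apply/seteqP; split=> x /=; rewrite ?in_itv/=.
    move=> /andP[x0 x1].
    have /ltr_add_invr[k] := x0; rewrite add0r => kx.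
    exists k => //=; rewrite /A/= in_itv/= x1 andbT.
    by rewrite (le_trans _ (ltW kx))// lef_pV2 ?posrE// ler_nat.
  by move=> [n _]; rewrite /A/= in_itv/= => /andP[nx ->]; rewrite (lt_le_trans _ nx).
have ndA : nondecreasing_seq A.
  move=> m n mn; apply/subsetPset => x; rewrite /A/= !in_itv/= => /andP[mx ->].
  by rewrite andbT (le_trans _ mx)// lef_pV2 ?posrE// ler_nat.
have mp : measurable_fun [set: R] (fun x : R => x `^ p) by exact: measurable_powR.
have C : (\int[leb]_(x in A n) (x `^ p)%:E)%E @[n --> \oo] -->
    (\int[leb]_(x in \bigcup_n A n) (x `^ p)%:E)%E.
  apply: ge0_nondecreasing_set_cvg_integral => //.
  - by move=> n; exact: measurable_itv.
  - by move=> n; apply: measurable_funTS; exact/measurable_EFinP.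
  - by move=> n x _; rewrite lee_fin powR_ge0.
rewrite UA -(cvg_lim _ C)//.
apply/cvg_lim => //.
rewrite (_ : (fun n => _) = (fun n => (F 1 - F (n.+2%:R^-1))%:E)); last first.
  apply/funext => n; rewrite (@continuous_FTC2 _ _ F)//.
  - apply: continuous_in_subspaceT => x /set_mem/=; rewrite in_itv/= => /andP[sx _].
    exact/continuous_powR_gt0/(lt_le_trans (An n)).
  - split.
    + by move=> x; rewrite in_itv/= => /andP[sx _]; have [] := dF _ (lt_trans (An n) sx).
    + by apply: cvg_at_right_filter; apply: cF.
    + by apply: cvg_at_left_filter; apply: cF.
  - move=> x; rewrite in_itv/= => /andP[sx _].
    by rewrite derive1E; have [_] := dF _ (lt_trans (An n) sx).
apply: cvg_EFin; first exact: nearW.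
rewrite /comp/= [X in _ --> X](_ : _ = F 1 - 0 / (p + 1)); last first.
  by rewrite mul0r subr0 /F powR1 mul1r.
apply: cvgB; first exact: cvg_cst.
apply: cvgMl.
have /cvg_at_rightP := @powR_cvg0 R _ pp; apply; split=> //.
have : (harmonic n.+1 : R) @[n --> \oo] --> (0 : R) by rewrite (cvg_shiftS (@harmonic R)); exact: cvg_harmonic.
by [].
Qed.


(** The shape of the dominating functions used below: an exponent below 1 at the origin, one above 1
    at infinity. *)
Lemma integrable_powR_split (p q : R) : p < 1 -> 1 < q ->
  leb.-integrable `]0, +oo[
    (EFin \o (fun x : R => if x <= 1 then x `^ (- p) else x `^ (- q))).
Proof.
move=> p1 q1; pose f (x : R) := if x <= 1 then x `^ (- p) else x `^ (- q).
have mf : measurable_fun [set: R] f.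
  by apply: measurable_fun_ifT => //; apply: measurable_fun_ler.
have f0 x : 0 <= f x by rewrite /f; case: ifP => _; exact: powR_ge0.
apply/integrableP; split; first by apply/measurable_EFinP; exact: measurable_funTS.
rewrite (@itv_bndbnd_setU _ _ _ (BRight 1)) ?bnd_simp//.
rewrite ge0_integral_setU//=; first last.
- apply/disj_setPS => x [/=]; rewrite !in_itv/= andbT => /andP[_ x1].
  by rewrite ltNge x1.
- apply/measurable_EFinP; apply: measurableT_comp => //; exact: measurable_funTS.
have -> : (\int[leb]_(x in `]0%R, 1%R]) `|(f x)%:E| = ((- p + 1)^-1)%:E)%E.
  rewrite -integral_powR_01; last lra.
  apply: eq_integral => x; rewrite inE/= in_itv/= => /andP[_ x1].
  by rewrite /f x1 ger0_norm// powR_ge0.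
rewrite lte_add_pinfty ?ltry//.
apply: le_lt_trans (ltry (1 `^ (- q + 1) / - (- q + 1))).
rewrite -integral_powR_tail//; last lra.
rewrite -[leRHS]integral_itv_obnd_cbnd; last first.
  by apply/measurable_EFinP; exact: measurable_funTS.
rewrite le_eqVlt; apply/orP; left; apply/eqP.
apply: eq_integral => x; rewrite inE/= in_itv/= andbT => x1.
by rewrite /f leNgt x1/= ger0_norm// powR_ge0.
Qed.

(* Fubini for [k' x * w t] on the region [0 < x < g t]. *)
Lemma layer_cake d (T : measurableType d)
    (mu : {sigma_finite_measure set T -> \bar R}) (g w : T -> R) (k k' N : R -> R) :
  measurable_fun setT g -> measurable_fun setT w -> (forall t, 0 <= w t) ->
  continuous k' -> (forall x : R, is_derive x 1 k (k' x)) -> k 0 = 0 ->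
  (forall x, 0 < x -> (\int[mu]_(t in [set t | (x < g t)%R]) (w t)%:E = (N x)%:E)%E) ->
  leb.-integrable `]0, +oo[ (EFin \o (fun x => k' x * N x)) ->
  mu.-integrable setT (EFin \o (fun t => k (Num.max 0 (g t)) * w t)) /\
  \int[mu]_t (k (Num.max 0 (g t)) * w t) = \int[leb]_(x in `]0, +oo[) (k' x * N x).
Proof.
move=> mg mw w0 ck dk k0 HN IN.
(* By the fundamental theorem of calculus the integral of [F] in [x] is [k (max 0 (g t)) * w t]; its
   integral in [t] is [k' x * N x]. *)
pose A := [set p : T * R | 0 < p.2 < g p.1].
pose F (p : T * R) : R := k' p.2 * (w p.1 * \1_A p).
have mg1 : measurable_fun [set: T * R] (fun p => g p.1) by exact: measurableT_comp.
have mA : measurable A.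
  rewrite [A](_ : _ = [set p | 0 < p.2] `&` [set p | p.2 < g p.1]); last first.
    apply/seteqP; split=> [p /andP[]//|p []/= p1 p2].
    by rewrite /A/= p1 p2.
  apply: measurableI; rewrite -[X in measurable X]setTI.
    by apply: (measurable_fun_ltr (f := cst 0)) => //.
  by apply: measurable_fun_ltr.
have mk : measurable_fun [set: R] k' by exact: continuous_measurable_fun.
have mF : measurable_fun setT F.
  apply: measurable_funM; first exact: measurableT_comp.
  by apply: measurable_funM; [exact: measurableT_comp|exact: measurable_indic].
have N0 x : 0 < x -> 0 <= N x.
  by move=> x0; rewrite -lee_fin -HN//; apply: integral_ge0 => t _; rewrite lee_fin.
have mwA x : measurable_fun [set: T] (fun t => w t * \1_A (t, x)).
  apply: measurable_funM => //.
  have mI : measurable_fun [set: T * R] (fun p => \1_A p : R) by exact: measurable_indic.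
  by apply: (measurableT_comp mI); exact: pair2_measurable.
have inner2 x (c : R) : (\int[mu]_t (c * (w t * \1_A (t, x)))%:E =
    if x \in `]0%R, +oo[%classic then (c * N x)%:E else 0)%E.
  case: ifPn => [|/negP]; rewrite inE/= in_itv/= andbT => x0; last first.
    rewrite integral0_eq// => t _; rewrite indicE memNset ?mulr0//.
    by rewrite /A/= => /andP[].
  have E0 : (\int[mu]_t (w t * \1_A (t, x))%:E = (N x)%:E)%E.
    rewrite -HN// [RHS]integral_mkcond; apply: eq_integral => t _.
    rewrite patchE indicE; case: ifPn; rewrite ?inE/= => gx.
      by rewrite mem_set ?mulr1//= /A/= x0.
    by rewrite memNset ?mulr0// /A/= x0; apply/negP; move: gx; rewrite notin_setE/= => /negP.
  under eq_integral do rewrite EFinM.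
  rewrite integralZl//; first by rewrite E0.
  apply/integrableP; split; first exact/measurable_EFinP.
  under eq_integral => t _ do rewrite gee0_abs ?lee_fin ?mulr_ge0//.
  by rewrite E0 ltry.
have inner1 t : (\int[leb]_x (F (t, x))%:E = (k (Num.max 0 (g t)) * w t)%:E)%E.
  have [g0|g0] := leP (g t) 0.
    rewrite k0 mul0r integral0_eq// => x _; rewrite /F indicE memNset ?mulr0//.
    by rewrite /A/= => /andP[x0] /lt_le_trans/(_ g0)/(lt_trans x0); rewrite ltxx.
  pose f x := k' x * w t.
  have cf : continuous f.
    by move=> x; apply: cvgM; [exact: ck|exact: cvg_cst].
  have mf : measurable_fun [set: R] f by exact: continuous_measurable_fun.
  have df (x : R) : is_derive x 1 (fun y => k y * w t) (f x).
    rewrite /f; have := dk x => dkx.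
    have -> : (fun y => k y * w t) = w t *: k by apply/funext => y; rewrite /= mulrC.
    by apply: is_derive_eq; rewrite /GRing.scale/= mulrC.
  have cF : continuous (fun y => k y * w t).
    move=> x; apply: differentiable_continuous; apply/derivable1_diffP.
    by have [] := df x.
  transitivity (\int[leb]_(x in `[0%R, g t]) (f x)%:E)%E.
    rewrite -integral_itv_bndo_bndc; last by apply/measurable_EFinP/measurable_funTS.
    rewrite -integral_itv_obnd_cbnd; last by apply/measurable_EFinP/measurable_funTS.
    rewrite [RHS]integral_mkcond; apply: eq_integral => x _.
    rewrite patchE /F indicE; case: ifPn; rewrite ?inE ?notin_setE/= in_itv/= => xx.
      by rewrite mem_set ?mulr1.
    by rewrite memNset ?mulr0.
  rewrite (@continuous_FTC2 _ f (fun y => k y * w t))//.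
  - by rewrite k0 mul0r sube0.
  - exact: continuous_subspaceT.
  - split; first by move=> x _; have [] := df x.
    + by apply: cvg_at_right_filter; apply: cF.
    + by apply: cvg_at_left_filter; apply: cF.
  - by move=> x _; rewrite derive1E; have [_] := df x.
(* Absolute integrability is tested in the order that integrates [t] first: there it is exactly the
   hypothesis on [k' x * N x], because [N] is nonnegative. *)
have IF : (mu \x leb)%E.-integrable setT (EFin \o F).
  apply/integrable21ltyP; first exact/measurable_EFinP.
  rewrite [ltLHS](_ : _ = \int[leb]_(x in `]0%R, +oo[) (`|k' x| * N x)%:E)%E; last first.
    rewrite [RHS]integral_mkcond; apply: eq_integral => x _.
    rewrite patchE -inner2; apply: eq_integral => t _ /=.
    by rewrite normrM [X in _ * X]ger0_norm// mulr_ge0.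
  have /integrableP[_] := IN.
  congr (_ < _)%E; apply: eq_integral => x; rewrite inE/= in_itv/= andbT => x0.
  by rewrite normrM (ger0_norm (N0 x x0)).
have E1 := @integral12_prod_meas1 _ _ _ _ _ mu leb _ IF.
have E2 := @integral21_prod_meas1 _ _ _ _ _ mu leb _ IF.
have I1 := @integrable_fubini_F _ _ _ _ _ mu leb _ IF.
have FE : fubini_F leb (EFin \o F) = EFin \o (fun t => k (Num.max 0 (g t)) * w t).
  by apply/funext => t; rewrite /fubini_F/= inner1.
split; first by rewrite FE in I1.
rewrite /Rintegral; congr fine.
transitivity (\int[mu]_x fubini_F leb (EFin \o F) x)%E; first by rewrite FE.
rewrite E1 -E2 [RHS]integral_mkcond; apply: eq_integral => x _.
by rewrite patchE -(inner2 x (k' x)).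
Qed.
End Integration.

(** * Trigonometric bounds and stable integrals *)

Section TrigBounds.
Context {R : realType}.
Implicit Types x y : R.

Lemma is_derive_continuous (f : R -> R) (x df : R) : is_derive x 1 f df -> {for x, continuous f}.
Proof.
by case=> dfx _; apply: differentiable_continuous; apply/derivable1_diffP.
Qed.

(** Applied in turn to sine, cosine and [sin y - y], each time with the previous estimate as bound
    on the derivative, this produces all the elementary inequalities below. *)
Lemma mean_value_bound (f df : R -> R) x (M : R) :
  (forall z : R, is_derive z 1 f (df z)) ->
  (forall z, `|z| <= `|x| -> `|df z| <= M) -> `|f x - f 0| <= M * `|x|.
Proof.
move=> dfE dM.
have cf a b : {within `[a, b], continuous f}.
  by apply: continuous_subspaceT => z; exact: is_derive_continuous (dfE z).
have [x0|x0] := leP 0 x.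
  have [c] := MVT_segment x0 (fun z _ => dfE z) (cf _ _).
  rewrite in_itv/= => /andP[c0 cx] ->; rewrite subr0 normrM ler_wpM2r// dM//.
  by rewrite !ger0_norm// (le_trans c0).
have [c] := MVT_segment (ltW x0) (fun z _ => dfE z) (cf _ _).
rewrite in_itv/= distrC => /andP[cx c0] ->; rewrite sub0r normrM normrN ler_wpM2r// dM//.
by rewrite !ler0_norm ?lerN2//; exact: ltW.
Qed.

Lemma norm_sin_le x : `|sin x| <= `|x|.
Proof.
have := @mean_value_bound sin cos x 1 (fun z => is_derive_sin z).
by rewrite sin0 subr0 mul1r; apply => z _; exact: cos_max.
Qed.

Lemma cosB1_le x : `|1 - cos x| <= `|x|.
Proof.
have := @mean_value_bound cos (fun z => - sin z) x 1 (fun z => is_derive_cos z).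
by rewrite cos0 mul1r distrC; apply => z _; rewrite normrN; exact: sin_max.
Qed.

Lemma cosB1_le_sqr x : `|1 - cos x| <= x ^+ 2.
Proof.
have := @mean_value_bound cos (fun z => - sin z) x `|x| (fun z => is_derive_cos z).
rewrite cos0 distrC (_ : `|x| * `|x| = x ^+ 2); last by rewrite -normrM -expr2 ger0_norm ?sqr_ge0.
by apply => z zx; rewrite normrN (le_trans (norm_sin_le z)).
Qed.

Lemma is_derive_sinB x : is_derive x 1 (fun y => sin y - y) (cos x - 1).
Proof. exact: is_deriveB. Qed.

Lemma sinB_le_sqr x : `|sin x - x| <= x ^+ 2.
Proof.
have := @mean_value_bound _ _ x `|x| is_derive_sinB.
rewrite sin0 !subr0 (_ : `|x| * `|x| = x ^+ 2); last by rewrite -normrM -expr2 ger0_norm ?sqr_ge0.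
by apply => z zx; rewrite distrC (le_trans (cosB1_le z)).
Qed.

Lemma sinB_le x : `|sin x - x| <= 2 * `|x|.
Proof.
apply: le_trans (ler_normB _ _) _; have := norm_sin_le x; lra.
Qed.

Lemma sin_le_id x : 0 <= x -> sin x <= x.
Proof. by move=> x0; have := norm_sin_le x; rewrite (ger0_norm x0); exact: le_trans (ler_norm _). Qed.

Lemma expRN_le_inv x : 0 < x -> expR (- x) <= x^-1.
Proof.
move=> x0; rewrite expRN lef_pV2 ?posrE ?expR_gt0//.
by apply: le_trans (expR_ge1Dx x); rewrite lerDr.
Qed.

Lemma onem_expRN_le x : 0 <= x -> 1 - expR (- x) <= x.
Proof. by move=> x0; have := expR_ge1Dx (- x); lra. Qed.

End TrigBounds.

(** * Sine and cosine integrals against powers, by rotation of the Gamma integral *)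

Section StableIntegrals.
Context {R : realType}.
Local Notation leb := (@lebesgue_measure R).
Local Notation pos := (`]0, +oo[%classic : set R).

(** Integration by parts without boundary terms: [layer_cake] with [g] the identity and weight
    [y^(- a)], whose tail integral from [x] is [x^(1 - a) / (a - 1)]. *)
Lemma powR_by_parts (a : R) (k k' : R -> R) : 1 < a ->
  continuous k' -> (forall x : R, is_derive x 1 k (k' x)) -> k 0 = 0 ->
  leb.-integrable pos (EFin \o (fun x => k' x * x `^ (1 - a))) ->
  leb.-integrable pos (EFin \o (fun y => k y * y `^ (- a))) /\
  (a - 1) * \int[leb]_(y in pos) (k y * y `^ (- a)) =
  \int[leb]_(x in pos) (k' x * x `^ (1 - a)).
Proof.
move=> a1 ck dk k0 IN.
have a10 : a - 1 != 0 by rewrite gt_eqF// subr_gt0.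
have mpos : measurable pos by exact: measurable_itv.
have IN' : leb.-integrable pos (EFin \o (fun x => k' x * (x `^ (1 - a) / (a - 1)))).
  apply: eq_integrable_real (integrableZr_real (a - 1)^-1 _ IN) => // x _.
  by rewrite mulrA.
have [||||I E] := @layer_cake R _ _ leb id (fun y => y `^ (- a)) k k'
    (fun x => x `^ (1 - a) / (a - 1)) _ _ _ ck dk k0 _ IN'.
- exact: measurable_id.
- exact: measurable_powR.
- by move=> t; exact: powR_ge0.
- move=> x x0; rewrite (_ : [set t | _] = `]x, +oo[%classic); last first.
    by apply/seteqP; split=> t /=; rewrite in_itv/= andbT.
  rewrite integral_itv_obnd_cbnd; last first.
    by apply/measurable_EFinP/measurable_funTS; exact: measurable_powR.
  rewrite integral_powR_tail//; last lra.
  by congr (_ `^ _ / _)%:E; ring.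
have Ep : {in pos, (fun t => k (Num.max 0 t) * t `^ (- a)) =1 (fun y => k y * y `^ (- a))}.
  by move=> t; rewrite inE/= in_itv/= andbT => t0; rewrite max_r// ltW.
have I' : leb.-integrable pos (EFin \o (fun y => k y * y `^ (- a))).
  apply: (@eq_integrable_real _ _ _ leb pos
    (fun t => k (Num.max 0 t) * t `^ (- a))) => //.
  exact: integrableS I.
split=> //.
transitivity ((a - 1) * \int[leb]_t (k (Num.max 0 t) * t `^ (- a))).
  congr (_ * _); rewrite Rintegral_mkcond; apply: eq_Rintegral => t _.
  rewrite patchE; case: ifPn => [tp|]; first by rewrite -Ep.
  rewrite notin_setE/= in_itv/= andbT => /negP; rewrite -leNgt => t0.
  by rewrite max_l// k0 mul0r.
rewrite E -RintegralZl//; apply: eq_Rintegral => x _.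
by field.
Qed.

(** [u] and [v] are the real and imaginary parts of [exp (- y e^(- i th))]. The angle leads from the
    Gamma integrand at 0 to pure oscillation at [pi / 2], in place of a contour shift. *)
Let u (th y : R) := expR (- (y * cos th)) * cos (y * sin th).
Let v (th y : R) := expR (- (y * cos th)) * sin (y * sin th).

Lemma is_derive_u_y th (y : R) : is_derive y 1 (u th)
  (- (expR (- (y * cos th)) * cos (y * sin th - th))).
Proof.
have D1 : is_derive y 1 (fun z : R => - (z * cos th)) (- cos th).
  by apply: is_derive_eq; rewrite /GRing.scale/=; ring.
have D2 : is_derive y 1 (fun z : R => z * sin th) (sin th).
  by apply: is_derive_eq; rewrite /GRing.scale/=; ring.
have D3 := @is_derive1_comp R expR _ y _ _ (is_derive_expR _) D1.
have D4 := @is_derive1_comp R cos _ y _ _ (is_derive_cos _) D2.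
have D5 := is_deriveM D3 D4.
apply: (is_derive_eq D5).
by rewrite /GRing.scale/= cosB; ring.
Qed.

Lemma is_derive_v_y th (y : R) : is_derive y 1 (v th)
  (- (expR (- (y * cos th)) * sin (y * sin th - th))).
Proof.
have D1 : is_derive y 1 (fun z : R => - (z * cos th)) (- cos th).
  by apply: is_derive_eq; rewrite /GRing.scale/=; ring.
have D2 : is_derive y 1 (fun z : R => z * sin th) (sin th).
  by apply: is_derive_eq; rewrite /GRing.scale/=; ring.
have D3 := @is_derive1_comp R expR _ y _ _ (is_derive_expR _) D1.
have D4 := @is_derive1_comp R sin _ y _ _ (is_derive_sin _) D2.
have D5 := is_deriveM D3 D4.
apply: (is_derive_eq D5).
by rewrite /GRing.scale/= sinB; ring.
Qed.

Lemma is_derive_u_th (th y : R) : is_derive th 1 (fun t => u t y)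
  (- (y * (expR (- (y * cos th)) * sin (y * sin th - th)))).
Proof.
have D1 : is_derive th 1 (fun t : R => - (y * cos t)) (y * sin th).
  by apply: is_derive_eq; rewrite /GRing.scale/=; ring.
have D2 : is_derive th 1 (fun t : R => y * sin t) (y * cos th).
  by apply: is_derive_eq; rewrite /GRing.scale/=; ring.
have D3 := @is_derive1_comp R expR _ th _ _ (is_derive_expR _) D1.
have D4 := @is_derive1_comp R cos _ th _ _ (is_derive_cos _) D2.
have D5 := is_deriveM D3 D4.
apply: (is_derive_eq D5).
by rewrite /GRing.scale/= sinB; ring.
Qed.

Lemma is_derive_v_th (th y : R) : is_derive th 1 (fun t => v t y)
  (y * (expR (- (y * cos th)) * cos (y * sin th - th))).
Proof.
have D1 : is_derive th 1 (fun t : R => - (y * cos t)) (y * sin th).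
  by apply: is_derive_eq; rewrite /GRing.scale/=; ring.
have D2 : is_derive th 1 (fun t : R => y * sin t) (y * cos th).
  by apply: is_derive_eq; rewrite /GRing.scale/=; ring.
have D3 := @is_derive1_comp R expR _ th _ _ (is_derive_expR _) D1.
have D4 := @is_derive1_comp R sin _ th _ _ (is_derive_sin _) D2.
have D5 := is_deriveM D3 D4.
apply: (is_derive_eq D5).
by rewrite /GRing.scale/= cosB; ring.
Qed.


Section Rotation.
Variable a : R.
Hypothesis a12 : 1 < a < 2.

Let a1 : 1 < a. Proof. by case/andP: a12. Qed.
Let a2 : a < 2. Proof. by case/andP: a12. Qed.
Let mpos : measurable pos. Proof. exact: measurable_itv. Qed.

(** [Gr - i Gi] is the integral of [(1 - exp (- y w)) y^(- a)] at [w = e^(- i th)]. Homogeneity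
    predicts a multiple of [w^(a - 1)], so that [(Gr, Gi)] should turn at angular speed [a - 1]. *)
Let Gr th := \int[leb]_(y in pos) ((1 - u th y) * y `^ (- a)).
Let Gi th := \int[leb]_(y in pos) (v th y * y `^ (- a)).
Let dom (y : R) := if y <= 1 then y `^ (- (a - 1)) else y `^ (- a).

Let dom_int : leb.-integrable pos (EFin \o dom).
Proof. apply: (@integrable_powR_split R (a - 1) a) => //; move: a2; lra. Qed.

Lemma powR_dom_bound (f : R -> R) (C : R) : measurable_fun [set: R] f ->
  (forall y, 0 < y -> `|f y| <= C * Num.min 1 y) ->
  forall y, 0 < y -> `|f y * y `^ (- a)| <= C * dom y.
Proof.
move=> mf fC y y0; have C0 : 0 <= C.
  have := le_trans (normr_ge0 _) (fC 1 ltr01).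
  by rewrite minxx mulr1.
rewrite normrM (ger0_norm (powR_ge0 _ _)) /dom; case: ifPn => y1.
  rewrite (_ : - (a - 1) = 1 + - a); last ring.
  rewrite powRD; last by apply/implyP => _; rewrite gt_eqF.
  rewrite powRr1 ?(ltW y0)// mulrA ler_wpM2r ?powR_ge0//.
  by rewrite (le_trans (fC y y0))// ler_wpM2l// ge_min lexx orbT.
rewrite ler_wpM2r ?powR_ge0// (le_trans (fC y y0))//.
by rewrite ler_piMr// ge_min lexx.
Qed.

Lemma integrable_powR_bounded (f : R -> R) (C : R) : measurable_fun [set: R] f ->
  (forall y, 0 < y -> `|f y| <= C * Num.min 1 y) ->
  leb.-integrable pos (EFin \o (fun y => f y * y `^ (- a))).
Proof.
move=> mf fC; apply: (le_integrable_real _ _ (integrableZl_real C _ dom_int)) => //.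
  by apply: measurable_funTS; apply: measurable_funM => //; exact: measurable_powR.
by move=> y; rewrite /= in_itv/= andbT; exact: powR_dom_bound.
Qed.

Let thI (th : R) := 0 <= th <= pi / 2.

Let cos_thI th : thI th -> 0 <= cos th.
Proof.
move=> /andP[t0 tp]; apply: cos_ge0_pihalf; rewrite tp andbT (le_trans _ t0)//.
by rewrite oppr_le0 divr_ge0// pi_ge0.
Qed.

Let e01 th y : thI th -> 0 < y -> 0 <= expR (- (y * cos th)) <= 1.
Proof.
move=> tI y0; rewrite expR_ge0 expR_le1 oppr_le0 mulr_ge0 ?cos_thI//; exact: ltW.
Qed.

Let v_bound th y : thI th -> 0 < y -> `|v th y| <= 2 * Num.min 1 y.
Proof.
move=> tI y0; have /andP[e0 e1] := e01 tI y0.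
have h1 : `|v th y| <= `|sin (y * sin th)|.
  by rewrite /v normrM (ger0_norm e0) ler_piMl.
have h2 : `|sin (y * sin th)| <= y.
  apply: le_trans (norm_sin_le _) _; rewrite normrM (gtr0_norm y0) ler_piMr ?(ltW y0)//.
  exact: sin_max.
have h3 := sin_max (y * sin th).
rewrite minEle; case: ifP => _; lra.
Qed.

Let u_bound th y : thI th -> 0 < y -> `|1 - u th y| <= 2 * Num.min 1 y.
Proof.
move=> tI y0; have /andP[e0 e1] := e01 tI y0.
have h0 : 0 <= y * cos th by rewrite mulr_ge0 ?cos_thI// ltW.
have h1 := cos_max (y * sin th).
have h2 : `|1 - cos (y * sin th)| <= y.
  apply: le_trans (cosB1_le _) _; rewrite normrM (gtr0_norm y0) ler_piMr ?(ltW y0)//.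
  exact: sin_max.
have h3 : 1 - expR (- (y * cos th)) <= y.
  apply: le_trans (onem_expRN_le h0) _; rewrite ler_piMr ?(ltW y0)//.
set e := expR _ in e0 e1 h3 *; set c := cos (y * _) in h1 h2 *.
have -> : 1 - u th y = (1 - e) + e * (1 - c) by rewrite /u -/e -/c; ring.
have h4 : `|e * (1 - c)| <= `|1 - c| by rewrite normrM (ger0_norm e0) ler_piMl.
have h5 : `|1 - e| = 1 - e by rewrite ger0_norm// subr_ge0.
have h6 : `|1 - e + e * (1 - c)| <= y + y.
  apply: le_trans (ler_normD _ _) _; rewrite h5; lra.
have h7 : `|1 - e + e * (1 - c)| <= 2.
  have -> : 1 - e + e * (1 - c) = 1 - e * c by ring.
  apply: le_trans (ler_normB _ _) _; rewrite normr1 normrM (ger0_norm e0).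
  have : e * `|c| <= 1 * 1 by apply: ler_pM.
  lra.
rewrite minEle; case: ifP => _; lra.
Qed.

Let mu_ th : measurable_fun [set: R] (u th).
Proof.
apply: continuous_measurable_fun => y.
exact: is_derive_continuous (is_derive_u_y th y).
Qed.

Let mv_ th : measurable_fun [set: R] (v th).
Proof.
apply: continuous_measurable_fun => y.
exact: is_derive_continuous (is_derive_v_y th y).
Qed.

Let Iu th : thI th -> leb.-integrable pos (EFin \o (fun y => (1 - u th y) * y `^ (- a))).
Proof.
move=> tI; apply: (@integrable_powR_bounded (fun y => 1 - u th y) 2).
  by apply: measurable_funB.
by move=> y; exact: u_bound.
Qed.

Let Iv th : thI th -> leb.-integrable pos (EFin \o (fun y => v th y * y `^ (- a))).
Proof.
by move=> tI; apply: (@integrable_powR_bounded (v th) 2) => // y; exact: v_bound.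
Qed.

(** Beyond 1 the missing power of [y] is taken from the exponential, at the price of [1 / c]; this
    degenerates as the angle tends to [pi / 2]. *)
Let edom (c y : R) : 0 < c -> 0 < y ->
  expR (- (y * c)) * y `^ (1 - a) <= Num.max 1 c^-1 * dom y.
Proof.
move=> c0 y0; have yc0 : 0 < y * c by rewrite mulr_gt0.
rewrite /dom; case: ifPn => y1.
  rewrite (_ : - (a - 1) = 1 - a); last ring.
  rewrite ler_wpM2r ?powR_ge0// le_max; apply/orP; left.
  by rewrite expR_le1 oppr_le0 ltW.
rewrite powRD; last by apply/implyP => _; rewrite gt_eqF.
rewrite powRr1 ?(ltW y0)// mulrA ler_wpM2r ?powR_ge0// le_max; apply/orP; right.
have := expRN_le_inv yc0; rewrite invfM -(ler_pM2r y0) => /le_trans; apply.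
by rewrite mulrAC mulVf ?gt_eqF// mul1r.
Qed.

Let wk (f : R -> R) th := fun y : R => expR (- (y * cos th)) * f (y * sin th - th).

Let wk_bound f th (c y : R) : (forall x : R, `|f x| <= 1) -> 0 < c -> c <= cos th -> 0 < y ->
  `|wk f th y * y `^ (1 - a)| <= Num.max 1 c^-1 * dom y.
Proof.
move=> f1 c0 cth y0; apply: le_trans (edom c0 y0).
rewrite normrM (ger0_norm (powR_ge0 _ _)) ler_wpM2r ?powR_ge0// normrM ger0_norm ?expR_ge0//.
apply: (@le_trans _ _ (expR (- (y * cos th)))); first by rewrite ler_piMr// expR_ge0.
by rewrite ler_expR lerN2 ler_pM2l.
Qed.

Let Iwk f th : (forall x : R, `|f x| <= 1) -> continuous f -> 0 < cos th ->
  leb.-integrable pos (EFin \o (fun y => wk f th y * y `^ (1 - a))).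
Proof.
move=> f1 cf c0; apply: (le_integrable_real _ _
    (integrableZl_real (Num.max 1 (cos th)^-1) _ dom_int)) => //.
  apply: measurable_funTS; apply: measurable_funM; last exact: measurable_powR.
  apply: measurable_funM.
    by apply: measurableT_comp => //; apply: measurableT_comp => //; apply: measurable_funM.
  apply: measurableT_comp; first exact: continuous_measurable_fun.
  by apply: measurable_funB => //; apply: measurable_funM.
by move=> y; rewrite /= in_itv/= andbT; exact: wk_bound.
Qed.

(** The differentiated integrand carries [y^(1 - a)], too large at infinity without exponential
    decay. So the angle stays in the open interval, with cosines bounded below by that of [q],
    halfway to [pi / 2]. *)
Let differentiate (F : R -> R -> R) (f : R -> R) (th : R) :
  (forall x : R, `|f x| <= 1) ->
  (forall t y : R, 0 < y -> is_derive t 1 (F ^~ y) (wk f t y * y `^ (1 - a))) ->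
  (forall t, thI t -> leb.-integrable pos (EFin \o F t)) -> 0 < th < pi / 2 ->
  is_derive th 1 (fun t => \int[leb]_(y in pos) F t y)
    (\int[leb]_(y in pos) (wk f th y * y `^ (1 - a))).
Proof.
move=> f1 dF IF /andP[t0 tp].
pose q := (th + pi / 2) / 2.
have q1 : th < q by rewrite /q; lra.
have q2 : q < pi / 2 by rewrite /q; lra.
have cq : 0 < cos q by apply: cos_gt0_pihalf; rewrite q2 andbT; lra.
pose M := Num.max 1 (cos q)^-1.
have I t : `]0, q[%classic t -> thI t.
  by rewrite /= in_itv/= => /andP[t1 t2]; rewrite /thI; lra.
have G0 y : 0 <= M * dom y.
  rewrite mulr_ge0//; first by rewrite le_max ler01.
  by rewrite /dom; case: ifP => _; exact: powR_ge0.
have IG : leb.-integrable pos (EFin \o (fun y => M * dom y)) by exact: integrableZl_real.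
have dE t y : pos y -> partial1of2 F t y = wk f t y * y `^ (1 - a).
  rewrite /= in_itv/= andbT => y0; rewrite /partial1of2 derive1E.
  by have [_ ->] := dF t y y0.
have dub t y : `]0, q[%classic t -> pos y -> `|partial1of2 F t y| <= M * dom y.
  move=> tq yp; rewrite dE//; apply: wk_bound => //.
    apply/ltW; rewrite ltr_cos// ?in_itv/=; move: tq yp; rewrite /= !in_itv/= => /andP[].
    + by move=> *; lra.
    + by move=> *; have := @pi_gt0 R; lra.
    + by move=> *; have := @pi_gt0 R; lra.
  by move: yp; rewrite /= in_itv/= andbT.
have dd t y : `]0, q[%classic t -> pos y -> derivable (F ^~ y) t 1.
  by move=> _; rewrite /= in_itv/= andbT => y0; have [] := dF t y y0.
have th0q : `]0, q[%classic th by rewrite /= in_itv/= t0.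
have mp : measurable (pos : set (measurableTypeR R)) by exact: measurable_itv.
have D := @derivable_under_integral R _ _ leb F pos mp th 0 q th0q
  (fun t tI => IF t (I t tI)) dd _ G0 IG dub.
split => //; rewrite -derive1E.
rewrite (@differentiation_under_integral R _ _ leb F pos mp th 0 q th0q
  (fun t tI => IF t (I t tI)) dd _ G0 IG dub).
by apply: eq_Rintegral => y; rewrite inE => yp; exact: dE.
Qed.

Let cosI (th : R) : 0 < th < pi / 2 -> 0 < cos th.
Proof. by move=> /andP[t0 tp]; apply: cos_gt0_pihalf; rewrite tp andbT; lra. Qed.

(** Differentiating in [th] produces a factor [y], which integration by parts in [y] removes again;
    this closes [Gr] and [Gi] into a linear system. *)
Let Gr_derive (th : R) : 0 < th < pi / 2 -> is_derive th 1 Gr (- ((a - 1) * Gi th)).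
Proof.
move=> thp; have c0 := cosI thp.
have D := @differentiate (fun t y => (1 - u t y) * y `^ (- a)) sin th (@sin_max R) _ Iu thp.
have : is_derive th 1 Gr (\int[leb]_(y in pos) (wk sin th y * y `^ (1 - a))).
  apply: D => t y y0.
  have D1 := is_derive_u_th t y.
  have -> : (fun t => (1 - u t y) * y `^ (- a)) = y `^ (- a) *: (cst 1 - u^~ y).
    by apply/funext => z /=; rewrite mulrC.
  apply: is_derive_eq; rewrite /GRing.scale/= sub0r opprK /wk.
  rewrite powRD; last by apply/implyP => _; rewrite gt_eqF.
  by rewrite powRr1 ?(ltW y0)//; ring.
move=> /is_derive_eq; apply.
have Iws := Iwk (@sin_max R) (@continuous_sin R) c0.
have [||||_ E] := @powR_by_parts a (v th) (fun y => - wk sin th y) a1.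
- move=> y; apply: cvgN; apply: cvgM.
    apply: (@continuous_comp _ _ _ (fun y : R => - (y * cos th)) expR); last exact: continuous_expR.
    by apply: cvgN; apply: cvgM; [exact: cvg_id|exact: cvg_cst].
  apply: (@continuous_comp _ _ _ (fun y : R => y * sin th - th) sin); last exact: continuous_sin.
  by apply: cvgB; [apply: cvgM; [exact: cvg_id|exact: cvg_cst]|exact: cvg_cst].
- by move=> y; exact: is_derive_v_y.
- by rewrite /v !mul0r sin0 mulr0.
- apply: (eq_integrable_real _ _ (integrableZl_real (-1) _ Iws)) => // y _ /=.
  by rewrite mulN1r mulNr.
rewrite /Gi E -[RHS]mulN1r -RintegralZl//; last first.
  apply: (eq_integrable_real _ _ (integrableZl_real (-1) _ Iws)) => // y _ /=.
  by rewrite mulN1r mulNr.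
by apply: eq_Rintegral => y _; rewrite mulN1r mulNr opprK.
Qed.

Let Gi_derive (th : R) : 0 < th < pi / 2 -> is_derive th 1 Gi ((a - 1) * Gr th).
Proof.
move=> thp; have c0 := cosI thp.
have D := @differentiate (fun t y => v t y * y `^ (- a)) cos th (@cos_max R) _ Iv thp.
have : is_derive th 1 Gi (\int[leb]_(y in pos) (wk cos th y * y `^ (1 - a))).
  apply: D => t y y0.
  have D1 := is_derive_v_th t y.
  have -> : (fun t => v t y * y `^ (- a)) = y `^ (- a) *: (v^~ y).
    by apply/funext => z /=; rewrite mulrC.
  apply: is_derive_eq; rewrite /GRing.scale/= /wk.
  rewrite powRD; last by apply/implyP => _; rewrite gt_eqF.
  by rewrite powRr1 ?(ltW y0)//; ring.
move=> /is_derive_eq; apply.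
have Iws := Iwk (@cos_max R) (@continuous_cos R) c0.
have [||||_ E] := @powR_by_parts a (fun y => 1 - u th y) (wk cos th) a1.
- move=> y; apply: cvgM.
    apply: (@continuous_comp _ _ _ (fun y : R => - (y * cos th)) expR); last exact: continuous_expR.
    by apply: cvgN; apply: cvgM; [exact: cvg_id|exact: cvg_cst].
  apply: (@continuous_comp _ _ _ (fun y : R => y * sin th - th) cos); last exact: continuous_cos.
  by apply: cvgB; [apply: cvgM; [exact: cvg_id|exact: cvg_cst]|exact: cvg_cst].
- move=> y; have D1 := is_derive_u_y th y.
  have -> : (fun y => 1 - u th y) = cst 1 - u th by [].
  by apply: is_derive_eq; rewrite sub0r opprK.
- by rewrite /u !mul0r oppr0 expR0 cos0 mulr1 subrr.
- exact: Iws.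
by rewrite /Gr E.
Qed.

Let ph : R := (a - 1) * (pi / 2).

(** The system is a rotation of speed [a - 1]; undoing the rotation leaves a constant vector, of
    which this is the first coordinate. *)
Let rotation_const (F1 F2 : R -> R) :
  (forall th : R, 0 < th < pi / 2 -> is_derive th 1 F1 (- ((a - 1) * F2 th))) ->
  (forall th : R, 0 < th < pi / 2 -> is_derive th 1 F2 ((a - 1) * F1 th)) ->
  forall s t : R, 0 < s -> s <= t -> t < pi / 2 ->
  F1 t * cos ((a - 1) * t) + F2 t * sin ((a - 1) * t) =
  F1 s * cos ((a - 1) * s) + F2 s * sin ((a - 1) * s).
Proof.
move=> d1 d2 s t s0 st tp.
pose H th := F1 th * cos ((a - 1) * th) + F2 th * sin ((a - 1) * th).
have dH (th : R) : 0 < th < pi / 2 -> is_derive th 1 H 0.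
  move=> thp; have D1 := d1 _ thp; have D2 := d2 _ thp.
  have D0 : is_derive th 1 (fun z : R => (a - 1) * z) (a - 1).
    by apply: is_derive_eq; rewrite /GRing.scale/=; ring.
  have D3 := @is_derive1_comp R cos _ th _ _ (is_derive_cos _) D0.
  have D4 := @is_derive1_comp R sin _ th _ _ (is_derive_sin _) D0.
  have D5 := is_deriveD (is_deriveM D1 D3) (is_deriveM D2 D4).
  by apply: (is_derive_eq D5); rewrite /GRing.scale/=; ring.
have [||c _] := @MVT_segment R H (cst 0) s t st.
- by move=> x; rewrite in_itv/= => /andP[sx xt]; apply: dH; lra.
- apply: continuous_in_subspaceT => x; rewrite inE/= in_itv/= => /andP[sx xt].
  by apply: is_derive_continuous; apply: dH; lra.
by rewrite mul0r => /eqP; rewrite subr_eq0 => /eqP.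
Qed.

(** Continuity up to both ends of the closed interval, where differentiation is out of reach: before
    differentiation the bound is uniform in the angle. *)
Let cvg_G (F : R -> R -> R) (s : nat -> R) (t : R) :
  (forall th, thI th -> measurable_fun [set: R] (F th)) ->
  (forall th y, thI th -> 0 < y -> `|F th y| <= 2 * Num.min 1 y) ->
  (forall y, {for t, continuous (F ^~ y)}) ->
  (forall n, thI (s n)) -> thI t -> s n @[n --> \oo] --> t ->
  \int[leb]_(y in pos) (F (s n) y * y `^ (- a)) @[n --> \oo] -->
  \int[leb]_(y in pos) (F t y * y `^ (- a)).
Proof.
move=> mF bF cF sI tI st.
apply: (@Rintegral_dominated_cvg R _ _ leb pos (fun n y => F (s n) y * y `^ (- a)) _
  (fun y => 2 * dom y) _ _ _ _ _ _).2 => //.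
- move=> n; apply: measurable_funTS; apply: measurable_funM; last exact: measurable_powR.
  exact: mF.
- apply: measurable_funTS; apply: measurable_funM; last exact: measurable_powR.
  exact: mF.
- apply: aeW => y yp; apply: cvgM; last exact: cvg_cst.
  exact: (cvg_comp _ _ st (cF y)).
- exact: integrableZl_real.
- move=> n y; rewrite /= in_itv/= andbT => y0; apply: powR_dom_bound => //.
  + exact: mF.
  + by move=> z z0; exact: bF.
Qed.

(** The conserved quantities, taken from near angle 0 to near [pi / 2], give two linear equations
    for the integrals at [pi / 2], solved by [cos^2 + sin^2 = 1]. The value at 0 is a Gamma integral
    after one integration by parts. *)
Lemma stable_integrals :
  [/\ leb.-integrable pos (EFin \o (fun y => sin y * y `^ (- a))),
      leb.-integrable pos (EFin \o (fun y => (1 - cos y) * y `^ (- a))),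
      \int[leb]_(y in pos) (sin y * y `^ (- a)) = Gamma (2 - a) / (a - 1) * sin ph &
      \int[leb]_(y in pos) ((1 - cos y) * y `^ (- a)) = Gamma (2 - a) / (a - 1) * cos ph].
Proof.
have p0 := @pi_gt0 R.
have tI : thI (pi / 2) by rewrite /thI; lra.
have zI : thI 0 by rewrite /thI; lra.
have uE : u (pi / 2) = cos by apply/funext => y; rewrite /u cos_pihalf sin_pihalf mulr0 oppr0 expR0 mul1r mulr1.
have vE : v (pi / 2) = sin by apply/funext => y; rewrite /v cos_pihalf sin_pihalf mulr0 oppr0 expR0 mul1r mulr1.
have v0 y : v 0 y = 0 by rewrite /v sin0 mulr0 sin0 mulr0.
have u0 y : u 0 y = expR (- y) by rewrite /u cos0 sin0 mulr1 mulr0 cos0 mulr1.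
have IA := Iv tI; have IB := Iu tI; rewrite vE in IA; rewrite uE in IB.
have Gi0 : Gi 0 = 0.
  rewrite /Gi /Rintegral integral0_eq// => y _; by rewrite v0 mul0r.
have a10 : a - 1 != 0 by rewrite gt_eqF// subr_gt0.
have Gr0 : Gr 0 = Gamma (2 - a) / (a - 1).
  have c0 : 0 < cos (0 : R) by rewrite cos0.
  have Iws := Iwk (@cos_max R) (@continuous_cos R) c0.
  have [||||_ E] := @powR_by_parts a (fun y => 1 - expR (- y)) (fun y => expR (- y)) a1.
  - move=> y; apply: (@continuous_comp _ _ _ (fun y : R => - y) expR); last exact: continuous_expR.
    by apply: cvgN; exact: cvg_id.
  - move=> y.
    have D1 : is_derive y 1 (fun z : R => - z) (- 1) by exact: is_deriveN.
    have D2 := @is_derive1_comp R expR _ y _ _ (is_derive_expR _) D1.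
    have -> : (fun y => 1 - expR (- y)) = cst 1 - (expR \o -%R) by [].
    by apply: is_derive_eq; rewrite mulrN1 sub0r opprK.
  - by rewrite oppr0 expR0 subrr.
  - apply: (eq_integrable_real _ _ Iws) => // y _ /=.
    by rewrite /wk cos0 sin0 mulr1 mulr0 subr0 cos0 mulr1.
  rewrite -[LHS](mulKf a10) mulrC; congr (_ / _).
  transitivity ((a - 1) * \int[leb]_(y in pos) ((1 - expR (- y)) * y `^ (- a))).
    by congr (_ * _); apply: eq_Rintegral => y _; rewrite u0.
  rewrite E /Gamma; apply: eq_Rintegral => x _; rewrite mulrC.
  by congr (_ `^ _ * _); ring.
(* [s n] and [t n] tend to the two ends from inside the open interval; [n.+2] gives
   [s n <= pi / 4 <= t n]. *)
pose s n : R := pi / 2 * n.+2%:R^-1.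
pose t n : R := pi / 2 - s n.
have n2 n : 0 < (n.+2%:R : R)^-1 <= 2^-1.
  by rewrite invr_gt0 ltr0n/= lef_pV2 ?posrE// ler_nat.
have s0 n : 0 < s n by rewrite mulr_gt0 ?divr_gt0//; have /andP[] := n2 n.
have sle n : s n <= pi / 2 * 2^-1.
  by rewrite ler_pM2l ?divr_gt0//; have /andP[] := n2 n.
have sI n : thI (s n) by have := s0 n; have := sle n; rewrite /thI; lra.
have tnI n : thI (t n) by have := s0 n; have := sle n; rewrite /thI /t; lra.
have st n : s n <= t n by have := s0 n; have := sle n; rewrite /t; lra.
have tp n : t n < pi / 2 by have := s0 n; rewrite /t; lra.
have cs : s n @[n --> \oo] --> (0 : R).
  rewrite -[X in _ --> X](mulr0 (pi / 2)); apply: cvgMr.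
  have : (harmonic n.+1 : R) @[n --> \oo] --> (0 : R).
    by rewrite (cvg_shiftS (@harmonic R)); exact: cvg_harmonic.
  by [].
have ct : t n @[n --> \oo] --> pi / 2.
  rewrite -[X in _ --> X](subr0 (pi / 2)); apply: cvgB => //; exact: cvg_cst.
have mu1 th : thI th -> measurable_fun [set: R] (fun y => 1 - u th y).
  by move=> _; apply: measurable_funB.
have cu y x : {for x, continuous ((fun th y => 1 - u th y) ^~ y)}.
  apply: cvgB; first exact: cvg_cst.
  exact: is_derive_continuous (is_derive_u_th x y).
have cv y x : {for x, continuous (v ^~ y)} by exact: is_derive_continuous (is_derive_v_th x y).
have Grs : Gr (s n) @[n --> \oo] --> Gr 0 by exact: (@cvg_G (fun th y => 1 - u th y)).
have Grt : Gr (t n) @[n --> \oo] --> Gr (pi / 2) by exact: (@cvg_G (fun th y => 1 - u th y)).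
have Gis : Gi (s n) @[n --> \oo] --> Gi 0 by exact: (@cvg_G v).
have Git : Gi (t n) @[n --> \oo] --> Gi (pi / 2) by exact: (@cvg_G v).
have ccos (w : nat -> R) (x : R) : w n @[n --> \oo] --> x ->
    cos ((a - 1) * w n) @[n --> \oo] --> cos ((a - 1) * x).
  move=> wx; apply: (cvg_comp (fun n => (a - 1) * w n) cos); last exact: continuous_cos.
  exact: cvgMr.
have csin (w : nat -> R) (x : R) : w n @[n --> \oo] --> x ->
    sin ((a - 1) * w n) @[n --> \oo] --> sin ((a - 1) * x).
  move=> wx; apply: (cvg_comp (fun n => (a - 1) * w n) sin); last exact: continuous_sin.
  exact: cvgMr.
have H1 : Gr (pi / 2) * cos ph + Gi (pi / 2) * sin ph = Gr 0.
  have C1 : Gr (t n) * cos ((a - 1) * t n) + Gi (t n) * sin ((a - 1) * t n) @[n --> \oo] -->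
      Gr (pi / 2) * cos ph + Gi (pi / 2) * sin ph.
    by apply: cvgD; apply: cvgM => //; [exact: ccos|exact: csin].
  have C2 : Gr (s n) * cos ((a - 1) * s n) + Gi (s n) * sin ((a - 1) * s n) @[n --> \oo] -->
      Gr 0 * cos ((a - 1) * 0) + Gi 0 * sin ((a - 1) * 0).
    by apply: cvgD; apply: cvgM => //; [exact: ccos|exact: csin].
  have E : (fun n => Gr (t n) * cos ((a - 1) * t n) + Gi (t n) * sin ((a - 1) * t n)) =
     (fun n => Gr (s n) * cos ((a - 1) * s n) + Gi (s n) * sin ((a - 1) * s n)).
    by apply/funext => n; apply: (rotation_const Gr_derive Gi_derive).
  rewrite E in C1; rewrite (cvg_unique _ C1 C2)//.
  by rewrite mulr0 cos0 sin0 mulr0 mulr1 addr0.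
(* The pair [(Gi, - Gr)] solves the same system, which supplies the second equation. *)
have H2 : Gi (pi / 2) * cos ph - Gr (pi / 2) * sin ph = 0.
  have C1 : Gi (t n) * cos ((a - 1) * t n) + (- Gr (t n)) * sin ((a - 1) * t n) @[n --> \oo] -->
      Gi (pi / 2) * cos ph + (- Gr (pi / 2)) * sin ph.
    by apply: cvgD; apply: cvgM => //; [exact: ccos|exact: cvgN|exact: csin].
  have C2 : Gi (s n) * cos ((a - 1) * s n) + (- Gr (s n)) * sin ((a - 1) * s n) @[n --> \oo] -->
      Gi 0 * cos ((a - 1) * 0) + (- Gr 0) * sin ((a - 1) * 0).
    by apply: cvgD; apply: cvgM => //; [exact: ccos|exact: cvgN|exact: csin].
  have E : (fun n => Gi (t n) * cos ((a - 1) * t n) + (- Gr (t n)) * sin ((a - 1) * t n)) =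
     (fun n => Gi (s n) * cos ((a - 1) * s n) + (- Gr (s n)) * sin ((a - 1) * s n)).
    apply/funext => n; apply: (@rotation_const Gi (fun th => - Gr th)) => //.
      by move=> th thp; have := Gi_derive thp; rewrite mulrN opprK.
    move=> th thp; have D := Gr_derive thp.
    have -> : (fun th => - Gr th) = - Gr by [].
    by apply: is_derive_eq; rewrite opprK.
  rewrite E in C1; rewrite -mulNr (cvg_unique _ C1 C2)//.
  by rewrite mulr0 sin0 mulr0 addr0 Gi0 mul0r.
have cs2 := cos2Dsin2 ph.
have AE : \int[leb]_(y in pos) (sin y * y `^ (- a)) = Gi (pi / 2) by rewrite /Gi vE.
have BE : \int[leb]_(y in pos) ((1 - cos y) * y `^ (- a)) = Gr (pi / 2) by rewrite /Gr uE.
split => //.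
- rewrite AE -Gr0 -H1.
  transitivity (Gi (pi / 2) * (cos ph ^+ 2 + sin ph ^+ 2)); first by rewrite cs2 mulr1.
  have {}H2 : Gi (pi / 2) * cos ph = Gr (pi / 2) * sin ph by lra.
  rewrite expr2 mulrDr mulrA H2; ring.
- rewrite BE -Gr0 -H1.
  transitivity (Gr (pi / 2) * (cos ph ^+ 2 + sin ph ^+ 2)); first by rewrite cs2 mulr1.
  have {}H2 : Gr (pi / 2) * sin ph = Gi (pi / 2) * cos ph by lra.
  rewrite (expr2 (sin ph)) mulrDr [Gr _ * (sin _ * _)]mulrA H2; ring.
Qed.

End Rotation.
End StableIntegrals.

(** * Lévy's continuity theorem *)

Section Fejer.
Context {R : realType}.

(** The squared modulus of the mean of [e^(i l t)] over [l < N], that is, the Fejér kernel divided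
    by [N]: with this normalisation [N] equally spaced translates add up to 1. *)
Definition fejer (N : nat) (t : R) : R :=
  N%:R ^- 2 * ((\sum_(l < N) cos (l%:R * t)) ^+ 2 + (\sum_(l < N) sin (l%:R * t)) ^+ 2).

Lemma fejer_ge0 N t : 0 <= fejer N t.
Proof. by rewrite /fejer mulr_ge0 ?addr_ge0 ?sqr_ge0 ?invr_ge0 ?exprn_ge0. Qed.

Lemma fejerE N t : fejer N t =
  N%:R ^- 2 * (\sum_(l < N) \sum_(m < N) cos ((l%:R - m%:R) * t)).
Proof.
rewrite /fejer; congr (_ * _); rewrite !expr2 !mulr_suml -big_split/=.
apply: eq_bigr => l _; rewrite !mulr_sumr -big_split/=; apply: eq_bigr => m _.
by rewrite mulrBl cosB.
Qed.

Lemma sin_natmul_2pi (x : R) n : sin (x + pi *+ 2 * n%:R) = sin x.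
Proof. by rewrite mulr_natr (periodicn (@sinD2pi R)). Qed.

Lemma sum_cos_arith (a h : R) n :
  2 * sin (h / 2) * (\sum_(j < n) cos (a - j%:R * h)) =
  sin (a + h / 2) - sin (a - n%:R * h + h / 2).
Proof.
elim: n => [|n IH]; first by rewrite big_ord0 mulr0 mul0r subr0 subrr.
rewrite big_ord_recr/= mulrDr IH.
have -> : sin (a - n%:R * h + h / 2) =
    sin (a - n%:R * h) * cos (h / 2) + cos (a - n%:R * h) * sin (h / 2) by rewrite sinD.
have -> : a - n.+1%:R * h + h / 2 = (a - n%:R * h) - h / 2 by rewrite -natr1; field.
by rewrite (sinB (a - _)); ring.
Qed.

Lemma sum_sin_arith (a h : R) n :
  2 * sin (h / 2) * (\sum_(j < n) sin (a - j%:R * h)) =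
  cos (a - n%:R * h + h / 2) - cos (a + h / 2).
Proof.
elim: n => [|n IH]; first by rewrite big_ord0 mulr0 mul0r subr0 subrr.
rewrite big_ord_recr/= mulrDr IH.
have -> : cos (a - n%:R * h + h / 2) =
    cos (a - n%:R * h) * cos (h / 2) - sin (a - n%:R * h) * sin (h / 2) by rewrite cosD.
have -> : a - n.+1%:R * h + h / 2 = (a - n%:R * h) - h / 2 by rewrite -natr1; field.
by rewrite (cosB (a - _)); ring.
Qed.

(** After expanding the square, the terms with [l] different from [m] vanish as sums over roots of
    unity; the [N] diagonal ones contribute [N] each. *)
Lemma fejer_sum N (y : R) : (0 < N)%N ->
  \sum_(j < N) fejer N (y - pi *+ 2 / N%:R * j%:R) = 1.
Proof.
move=> N0; have N1 : (N%:R : R) != 0 by rewrite pnatr_eq0 -lt0n.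
have Np : 0 < (N%:R : R) by rewrite ltr0n.
under eq_bigr do rewrite fejerE.
rewrite -mulr_sumr exchange_big/=.
have key (l m : 'I_N) : \sum_(j < N) cos ((l%:R - m%:R) * (y - pi *+ 2 / N%:R * j%:R)) =
    if l == m then N%:R else 0.
  case: eqVneq => [->|lm].
    under eq_bigr do rewrite subrr mul0r cos0.
    by rewrite sumr_const card_ord.
  set d : R := l%:R - m%:R.
  have E := sum_cos_arith (d * y) (d * (pi *+ 2 / N%:R)) N.
  (* The indices differ by less than [N], so the angle is not a multiple of [pi]. *)
  have s0 : sin (d * (pi *+ 2 / N%:R) / 2) != 0.
    have -> : d * (pi *+ 2 / N%:R) / 2 = d / N%:R * pi.
      by rewrite -mulr_natr; field.
    have pos (p q : 'I_N) : (q < p)%N -> 0 < sin ((p%:R - q%:R) / N%:R * pi : R).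
      move=> qp; apply: sin_gt0_pi; apply/andP; split.
        by rewrite mulr_gt0 ?pi_gt0// divr_gt0// subr_gt0 ltr_nat.
      rewrite gtr_pMl ?pi_gt0// ltr_pdivrMr// mul1r.
      apply: (@le_lt_trans _ _ p%:R); first by rewrite lerBlDr lerDl.
      by rewrite ltr_nat.
    have [lm'|ml|/val_inj/eqP] := ltngtP m l; last by rewrite eq_sym (negbTE lm).
      by rewrite gt_eqF// pos.
    rewrite -oppr_eq0 -sinN -mulNr -mulNr opprB gt_eqF// pos//.
  have Z : sin (d * y + d * (pi *+ 2 / N%:R) / 2) =
      sin (d * y - N%:R * (d * (pi *+ 2 / N%:R)) + d * (pi *+ 2 / N%:R) / 2).
    set z := d * y + _.
    have -> : d * y - N%:R * (d * (pi *+ 2 / N%:R)) + d * (pi *+ 2 / N%:R) / 2 =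
       z - pi *+ 2 * l%:R + pi *+ 2 * m%:R.
      by rewrite /z /d -mulr_natr; field.
    by rewrite sin_natmul_2pi -[RHS](sin_natmul_2pi _ l) subrK.
  move: E; rewrite Z subrr => /eqP; rewrite mulf_eq0 mulf_eq0 pnatr_eq0 (negbTE s0)/= => /eqP E.
  rewrite -[RHS]E; apply: eq_bigr => j _; congr cos; ring.
transitivity (N%:R ^- 2 * (\sum_(l < N) (N%:R : R))).
  congr (_ * _); apply: eq_bigr => l _; rewrite exchange_big/=.
  rewrite (bigD1 l)//= key eqxx big1 ?addr0// => m ml.
  by rewrite key eq_sym (negbTE ml).
by rewrite sumr_const card_ord -mulr_natr; field.
Qed.

(** Multiplication by [1 - cos t = 2 sin^2 (t / 2)] makes the geometric sums telescope to a
    difference of two unit vectors. Away from multiples of [2 pi] the kernel is thus of order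
    [N^(-2)]. *)
Lemma fejer_tail N (t : R) : N%:R ^+ 2 * (fejer N t * (1 - cos t)) <= 2.
Proof.
have [->|N0] := posnP N; first by rewrite expr0n/= mul0r.
have N1 : (N%:R : R) != 0 by rewrite pnatr_eq0 -lt0n.
rewrite /fejer mulrA mulrA divff ?expf_neq0// mul1r.
have C := sum_cos_arith 0 t N; have S := sum_sin_arith 0 t N.
set c := \sum_(l < N) cos (l%:R * t); set s := \sum_(l < N) sin (l%:R * t).
have cE : \sum_(j < N) cos (0 - j%:R * t) = c by apply: eq_bigr => j _; rewrite sub0r cosN.
have sE : \sum_(j < N) sin (0 - j%:R * t) = - s.
  by rewrite -sumrN; apply: eq_bigr => j _; rewrite sub0r sinN.
rewrite cE !add0r in C; rewrite sE !add0r in S.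
have t2 : 1 - cos t = 2 * sin (t / 2) ^+ 2.
  rewrite [in LHS](_ : t = t / 2 *+ 2); last by rewrite -mulr_natr; field.
  by rewrite cos_mulr2n sin2cos2 -mulr_natr; ring.
have E : (c ^+ 2 + s ^+ 2) * (1 - cos t) =
   ((2 * sin (t / 2) * c) ^+ 2 + (2 * sin (t / 2) * - s) ^+ 2) / 2.
  by rewrite t2; field.
rewrite E C S.
set p := t / 2; set q := - (N%:R * t) + p.
have -> : (sin p - sin q) ^+ 2 + (cos q - cos p) ^+ 2 =
   (cos p ^+ 2 + sin p ^+ 2) + (cos q ^+ 2 + sin q ^+ 2) - 2 * (cos p * cos q + sin p * sin q).
  by ring.
rewrite !cos2Dsin2 -cosB; have := cos_geN1 (p - q); lra.
Qed.

End Fejer.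

Section TrigFun.
Context {R : realType} {k : nat}.
Local Notation V := 'rV[R]_k.

(** The phase [ph] makes sines available as well. An inductive predicate lets boundedness,
    measurability and convergence of integrals be proved by induction. *)
Inductive trig_fun : (V -> R) -> Prop :=
| trig_cos (u : 'I_k -> R) (ph : R) : trig_fun (fun x => cos (\sum_i u i * x 0 i + ph))
| trig_add f g : trig_fun f -> trig_fun g -> trig_fun (fun x => f x + g x)
| trig_scale c f : trig_fun f -> trig_fun (fun x => c * f x).

Lemma eq_trig (f g : V -> R) : f =1 g -> trig_fun f -> trig_fun g.
Proof. by move=> /funext ->. Qed.

Lemma trig_cst c : trig_fun (fun=> c).
Proof.
apply: (eq_trig _ (trig_scale c (trig_cos (fun=> 0) 0))) => x /=.
by rewrite big1 ?addr0 ?cos0 ?mulr1// => i _; rewrite mul0r.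
Qed.

Lemma trig_mul f g : trig_fun f -> trig_fun g -> trig_fun (fun x => f x * g x).
Proof.
move=> tf; elim: tf g => {f} [u p|f1 f2 _ I1 _ I2|c f _ I] g tg.
- elim: tg => {g} [v q|g1 g2 _ I1 _ I2|c g _ I].
  + apply: (eq_trig _ (trig_scale 2^-1 (trig_add
      (trig_cos (fun i => u i + v i) (p + q)) (trig_cos (fun i => u i - v i) (p - q))))).
    move=> x /=.
    have -> : \sum_i (u i + v i) * x 0 i + (p + q) =
       (\sum_i u i * x 0 i + p) + (\sum_i v i * x 0 i + q).
      rewrite addrACA -big_split/=; congr (_ + _).
      by apply: eq_bigr => i _; rewrite mulrDl.
    have -> : \sum_i (u i - v i) * x 0 i + (p - q) =
       (\sum_i u i * x 0 i + p) - (\sum_i v i * x 0 i + q).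
      rewrite opprD addrACA -sumrB; congr (_ + _).
      by apply: eq_bigr => i _; rewrite mulrBl.
    by rewrite cosD cosB; field.
  + by apply: eq_trig (trig_add I1 I2) => x /=; rewrite mulrDr.
  + by apply: eq_trig (trig_scale c I) => x /=; rewrite mulrCA.
- by apply: eq_trig (trig_add (I1 _ tg) (I2 _ tg)) => x /=; rewrite mulrDl.
- by apply: eq_trig (trig_scale c (I _ tg)) => x /=; rewrite mulrA.
Qed.

Lemma trig_sum (I : Type) (r : seq I) (F : I -> V -> R) :
  (forall i, trig_fun (F i)) -> trig_fun (fun x => \sum_(i <- r) F i x).
Proof.
move=> tF; elim: r => [|i r IH].
  by apply: eq_trig (trig_cst 0) => x; rewrite big_nil.
by apply: eq_trig (trig_add (tF i) IH) => x; rewrite big_cons.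
Qed.

Lemma trig_prod (I : Type) (r : seq I) (F : I -> V -> R) :
  (forall i, trig_fun (F i)) -> trig_fun (fun x => \prod_(i <- r) F i x).
Proof.
move=> tF; elim: r => [|i r IH].
  by apply: eq_trig (trig_cst 1) => x; rewrite big_nil.
by apply: eq_trig (trig_mul (tF i) IH) => x; rewrite big_cons.
Qed.

Lemma trig_fejer N (c s : R) i : trig_fun (fun x => fejer N (c * x 0 i + s)).
Proof.
have tc (l : nat) : trig_fun (fun x => cos (l%:R * (c * x 0 i + s))).
  apply: eq_trig (trig_cos (fun j => if j == i then l%:R * c else 0) (l%:R * s)) => x /=.
  rewrite (bigD1 i)//= eqxx big1 ?addr0; first by congr cos; ring.
  by move=> j /negbTE ->; rewrite mul0r.
have ts (l : nat) : trig_fun (fun x => sin (l%:R * (c * x 0 i + s))).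
  apply: eq_trig (trig_cos (fun j => if j == i then l%:R * c else 0) (l%:R * s - pi / 2)) => x /=.
  rewrite (bigD1 i)//= eqxx big1 ?addr0; last by move=> j /negbTE ->; rewrite mul0r.
  by rewrite addrA cosBpihalf; congr sin; ring.
have sc := trig_sum (index_enum 'I_N) (fun l : 'I_N => tc l).
have ss := trig_sum (index_enum 'I_N) (fun l : 'I_N => ts l).
exact: trig_scale (trig_add (trig_mul sc sc) (trig_mul ss ss)).
Qed.

End TrigFun.

(** * Trigonometric approximation on cubes *)

Section Approximation.
Context {R : realType} {k : nat}.
Local Notation V := 'rV[R]_k.

(** Only [x] has to lie in the cube: the interpolation nodes [p] of the next lemma may lie outside.
    Compactness is used as a covering property for this reason. *)
Lemma uniform_continuous_cube (f : V -> R) (L e : R) : continuous f -> 0 < e ->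
  exists2 del : R, 0 < del & forall x p : V, (forall i, `|x 0 i| <= L) ->
    (forall i, `|p 0 i - x 0 i| <= del) -> `|f x - f p| <= e.
Proof.
move=> cf e0.
pose K : set V := [set x | forall i, `|x 0 i| <= L].
have cK : compact K.
  have -> : K = [set v : V | forall i, `[- L, L]%classic (v ord0 i)].
    by apply/seteqP; split=> x /= xL i; have := xL i; rewrite /= in_itv/= -ler_norml.
  by apply: (@rV_compact _ _ (fun=> `[- L, L]%classic)) => i; exact: segment_compact.
have := cK => /compact_near_coveringP/(_ R (0^'+)
  (fun del (x : V) => forall p : V, (forall i, `|p 0 i - x 0 i| <= del) -> `|f x - f p| <= e) _).
case=> [x Kx|del/= del0 H].
  have [r r0 xr] : exists2 r : R, 0 < r &
      forall y : V, (forall i, `|x 0 i - y 0 i| < r) -> `|f x - f y| < e / 2.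
    have /cvgrPdist_lt/(_ _ (divr_gt0 e0 (@ltr0n R 2))) := cf x.
    rewrite near_simpl => /nbhs_ballP[r /= r0 xr]; exists r => // y xy.
    by apply: xr; split=> // j i; rewrite (ord1 j); exact: xy.
  near=> y del => p /= yp.
  have xy i : `|x 0 i - y 0 i| < r / 2.
    have : ball x (r / 2) y by near: y; apply: nbhsx_ballx; rewrite divr_gt0.
    by move=> [_ /(_ 0 i)].
  have dr : del < r / 2 by near: del; apply: nbhs_right_lt; rewrite divr_gt0.
  have h1 : `|f x - f y| < e / 2.
    apply: xr => i; apply: lt_trans (xy i) _; lra.
  have h2 : `|f x - f p| < e / 2.
    apply: xr => i.
    have -> : x 0 i - p 0 i = (x 0 i - y 0 i) - (p 0 i - y 0 i) by ring.
    by apply: le_lt_trans (ler_normB _ _) _; have := xy i; have := yp i; lra.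
  have -> : f y - f p = (f x - f p) - (f x - f y) by ring.
  by apply: le_trans (ler_normB _ _) _; lra.
exists (del / 2); first by rewrite divr_gt0.
move=> x p xL px; apply: (H (del / 2)) => //.
- by rewrite /= sub0r normrN ger0_norm ?divr_ge0 ?ltW// ltr_pdivrMr//; lra.
- by rewrite divr_gt0.
Unshelve. all: by end_near. Qed.

(** [g] averages the values of [f] at grid nodes, with products of Fejér kernels as weights. As the
    weights are nonnegative with sum 1, the bound [B] holds on the whole space, which controls the
    error off the cube later. *)
Lemma trig_approximation (f : V -> R) (B L e : R) : continuous f ->
  (forall x, `|f x| <= B) -> 0 < L -> 0 < e ->
  exists g : V -> R, [/\ trig_fun g, forall x, `|g x| <= B &
    forall x : V, (forall i, `|x 0 i| <= L) -> `|f x - g x| <= e].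
Proof.
move=> cf fB L0 e0.
have B0 : 0 <= B by apply: le_trans (fB 0).
have e20 : 0 < e / 2 by rewrite divr_gt0.
have [del0 del00 Hdel] := uniform_continuous_cube L cf e20.
have p0 := @pi_gt0 R.
(* The period in each coordinate is [8 L], so angles in the cube are at most [pi / 4], whereas those
   of the nodes fill [[- pi, pi[]: their differences stay below [5 pi / 4], away from a full
   turn. *)
pose c := pi / (4 * L).
have c0 : 0 < c by rewrite divr_gt0// mulr_gt0.
(* The angle of a distance [del0], capped so that an angle up to [5 pi / 4], seen from the other
   side of the circle, is also at least [dl]; then [s0] bounds [1 - cos] below at all far nodes. *)
pose dl := Num.min (c * del0) (pi / 2).
have dl0 : 0 < dl by rewrite lt_min mulr_gt0//= divr_gt0.
pose s0 := 1 - cos dl.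
have dlp : dl <= pi / 2 by rewrite ge_min lexx orbT.
have s00 : 0 < s0.
  rewrite subr_gt0 -(@cos0 R) ltr_cos// in_itv/=; lra.
(* Each of [k] coordinates has [N] nodes of far weight at most [(2 / s0) / N^2], and [f] oscillates
   by at most [2 B]: the far nodes contribute [M / N]. *)
pose M := 2 * B * k%:R * (2 / s0).
have [N N0 NM] : exists2 N : nat, (0 < N)%N & M / N%:R <= e / 2.
  exists (Num.truncn (M / (e / 2))).+1 => //.
  have M0 : 0 <= M by rewrite !mulr_ge0// ltW// invr_gt0.
  rewrite ler_pdivrMr ?ltr0n// mulrC -ler_pdivrMr//.
  by apply/ltW/truncnS_gt.
have N1 : (N%:R : R) != 0 by rewrite pnatr_eq0 -lt0n.
have NR : 0 < (N%:R : R) by rewrite ltr0n.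
pose node (j : 'I_N) : R := (pi *+ 2 / N%:R * j%:R - pi) / c.
pose pt (J : {ffun 'I_k -> 'I_N}) : V := \row_i node (J i).
pose w (x : V) i (j : 'I_N) : R := fejer N (c * x 0 i + (pi - pi *+ 2 / N%:R * j%:R)).
have w0 x i j : 0 <= w x i j by exact: fejer_ge0.
have w1 x i : \sum_j w x i j = 1.
  rewrite -(fejer_sum (c * x 0 i + pi) N0); apply: eq_bigr => j _.
  by rewrite /w addrA.
pose W x (J : {ffun 'I_k -> 'I_N}) : R := \prod_i w x i (J i).
have W0 x J : 0 <= W x J by apply: prodr_ge0.
have W1 x : \sum_J W x J = 1.
  rewrite /W -(bigA_distr_bigA (fun i j => w x i j)) big1//.
pose g x := \sum_J f (pt J) * W x J.
exists g; split.
- apply: trig_sum => J; apply: trig_scale; apply: trig_prod => i.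
  exact: trig_fejer.
- move=> x; apply: le_trans (ler_norm_sum _ _ _) _.
  rewrite -[leRHS]mulr1 -(W1 x) mulr_sumr; apply: ler_sum => J _.
  by rewrite normrM (ger0_norm (W0 _ _)) ler_wpM2r.
move=> x xL.
pose far i (j : 'I_N) : R := if del0 < `|node j - x 0 i| then 1 else 0.
have bound J : `|f x - f (pt J)| <= e / 2 + 2 * B * \sum_i far i (J i).
  have far0 i j : 0 <= far i j by rewrite /far; case: ifP.
  have S0 : 0 <= \sum_i far i (J i) by apply: sumr_ge0.
  have [H|] := pselect (forall i, `|pt J 0 i - x 0 i| <= del0).
    by apply: le_trans (Hdel _ _ xL H) _; rewrite lerDl !mulr_ge0.
  move=> /existsNP[i /negP]; rewrite -ltNge mxE => H.
  have : 1 <= \sum_i far i (J i).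
    rewrite (bigD1 i)//= {1}/far H lerDl; exact: sumr_ge0.
  move=> S1; have := ler_normB (f x) (f (pt J)); have := fB x; have := fB (pt J).
  have : 2 * B * 1 <= 2 * B * \sum_i far i (J i) by rewrite ler_wpM2l// mulr_ge0.
  lra.
have farw i j : far i j * w x i j <= 2 / s0 / N%:R ^+ 2.
  rewrite /far; case: ifP => [H|_]; last by rewrite mul0r !divr_ge0// ltW.
  rewrite mul1r.
  set t := c * x 0 i + (pi - pi *+ 2 / N%:R * j%:R).
  have tE : t = - (c * (node j - x 0 i)).
    by rewrite /t /node; field; rewrite gt_eqF.
  have t1 : dl <= `|t|.
    rewrite tE normrN normrM (gtr0_norm c0) ge_min ler_pM2l// ltW//.
  have h0 : 0 <= pi *+ 2 / N%:R :> R.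
    by apply: divr_ge0 => //; apply: mulrn_wge0; exact: ltW.
  have t2 : `|t| <= pi + pi / 4.
    have -> : t = c * x 0 i + (pi - pi *+ 2 / N%:R * j%:R) by [].
    apply: le_trans (ler_normD _ _) _; rewrite addrC; apply: lerD.
      rewrite ler_norml; apply/andP; split.
        have : pi *+ 2 / N%:R * j%:R <= pi *+ 2 / N%:R * N%:R :> R.
          by apply: ler_wpM2l => //; rewrite ler_nat ltnW.
        by rewrite divfK// -mulr_natr; lra.
      have : 0 <= pi *+ 2 / N%:R * j%:R :> R by rewrite mulr_ge0.
      lra.
    rewrite normrM (gtr0_norm c0) (le_trans (ler_wpM2l (ltW c0) (xL i)))//.
    by rewrite /c le_eqVlt; apply/orP; left; apply/eqP; field; rewrite gt_eqF.
  have cost : s0 <= 1 - cos t.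
    rewrite lerD2l lerN2 -(cos_norm t).
    have [tp|tp] := leP `|t| pi.
      by rewrite leNgt ltr_cos ?in_itv/= -?leNgt//; lra.
    have -> : cos `|t| = cos (2 * pi - `|t|).
      by rewrite mulr_natl cosB cos2pi sin2pi mul1r mul0r addr0.
    by rewrite leNgt ltr_cos ?in_itv/= -?leNgt//; lra.
  have := fejer_tail N t.
  have f0 := fejer_ge0 N t => T.
  have : N%:R ^+ 2 * (fejer N t * s0) <= 2.
    apply: le_trans T; rewrite ler_pM2l ?exprn_gt0//; exact: ler_wpM2l.
  rewrite /w -/t => H2.
  rewrite ler_pdivlMr ?exprn_gt0// ler_pdivlMr// mulrAC mulrC mulrA -mulrA.
  by move: H2; rewrite mulrA [_ * fejer _ _]mulrC -mulrA.
(* Since [far i] involves one coordinate only, the weights of the other coordinates sum to 1. *)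
have sumfar i : \sum_J W x J * far i (J i) <= 2 / s0 / N%:R.
  have -> : \sum_J W x J * far i (J i) = \sum_j far i j * w x i j.
    pose v l j := w x l j * (if l == i then far i j else 1).
    transitivity (\sum_(J : {ffun 'I_k -> 'I_N}) \prod_l v l (J l)).
      apply: eq_bigr => J _; rewrite /v big_split/= -/(W x J); congr (_ * _).
      by rewrite (bigD1 i)//= eqxx big1 ?mulr1// => l /negbTE ->.
    rewrite -(bigA_distr_bigA v) (bigD1 i)//= [X in _ * X]big1 ?mulr1.
      by apply: eq_bigr => j _; rewrite /v eqxx mulrC.
    move=> l li; rewrite -[RHS](w1 x l); apply: eq_bigr => j _.
    by rewrite /v (negbTE li) mulr1.
  apply: le_trans (ler_sum _ (fun j _ => farw i j)) _.
  rewrite sumr_const card_ord -mulr_natr le_eqVlt; apply/orP; left; apply/eqP.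
  by field; rewrite N1 gt_eqF.
have -> : f x - g x = \sum_J (f x - f (pt J)) * W x J.
  rewrite /g -[X in X - _]mulr1 -(W1 x) mulr_sumr -sumrB.
  by apply: eq_bigr => J _; rewrite mulrBl.
apply: le_trans (ler_norm_sum _ _ _) _.
have S1 : \sum_(J : {ffun 'I_k -> 'I_N}) `|(f x - f (pt J)) * W x J| <=
    \sum_(J : {ffun 'I_k -> 'I_N}) (e / 2 + 2 * B * (\sum_i far i (J i))) * W x J.
  by apply: ler_sum => J _; rewrite normrM (ger0_norm (W0 _ _)) ler_wpM2r.
apply: le_trans S1 _.
rewrite (eq_bigr (fun J : {ffun 'I_k -> 'I_N} => e / 2 * W x J + 2 * B * (\sum_i (W x J * far i (J i))))); last first.
  by move=> J _; rewrite -mulr_sumr mulrDl; ring.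
rewrite big_split/= -mulr_sumr W1 mulr1 -mulr_sumr exchange_big/=.
have : 2 * B * \sum_i \sum_J W x J * far i (J i) <= M / N%:R.
  have -> : M / N%:R = 2 * B * \sum_(i < k) (2 / s0 / N%:R).
    rewrite sumr_const card_ord -mulr_natr /M; field; rewrite N1 gt_eqF//.
  by rewrite ler_wpM2l ?mulr_ge0//; apply: ler_sum => i _.
lra.
Qed.

End Approximation.

Section BoundedIntegrals.
Context {R : realType} d (T : measurableType d) (P : probability T R).

Lemma bounded_integrable (f : T -> R) (M : R) : measurable_fun setT f ->
  (forall w, `|f w| <= M) -> P.-integrable setT (EFin \o f).
Proof.
move=> mf fM; apply: (@le_integrable_real R _ _ P setT f (cst M)) => //.
exact: finite_measure_integrable_cst.
Qed.

Lemma Rintegral_prob_cst (M : R) : \int[P]_w M = M.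
Proof. by rewrite Rintegral_cst//= [X in fine X](@probability_setT _ _ _ P) mulr1. Qed.

Lemma norm_Rintegral_le (f : T -> R) (M : R) : measurable_fun setT f ->
  (forall w, `|f w| <= M) -> `|\int[P]_w f w| <= M.
Proof.
move=> mf fM; have If := bounded_integrable mf fM.
apply: le_trans (le_normr_Rintegral _ If) _ => //.
rewrite -[leRHS]Rintegral_prob_cst; apply: le_Rintegral => //.
- exact: integrable_norm.
- exact: finite_measure_integrable_cst.
Qed.

Lemma trig_bounded k (g : 'rV[R]_k -> R) : trig_fun g -> exists M, forall x, `|g x| <= M.
Proof.
elim=> {g} [u p|g1 g2 _ [M1 H1] _ [M2 H2]|c g _ [M H]].
- by exists 1 => x; exact: cos_max.
- by exists (M1 + M2) => x; apply: le_trans (ler_normD _ _) _; exact: lerD.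
- by exists (`|c| * M) => x; rewrite normrM ler_wpM2l.
Qed.

Lemma trig_measurable k (Z : 'I_k -> T -> R) (g : 'rV[R]_k -> R) :
  (forall i, measurable_fun setT (Z i)) -> trig_fun g ->
  measurable_fun setT (fun w => g (\row_i Z i w)).
Proof.
move=> mZ; elim=> {g} [u p|g1 g2 _ H1 _ H2|c g _ H].
- apply: (measurableT_comp (f := cos)); first exact: continuous_measurable_fun (@continuous_cos R).
  apply: measurable_funD => //; apply: measurable_sum => i.
  rewrite (_ : (fun x => _ * _) = (fun x => u i * Z i x)); first exact: measurable_funM.
  by apply/funext => x; rewrite mxE.
- exact: measurable_funD.
- exact: measurable_funM.
Qed.

(** A pointwise limit of trigonometric functions, accurate to [1 / (n + 1)] on the cube of radius
    [n + 1], so that only the measurability of the coordinates is used. *)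
Lemma continuous_row_measurable k (Z : 'I_k -> T -> R) (f : 'rV[R]_k -> R) (B : R) :
  (forall i, measurable_fun setT (Z i)) -> continuous f -> (forall x, `|f x| <= B) ->
  measurable_fun setT (fun w => f (\row_i Z i w)).
Proof.
move=> mZ cf fB.
have /choice[g Hg] : forall n : nat, exists g : 'rV[R]_k -> R, [/\ trig_fun g,
    forall x, `|g x| <= B &
    forall x : 'rV[R]_k, (forall i, `|x 0 i| <= n.+1%:R) -> `|f x - g x| <= n.+1%:R^-1].
  by move=> n; apply: trig_approximation => //; rewrite ?ltr0n ?invr_gt0 ?ltr0n.
apply: (measurable_fun_cvg (h := fun n w => g n (\row_i Z i w))).
  by move=> n; have [tg _ _] := Hg n; exact: trig_measurable.
move=> w _; set x := \row_i Z i w.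
apply/cvgrPdist_le => e e0; near=> n.
have [_ _ /(_ x) H] := Hg n.
apply: le_trans (H _) _.
  move=> i; apply: (@le_trans _ _ (\sum_j `|x 0 j|)).
    by rewrite (bigD1 i)//= lerDl; exact: sumr_ge0.
  apply/ltW; near: n; exists (Num.truncn (\sum_j `|x 0 j|)) => // m /= mn.
  apply: lt_le_trans (truncnS_gt _) _; by rewrite ler_nat ltnS.
by apply/ltW; near: n; exact: near_infty_natSinv_lt (PosNum e0).
Unshelve. all: by end_near. Qed.

(** On the cube the integrands differ by at most [e]; off it by at most [2 B], on an event of
    probability at most [k * eta] by the union bound. *)
Lemma trig_close k (Z : 'I_k -> T -> R) (f g : 'rV[R]_k -> R) (B L e eta : R) :
  (forall i, measurable_fun setT (Z i)) -> continuous f -> (forall x, `|f x| <= B) ->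
  trig_fun g -> (forall x, `|g x| <= B) -> 0 <= e ->
  (forall x : 'rV[R]_k, (forall i, `|x 0 i| <= L) -> `|f x - g x| <= e) ->
  (forall i, \int[P]_w \1_[set w | L < `|Z i w|] w <= eta) ->
  `|\int[P]_w f (\row_i Z i w) - \int[P]_w g (\row_i Z i w)| <= e + 2 * B * (k%:R * eta).
Proof.
move=> mZ cf fB tg gB e0 fg tail.
have B0 : 0 <= B by apply: le_trans (fB 0).
have mf := continuous_row_measurable mZ cf fB.
have mg := trig_measurable mZ tg.
have If : P.-integrable setT (EFin \o (fun w => f (\row_i Z i w))).
  by apply: (bounded_integrable mf) => w; exact: fB.
have Ig : P.-integrable setT (EFin \o (fun w => g (\row_i Z i w))).
  by apply: (bounded_integrable mg) => w; exact: gB.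
rewrite -RintegralB//.
have mA i : measurable [set w | L < `|Z i w|].
  rewrite -[X in measurable X]setTI.
  by apply: (measurable_fun_ltr (f := cst L)) => //; exact: measurableT_comp.
pose ind i w : R := \1_[set w | L < `|Z i w|] w.
have mi i : measurable_fun setT (ind i) by exact: measurable_indic.
have Ii i : P.-integrable setT (EFin \o ind i).
  apply: (@bounded_integrable _ 1) => // w.
  by rewrite /ind indicE; case: (_ \in _); rewrite ?normr1 ?normr0.
have kE : k%:R = \sum_(i < k) (1 : R) by rewrite sumr_const card_ord.
have Isum : P.-integrable setT (EFin \o (fun w => \sum_i ind i w)).
  apply: (@bounded_integrable _ k%:R); first by apply: measurable_sum => i.
  move=> w; apply: le_trans (ler_norm_sum _ _ _) _.
  rewrite kE.
  by apply: ler_sum => i _; rewrite /ind indicE; case: (_ \in _); rewrite ?normr1 ?normr0.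
have -> : e + 2 * B * (k%:R * eta) = e + 2 * B * \sum_(i < k) eta.
  by rewrite sumr_const card_ord -(mulr_natl eta).
have Ifg : P.-integrable setT (EFin \o (fun w => f (\row_i Z i w) - g (\row_i Z i w))).
  by apply: (@bounded_integrable _ (B + B)); [exact: measurable_funB|
    move=> w; apply: le_trans (ler_normB _ _) _; exact: lerD].
apply: le_trans (le_normr_Rintegral _ Ifg) _ => //.
apply: (@le_trans _ _ (\int[P]_w (e + 2 * B * \sum_i ind i w))).
  apply: le_Rintegral => //.
  - exact: integrable_norm.
  - apply: (@bounded_integrable _ (e + 2 * B * k%:R)).
      by apply: measurable_funD => //; apply: measurable_funM => //; exact: measurable_sum.
    move=> w; rewrite ger0_norm; last first.
      rewrite addr_ge0// !mulr_ge0// sumr_ge0// => i _; rewrite /ind indicE; by case: (_ \in _).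
    rewrite lerD2l ler_wpM2l ?mulr_ge0//.
    rewrite kE.
    by apply: ler_sum => i _; rewrite /ind indicE; case: (_ \in _).
  - move=> w _; set x := \row_i Z i w.
    have S0 : 0 <= \sum_i ind i w.
      by apply: sumr_ge0 => i _; rewrite /ind indicE; case: (_ \in _).
    have [H|] := pselect (forall i, `|x 0 i| <= L).
      by apply: le_trans (fg _ H) _; rewrite lerDl !mulr_ge0.
    move=> /existsNP[i /negP]; rewrite -ltNge mxE => H.
    have : 1 <= \sum_i ind i w.
      rewrite (bigD1 i)//= {1}/ind indicE mem_set// lerDl; apply: sumr_ge0 => j _.
      by rewrite /ind indicE; case: (_ \in _).
    move=> S1; have := ler_normB (f x) (g x); have := fB x; have := gB x.
    have : 2 * B * 1 <= 2 * B * \sum_i ind i w by rewrite ler_wpM2l// mulr_ge0.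
    lra.
rewrite RintegralD//; last 2 first.
- exact: finite_measure_integrable_cst.
- exact: integrableZl_real.
rewrite Rintegral_prob_cst lerD2l RintegralZl// ler_wpM2l ?mulr_ge0//.
rewrite (Rintegral_sum _ measurableT Ii).2; apply: ler_sum => i _; exact: tail.
Qed.

End BoundedIntegrals.

(** * Tightness from convergence of the real parts of characteristic functions *)

Section Tightness.
Context {R : realType}.
Local Notation leb := (@lebesgue_measure R).
Local Notation I01 := (`[0%R, 1%R]%classic : set R).

Let m01 : measurable (I01 : set (measurableTypeR R)). Proof. exact: measurable_itv. Qed.

Let leb01 : leb I01 = 1%E.
Proof. by rewrite lebesgue_measure_itv/= lte_fin ltr01 oppr0 adde0. Qed.

Let I01_cst (c : R) : leb.-integrable I01 (EFin \o cst c).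
Proof.
apply/integrableP; split; first exact/measurable_EFinP.
apply: (@le_lt_trans _ _ (`|c|%:E * leb I01)%E); first by rewrite -integral_cst.
by rewrite leb01 mule1 ltry.
Qed.

Let I01_int (c : R) : \int[leb]_(z in I01) c = c.
Proof.
rewrite Rintegral_cst//; transitivity (c * fine (leb I01)); first by [].
by rewrite leb01 mulr1.
Qed.

Let onem_cos_meas (x : R) : measurable_fun [set: R] (fun z => 1 - cos (z * x)).
Proof.
apply: measurable_funB => //; apply: (measurableT_comp (f := cos)).
  exact: continuous_measurable_fun (@continuous_cos R).
by apply: measurable_funM.
Qed.

Let onem_cos_ge0 (x : R) : 0 <= 1 - cos x.
Proof. by rewrite subr_ge0 cos_le1. Qed.

Let onem_cos_le2 (x : R) : `|1 - cos x| <= 2.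
Proof. by rewrite ger0_norm//; have := cos_geN1 x; lra. Qed.

(** This is [1 - sin x / x] off 0. The average over frequencies stays away from 0 for large [|x|],
    whereas [1 - cos x] keeps returning to 0. *)
Definition mean_onem_cos (x : R) := \int[leb]_(z in I01) (1 - cos (z * x)).

Let Iq (x : R) : leb.-integrable I01 (EFin \o (fun z => 1 - cos (z * x))).
Proof.
apply: (@le_integrable_real R _ _ leb I01 _ (cst 2)) => //.
  exact: (measurable_funTS (onem_cos_meas x)).
Qed.

Lemma mean_onem_cos_ge0 x : 0 <= mean_onem_cos x.
Proof. by apply: Rintegral_ge0. Qed.

Lemma mean_onem_cos_le (x c : R) : (forall z : R, 0 <= z <= 1 -> 1 - cos (z * x) <= c) ->
  mean_onem_cos x <= c.
Proof.
move=> H; rewrite /mean_onem_cos.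
rewrite -[leRHS](I01_int c); apply: le_Rintegral => //; exact: I01_cst.
Qed.

Lemma mean_onem_cos_half (x : R) : 2 <= `|x| -> 2^-1 <= mean_onem_cos x.
Proof.
move=> x2; have x0 : x != 0 by rewrite -normr_gt0 (lt_le_trans _ x2).
pose F z := z - sin (z * x) / x.
have dF (z : R) : is_derive z 1 F (1 - cos (z * x)).
  have D0 : is_derive z 1 (fun y : R => y * x) x.
    by apply: is_derive_eq; rewrite /GRing.scale/=; ring.
  have D1 := @is_derive1_comp R sin _ z _ _ (is_derive_sin _) D0.
  have -> : F = id - x^-1 *: (sin \o ( *%R^~ x)).
    by apply/funext => y; rewrite /F/= /GRing.scale/= [X in _ = _ - X]mulrC.
  by apply: is_derive_eq; rewrite /GRing.scale/= mulrC mulfK.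
have E : (\int[leb]_(z in I01) (1 - cos (z * x))%:E = (F 1)%:E - (F 0)%:E)%E.
  apply: continuous_FTC2 => //.
  - apply: continuous_subspaceT => z; apply: cvgB; first exact: cvg_cst.
    apply: (@continuous_comp _ _ _ (fun y : R => y * x) cos); last exact: continuous_cos.
    by apply: cvgM; [exact: cvg_id|exact: cvg_cst].
  - split; first by move=> z _; have [] := dF z.
    + by apply: cvg_at_right_filter; exact: is_derive_continuous (dF 0).
    + by apply: cvg_at_left_filter; exact: is_derive_continuous (dF 1).
  - by move=> z _; rewrite derive1E; have [_] := dF z.
rewrite /mean_onem_cos /Rintegral E /= /F !mul1r mul0r sin0 mul0r subr0.
have : `|sin x / x| <= 2^-1.
  rewrite normrM normfV ler_pdivrMr ?normr_gt0//.
  apply: le_trans (sin_max _) _; lra.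
have := ler_norm (sin x / x); lra.
Qed.

Section Prob.
Context d (T : measurableType d) (P : probability T R).

(** Expresses a quantity that dominates the tail of [Z] through its characteristic function on
    [[0, dl]]. *)
Lemma mean_onem_cos_Fubini (Z : T -> R) (dl : R) : measurable_fun setT Z ->
  measurable_fun setT (fun w => mean_onem_cos (dl * Z w)) /\
  \int[P]_w mean_onem_cos (dl * Z w) =
  \int[leb]_(z in I01) (1 - \int[P]_w cos (z * dl * Z w)).
Proof.
move=> mZ.
pose F (p : T * R) : R := (1 - cos (p.2 * (dl * Z p.1))) * \1_I01 p.2.
have mF : measurable_fun setT F.
  apply: measurable_funM; last first.
    by apply: (measurableT_comp (f := (\1_I01 : R -> R))).
  apply: measurable_funB => //; apply: (measurableT_comp (f := cos)).
    exact: continuous_measurable_fun (@continuous_cos R).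
  apply: measurable_funM => //; apply: measurable_funM => //.
  exact: measurableT_comp.
have inner1 w : (\int[leb]_z (F (w, z))%:E = (mean_onem_cos (dl * Z w))%:E)%E.
  rewrite /mean_onem_cos /Rintegral fineK; last by apply: integrable_fin_num => //; exact: Iq.
  rewrite [RHS]integral_mkcond; apply: eq_integral => z _.
  by rewrite patchE /F indicE; case: (_ \in _); rewrite ?mulr1 ?mulr0.
have q2 x : mean_onem_cos x <= 2.
  by apply: mean_onem_cos_le => z _; apply: le_trans (ler_norm _) _.
have IF : (P \x leb)%E.-integrable setT (EFin \o F).
  apply/integrable12ltyP; first exact/measurable_EFinP.
  apply: (@le_lt_trans _ _ (\int[P]_w (cst 2%:E w))%E); last first.
    by rewrite integral_cst// [X in (_ * X)%E](@probability_setT _ _ _ P) mule1 ltry.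
  apply: ge0_le_integral => //.
  - by move=> w _; exact: integral_ge0.
  - apply: (@measurable_fun_fubini_tonelli_F _ _ _ _ _ leb (abse \o (EFin \o F))) => //.
    + by apply: measurableT_comp => //; exact/measurable_EFinP.
    + by move=> p; exact: abse_ge0.
  - move=> w _; rewrite [leLHS](_ : _ = (mean_onem_cos (dl * Z w))%:E); first by rewrite lee_fin.
    rewrite -inner1; apply: eq_integral => z _; rewrite /= ger0_norm//.
    by rewrite /F mulr_ge0// indicE.
have E1 := @integral12_prod_meas1 _ _ _ _ _ P leb _ IF.
have E2 := @integral21_prod_meas1 _ _ _ _ _ P leb _ IF.
have M1 := @measurable_fubini_F _ _ _ _ _ P leb _ IF.
have FE : fubini_F leb (EFin \o F) = EFin \o (fun w => mean_onem_cos (dl * Z w)).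
  by apply/funext => w; rewrite /fubini_F/= inner1.
split; first by rewrite FE in M1; exact/measurable_EFinP.
rewrite /Rintegral; congr fine.
transitivity (\int[P]_w fubini_F leb (EFin \o F) w)%E; first by rewrite FE.
rewrite E1 -E2 [RHS]integral_mkcond; apply: eq_integral => z _.
rewrite patchE /fubini_G/= /F; case: ifPn => zI /=; last first.
  by rewrite integral0_eq// => w _; rewrite indicE (negbTE zI) mulr0.
have mc : measurable_fun setT (fun w => cos (z * dl * Z w)).
  apply: (measurableT_comp (f := cos)); first exact: continuous_measurable_fun (@continuous_cos R).
  exact: measurable_funM.
have Ic : P.-integrable setT (EFin \o (fun w => cos (z * dl * Z w))).
  by apply: (@bounded_integrable R _ _ P _ 1) => // w; exact: cos_max.
rewrite -[X in _ = (X - _)%:E](Rintegral_prob_cst P 1) -RintegralB//; last first.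
  exact: finite_measure_integrable_cst.
rewrite /Rintegral fineK; last first.
  apply: integrable_fin_num => //; apply: integrableB_real => //.
  exact: finite_measure_integrable_cst.
by apply: eq_integral => w _; rewrite indicE zI mulr1 mulrA.
Qed.

Lemma tail_le_mean (Z : T -> R) (dl : R) : measurable_fun setT Z -> 0 < dl ->
  \int[P]_w \1_[set w | 2 / dl < `|Z w|] w <= 2 * \int[P]_w mean_onem_cos (dl * Z w).
Proof.
move=> mZ dl0; have [mq _] := mean_onem_cos_Fubini dl mZ.
have q2 x : mean_onem_cos x <= 2.
  by apply: mean_onem_cos_le => z _; apply: le_trans (ler_norm _) _.
have Iq' : P.-integrable setT (EFin \o (fun w => mean_onem_cos (dl * Z w))).
  by apply: (@bounded_integrable R _ _ P _ 2) => // w; rewrite ger0_norm ?mean_onem_cos_ge0.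
have mA : measurable [set w | 2 / dl < `|Z w|].
  rewrite -[X in measurable X]setTI.
  by apply: (measurable_fun_ltr (f := cst (2 / dl))) => //; exact: measurableT_comp.
rewrite -RintegralZl//; apply: le_Rintegral => //.
- apply: (@bounded_integrable R _ _ P _ 1) => // w.
  by rewrite indicE; case: (_ \in _); rewrite ?normr1 ?normr0.
- exact: integrableZl_real.
move=> w _; rewrite indicE; case: (boolP (_ \in _)) => [|_]; last first.
  by rewrite mulr_ge0 ?mean_onem_cos_ge0.
rewrite inE/= => H.
have : 2 <= `|dl * Z w|.
  by rewrite normrM (gtr0_norm dl0) -ler_pdivrMl// mulrC ltW.
move=> /mean_onem_cos_half; rewrite /=; lra.
Qed.

End Prob.

(** For the limit [Y] the mean of [mean_onem_cos (dl * Y)] tends to 0 with [dl]. Once [dl] is fixed,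
    dominated convergence on the unit interval of frequencies carries the smallness over to
    [X n]. *)
Lemma tight_of_cvg_charfun d (T : measurableType d) (P : probability T R)
    d' (T' : measurableType d') (Q : probability T' R) (X : nat -> T -> R) (Y : T' -> R) (e : R) :
  (forall n, measurable_fun setT (X n)) -> measurable_fun setT Y ->
  (forall z : R, \int[P]_w cos (z * X n w) @[n --> \oo] --> \int[Q]_w cos (z * Y w)) ->
  0 < e -> exists2 L : R, 0 < L & \int[Q]_w \1_[set w | L < `|Y w|] w <= e /\
    \forall n \near \oo, \int[P]_w \1_[set w | L < `|X n w|] w <= e.
Proof.
move=> mX mY XY e0.
have q2 x : mean_onem_cos x <= 2.
  by apply: mean_onem_cos_le => z _; apply: le_trans (ler_norm _) _.
have cQ : \int[Q]_w mean_onem_cos (m.+1%:R^-1 * Y w) @[m --> \oo] --> \int[Q]_w (cst 0 w : R).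
  apply: (@Rintegral_dominated_cvg R _ _ Q setT (fun m w => mean_onem_cos (m.+1%:R^-1 * Y w))
    (cst 0) (cst 2) _ _ _ _ _ _).2 => //.
  - by move=> m; have [] := mean_onem_cos_Fubini Q m.+1%:R^-1 mY.
  - apply: aeW => w _; apply: (@squeeze_cvgr _ _ _ _ (cst 0) (fun m => m.+1%:R^-1 * `|Y w|)).
    + apply: nearW => m; rewrite mean_onem_cos_ge0/=; apply: mean_onem_cos_le => z /andP[z0 z1].
      apply: le_trans (ler_norm _) _; apply: le_trans (cosB1_le _) _.
      rewrite !normrM (ger0_norm z0) [X in _ * (X * _)]ger0_norm ?invr_ge0//.
      by rewrite ler_piMl// mulr_ge0// invr_ge0.
    + exact: cvg_cst.
    + rewrite -[X in _ --> X](mul0r `|Y w|); apply: cvgMl; exact: cvg_harmonic.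
  - exact: finite_measure_integrable_cst.
  - by move=> m w _; rewrite ger0_norm ?mean_onem_cos_ge0.
rewrite Rintegral_prob_cst in cQ.
(* [tail_le_mean] costs a factor 2 and the passage from [Y] to [X n] doubles the error, hence a
   quarter. *)
have e40 : 0 < e / 4 by rewrite divr_gt0.
have /cvgrPdist_lt/(_ _ e40)[m _ /(_ m (leqnn m))] := cQ.
set dl : R := m.+1%:R^-1.
have dl0 : 0 < dl by rewrite invr_gt0.
rewrite sub0r normrN => /(le_lt_trans (ler_norm _)) qY.
exists (2 / dl); first by rewrite divr_gt0.
split; first by apply: le_trans (tail_le_mean Q mY dl0) _; lra.
have cP : \int[P]_w mean_onem_cos (dl * X n w) @[n --> \oo] --> \int[Q]_w mean_onem_cos (dl * Y w).
  rewrite (mean_onem_cos_Fubini Q dl mY).2.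
  under eq_fun do rewrite (mean_onem_cos_Fubini P dl (mX _)).2.
  have b1 d1 (T1 : measurableType d1) (P1 : probability T1 R) (Z : T1 -> R) (z : R) :
      measurable_fun setT Z -> `|1 - \int[P1]_w cos (z * dl * Z w)| <= 2.
    move=> mZ; apply: le_trans (ler_normB _ _) _; rewrite normr1.
    have : `|\int[P1]_w cos (z * dl * Z w)| <= 1.
      apply: norm_Rintegral_le; last by move=> w; exact: cos_max.
      apply: (measurableT_comp (f := cos)); first exact: continuous_measurable_fun (@continuous_cos R).
      exact: measurable_funM.
    lra.
  have mz d1 (T1 : measurableType d1) (P1 : probability T1 R) (Z : T1 -> R) :
      measurable_fun setT Z -> measurable_fun [set: R] (fun z => 1 - \int[P1]_w cos (z * dl * Z w)).
    move=> mZ.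
    pose f (p : T1 * R) : \bar R := (1 - cos (p.2 * dl * Z p.1))%:E.
    have mf : measurable_fun setT f.
      apply/measurable_EFinP; apply: measurable_funB => //; apply: (measurableT_comp (f := cos)).
        exact: continuous_measurable_fun (@continuous_cos R).
      by apply: measurable_funM; [exact: measurable_funM|exact: measurableT_comp].
    have f0 p : (0 <= f p)%E by rewrite lee_fin.
    have := measurable_fun_fubini_tonelli_G (m1 := P1) f mf f0.
    rewrite [X in measurable_fun _ X](_ : _ = EFin \o (fun z => 1 - \int[P1]_w cos (z * dl * Z w))).
      by move/measurable_EFinP.
    apply/funext => z; rewrite /fubini_G /f/=.
    have mc : measurable_fun setT (fun w => cos (z * dl * Z w)).
      apply: (measurableT_comp (f := cos)); first exact: continuous_measurable_fun (@continuous_cos R).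
      exact: measurable_funM.
    have Ic : P1.-integrable setT (EFin \o (fun w => cos (z * dl * Z w))).
      by apply: (@bounded_integrable R _ _ P1 _ 1) => // w; exact: cos_max.
    rewrite -[X in _ = (X - _)%:E](Rintegral_prob_cst P1 1) -RintegralB//; last first.
      exact: finite_measure_integrable_cst.
    rewrite /Rintegral fineK//; apply: integrable_fin_num => //; apply: integrableB_real => //.
    exact: finite_measure_integrable_cst.
  apply: (@Rintegral_dominated_cvg R _ _ leb I01 _ _ (cst 2) m01 _ _ _ _ _).2 => //.
  - by move=> n; apply: measurable_funTS; exact: mz.
  - by apply: measurable_funTS; exact: mz.
  - by apply: aeW => z _; apply: cvgB; [exact: cvg_cst|exact: XY].
  - by move=> n z _; exact: b1.
have e2 : 0 < e / 4 by [].
have /cvgrPdist_lt/(_ _ e2) := cP.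
apply: filterS => n; rewrite distrC => H.
apply: le_trans (tail_le_mean P (mX n) dl0) _.
have := ler_norm (\int[P]_w mean_onem_cos (dl * X n w) - \int[Q]_w mean_onem_cos (dl * Y w)).
lra.
Qed.

End Tightness.

Lemma expectationE {R : realType} d (T : measurableType d) (P : probability T R) (Z : T -> R) :
  ('E_P[Z] = \int[P]_w (Z w)%:E)%E.
Proof. by rewrite unlock. Qed.

Section LevyContinuity.
Context {R : realType} d (T : measurableType d) (P : probability T R)
  d' (T' : measurableType d') (Q : probability T' R) (k : nat).
Variables (X : nat -> 'I_k -> T -> R) (Y : 'I_k -> T' -> R).
Hypothesis mX : forall n i, measurable_fun setT (X n i).
Hypothesis mY : forall i, measurable_fun setT (Y i).
Hypothesis XYcos : forall u : 'I_k -> R,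
  \int[P]_w cos (\sum_i u i * X n i w) @[n --> \oo] --> \int[Q]_w cos (\sum_i u i * Y i w).
Hypothesis XYsin : forall u : 'I_k -> R,
  \int[P]_w sin (\sum_i u i * X n i w) @[n --> \oo] --> \int[Q]_w sin (\sum_i u i * Y i w).

Lemma trig_cvg (g : 'rV[R]_k -> R) : trig_fun g ->
  \int[P]_w g (\row_i X n i w) @[n --> \oo] --> \int[Q]_w g (\row_i Y i w).
Proof.
elim=> {g} [u p|g1 g2 t1 H1 t2 H2|c g t H].
- have E d1 (T1 : measurableType d1) (P1 : probability T1 R) (Z : 'I_k -> T1 -> R) :
      (forall i, measurable_fun setT (Z i)) ->
      \int[P1]_w cos (\sum_i u i * (\row_i Z i w) 0 i + p) =
      \int[P1]_w cos (\sum_i u i * Z i w) * cos p - \int[P1]_w sin (\sum_i u i * Z i w) * sin p.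
    move=> mZ.
    have mS : measurable_fun setT (fun w => \sum_i u i * Z i w).
      by apply: measurable_sum => i; exact: measurable_funM.
    have Ic : P1.-integrable setT (EFin \o (fun w => cos (\sum_i u i * Z i w))).
      apply: (@bounded_integrable R _ _ P1 _ 1) => [|w]; last exact: cos_max.
      exact: (measurableT_comp (continuous_measurable_fun (@continuous_cos R))).
    have Is : P1.-integrable setT (EFin \o (fun w => sin (\sum_i u i * Z i w))).
      apply: (@bounded_integrable R _ _ P1 _ 1) => [|w]; last exact: sin_max.
      exact: (measurableT_comp (continuous_measurable_fun (@continuous_sin R))).
    rewrite -!RintegralZr// -RintegralB//; last 2 first.
    - exact: integrableZr_real.
    - exact: integrableZr_real.
    apply: eq_Rintegral => w _; rewrite -cosD; congr (cos (_ + _)).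
    by apply: eq_bigr => i _; rewrite mxE.
  rewrite E//; under eq_fun do rewrite E//.
  by apply: cvgB; apply: cvgMl.
- have E d1 (T1 : measurableType d1) (P1 : probability T1 R) (Z : 'I_k -> T1 -> R) :
      (forall i, measurable_fun setT (Z i)) ->
      \int[P1]_w (g1 (\row_i Z i w) + g2 (\row_i Z i w)) =
      \int[P1]_w g1 (\row_i Z i w) + \int[P1]_w g2 (\row_i Z i w).
    move=> mZ; have [M1 b1] := trig_bounded t1; have [M2 b2] := trig_bounded t2.
    rewrite RintegralD//.
      by apply: (@bounded_integrable R _ _ P1 _ M1) => //; exact: trig_measurable.
    by apply: (@bounded_integrable R _ _ P1 _ M2) => //; exact: trig_measurable.
  rewrite E//; under eq_fun do rewrite E//.
  exact: cvgD.
- have E d1 (T1 : measurableType d1) (P1 : probability T1 R) (Z : 'I_k -> T1 -> R) :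
      (forall i, measurable_fun setT (Z i)) ->
      \int[P1]_w (c * g (\row_i Z i w)) = c * \int[P1]_w g (\row_i Z i w).
    move=> mZ; have [M b] := trig_bounded t.
    rewrite RintegralZl//.
    by apply: (@bounded_integrable R _ _ P1 _ M) => //; exact: trig_measurable.
  rewrite E//; under eq_fun do rewrite E//.
  exact: cvgMr.
Qed.

(** [f] is exchanged for a trigonometric [g] under both laws, at a cost controlled by tightness of
    the coordinates, and for [g] convergence is [trig_cvg]. *)
Lemma levy_continuity :
  cvg_in_distribution P Q (fun n w => \row_i X n i w) (fun w => \row_i Y i w).
Proof.
move=> f cf [B fB].
have B0 : 0 <= B by apply: le_trans (fB 0).
have mfX n := continuous_row_measurable (mX n) cf fB.
have mfY := continuous_row_measurable mY cf fB.
have IX n : P.-integrable setT (EFin \o (fun w => f (\row_i X n i w))).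
  by apply: (@bounded_integrable R _ _ P _ B) => // w.
have IY : Q.-integrable setT (EFin \o (fun w => f (\row_i Y i w))).
  by apply: (@bounded_integrable R _ _ Q _ B) => // w.
suff H : \int[P]_w f (\row_i X n i w) @[n --> \oo] --> \int[Q]_w f (\row_i Y i w).
  have EX n : ('E_P[f \o (fun w => \row_i X n i w)] = (\int[P]_w f (\row_i X n i w))%R%:E)%E.
    by rewrite expectationE /Rintegral (fineK (integrable_fin_num measurableT (IX n))).
  rewrite (eq_cvg _ _ EX) expectationE -(fineK (integrable_fin_num measurableT IY)).
  by apply: cvg_EFin => //; exact: nearW.
apply/cvgrPdist_le => e e0.
(* The three comparisons below cost [2 e1], [e1] and [2 e1]. *)
pose e1 := e / 6.
have e10 : 0 < e1 by rewrite divr_gt0.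
(* Makes the union bound over the [k] coordinates at most [e1]; the summand 1 covers [B = 0] and
   [k = 0]. *)
pose eta := e1 / (2 * B * k%:R + 1).
have D0 : 0 < 2 * B * k%:R + 1 by rewrite ltr_wpDl// !mulr_ge0.
have eta0 : 0 < eta by rewrite divr_gt0.
have etaE : 2 * B * (k%:R * eta) <= e1.
  have -> : 2 * B * (k%:R * eta) = e1 * (2 * B * k%:R / (2 * B * k%:R + 1)).
    by rewrite /eta; field; exact: lt0r_neq0.
  by rewrite ler_piMr ?(ltW e10)// ler_pdivrMr// mul1r lerDl.
have H (i : 'I_k) : exists L : R, 0 < L /\ (\int[Q]_w \1_[set w | L < `|Y i w|] w <= eta /\
    \forall n \near \oo, \int[P]_w \1_[set w | L < `|X n i w|] w <= eta).
  (* A vector [u] supported on one coordinate gives the marginal law. *)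
  have Hc (z : R) : \int[P]_w cos (z * X n i w) @[n --> \oo] --> \int[Q]_w cos (z * Y i w).
    have := @XYcos (fun j => if j == i then z else 0).
    have E (V : 'I_k -> R) : \sum_j (if j == i then z else 0) * V j = z * V i.
      by rewrite (bigD1 i)//= eqxx big1 ?addr0// => j /negbTE ->; rewrite mul0r.
    have EX n : \int[P]_w cos (\sum_j (if j == i then z else 0) * X n j w) =
        \int[P]_w cos (z * X n i w).
      by apply: eq_Rintegral => w _; rewrite (E (fun j => X n j w)).
    rewrite (eq_cvg _ _ EX) (_ : \int[Q]_w _ = \int[Q]_w cos (z * Y i w))//.
    by apply: eq_Rintegral => w _; rewrite (E (fun j => Y j w)).
  have [L L0 H] := tight_of_cvg_charfun (fun n => mX n i) (mY i) Hc eta0.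
  by exists L.
have /choice[Li HL] := H.
(* One cut-off for all coordinates; the summand 1 keeps it positive when there are none. *)
pose L := \sum_i Li i + 1.
have LiL i : Li i <= L.
  rewrite /L (bigD1 i)//= -addrA lerDl addr_ge0// sumr_ge0// => j _.
  by have [/ltW] := HL j.
have L0 : 0 < L by rewrite ltr_wpDl// sumr_ge0// => j _; have [/ltW] := HL j.
have tailL d1 (T1 : measurableType d1) (P1 : probability T1 R) (Z : T1 -> R) i :
    measurable_fun setT Z -> \int[P1]_w \1_[set w | Li i < `|Z w|] w <= eta ->
    \int[P1]_w \1_[set w | L < `|Z w|] w <= eta.
  move=> mZ; apply: le_trans.
  have mI (c : R) : measurable [set w | c < `|Z w|].
    rewrite -[X in measurable X]setTI.
    by apply: (measurable_fun_ltr (f := cst c)) => //; exact: measurableT_comp.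
  have II (c : R) : P1.-integrable setT (EFin \o (\1_[set w | c < `|Z w|])).
    apply: (@bounded_integrable R _ _ P1 _ 1) => // w.
    by rewrite indicE; case: (_ \in _); rewrite ?normr1 ?normr0.
  apply: le_Rintegral => // w _.
  rewrite !indicE; case: (boolP (w \in [set w | L < _])) => [|_]; last by case: (_ \in _).
  by rewrite inE/= => H1; rewrite mem_set//= (le_lt_trans (LiL i)).
have [g [tg gB fg]] := trig_approximation cf fB L0 e10.
have cY : `|\int[Q]_w f (\row_i Y i w) - \int[Q]_w g (\row_i Y i w)| <= e1 + e1.
  apply: le_trans (@trig_close R _ _ Q k Y f g B L e1 eta mY cf fB tg gB (ltW e10) fg _) _.
    by move=> i; apply: (tailL _ _ _ _ i) => //; have [_ []] := HL i.
  by rewrite lerD2l.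
have nearX : \forall n \near \oo, forall i, \int[P]_w \1_[set w | L < `|X n i w|] w <= eta.
  apply: filter_forall => i; have [_ [_]] := HL i.
  by apply: filterS => n; exact: tailL.
have /cvgrPdist_le/(_ _ e10) nearG := trig_cvg tg.
near=> n.
have h1 : `|\int[Q]_w g (\row_i Y i w) - \int[P]_w g (\row_i X n i w)| <= e1.
  by near: n; exact: nearG.
have h2 : `|\int[P]_w f (\row_i X n i w) - \int[P]_w g (\row_i X n i w)| <= e1 + e1.
  apply: le_trans (@trig_close R _ _ P k (X n) f g B L e1 eta (mX n) cf fB tg gB (ltW e10) fg _) _.
    by near: n; exact: nearX.
  by rewrite lerD2l.
set a := \int[Q]_w f _ in cY *; set b := \int[P]_w f _ in h2 *.
set a' := \int[Q]_w g _ in cY h1 *; set b' := \int[P]_w g _ in h1 h2 *.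
have -> : a - b = (a - a') + (a' - b') - (b - b') by ring.
apply: le_trans (ler_normB _ _) _; apply: le_trans (lerD (ler_normD _ _) (lexx _)) _.
rewrite /e1 in cY h1 h2; lra.
Unshelve. all: by end_near. Qed.

End LevyContinuity.

Lemma cvg_in_distribution_real {R : realType} d (T : measurableType d) (P : probability T R)
    d' (T' : measurableType d') (Q : probability T' R) (X : nat -> T -> R) (Y : T' -> R) :
  (forall n, measurable_fun setT (X n)) -> measurable_fun setT Y ->
  (forall z : R, \int[P]_w cos (z * X n w) @[n --> \oo] --> \int[Q]_w cos (z * Y w)) ->
  (forall z : R, \int[P]_w sin (z * X n w) @[n --> \oo] --> \int[Q]_w sin (z * Y w)) ->
  cvg_in_distribution P Q X Y.
Proof.
move=> mX mY hc hs f cf [B fB].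
have E (u : 'I_1 -> R) (V : R) : \sum_i u i * V = u 0 * V by rewrite big_ord1.
have H := @levy_continuity R _ T P _ T' Q 1 (fun n _ => X n) (fun _ => Y)
  (fun n _ => mX n) (fun _ => mY) _ _ (fun x => f (x ord0 ord0)) _ _.
suff : ('E_P[(fun x : 'rV[R]_1 => f (x ord0 ord0)) \o (fun w => \row_(i < 1) X n w)])%E @[n --> \oo]
  --> ('E_Q[(fun x : 'rV[R]_1 => f (x ord0 ord0)) \o (fun w => \row_(i < 1) Y w)])%E.
  have EX (S : Type) (V : S -> R) : (fun x : 'rV[R]_1 => f (x ord0 ord0)) \o (fun w => \row_(i < 1) V w) = f \o V.
    by apply/funext => w /=; rewrite mxE.
  by rewrite EX; under eq_cvg do rewrite EX.
apply: H.
- move=> u; have EX n : \int[P]_w cos (\sum_(i < 1) u i * X n w) = \int[P]_w cos (u 0 * X n w).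
    by apply: eq_Rintegral => w _; rewrite E.
  rewrite (eq_cvg _ _ EX) (_ : \int[Q]_w _ = \int[Q]_w cos (u 0 * Y w)); first exact: hc.
  by apply: eq_Rintegral => w _; rewrite E.
- move=> u; have EX n : \int[P]_w sin (\sum_(i < 1) u i * X n w) = \int[P]_w sin (u 0 * X n w).
    by apply: eq_Rintegral => w _; rewrite E.
  rewrite (eq_cvg _ _ EX) (_ : \int[Q]_w _ = \int[Q]_w sin (u 0 * Y w)); first exact: hs.
  by apply: eq_Rintegral => w _; rewrite E.
- move=> x; apply: (@continuous_comp _ _ _ (fun x : 'rV[R]_1 => x ord0 ord0) f); last exact: cf.
  exact: coord_continuous.
- by exists B => x.
Qed.

(** * Characteristic functions *)

Local Open Scope complex_scope.

(** Counting integers versus measuring length, with an error of at most one. It serves both the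
    approximation of bounded functions by superlevel sets and the grid counts. *)
Lemma count_le_bounds (R : realType) (N : nat) (x : R) :
  let c := Num.max 0 (Num.min x N%:R) in
  let s : R := \sum_(k < N) (if k%:R <= x then 1 else 0) in c <= s /\ s <= c + 1.
Proof.
move=> c s; rewrite {}/c {}/s; have [x0|x0] := ltP x 0.
  rewrite big1; first by rewrite maxElt minElt; repeat case: ifP; lra.
  by move=> k _; rewrite leNgt (lt_le_trans x0).
elim: N => [|N [IH1 IH2]].
  by rewrite big_ord0 (min_r x0) maxxx add0r; lra.
rewrite big_ord_recr/=; have N1 : N.+1%:R = N%:R + 1 :> R by rewrite natr1.
have N0 : 0 <= (N%:R : R) by [].
have c0 M : Num.max 0 (Num.min x M%:R) = Num.min x M%:R.
  by rewrite max_r// le_min x0 ler0n.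
rewrite !c0 in IH1 IH2 *.
have [Nx|Nx] := leP N%:R x; last first.
  rewrite addr0 (min_l (_ : x <= N.+1%:R)); last by rewrite N1; lra.
  by rewrite (min_l (ltW Nx)) in IH1 IH2.
have -> : \sum_(k < N) (if k%:R <= x then 1 else 0) = N%:R :> R.
  transitivity (\sum_(k < N) (1 : R)); last by rewrite sumr_const card_ord.
  apply: eq_bigr => k _; rewrite (le_trans _ Nx)// ler_nat; exact: ltnW.
by rewrite N1 minEle; case: ifP; lra.
Qed.

Section Independence.
Context {R : realType}.

Lemma measurable_step_approximation (f : R -> R) (M : R) (N : nat) : (0 < N)%N -> 0 < M ->
  (forall x, 0 <= f x <= M) ->
  forall x, `|f x - M / N%:R * \sum_(j < N) (if j%:R <= f x * N%:R / M then 1 else 0)| <= M / N%:R.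
Proof.
move=> N0 M0 fM x; have NR : 0 < (N%:R : R) by rewrite ltr0n.
have [/andP[f0 f1]] := fM x.
have [] := count_le_bounds N (f x * N%:R / M).
set s := \sum_(j < N) _.
rewrite min_l; last by rewrite ler_pdivrMr// mulrC ler_pM2l.
rewrite max_r; last by rewrite !mulr_ge0// invr_ge0 ltW.
move=> h1 h2.
have E : f x = M / N%:R * (f x * N%:R / M) by field; rewrite !gt_eqF.
have c0 : 0 < M / N%:R by rewrite divr_gt0.
rewrite {1}E -mulrBr normrM (gtr0_norm c0) ler_piMr ?(ltW c0)//.
by rewrite ler_norml; lra.
Qed.

Context d (T : measurableType d) (P : probability T R).

(** [f] is uniformly close to a combination of indicators of its superlevel sets, for which the
    factorisation is assumed. [W] will carry the coordinates already treated, [X] the next one. *)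
Lemma indep_integral (W X : T -> R) (c Mw : R) :
  measurable_fun setT W -> (forall w, `|W w| <= Mw) -> measurable_fun setT X ->
  (forall B, measurable B -> \int[P]_w (W w * \1_B (X w)) = c * fine (P (X @^-1` B))) ->
  forall (f : R -> R) (M : R), measurable_fun setT f -> (forall x, `|f x| <= M) ->
  \int[P]_w (W w * f (X w)) = c * \int[P]_w f (X w).
Proof.
move=> mW WM mX H f M mf fM.
have M0 : 0 <= M by apply: le_trans (fM 0).
have Mw0 : 0 <= Mw by apply: le_trans (WM point).
have indE B w : `|\1_B (X w)| <= 1 :> R.
  by rewrite indicE; case: (_ \in _); rewrite ?normr1 ?normr0.
have mI B : measurable B -> measurable_fun setT (fun w => \1_B (X w) : R).
  by move=> mB; apply: (measurableT_comp (f := (\1_B : R -> R))).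
have IB B : measurable B -> P.-integrable setT (EFin \o (fun w => \1_B (X w))).
  by move=> mB; apply: (@bounded_integrable R _ _ P _ 1) => //; exact: mI.
have IWB B : measurable B -> P.-integrable setT (EFin \o (fun w => W w * \1_B (X w))).
  move=> mB; apply: (@bounded_integrable R _ _ P _ (Mw * 1)).
    by apply: measurable_funM => //; exact: mI.
  by move=> w; rewrite normrM ler_pM.
have PB B : measurable B -> \int[P]_w \1_B (X w) = fine (P (X @^-1` B)).
  move=> mB; have := integral_indic P measurableT (_ : measurable (X @^-1` B)).
  rewrite setIT => <-//; by rewrite -[X in measurable X]setTI; exact: mX.
(* The step approximation is for nonnegative functions. The shift is undone at the end, where the
   case [B = setT] identifies [c] as the integral of [W]. *)
pose g x := f x + M.
have gM x : 0 <= g x <= 2 * M + 1.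
  have := fM x; rewrite ler_norml /g; lra.
have Mp : 0 < 2 * M + 1 by lra.
have mg : measurable_fun setT g by apply: measurable_funD.
have mgX : measurable_fun setT (fun w => g (X w)) by exact: measurableT_comp.
have Ig : P.-integrable setT (EFin \o (fun w => g (X w))).
  apply: (@bounded_integrable R _ _ P _ (2 * M + 1)) => // w.
  by have /andP[g0 g1] := gM (X w); rewrite ger0_norm.
have IWg : P.-integrable setT (EFin \o (fun w => W w * g (X w))).
  apply: (@bounded_integrable R _ _ P _ (Mw * (2 * M + 1))); first exact: measurable_funM.
  by move=> w; rewrite normrM ler_pM//; have /andP[g0 g1] := gM (X w); rewrite ger0_norm.
have If : P.-integrable setT (EFin \o (fun w => f (X w))).
  by apply: (@bounded_integrable R _ _ P _ M) => //; exact: measurableT_comp.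
have IWf : P.-integrable setT (EFin \o (fun w => W w * f (X w))).
  apply: (@bounded_integrable R _ _ P _ (Mw * M)).
    by apply: measurable_funM => //; exact: measurableT_comp.
  by move=> w; rewrite normrM ler_pM.
have IW : P.-integrable setT (EFin \o W) by exact: bounded_integrable WM.
have key N : (0 < N)%N -> `|\int[P]_w (W w * g (X w)) - c * \int[P]_w g (X w)| <=
    (Mw + `|c|) * ((2 * M + 1) / N%:R).
  move=> N0; set D := (2 * M + 1) / N%:R.
  have D0 : 0 <= D by rewrite divr_ge0// ltW.
  pose B (j : 'I_N) : set R := [set x | j%:R <= g x * N%:R / (2 * M + 1)].
  have mB j : measurable (B j).
    rewrite -[X in measurable X]setTI; apply: (measurable_fun_ler (f := cst _)) => //.
    by apply: measurable_funM => //; exact: measurable_funM.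
  pose s x : R := D * \sum_j \1_(B j) x.
  have gs x : `|g x - s x| <= D.
    have := measurable_step_approximation N0 Mp gM x.
    rewrite (eq_bigr (fun j : 'I_N => \1_(B j) x))// => j _.
    by rewrite indicE; case: ifPn => Hj; [rewrite mem_set|rewrite memNset//; exact/negP].
  have [Is Es] := Rintegral_sum (index_enum 'I_N) measurableT (fun j => IB _ (mB j)).
  have [IWs EWs] := Rintegral_sum (index_enum 'I_N) measurableT (fun j => IWB _ (mB j)).
  have EWs' : \int[P]_w (W w * s (X w)) = D * \sum_j c * fine (P (X @^-1` (B j))).
    rewrite (eq_bigr (fun j => \int[P]_w (W w * \1_(B j) (X w)))); last by move=> j _; rewrite H.
    rewrite -EWs -RintegralZl//; apply: eq_Rintegral => w _.
    by rewrite /s mulrCA -mulr_sumr.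
  have Es' : \int[P]_w s (X w) = D * \sum_j fine (P (X @^-1` (B j))).
    rewrite (eq_bigr (fun j => \int[P]_w \1_(B j) (X w))); last by move=> j _; rewrite PB.
    by rewrite -Es -RintegralZl.
  have Eq : \int[P]_w (W w * s (X w)) = c * \int[P]_w s (X w).
    by rewrite EWs' Es' -mulr_sumr mulrCA.
  have Is' : P.-integrable setT (EFin \o (fun w => s (X w))) by exact: integrableZl_real.
  have IWs' : P.-integrable setT (EFin \o (fun w => W w * s (X w))).
    apply: (eq_integrable_real _ _ (integrableZl_real D _ IWs)) => // w _.
    by rewrite /s mulrCA -mulr_sumr.
  have e1 : `|\int[P]_w (W w * g (X w)) - \int[P]_w (W w * s (X w))| <= Mw * D.
    rewrite -RintegralB//; apply: norm_Rintegral_le.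
      apply/measurable_EFinP; apply: (measurable_int P); exact: integrableB_real.
    by move=> w; rewrite -mulrBr normrM ler_pM.
  have e2 : `|\int[P]_w g (X w) - \int[P]_w s (X w)| <= D.
    rewrite -RintegralB//; apply: norm_Rintegral_le => //.
    apply/measurable_EFinP; apply: (measurable_int P); exact: integrableB_real.
  have -> : \int[P]_w (W w * g (X w)) - c * \int[P]_w g (X w) =
     (\int[P]_w (W w * g (X w)) - \int[P]_w (W w * s (X w))) -
     c * (\int[P]_w g (X w) - \int[P]_w s (X w)) by rewrite Eq; ring.
  apply: le_trans (ler_normB _ _) _; rewrite mulrDl lerD// normrM.
  by rewrite ler_wpM2l.
have Eg : \int[P]_w (W w * g (X w)) = c * \int[P]_w g (X w).
  apply/eqP; rewrite -subr_eq0 -normr_le0; apply/ler_addgt0Pr => e e0.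
  rewrite add0r; set K := (Mw + `|c|) * (2 * M + 1).
  have K0 : 0 <= K by apply: mulr_ge0; [exact: addr_ge0|exact: ltW].
  apply: le_trans (key (Num.truncn (K / e)).+1 isT) _.
  rewrite mulrA -/K ler_pdivrMr ?ltr0n// mulrC -ler_pdivrMr//.
  by apply/ltW/truncnS_gt.
have W1 : \int[P]_w W w = c.
  have := H setT measurableT; rewrite preimage_setT.
  have -> : fine (P setT) = 1 by rewrite [X in fine X](@probability_setT _ _ _ P).
  rewrite mulr1 => <-; apply: eq_Rintegral => w _.
  by rewrite indicE in_setT mulr1.
have : \int[P]_w (W w * g (X w)) = \int[P]_w (W w * f (X w)) + M * \int[P]_w W w.
  rewrite -RintegralZl// -RintegralD//; last exact: integrableZl_real.
  by apply: eq_Rintegral => w _; rewrite /g; ring.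
have : \int[P]_w g (X w) = \int[P]_w f (X w) + M.
  rewrite RintegralD// ?Rintegral_prob_cst//.
  exact: finite_measure_integrable_cst.
rewrite Eg W1 => -> ; nra.
Qed.

Definition ecf (Y : T -> R) : R[i] := (\int[P]_w cos (Y w)) +i* (\int[P]_w sin (Y w)).

Lemma integral_indicator_indep n (X : 'I_n -> T -> R) (B : 'I_n -> set R) :
  (forall i, measurable_fun setT (X i)) -> mutually_independent P X ->
  (forall i, measurable (B i)) ->
  \int[P]_w (\prod_i \1_(B i) (X i w)) = \prod_i fine (P (X i @^-1` (B i))).
Proof.
move=> mX ind mB; have E := ind B mB.
have mC i : measurable (X i @^-1` B i).
  by rewrite -[X in measurable X]setTI; exact: mX.
have mI : measurable (\bigcap_(i in [set: 'I_n]) (X i @^-1` B i)).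
  by apply: fin_bigcap_measurable => // i _; exact: mC.
transitivity (fine (P (\bigcap_(i in [set: 'I_n]) (X i @^-1` B i)))).
  have := integral_indic P measurableT mI; rewrite setIT => <-.
  congr fine; apply: eq_integral => w _; congr EFin.
  rewrite indicE; case: (boolP (w \in _)) => [|/negP].
    by rewrite inE/= => H; rewrite big1// => i _; rewrite indicE mem_set//; exact: H.
  rewrite inE/= => /existsNP[i /not_implyP[_ H]].
  by rewrite (bigD1 i)//= indicE memNset// mul0r.
have F : (\prod_i P (X i @^-1` (B i)) = (\prod_i fine (P (X i @^-1` (B i))))%:E)%E.
  rewrite -prodEFin; apply: eq_bigr => i _.
  by rewrite fineK// fin_num_measure.
by rewrite E F.
Qed.

(** Independence is given for indicators only, so coordinates are converted one at a time: at stage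
    [m] those below [m] enter through their exponentials and the others through arbitrary
    indicators, which is the input of [indep_integral] at the next stage. *)
Lemma ecf_indep n (X : 'I_n -> T -> R) (u : 'I_n -> R) :
  (forall i, measurable_fun setT (X i)) -> mutually_independent P X ->
  ecf (fun w => \sum_i u i * X i w) = \prod_i ecf (fun w => u i * X i w).
Proof.
move=> mX ind.
pose A (m : nat) w : R := \sum_(i < n | (i < m)%N) u i * X i w.
pose I (m : nat) (B : 'I_n -> set R) w : R := \prod_(i < n | (m <= i)%N) \1_(B i) (X i w).
pose q (m : nat) (B : 'I_n -> set R) : R := \prod_(i < n | (m <= i)%N) fine (P (X i @^-1` (B i))).
pose phi (i : 'I_n) := ecf (fun w => u i * X i w).
have mA m : measurable_fun setT (A m).
  have -> : A m = (fun w => \sum_(i < n) (if (i < m)%N then u i * X i w else 0)).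
    by apply/funext => w; rewrite /A big_mkcond.
  by apply: measurable_sum => i; case: (i < m)%N => //; exact: measurable_funM.
have mI m B : (forall i, measurable (B i)) -> measurable_fun setT (I m B).
  move=> mB.
  have -> : I m B = (fun w => \prod_(i < n) (if (m <= i)%N then \1_(B i) (X i w) else 1)).
    by apply/funext => w; rewrite /I big_mkcond.
  apply: measurable_prod => i _; case: (m <= i)%N => //.
  by apply: (measurableT_comp (f := (\1_(B i) : R -> R))).
have bI m B w : `|I m B w| <= 1.
  rewrite /I normr_prod; apply: prodr_ile1 => i _; rewrite normr_ge0 indicE.
  by rewrite normr_nat lern1 leq_b1.
have mcos Y : measurable_fun setT Y -> measurable_fun setT (fun w : T => cos (Y w) : R).
  exact: (measurableT_comp (continuous_measurable_fun (@continuous_cos R))).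
have msin Y : measurable_fun setT Y -> measurable_fun setT (fun w : T => sin (Y w) : R).
  exact: (measurableT_comp (continuous_measurable_fun (@continuous_sin R))).
have bcos (x : R) : `|cos x| <= 1 by rewrite ler_norml cos_geN1 cos_le1.
have bsin (x : R) : `|sin x| <= 1 by rewrite ler_norml sin_geN1 sin_le1.
have claim (m : nat) : (m <= n)%N -> forall B : 'I_n -> set R, (forall i, measurable (B i)) ->
   (\int[P]_w (cos (A m w) * I m B w)) +i* (\int[P]_w (sin (A m w) * I m B w)) =
   (\prod_(i < n | (i < m)%N) phi i) * (q m B)%:C.
  elim: m => [_ B mB|m IH mn B mB].
    have A0 w : A 0%N w = 0 by rewrite /A big_pred0.
    under eq_Rintegral do rewrite A0 cos0 mul1r.
    under [X in _ +i* X]eq_Rintegral do rewrite A0 sin0 mul0r.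
    rewrite [X in X * _]big_pred0// mul1r Rintegral_cst// mul0r.
    by rewrite integral_indicator_indep.
  pose o := Ordinal mn.
  have Eo (i : 'I_n) : (i < m.+1)%N && (i != o) = (i < m)%N.
    by rewrite ltnS [RHS]ltn_neqAle andbC.
  have Eo' (i : 'I_n) : (m <= i)%N && (i != o) = (m.+1 <= i)%N.
    by rewrite [RHS]ltn_neqAle andbC eq_sym.
  have AS w : A m.+1 w = A m w + u o * X o w.
    rewrite /A (bigD1 o)//= addrC; congr (_ + _); apply: eq_bigl => i; exact: Eo.
  have PS : \prod_(i < n | (i < m.+1)%N) phi i = (\prod_(i < n | (i < m)%N) phi i) * phi o.
    rewrite (bigD1 o)//= mulrC; congr (_ * _); apply: eq_bigl => i; exact: Eo.
  pose B' (C : set R) i := if i == o then C else B i.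
  have mB' C : measurable C -> forall i, measurable (B' C i).
    by move=> mC i; rewrite /B'; case: ifP.
  have IS C w : I m (B' C) w = I m.+1 B w * \1_C (X o w).
    rewrite /I (bigD1 o)//= {1}/B' eqxx mulrC; congr (_ * _).
    apply: eq_big => i; first exact: Eo'.
    by rewrite /B' => /andP[_ /negPf ->].
  have qS C : q m (B' C) = q m.+1 B * fine (P (X o @^-1` C)).
    rewrite /q (bigD1 o)//= {1}/B' eqxx mulrC; congr (_ * _).
    apply: eq_big => i; first exact: Eo'.
    by rewrite /B' => /andP[_ /negPf ->].
  have {}IH C mC := IH (ltnW mn) (B' C) (mB' C mC).
  rewrite PS; case: (\prod_(i < n | (i < m)%N) phi i) IH => zr zi IH.
  have simpl1 (x y r : R) : (x +i* y) * r%:C = (x * r) +i* (y * r) by simpc.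
  have IHc C : measurable C -> \int[P]_w ((cos (A m w) * I m.+1 B w) * \1_C (X o w)) =
      (zr * q m.+1 B) * fine (P (X o @^-1` C)).
    move=> mC; have := IH C mC; rewrite qS simpl1 => -[+ _].
    rewrite mulrA => <-; apply: eq_Rintegral => w _; by rewrite IS mulrA.
  have IHs C : measurable C -> \int[P]_w ((sin (A m w) * I m.+1 B w) * \1_C (X o w)) =
      (zi * q m.+1 B) * fine (P (X o @^-1` C)).
    move=> mC; have := IH C mC; rewrite qS simpl1 => -[_ +].
    rewrite mulrA => <-; apply: eq_Rintegral => w _; by rewrite IS mulrA.
  have mWc : measurable_fun setT (fun w => cos (A m w) * I m.+1 B w).
    by apply: measurable_funM; [exact: mcos|exact: mI].
  have mWs : measurable_fun setT (fun w => sin (A m w) * I m.+1 B w).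
    by apply: measurable_funM; [exact: msin|exact: mI].
  have bWc w : `|cos (A m w) * I m.+1 B w| <= 1 by rewrite normrM mulr_ile1.
  have bWs w : `|sin (A m w) * I m.+1 B w| <= 1 by rewrite normrM mulr_ile1.
  pose fc x := cos (u o * x); pose fs x := sin (u o * x).
  have mfc : measurable_fun setT fc.
    apply: (measurableT_comp (continuous_measurable_fun (@continuous_cos R))); exact: measurable_funM.
  have mfs : measurable_fun setT fs.
    apply: (measurableT_comp (continuous_measurable_fun (@continuous_sin R))); exact: measurable_funM.
  have ibb (f g : T -> R) : measurable_fun setT f -> measurable_fun setT g -> (forall w, `|f w| <= 1) ->
     (forall w, `|g w| <= 1) -> P.-integrable setT (EFin \o (fun w => f w * g w)).
    move=> mf mg bf bg; apply: (@bounded_integrable R _ _ P _ 1); first exact: measurable_funM.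
    by move=> w; rewrite normrM mulr_ile1.
  have bfc w : `|fc (X o w)| <= 1 by exact: bcos.
  have bfs w : `|fs (X o w)| <= 1 by exact: bsin.
  have mfX (f : R -> R) : measurable_fun setT f -> measurable_fun setT (fun w => f (X o w)).
    by move=> mf; exact: (measurableT_comp mf (mX o)).
  have cc := indep_integral mWc bWc (mX o) IHc mfc (fun x => bcos _).
  have cs := indep_integral mWc bWc (mX o) IHc mfs (fun x => bsin _).
  have sc := indep_integral mWs bWs (mX o) IHs mfc (fun x => bcos _).
  have ss := indep_integral mWs bWs (mX o) IHs mfs (fun x => bsin _).
  have -> : \int[P]_w (cos (A m.+1 w) * I m.+1 B w) =
      zr * q m.+1 B * (\int[P]_w fc (X o w)) - zi * q m.+1 B * (\int[P]_w fs (X o w)).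
    rewrite -cc -ss -RintegralB//.
    - apply: eq_Rintegral => w _; rewrite AS cosD /fc /fs; ring.
    - by apply: ibb => //; exact: mfX.
    - by apply: ibb => //; exact: mfX.
  have -> : \int[P]_w (sin (A m.+1 w) * I m.+1 B w) =
      zi * q m.+1 B * (\int[P]_w fc (X o w)) + zr * q m.+1 B * (\int[P]_w fs (X o w)).
    rewrite -cs -sc -RintegralD//.
    - apply: eq_Rintegral => w _; rewrite AS sinD /fc /fs; ring.
    - by apply: ibb => //; exact: mfX.
    - by apply: ibb => //; exact: mfX.
  rewrite /phi /ecf simpl1; simpc; congr (_ +i* _); rewrite /fc /fs; ring.
have none (i : 'I_n) : (n <= i)%N = false by rewrite leqNgt ltn_ord.
have all (i : 'I_n) : (i < n)%N = true by rewrite ltn_ord.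
have I1 w : I n (fun=> setT) w = 1 by rewrite /I big_pred0.
have q1 : q n (fun=> setT) = 1 by rewrite /q big_pred0.
have := claim n (leqnn n) (fun=> setT) (fun=> measurableT).
have -> : \prod_(i < n | (i < n)%N) phi i = \prod_i phi i by apply: eq_bigl => i; exact: all.
rewrite q1 rmorph1 mulr1 => <-.
rewrite /ecf; congr (_ +i* _); apply: eq_Rintegral => w _; rewrite I1 mulr1.
  by congr cos; apply: eq_bigl => i; rewrite all.
by congr sin; apply: eq_bigl => i; rewrite all.
Qed.

End Independence.

Section ComplexExponential.
Context {R : realType}.

Lemma cexpE (x y : R) : cexp (x +i* y) = (expR x * cos y) +i* (expR x * sin y).
Proof. by rewrite /cexp/=; simpc. Qed.

Lemma cexp0 : cexp (0 : R[i]) = 1.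
Proof. by rewrite /cexp/= expR0 cos0 sin0; simpc. Qed.

Lemma cexpD (x y : R[i]) : cexp (x + y) = cexp x * cexp y.
Proof.
case: x y => [a b] [c e]; rewrite -[_ + _]/((a + c) +i* (b + e)) !cexpE expRD cosD sinD.
by simpc; congr (_ +i* _); ring.
Qed.

Lemma cexp_sum (I : Type) (s : seq I) (F : I -> R[i]) :
  cexp (\sum_(i <- s) F i) = \prod_(i <- s) cexp (F i).
Proof. by elim: s => [|i s IH]; rewrite ?big_nil ?cexp0// !big_cons cexpD IH. Qed.

Lemma square_root_cexp (C S A B : R -> R) :
  continuous C -> continuous S -> continuous A -> continuous B ->
  C 0 = 1 -> A 0 = 0 -> B 0 = 0 ->
  (forall z, (C z +i* S z) * (C z +i* S z) = cexp (A z +i* B z)) ->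
  forall z, C z +i* S z = cexp ((A z / 2) +i* (B z / 2)).
Proof.
move=> cC cS cA cB C0 A0 B0 H.
pose r z := expR (- (A z / 2)) * (C z * cos (B z / 2) + S z * sin (B z / 2)).
pose i z := expR (- (A z / 2)) * (S z * cos (B z / 2) - C z * sin (B z / 2)).
have ri z : (r z) ^+ 2 - (i z) ^+ 2 = 1 /\ 2 * (r z * i z) = 0.
  have := H z; rewrite cexpE; simpc => -[h1 h2].
  have EA : expR (A z) = expR (A z / 2) ^+ 2 by rewrite -expRM_natl; congr expR; field.
  have EB : B z = B z / 2 + B z / 2 by field.
  have e1 : expR (- (A z / 2)) * expR (A z / 2) = 1 by rewrite mulrC expRxMexpNx_1.
  have t1 := cos2Dsin2 (B z / 2).
  have EC : cos (B z) = cos (B z / 2) * cos (B z / 2) - sin (B z / 2) * sin (B z / 2).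
    by rewrite -cosD -EB.
  have ES : sin (B z) = sin (B z / 2) * cos (B z / 2) + cos (B z / 2) * sin (B z / 2).
    by rewrite -sinD -EB.
  move: h1 h2; rewrite EA EC ES /r /i.
  move: (expR (A z / 2)) (expR (- (A z / 2))) (cos (B z / 2)) (sin (B z / 2)) e1 t1
     (C z) (S z) => E F c s e1 t1 x y h1 h2.
  split.
    have -> : (F * (x * c + y * s)) ^+ 2 - (F * (y * c - x * s)) ^+ 2 =
      F ^+ 2 * ((x * x - y * y) * (c * c - s * s) + (x * y + y * x) * (s * c + c * s)) by ring.
    rewrite h1 h2.
    have -> : F ^+ 2 * (E ^+ 2 * (c * c - s * s) * (c * c - s * s) +
      E ^+ 2 * (s * c + c * s) * (s * c + c * s)) = (F * E) ^+ 2 * (c ^+ 2 + s ^+ 2) ^+ 2 by ring.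
    by rewrite e1 t1; ring.
  have -> : 2 * (F * (x * c + y * s) * (F * (y * c - x * s))) =
      F ^+ 2 * ((x * y + y * x) * (c * c - s * s) - (x * x - y * y) * (s * c + c * s)) by ring.
  rewrite h1 h2; ring.
have i0 z : i z = 0.
  have [h1 h2] := ri z; apply/eqP; apply: contraT => i0.
  have r0 : r z = 0.
    apply/eqP; move: h2 => /eqP; rewrite mulf_eq0 pnatr_eq0/= mulf_eq0.
    by rewrite (negPf i0) orbF.
  by move: h1; rewrite r0; have := sqr_ge0 (i z); lra.
have r2 z : r z = 1 \/ r z = -1.
  have [h1 _] := ri z; move: h1; rewrite i0 expr0n/= subr0 => /eqP.
  by rewrite sqrf_eq1 => /orP[/eqP|/eqP]; [left|right].
have cr : continuous r.
  have ch (f : R -> R) : continuous f -> continuous (fun z => f z / 2).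
    by move=> cf x; apply: cvgMl; exact: cf.
  move=> x; apply: cvgM.
    apply: (continuous_comp (f := fun z => - (A z / 2))); last exact: continuous_expR.
    by apply: cvgN; exact: ch.
  apply: cvgD; apply: cvgM.
  - exact: cC.
  - by apply: (continuous_comp (f := fun z => B z / 2)); [exact: ch|exact: continuous_cos].
  - exact: cS.
  - by apply: (continuous_comp (f := fun z => B z / 2)); [exact: ch|exact: continuous_sin].
have r0 : r 0 = 1 by rewrite /r A0 B0 C0 mul0r oppr0 expR0 cos0 sin0; ring.
have r1 z : r z = 1.
  have [//|rz] := r2 z; exfalso.
  have cw x y : {within `[x, y], continuous r} by exact: continuous_subspaceT.
  have [c _ rc] : exists2 c, c \in `[Num.min 0 z, Num.max 0 z] & r c = 0.
    apply: (@IVT R r); first by rewrite ge_min le_max lexx.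
      exact: cw.
    rewrite ge_min le_max; have [z0|z0] := leP 0 z; rewrite r0 rz; lra.
  by have [] := r2 c; rewrite rc; lra.
move=> z; have := r1 z; have := i0 z; rewrite cexpE /r /i.
have e1 : expR (A z / 2) * expR (- (A z / 2)) = 1 by rewrite expRxMexpNx_1.
have t1 := cos2Dsin2 (B z / 2).
move: (expR (A z / 2)) (expR (- (A z / 2))) (cos (B z / 2)) (sin (B z / 2)) e1 t1
     (C z) (S z) => E F c s e1 t1 x y h1 h2.
have g1 : x * c + y * s = E.
  by rewrite -[LHS]mul1r -e1 -mulrA h2 mulr1.
have g2 : y * c - x * s = 0.
  by rewrite -[LHS]mul1r -e1 -mulrA h1 mulr0.
congr (_ +i* _).
  have -> : x = (x * c + y * s) * c - (y * c - x * s) * s by rewrite -[LHS]mulr1 -t1; ring.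
  by rewrite g1 g2 mul0r subr0.
have -> : y = (x * c + y * s) * s + (y * c - x * s) * c by rewrite -[LHS]mulr1 -t1; ring.
by rewrite g1 g2 mul0r addr0.
Qed.

End ComplexExponential.

Section Ecf.
Context {R : realType} d (T : measurableType d) (P : probability T R).
Implicit Types Y Z : T -> R.

Lemma measurable_cos_comp Y : measurable_fun setT Y -> measurable_fun setT (fun w => cos (Y w)).
Proof. exact: (measurableT_comp (continuous_measurable_fun (@continuous_cos R))). Qed.

Lemma measurable_sin_comp Y : measurable_fun setT Y -> measurable_fun setT (fun w => sin (Y w)).
Proof. exact: (measurableT_comp (continuous_measurable_fun (@continuous_sin R))). Qed.

Lemma integrable_cos_comp Y : measurable_fun setT Y ->
  P.-integrable setT (EFin \o (fun w => cos (Y w))).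
Proof.
move=> mY; apply: (@bounded_integrable R _ _ P _ 1); first exact: measurable_cos_comp.
by move=> w; exact: cos_max.
Qed.

Lemma integrable_sin_comp Y : measurable_fun setT Y ->
  P.-integrable setT (EFin \o (fun w => sin (Y w))).
Proof.
move=> mY; apply: (@bounded_integrable R _ _ P _ 1); first exact: measurable_sin_comp.
by move=> w; exact: sin_max.
Qed.

Lemma charfun_ecf Y z : charfun P Y z = ecf P (fun w => z * Y w).
Proof.
rewrite /charfun /cintegral /ecf; congr (_ +i* _); apply: eq_Rintegral => w _.
  by rewrite cexpE expR0 !mul1r.
by rewrite cexpE expR0 !mul1r.
Qed.

Lemma ecf_ae Y Z : measurable_fun setT Y -> measurable_fun setT Z ->
  {ae P, forall w, Y w = Z w} -> ecf P Y = ecf P Z.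
Proof.
move=> mY mZ YZ; rewrite /ecf /Rintegral; congr (fine _ +i* fine _); apply: ae_eq_integral => //.
- by apply/measurable_EFinP; exact: measurable_cos_comp.
- by apply/measurable_EFinP; exact: measurable_cos_comp.
- by apply: filterS YZ => w -> _.
- by apply/measurable_EFinP; exact: measurable_sin_comp.
- by apply/measurable_EFinP; exact: measurable_sin_comp.
- by apply: filterS YZ => w -> _.
Qed.

Lemma ecf_cvg (Y : nat -> T -> R) Z : (forall n, measurable_fun setT (Y n)) ->
  measurable_fun setT Z -> {ae P, forall w, Y n w @[n --> \oo] --> Z w} ->
  \int[P]_w cos (Y n w) @[n --> \oo] --> \int[P]_w cos (Z w) /\
  \int[P]_w sin (Y n w) @[n --> \oo] --> \int[P]_w sin (Z w).
Proof.
move=> mY mZ YZ; have I1 : P.-integrable setT (EFin \o cst 1).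
  exact: finite_measure_integrable_cst.
split.
- have [] // := @Rintegral_dominated_cvg R _ _ P setT (fun n w => cos (Y n w))
      (fun w => cos (Z w)) (cst 1) measurableT (fun n => measurable_cos_comp (mY n))
      (measurable_cos_comp mZ) _ I1 (fun n w _ => cos_max _).
  by apply: filterS YZ => w H _; apply: continuous_cvg => //; exact: continuous_cos.
- have [] // := @Rintegral_dominated_cvg R _ _ P setT (fun n w => sin (Y n w))
      (fun w => sin (Z w)) (cst 1) measurableT (fun n => measurable_sin_comp (mY n))
      (measurable_sin_comp mZ) _ I1 (fun n w _ => sin_max _).
  by apply: filterS YZ => w H _; apply: continuous_cvg => //; exact: continuous_sin.
Qed.

Lemma ecf_continuous Y : measurable_fun setT Y ->
  continuous (fun z : R => \int[P]_w cos (z * Y w)) /\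
  continuous (fun z : R => \int[P]_w sin (z * Y w)).
Proof.
move=> mY; have mZ z : measurable_fun setT (fun w => z * Y w) by exact: measurable_funM.
have key (z : R) (u : nat -> R) : u n @[n --> \oo] --> z ->
   {ae P, forall w, u n * Y w @[n --> \oo] --> z * Y w}.
  by move=> uz; apply: aeW => w; apply: cvgMl.
split=> z; apply/continuous_withinNx/cvgr_dnbhsP => u [_ uz].
  by have [] := ecf_cvg (fun n => mZ (u n)) (mZ z) (key _ _ uz).
by have [] := ecf_cvg (fun n => mZ (u n)) (mZ z) (key _ _ uz).
Qed.

Lemma ecf_law Y Z : measurable_fun setT Y -> measurable_fun setT Z ->
  (forall B, measurable B -> P (Y @^-1` B) = P (Z @^-1` B)) ->
  forall z, ecf P (fun w => z * Y w) = ecf P (fun w => z * Z w).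
Proof.
move=> mY mZ E z.
have H (f : R -> R) M : measurable_fun setT f -> (forall x, `|f x| <= M) ->
   \int[P]_w f (Y w) = \int[P]_w f (Z w).
  move=> mf fM.
  have IX X : measurable_fun setT X -> P.-integrable setT ((EFin \o f) \o X).
    by move=> mX; apply: (@bounded_integrable R _ _ P _ M) => //; exact: measurableT_comp.
  rewrite /Rintegral -(@integral_pushforward _ _ _ _ _ _ mY P setT (EFin \o f) _ (IX _ mY) measurableT);
    last exact/measurable_EFinP.
  rewrite -(@integral_pushforward _ _ _ _ _ _ mZ P setT (EFin \o f) _ (IX _ mZ) measurableT);
    last exact/measurable_EFinP.
  congr fine; apply: eq_measure_integral => A mA _; exact: E.
rewrite /ecf; congr (_ +i* _).
  apply: (H (fun x => cos (z * x)) 1) => [|x]; last exact: cos_max.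
  by apply: (measurableT_comp (continuous_measurable_fun (@continuous_cos R))); exact: measurable_funM.
apply: (H (fun x => sin (z * x)) 1) => [|x]; last exact: sin_max.
by apply: (measurableT_comp (continuous_measurable_fun (@continuous_sin R))); exact: measurable_funM.
Qed.

End Ecf.

(** * Step functions on a time grid *)

Section StepFunctions.
Context {R : realType}.
Local Notation leb := (@lebesgue_measure R).

(** The sorted times preceded by 0 and continued by their last value, a form that the independence
    of increments accepts; repeated times are allowed. *)
Lemma sorted_grid k (t : 'I_k -> R) : (forall i, 0 <= t i) ->
  exists tau : nat -> R, [/\ tau 0%N = 0, forall j, tau j <= tau j.+1 &
    forall i, exists2 l, (l <= k)%N & t i = tau l].
Proof.
move=> t0; pose s := sort <=%R (codom t).
have ss : size s = k by rewrite size_sort size_codom card_ord.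
exists (fun j => nth 0 (0 :: s) (minn j k)); split.
- by rewrite min0n.
- move=> j; have [jk|jk] := ltnP j k; last first.
    by rewrite (minn_idPr (leqW jk)).
  rewrite (minn_idPl jk).
  have : path <=%R 0 s.
    rewrite path_min_sorted; first by apply: sort_sorted; exact: le_total.
    by apply/allP => x; rewrite mem_sort => /codomP[i ->].
  by move=> /(pathP 0)/(_ j); rewrite ss => /(_ jk).
- move=> i; have ti : t i \in s by rewrite mem_sort codom_f.
  have ik : (index (t i) s < k)%N by rewrite -[X in (_ < X)%N]ss index_mem.
  exists (index (t i) s).+1 => //.
  by rewrite (minn_idPl ik)/= nth_index.
Qed.

(** The integrand whose integral against the increments of a process [Y] is the combination of the
    [Y (t i)] with coefficients [u i]. *)
Definition step_sum k (u t : 'I_k -> R) (v : R) : R :=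
  \sum_i u i * (if v < t i then 1 else 0).

(** The step function is constant between consecutive grid times and vanishes after the last one,
    where [F 0 = 0] makes the integral finite. *)
Lemma step_sum_grid k (u t : 'I_k -> R) (tau : nat -> R) (F : R -> R) : F 0 = 0 ->
  tau 0%N = 0 -> (forall j, tau j <= tau j.+1) ->
  (forall i, exists2 l, (l <= k)%N & t i = tau l) ->
  leb.-integrable `[0, +oo[ (EFin \o (fun v => F (step_sum u t v))) /\
  \int[leb]_(v in `[0, +oo[) F (step_sum u t v) =
    \sum_(j < k) (tau j.+1 - tau j) * F (step_sum u t (tau j)).
Proof.
move=> F0 tau0 tauS taut.
have tauM i j : (i <= j)%N -> tau i <= tau j by apply: (homo_leq (r := <=%R)) => //; exact: le_trans.
pose G (j : nat) (v : R) : R := F (step_sum u t (tau j)) * \1_(`[tau j, tau j.+1[%classic) v.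
have E v : 0 <= v -> F (step_sum u t v) = \sum_(j < k) G j v.
  move=> v0.
  have -> : \sum_(j < k) G j v = if v < tau k then F (step_sum u t v) else 0.
    rewrite -(big_mkord xpredT (G ^~ v)).
    suff claim m : \sum_(0 <= j < m) G j v = if v < tau m then F (step_sum u t v) else 0 by [].
    elim: m => [|m IH]; first by rewrite big_nil tau0 ltNge v0.
    rewrite big_nat_recr//= IH /G indicE.
    case: (ltP v (tau m)) => vm.
      rewrite memNset/=; last by rewrite in_itv/= leNgt vm.
      by rewrite mulr0 addr0 (lt_le_trans vm).
    rewrite add0r; case: (ltP v (tau m.+1)) => vm1.
      rewrite mem_set/=; last by rewrite in_itv/= vm.
      rewrite mulr1; congr F; apply: eq_bigr => i _; congr (_ * _).
      have [l _ ->] := taut i.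
      case: (ltP v (tau l)) => vl; first by rewrite (le_lt_trans vm).
      case: ifP => // ml.
      have [lm|lm] := leqP l m; first by move: ml; rewrite ltNge tauM.
      by have := lt_le_trans vm1 (tauM _ _ lm); rewrite ltNge vl.
    by rewrite memNset/= ?mulr0// in_itv/= ltNge vm1 andbF.
  case: ltP => // vk; rewrite -F0; congr F; apply: big1 => i _.
  have [l lk ->] := taut i.
  by rewrite ltNge (le_trans (tauM _ _ lk))// mulr0.
have II j : leb.-integrable `[0, +oo[ (EFin \o (\1_(`[tau j, tau j.+1[%classic) : R -> R)).
  apply: (@integrableS _ _ _ _ setT) => //.
  apply/integrableP; split; first by apply/measurable_EFinP.
  rewrite [ltLHS](_ : _ = \int[leb]_x (\1_(`[tau j, tau j.+1[%classic) x)%:E)%E; last first.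
    by apply: eq_integral => v _ /=; rewrite ger0_norm// indicE.
  rewrite integral_indic//.
  have H : (leb `[tau j, tau j.+1[ < +oo)%E.
    by rewrite lebesgue_measure_itv/=; case: ifP => _; rewrite -?EFinD ltry.
  by rewrite setIT; exact: H.
have IG j : leb.-integrable `[0, +oo[ (EFin \o G j).
  by apply: integrableZl_real.
have mD : measurable (`[0, +oo[%classic : set (measurableTypeR R)) by exact: measurable_itv.
have [IS ES] := Rintegral_sum (index_enum 'I_k) mD (fun j : 'I_k => IG j).
have EE : {in `[0, +oo[%classic, (fun v => \sum_(j < k) G j v) =1 (fun v => F (step_sum u t v))}.
  by move=> v; rewrite inE/= in_itv/= andbT => v0; rewrite E.
split; first exact: (eq_integrable_real mD EE IS).
transitivity (\int[leb]_(v in `[0, +oo[) (\sum_(j < k) G j v)).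
  by apply: eq_Rintegral => v vD; rewrite EE.
transitivity (\sum_(j < k) \int[leb]_(v in `[0, +oo[) G j v); first exact: ES.
apply: eq_bigr => j _.
have -> : \int[leb]_(v in `[0, +oo[) G j v = F (step_sum u t (tau j)) *
    \int[leb]_(v in `[0, +oo[) (\1_(`[tau j, tau j.+1[%classic) v) by exact: RintegralZl.
rewrite mulrC; congr (_ * _).
have H : leb `[tau j, tau j.+1[ = (tau j.+1 - tau j)%:E.
  rewrite lebesgue_measure_itv/= lte_fin; case: ltP => //= h.
  by apply/eqP; rewrite eqe eq_sym subr_eq0 eq_le h tauS.
rewrite /Rintegral integral_indic// setIidl; first exact: (congr1 fine H).
move=> v/=; rewrite !in_itv/= andbT => /andP[+ _]; apply: le_trans.
by rewrite -tau0; exact: tauM.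
Qed.

End StepFunctions.

(** * Characteristic functions of Lévy processes *)

Section LevyProcess.
Context {R : realType} d (T : measurableType d) (Q : probability T R).
Variables (Y : R -> {RV Q >-> R}) (A B : R -> R).
Hypothesis YL : levy_process Y.
Hypotheses (cA : continuous A) (cB : continuous B) (A0 : A 0 = 0) (B0 : B 0 = 0).
Hypothesis Y1 : has_log_charfun Q (Y 1) (fun z => A z +i* B z).

Let mY t : measurable_fun setT (Y t). Proof. exact: measurable_funPT. Qed.

Let phi t z := ecf Q (fun w => z * Y t w).

Let phiD (s t z : R) : 0 <= s -> 0 <= t -> phi (s + t) z = phi s z * phi t z.
Proof.
(* The times 0, [s] and [s + t], constant afterwards: two increments, the first of which is almost
   surely [Y s]. *)
move=> s0 t0; pose tt i : R := if i is i'.+1 then (if i' is _.+1 then s + t else s) else 0.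
have tt0 i : tt i <= tt i.+1 by case: i => [|[|i]] //=; rewrite lerDl.
have := @ecf_indep R _ T Q 2 (fun i w => Y (tt i.+1) w - Y (tt i) w) (fun=> z) _
  (levy_process_indep YL (erefl (tt 0%N)) tt0).
rewrite big_ord_recl big_ord1/= => H.
have Z0 := levy_process_0 YL.
transitivity (ecf Q (fun w => \sum_(i < 2) z * (Y (tt i.+1) w - Y (tt i) w))).
  apply: ecf_ae; first exact: measurable_funM.
    by apply: measurable_sum => i; apply: measurable_funM => //; exact: measurable_funB.
  by apply: filterS Z0 => w /= Z0; rewrite big_ord_recl big_ord1/= Z0; ring.
rewrite H; last by move=> i; exact: measurable_funB.
congr (_ * _).
  apply: ecf_ae; [|exact: measurable_funM|].
    by apply: measurable_funM => //; exact: measurable_funB.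
  by apply: filterS Z0 => w /= ->; rewrite subr0.
apply: ecf_law => //; first exact: measurable_funB.
by move=> C mC; exact: (levy_process_stationary YL).
Qed.

(** The characteristic function at half the time is a continuous square root, so [square_root_cexp]
    determines it. *)
Let dyadic k z : phi (2 ^- k) z = cexp ((A z / 2 ^+ k) +i* (B z / 2 ^+ k)).
Proof.
elim: k z => [|k IH] z.
  by rewrite expr0 invr1 !mulr1 -Y1 charfun_ecf.
have E (x : R) : x / 2 ^+ k.+1 = x / 2 ^+ k / 2.
  by rewrite exprS invfM; ring.
rewrite !E.
have [cC cS] := @ecf_continuous R _ T Q (Y (2 ^- k.+1)) (mY _).
have cd (f : R -> R) : continuous f -> continuous (fun z => f z / 2 ^+ k).
  by move=> cf x; apply: cvgMl; exact: cf.
apply: (@square_root_cexp R (fun z => \int[Q]_w cos (z * Y (2 ^- k.+1) w))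
   (fun z => \int[Q]_w sin (z * Y (2 ^- k.+1) w)) (fun z => A z / 2 ^+ k) (fun z => B z / 2 ^+ k)) => //.
- exact: cd.
- exact: cd.
- under eq_Rintegral do rewrite mul0r cos0.
  exact: Rintegral_prob_cst.
- by rewrite A0 mul0r.
- by rewrite B0 mul0r.
move=> x; rewrite -IH -[LHS]/(phi (2 ^- k.+1) x * phi (2 ^- k.+1) x) -phiD ?invr_ge0 ?exprn_ge0//.
by congr phi; rewrite exprS invfM; field.
Qed.

Let dyadic_mul k m z : phi (m.+1%:R / 2 ^+ k) z =
  cexp ((m.+1%:R / 2 ^+ k * A z) +i* (m.+1%:R / 2 ^+ k * B z)).
Proof.
elim: m => [|m IH].
  by rewrite mul1r dyadic (mulrC (A z)) (mulrC (B z)).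
have -> : m.+2%:R / 2 ^+ k = m.+1%:R / 2 ^+ k + 2 ^- k :> R by rewrite -[in LHS]natr1; ring.
rewrite phiD ?divr_ge0 ?invr_ge0 ?exprn_ge0// IH dyadic -cexpD.
by congr cexp; simpc; congr (_ +i* _); ring.
Qed.

(** Known at dyadic times by halving and adding, and at all times by right-continuity of the
    paths. *)
Lemma levy_process_ecf t z : 0 <= t ->
  ecf Q (fun w => z * Y t w) = cexp ((t * A z) +i* (t * B z)).
Proof.
(* Dyadic times strictly above [t], as the right limit excludes [t] itself; the successor also keeps
   the numerator in the form that [dyadic_mul] handles. *)
move=> t0; pose tn n : R := (Num.truncn (t * 2 ^+ n)).+1%:R / 2 ^+ n.
have p2 n : 0 < 2 ^+ n :> R by rewrite exprn_gt0.
have tn1 n : t < tn n by rewrite /tn ltr_pdivlMr// truncnS_gt.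
have tn2 n : tn n <= t + 2 ^- n.
  rewrite /tn ler_pdivrMr// mulrDl mulVf ?gt_eqF// -natr1 lerD2r.
  by rewrite truncn_le// mulr_ge0// ltW.
have c2 : (2 ^- n : R) @[n --> \oo] --> 0.
  have := @cvg_geometric R 1 2^-1; rewrite /geometric/=.
  rewrite ger0_norm ?invr_ge0// => H.
  apply: cvg_trans (H _); last lra.
  by apply: near_eq_cvg; near=> n; rewrite mul1r exprVn.
have ct : tn n @[n --> \oo] --> t.
  apply: (squeeze_cvgr (f := fun=> t) (h := fun n => t + 2 ^- n)).
  - by near=> n; rewrite (ltW (tn1 n)) tn2.
  - exact: cvg_cst.
  - by rewrite -[X in _ --> X]addr0; apply: cvgD => //; exact: cvg_cst.
have ctr : tn n @[n --> \oo] --> t^'+.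
  move=> U [e /= e0 H]; have /cvgrPdist_lt/(_ e e0) := ct.
  by apply: filterS => n; move/H => /= H'; apply: H'; exact: tn1.
have cad := levy_process_cadlag YL.
have := @ecf_cvg R _ T Q (fun n w => z * Y (tn n) w) (fun w => z * Y t w)
  (fun n => measurable_funM (measurable_cst z) (mY _)) (measurable_funM (measurable_cst z) (mY _)) _.
case.
  apply: filterS cad => w /(_ t t0)[H _]; apply: cvgMr.
  exact: (cvg_comp _ _ ctr H).
have E n : (\int[Q]_w cos (z * Y (tn n) w) = expR (tn n * A z) * cos (tn n * B z)) *
   (\int[Q]_w sin (z * Y (tn n) w) = expR (tn n * A z) * sin (tn n * B z)).
  by have := dyadic_mul n (Num.truncn (t * 2 ^+ n)) z; rewrite cexpE /phi /ecf => -[-> ->].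
rewrite (eq_cvg _ _ (fun n => (E n).1)) (eq_cvg _ _ (fun n => (E n).2)) => h1 h2.
have lA : tn n * A z @[n --> \oo] --> t * A z by apply: cvgMl.
have lB : tn n * B z @[n --> \oo] --> t * B z by apply: cvgMl.
have leA : expR (tn n * A z) @[n --> \oo] --> expR (t * A z).
  by apply: continuous_cvg => //; exact: continuous_expR.
rewrite cexpE /ecf; congr (_ +i* _).
  apply: (cvg_unique _ h1) => //; apply: cvgM => //.
  by apply: continuous_cvg => //; exact: continuous_cos.
apply: (cvg_unique _ h2) => //; apply: cvgM => //.
by apply: continuous_cvg => //; exact: continuous_sin.
Unshelve. all: by end_near. Qed.

(** Summation by parts over the sorted grid turns the combination into one of independent stationary
    increments. The exponent is written as an integral over time because the limit of the partial
    sums appears in that form. *)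
Lemma levy_process_fdd_ecf k (u t : 'I_k -> R) : (forall i, 0 <= t i) ->
  ecf Q (fun w => \sum_i u i * Y (t i) w) =
  cexp ((\int[lebesgue_measure]_(v in `[0, +oo[) A (step_sum u t v)) +i*
        (\int[lebesgue_measure]_(v in `[0, +oo[) B (step_sum u t v))).
Proof.
move=> t0; have [tau [tau0 tauS taut]] := sorted_grid t0.
have [_ ->] := step_sum_grid u A0 tau0 tauS taut.
have [_ ->] := step_sum_grid u B0 tau0 tauS taut.
have tauM i j : (i <= j)%N -> tau i <= tau j by apply: (homo_leq (r := <=%R)) => //; exact: le_trans.
have tau_ge0 i : 0 <= tau i by rewrite -tau0; exact: tauM.
pose D (j : nat) w := Y (tau j.+1) w - Y (tau j) w.
have mD j : measurable_fun setT (D j) by exact: measurable_funB.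
transitivity (ecf Q (fun w => \sum_(j < k) step_sum u t (tau j) * D j w)).
  apply: ecf_ae.
  - by apply: measurable_sum => i; exact: measurable_funM.
  - by apply: measurable_sum => i; exact: measurable_funM.
  apply: filterS (levy_process_0 YL) => w Y0.
  rewrite [RHS](eq_bigr (fun j : 'I_k => \sum_i u i * ((if tau j < t i then 1 else 0) * D j w))); last first.
    by move=> j _; rewrite mulr_suml; apply: eq_bigr => i _; rewrite mulrA.
  rewrite [RHS]exchange_big/=; apply: eq_bigr => i _; rewrite -mulr_sumr; congr (_ * _).
  have [l lk ->] := taut i.
  rewrite -(big_mkord xpredT (fun j => (if tau j < tau l then 1 else 0) * D j w)).
  rewrite (@big_cat_nat _ _ _ l)//=.
  rewrite [X in _ = _ + X]big_nat [X in _ = _ + X]big1 ?addr0; last first.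
    by move=> j /andP[lj _]; rewrite ltNge tauM// mul0r.
  rewrite [RHS]big_nat [RHS](eq_bigr (fun j => Y (tau j.+1) w - Y (tau j) w)).
    by rewrite -big_nat telescope_sumr// tau0 Y0 subr0.
  (* If [tau j] already equals [tau l], the increment is zero, so the strict inequality in
     [step_sum] does no harm at repeated times. *)
  move=> j /andP[_ jl]; case: ltP => [_|h]; first by rewrite mul1r.
  have e1 : tau j = tau l by apply/eqP; rewrite eq_le h tauM// ltnW.
  have e2 : tau j.+1 = tau j by apply/eqP; rewrite eq_le tauS andbT e1 tauM.
  by rewrite e2 mul0r subrr.
rewrite (@ecf_indep _ _ _ _ k (fun (j : 'I_k) w => D j w)) //; last exact: (levy_process_indep YL).
have -> : ((\sum_(j < k) (tau j.+1 - tau j) * A (step_sum u t (tau j))) +i*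
   (\sum_(j < k) (tau j.+1 - tau j) * B (step_sum u t (tau j)))) =
   \sum_(j < k) (((tau j.+1 - tau j) * A (step_sum u t (tau j))) +i*
     ((tau j.+1 - tau j) * B (step_sum u t (tau j)))) :> R[i].
  by elim: (index_enum 'I_k) => [|j s IH]; rewrite ?big_nil// !big_cons -IH; simpc.
rewrite cexp_sum; apply: eq_bigr => j _.
have dj : 0 <= tau j.+1 - tau j by rewrite subr_ge0.
rewrite -levy_process_ecf//; apply: ecf_law => // C mC.
have := levy_process_stationary YL (tau_ge0 j) dj mC.
by rewrite addrCA subrr addr0.
Qed.

End LevyProcess.

(** * Lévy measures and Lévy bases *)

Section Moments.
Context {R : realType}.

Lemma onem_cos_ge (y : R) : `|y| <= 1 -> y ^+ 2 / 8 <= 1 - cos y.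
Proof.
move=> y1; pose t := y / 2; have Ey : y = t + t by rewrite /t; field.
have -> : 1 - cos y = 2 * (sin t) ^+ 2.
  by rewrite Ey cosD -[X in X - _](cos2Dsin2 t); ring.
have t1 : `|t| <= 1 / 2 by rewrite /t normrM (ger0_norm (_ : 0 <= 2^-1)) ?invr_ge0//; lra.
have s1 : `|t| / 2 <= `|sin t|.
  have h1 := sinB_le_sqr t; have h2 := lerB_normD t (sin t - t).
  have e2 : t ^+ 2 = `|t| * `|t| by rewrite -expr2 real_normK// num_real.
  have e3 : t + (sin t - t) = sin t by ring.
  rewrite e3 in h2; have n0 := normr_ge0 t; nra.
have -> : y ^+ 2 / 8 = 2 * (`|t| / 2) ^+ 2.
  by rewrite exprMn real_normK ?num_real// /t; field.
rewrite ler_pM2l// -[X in _ <= X]real_normK ?num_real//.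
by rewrite ler_sqr ?nnegrE// divr_ge0.
Qed.

(** Where [|g| <= n + 1], the choice [z = 1 / (n + 1)] keeps [|z g| <= 1], so [g^2] is at most
    [8 z^(-2) (1 - cos (z g))]; then monotone convergence. Applied both to [nu] and to the law of
    [L A]. *)
Lemma second_moment_le d (T : measurableType d) (mu : {measure set T -> \bar R})
    (g : T -> R) (K : R) : measurable_fun setT g ->
  (forall z : R, 0 < z -> z <= 1 -> (\int[mu]_t (1 - cos (z * g t))%:E <= (K * z ^+ 2)%:E)%E) ->
  (\int[mu]_t (g t ^+ 2)%:E <= (8 * K)%:E)%E.
Proof.
move=> mg H.
have mg2 : measurable_fun setT (fun t => g t ^+ 2) by exact: measurable_funX.
pose f n t := (if `|g t| <= n.+1%:R then g t ^+ 2 else 0)%:E.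
have mf n : measurable_fun setT (f n).
  apply/measurable_EFinP; apply: measurable_fun_ifT => //.
  by apply: measurable_fun_ler => //; exact: measurableT_comp.
have f0 n t : (0 <= f n t)%E by rewrite lee_fin; case: ifP => // _; exact: sqr_ge0.
have fnd t : setT t -> {homo f^~ t : n m / (n <= m)%N >-> (n <= m)%E}.
  move=> _ n m nm; rewrite /f lee_fin; case: ifP => h; last first.
    by case: ifP => // _; exact: sqr_ge0.
  by rewrite (le_trans h) ?ler_nat.
have Elim t : limn (f^~ t) = (g t ^+ 2)%:E.
  apply: cvg_lim => //; apply: cvg_near_cst; near=> n.
  rewrite /f ifT//; apply: ltW; apply: lt_le_trans (_ : n%:R <= _).
    by near: n; exact: nbhs_infty_gtr.
  by rewrite ler_nat.
under eq_integral do rewrite -Elim.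
rewrite monotone_convergence//; apply: lime_le.
  apply: ereal_nondecreasing_is_cvgn => m n mn.
  by apply: ge0_le_integral => // t _; exact: fnd.
apply: nearW => n.
have n0 : 0 < n.+1%:R^-1 :> R by rewrite invr_gt0.
have n1 : n.+1%:R^-1 <= 1 :> R by rewrite invf_le1 ?ler1n.
have c0 (t : T) : 0 <= 1 - cos (n.+1%:R^-1 * g t) by rewrite subr_ge0 cos_le1.
have mc : measurable_fun setT (fun t => 1 - cos (n.+1%:R^-1 * g t)).
  apply: measurable_funB => //.
  apply: (measurableT_comp (continuous_measurable_fun (@continuous_cos R))).
  exact: measurable_funM.
have -> : (8 * K)%:E = ((8 * n.+1%:R ^+ 2)%:E * (K * n.+1%:R^-1 ^+ 2)%:E)%E.
  have key (N : R) : N != 0 -> 8 * K = 8 * N ^+ 2 * (K * N^-1 ^+ 2) by move=> N0; field.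
  by rewrite -EFinM -key// pnatr_eq0.
apply: (@le_trans _ _ ((8 * n.+1%:R ^+ 2)%:E * \int[mu]_t (1 - cos (n.+1%:R^-1 * g t))%:E)%E); last first.
  by rewrite lee_pmul2l ?lte_fin ?mulr_gt0 ?exprn_gt0//; exact: H.
rewrite -ge0_integralZl; [|by []|by apply/measurable_EFinP|by move=> t _; rewrite lee_fin|
  by rewrite lee_fin mulr_ge0// exprn_ge0].
apply: ge0_le_integral => //.
- by apply/measurable_EFinP; exact: measurable_funM.
move=> t _; rewrite /f -EFinM lee_fin; case: ifP => [gt|_]; last first.
  by rewrite !mulr_ge0// exprn_ge0.
have := @onem_cos_ge (n.+1%:R^-1 * g t).
rewrite normrM gtr0_norm// => /(_ _) h.
have {}h : (n.+1%:R^-1 * g t) ^+ 2 / 8 <= 1 - cos (n.+1%:R^-1 * g t).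
  by apply: h; rewrite mulrC ler_pdivrMr// mul1r.
have key (N x : R) : N != 0 -> 8 * (N ^+ 2 * ((N^-1 * x) ^+ 2 / 8)) = x ^+ 2 by move=> N0; field.
rewrite -mulrA -[leLHS](key n.+1%:R) ?pnatr_eq0//.
by rewrite ler_pM2l// ler_pM2l// exprn_gt0.
Unshelve. all: by end_near. Qed.

End Moments.

Section LevyMeasureIntegrals.
Context {R : realType} (nu : {measure set R -> \bar R}).

Definition levy_C (z : R) : R := \int[nu]_x (1 - cos (z * x)).
Definition levy_D (z : R) : R := \int[nu]_x (sin (z * x) - z * x).

Let mcosz (z : R) : measurable_fun [set: R] (fun x => 1 - cos (z * x)).
Proof.
apply: measurable_funB => //.
apply: (measurableT_comp (continuous_measurable_fun (@continuous_cos R))).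
exact: measurable_funM.
Qed.

Let msinz (z : R) : measurable_fun [set: R] (fun x => sin (z * x) - z * x).
Proof.
apply: measurable_funB; last exact: measurable_funM.
apply: (measurableT_comp (continuous_measurable_fun (@continuous_sin R))).
exact: measurable_funM.
Qed.

Section SquareIntegrable.
Hypothesis I2 : nu.-integrable setT (EFin \o (fun x : R => x ^+ 2)).
Let M := \int[nu]_x (x ^+ 2).

Let I2z (z : R) : nu.-integrable setT (EFin \o (fun x : R => z ^+ 2 * x ^+ 2)).
Proof. exact: integrableZl_real. Qed.

Lemma levy_C_integrable (z : R) : nu.-integrable setT (EFin \o (fun x => 1 - cos (z * x))).
Proof.
apply: (le_integrable_real _ (mcosz z) (I2z z)) => // x _.
by rewrite -exprMn; exact: cosB1_le_sqr.
Qed.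

Lemma levy_D_integrable (z : R) : nu.-integrable setT (EFin \o (fun x => sin (z * x) - z * x)).
Proof.
apply: (le_integrable_real _ (msinz z) (I2z z)) => // x _.
by rewrite -exprMn; exact: sinB_le_sqr.
Qed.

Lemma levy_C_ge0 (z : R) : 0 <= levy_C z.
Proof. by apply: Rintegral_ge0 => // x _; rewrite subr_ge0 cos_le1. Qed.

Lemma levy_C_le (z : R) : `|levy_C z| <= M * z ^+ 2.
Proof.
apply: le_trans (le_normr_Rintegral _ (levy_C_integrable z)) _ => //.
rewrite mulrC -RintegralZl//; apply: le_Rintegral => //.
- exact: integrable_norm (levy_C_integrable z).
- by move=> x _; rewrite -exprMn; exact: cosB1_le_sqr.
Qed.

Lemma levy_D_le (z : R) : `|levy_D z| <= M * z ^+ 2.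
Proof.
apply: le_trans (le_normr_Rintegral _ (levy_D_integrable z)) _ => //.
rewrite mulrC -RintegralZl//; apply: le_Rintegral => //.
- exact: integrable_norm (levy_D_integrable z).
- by move=> x _; rewrite -exprMn; exact: sinB_le_sqr.
Qed.

Lemma levy_C0 : levy_C 0 = 0.
Proof. by have := levy_C_le 0; rewrite expr0n/= mulr0 normr_le0 => /eqP. Qed.

Lemma levy_D0 : levy_D 0 = 0.
Proof. by have := levy_D_le 0; rewrite expr0n/= mulr0 normr_le0 => /eqP. Qed.

Let continuity (F : R -> R -> R) : (forall z, measurable_fun [set: R] (F z)) ->
  (forall x, continuous (F ^~ x)) -> (forall z x, `|F z x| <= z ^+ 2 * x ^+ 2) ->
  continuous (fun z : R => \int[nu]_x F z x).
Proof.
move=> mF cF bF z; apply/continuous_withinNx/cvgr_dnbhsP => u [_ uz].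
have [B uB] : exists B, forall n, `|u n| <= B.
  by have /cvg_seq_bounded/pinfty_ex_gt0[B _ H] : cvgn u by [apply/cvg_ex; exists z]; exists B => n; exact: H.
have B0 : 0 <= B by exact: le_trans (uB 0%N).
have [] // := @Rintegral_dominated_cvg R _ _ nu setT (fun n => F (u n)) (F z)
  (fun x => B ^+ 2 * x ^+ 2) measurableT (fun n => mF (u n)) (mF z) _ (I2z B) _.
- by apply: aeW => x _; exact: (cvg_comp u (F ^~ x) uz (cF x z)).
- move=> n x _; apply: le_trans (bF _ _) _; rewrite ler_wpM2r ?sqr_ge0//.
  by rewrite -real_normK ?num_real// ler_sqr ?nnegrE.
Qed.

Lemma levy_C_continuous : continuous levy_C.
Proof.
apply: continuity => [z|x z|z x]; first exact: mcosz.
- apply: cvgB; first exact: cvg_cst.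
  by apply: (cvg_comp (fun z : R => z * x) (@cos R)); [exact: mulrr_continuous|exact: continuous_cos].
- by rewrite -exprMn; exact: cosB1_le_sqr.
Qed.

Lemma levy_D_continuous : continuous levy_D.
Proof.
apply: continuity => [z|x z|z x]; first exact: msinz.
- apply: cvgB; last exact: mulrr_continuous.
  by apply: (cvg_comp (fun z : R => z * x) (@sin R)); [exact: mulrr_continuous|exact: continuous_sin].
- by rewrite -exprMn; exact: sinB_le_sqr.
Qed.

(** With a second moment the jumps larger than 1 can be compensated too; their mean moves into the
    drift, and [m] becomes the mean of the seed. *)
Lemma levy_exponentE (gamma : R) : exists m : R, forall z : R,
  levy_exponent gamma 0 nu z = (- levy_C z) +i* (m * z + levy_D z).
Proof.
pose f (x : R) := x - x * \1_[set y : R | `|y| <= 1] x.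
have mI : measurable_fun [set: R] (\1_[set y : R | `|y| <= 1] : R -> R).
  apply: measurable_indic; rewrite -[X in measurable X]setTI.
  by apply: (measurable_fun_ler (f := fun y : R => `|y|)) => //; exact: measurableT_comp.
have mf : measurable_fun [set: R] f.
  by apply: measurable_funB => //; exact: measurable_funM.
have If : nu.-integrable setT (EFin \o f).
  apply: (le_integrable_real _ mf I2) => // x _.
  rewrite /f indicE; case: (boolP (x \in _)) => [_|/negP]; first by rewrite mulr1 subrr normr0 sqr_ge0.
  rewrite inE/= mulr0 subr0 => /negP; rewrite -ltNge => x1.
  by rewrite -[leRHS]real_normK ?num_real// expr2 ler_peMl// ltW.
exists (gamma + \int[nu]_x f x) => z.
have S0 (g : R -> R) : measurable_fun setT g -> g 0 = 0 ->
    \int[nu]_(x in [set~ 0]) g x = \int[nu]_x g x.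
  move=> mg g0; rewrite Rintegral_mkcond; apply: eq_Rintegral => x _.
  rewrite /patch; case: ifPn => //; rewrite notin_setE/= => /contrapT ->.
  by rewrite g0.
pose j (x : R) := z * x * \1_[set y : R | `|y| <= 1] x.
have ER x : complex.Re (cexp (0 +i* (z * x)) - 1 - (0 +i* j x)) = cos (z * x) - 1.
  by rewrite cexpE expR0/=; ring.
have EI x : complex.Im (cexp (0 +i* (z * x)) - 1 - (0 +i* j x)) = sin (z * x) - j x.
  by rewrite cexpE expR0/=; ring.
rewrite /levy_exponent /cintegral (eq_Rintegral _ (fun x _ => ER x)) (eq_Rintegral _ (fun x _ => EI x)).
have ms : measurable_fun [set: R] (fun x => sin (z * x)).
  by apply: (measurableT_comp (continuous_measurable_fun (@continuous_sin R))); exact: measurable_funM.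
rewrite (S0 (fun x => cos (z * x) - 1)); last 2 first.
- by apply: measurable_funB => //; apply: measurable_cos_comp; exact: measurable_funM.
- by rewrite mulr0 cos0 subrr.
rewrite (S0 (fun x => sin (z * x) - j x)); last 2 first.
- by apply: measurable_funB => //; apply: measurable_funM => //; exact: measurable_funM.
- by rewrite /j mulr0 mul0r sin0 subrr.
rewrite expr0n/= mulr0 mul0r; simpc; congr (_ +i* _).
  rewrite -[RHS]mulN1r -RintegralZl//; last exact: levy_C_integrable.
  by apply: eq_Rintegral => x _; ring.
rewrite mulrDl -addrA; congr (_ + _).
rewrite mulrC -RintegralZl// -RintegralD//; last 2 first.
- exact: integrableZl_real.
- exact: levy_D_integrable.
by apply: eq_Rintegral => x _; rewrite /f /j; ring.
Qed.

End SquareIntegrable.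
End LevyMeasureIntegrals.

Lemma Rintegral_indicator {R : realType} d (T : measurableType d) (mu : {measure set T -> \bar R})
    (E : set T) : measurable E -> (mu E < +oo)%E ->
  mu.-integrable setT (EFin \o (\1_E : T -> R)) /\ \int[mu]_x (\1_E x) = fine (mu E).
Proof.
move=> mE Ef; have H : (\int[mu]_x (\1_E x)%:E = mu E)%E by rewrite integral_indic// setIT.
split; last by rewrite /Rintegral H.
apply/integrableP; split; first by apply/measurable_EFinP.
rewrite [ltLHS](_ : _ = \int[mu]_x (\1_E x)%:E)%E; first by rewrite H.
by apply: eq_integral => x _ /=; rewrite ger0_norm// indicE.
Qed.

(** * Weighted sums of a Lévy basis *)

Section LevyBasisCharfun.
Context {R : realType} d (T : measurableType d) (P : probability T R).
Variables (gamma : R) (nu : {measure set R -> \bar R}) (L : set (R * R) -> {RV P >-> R}).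
Hypothesis hL : levy_basis gamma 0 nu L.
Local Notation leb2 := (@lebesgue_measure R \x @lebesgue_measure R)%E.

Lemma fin_borel0 : fin_borel (set0 : set (R * R)).
Proof. by split; [exact: measurable0|rewrite /Leb2 measure0]. Qed.

(** Additivity for the constant sequence of empty sets: a series with constant terms converges only
    if they are 0. *)
Lemma levy_basis_set0 : {ae P, forall w, L set0 w = 0}.
Proof.
have E0 : \bigcup_(i in [set: nat]) (set0 : set (R * R)) = set0 by rewrite bigcup0.
have := @levy_basis_additive _ _ _ _ _ _ _ _ hL (fun=> set0) (fun=> fin_borel0).
rewrite E0 => /(_ _ fin_borel0) H.
have {H} := H (fun i j _ _ '(ex_intro x (conj x0 _)) => False_ind _ x0).
apply: filterS => w cv.
have h0 : (fun=> L set0 w) @ \oo --> (0 : R).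
  by apply: cvg_series_cvg_0; apply/cvg_ex; exists (L set0 w).
exact: (cvg_unique _ (cvg_cst (L set0 w)) h0).
Qed.

Lemma levy_basis_finite_additive n (E : 'I_n -> set (R * R)) :
  (forall i, fin_borel (E i)) -> trivIset setT E -> fin_borel (\bigcup_i E i) ->
  {ae P, forall w, L (\bigcup_i E i) w = \sum_i L (E i) w}.
Proof.
move=> fE tE fU.
pose A j := oapp E set0 (insub j : option 'I_n).
have AU : \bigcup_j A j = \bigcup_i E i.
  apply/seteqP; split => p [j _]; rewrite /A.
    by case: insubP => // i _ _ /= Ep; exists i.
  by move=> Ep; exists (val j) => //; rewrite valK.
have fA j : fin_borel (A j).
  by rewrite /A; case: insubP => [i _ _|_] //=; exact: fin_borel0.
have tA : trivIset setT A.
  move=> i j _ _ [p [] ]; rewrite /A; case: insubP => // i' _ Ei; case: insubP => // j' _ Ej /= pi pj.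
  by rewrite -Ei -Ej; congr val; apply: tE => //; exists p.
have := levy_basis_additive hL fA tA; rewrite AU => /(_ fU) H.
apply: filterS2 H levy_basis_set0 => w cv L0.
apply: (cvg_unique _ cv) => //; apply: cvg_near_cst; near=> m.
have nm : (n <= m)%N by near: m; exact: nbhs_infty_ge.
rewrite /series/= (@big_cat_nat _ _ _ n)//= big_mkord [X in _ + X]big_nat [X in _ + X]big1 ?addr0.
  by apply: eq_bigr => i _; rewrite /A valK.
by move=> j /andP[nj _]; rewrite /A insubF/= ?L0// ltnNge nj.
Unshelve. all: by end_near. Qed.

Section Atoms.
Variables (N : nat) (A : 'I_N -> set (R * R)) (th : 'I_N -> R).
Hypothesis fA : forall k, fin_borel (A k).

(** [sig p] records which of the sets [A k] contain [p], and [B s] is the atom of signature [s]. The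
    empty signature is sent to the empty set, since its true atom has infinite measure. *)
Let S := {ffun 'I_N -> bool}.
Let sig (p : R * R) : S := [ffun k => p \in A k].
Let B (s : S) : set (R * R) := [set p | sig p = s /\ exists k, s k].
Let e (i : 'I_#|{: S}|) : S := enum_val i.
Let ths (s : S) : R := \sum_k th k * (s k)%:R.
Definition weighted_count (p : R * R) : R := \sum_k th k * \1_(A k) p.

Let hE p : weighted_count p = ths (sig p).
Proof. by apply: eq_bigr => k _; rewrite indicE ffunE. Qed.

Let fB s : fin_borel (B s).
Proof.
have [[k sk]|H] := pselect (exists k, s k); last first.
  rewrite (_ : B s = set0); first exact: fin_borel0.
  by apply/seteqP; split => // p [].
have mB : measurable (B s).
  rewrite (_ : B s = \bigcap_(k in [set: 'I_N]) (if s k then A k else ~` A k)); last first.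
    apply/seteqP; split => p.
      move=> [<- _] i _; rewrite ffunE; case: ifPn; rewrite ?inE//.
      by rewrite notin_setE.
    move=> H; split; last by exists k.
    apply/ffunP => i; have := H i Logic.I; rewrite ffunE; case: ifPn => _.
      by move=> /mem_set.
    by move=> h; apply: memNset.
  apply: fin_bigcap_measurable => // i _; have [mA _] := fA i.
  by case: ifP => // _; exact: measurableC.
split => //; have [mA] := fA k; apply: le_lt_trans.
apply: le_measure; rewrite ?inE// => p [E _].
by move: sk; rewrite -E ffunE inE.
Qed.

Let tB s s' p : B s p -> B s' p -> s = s'.
Proof. by move=> [<- _] [<- _]. Qed.

Let tE : trivIset setT (fun i => B (e i)).
Proof.
move=> i j _ _ [p [pi pj]]; apply: enum_val_inj; exact: tB pi pj.
Qed.

Let memA p k : p \in A k = sig p k.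
Proof. by rewrite ffunE. Qed.

Let AE k : A k = \bigcup_i (if e i k then B (e i) else set0).
Proof.
apply/seteqP; split => p.
  move=> /mem_set pA; exists (enum_rank (sig p)) => //.
  rewrite /e enum_rankK -memA pA; split => //; exists k; by rewrite -memA.
move=> [i _]; case: ifPn => // ik [E _].
by move: ik; rewrite -E -memA inE.
Qed.

Let LA : {ae P, forall w, forall k, L (A k) w = \sum_i (e i k)%:R * L (B (e i)) w}.
Proof.
apply: filter_forall => k.
have fE i : fin_borel (if e i k then B (e i) else set0).
  by case: ifP => _; [exact: fB|exact: fin_borel0].
have := levy_basis_finite_additive fE _ _; rewrite -AE => /(_ _ (fA k)) H.
have {H} := H _; move=> H.
apply: filterS2 (H _) levy_basis_set0 => [w -> L0|].
  by apply: eq_bigr => i _; case: ifP => _; rewrite ?mul1r// mul0r.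
move=> i j _ _ [p []]; case: ifP => // _ pi; case: ifP => // _ pj.
by apply: tE => //; exists p.
Qed.

Lemma weighted_count_integral (f : R -> R) : f 0 = 0 ->
  leb2.-integrable setT (EFin \o (fun p => f (weighted_count p))) /\
  \int[leb2]_p f (weighted_count p) =
    \sum_i fine (Leb2 (B (e i))) * f (ths (e i)).
Proof.
move=> f0.
have E p : f (weighted_count p) = \sum_i f (ths (e i)) * \1_(B (e i)) p.
  rewrite hE; have [[k sk]|H] := pselect (exists k, sig p k).
    rewrite (bigD1 (enum_rank (sig p)))//= /e enum_rankK indicE mem_set; last by split=> //; exists k.
    rewrite mulr1 big1 ?addr0// => i ir; rewrite indicE memNset ?mulr0// => -[E _].
    by move: ir; rewrite E enum_valK eqxx.
  rewrite [RHS]big1.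
    rewrite /ths big1 ?f0// => k _; case sk : (sig p k); last by rewrite mulr0.
    by exfalso; apply: H; exists k.
  by move=> i _; rewrite indicE memNset ?mulr0// => -[E [k sk]]; apply: H; exists k; rewrite E.
have IB i := @Rintegral_indicator R _ _ leb2 (B (e i)) (fB _).1 (fB _).2.
have [] := @Rintegral_sum R _ _ leb2 setT _ (index_enum 'I_#|{: S}|)
  (fun i p => f (ths (e i)) * \1_(B (e i)) p) measurableT
  (fun i => integrableZl_real _ measurableT (IB i).1).
have -> : (fun p => \sum_i f (ths (e i)) * \1_(B (e i)) p) = (fun p => f (weighted_count p)).
  by apply/funext => p; rewrite E.
move=> I ->; split => //; apply: eq_bigr => i _.
by rewrite RintegralZl//; [rewrite (IB i).2 mulrC|exact: (IB i).1].
Qed.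

Variable m : R.
Hypothesis psiE : forall z, levy_exponent gamma 0 nu z = (- levy_C nu z) +i* (m * z + levy_D nu z).
Hypotheses (C0 : levy_C nu 0 = 0) (D0 : levy_D nu 0 = 0).

(** Almost surely every [L (A k)] is the sum over the atoms in [A k], so the combination is one of
    independent variables. Centring by [m] times the area cancels the drift and leaves [C] and
    [D]. *)
Lemma levy_basis_sum_ecf :
  ecf P (fun w => \sum_k th k * (L (A k) w - m * fine (Leb2 (A k)))) =
  cexp ((- \int[leb2]_p levy_C nu (weighted_count p)) +i*
        (\int[leb2]_p levy_D nu (weighted_count p))).
Proof.
(* The total centring regrouped by atoms: [weighted_count_integral] for the linear function
   [m * z]. *)
pose c := \sum_i fine (Leb2 (B (e i))) * (m * ths (e i)).
have mL E : measurable_fun setT (L E) by exact: measurable_funPT.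
have Ec : \sum_k th k * (m * fine (Leb2 (A k))) = c.
  have [_ Hc] := @weighted_count_integral (fun z => m * z) (mulr0 m).
  rewrite (_ : c = \int[leb2]_p (m * weighted_count p)); last exact: esym Hc.
  have IA k := @Rintegral_indicator R _ _ leb2 (A k) (fA k).1 (fA k).2.
  have [I EI] := @Rintegral_sum R _ _ leb2 setT _ (index_enum 'I_N)
    (fun i p => th i * \1_(A i) p) measurableT
    (fun i => integrableZl_real _ measurableT (IA i).1).
  rewrite RintegralZl// EI mulr_sumr; apply: eq_bigr => k _.
  by rewrite RintegralZl//; [rewrite (IA k).2; ring|exact: (IA k).1].
have ecf_shift (Z : T -> R) : measurable_fun setT Z ->
   ecf P (fun w => Z w - c) = ecf P Z * cexp (0 +i* (- c)).
  move=> mZ; rewrite cexpE expR0 !mul1r cosN sinN /ecf; simpc.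
  have IC := integrable_cos_comp P mZ; have IS := integrable_sin_comp P mZ.
  congr (_ +i* _).
    rewrite -!RintegralZr// -RintegralD//.
    - by apply: eq_Rintegral => w _; rewrite cosB; ring.
    - exact: integrableZr_real.
    - exact: integrableZr_real.
  rewrite addrC -!RintegralZr// -RintegralB//.
  - by apply: eq_Rintegral => w _; rewrite sinB; ring.
  - exact: integrableZr_real.
  - exact: integrableZr_real.
transitivity (ecf P (fun w => \sum_i ths (e i) * L (B (e i)) w - c)).
  apply: ecf_ae.
  - by apply: measurable_sum => i; apply: measurable_funM => //; exact: measurable_funB.
  - by apply: measurable_funB => //; apply: measurable_sum => i; exact: measurable_funM.
  apply: filterS LA => w LAw; rewrite -Ec.
  rewrite [LHS](eq_bigr (fun k => \sum_i th k * ((e i k)%:R * L (B (e i)) w) - th k * (m * fine (Leb2 (A k))))).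
    rewrite !sumrB exchange_big/=; congr (_ - _); apply: eq_bigr => i _.
    by rewrite /ths mulr_suml; apply: eq_bigr => k _; ring.
  by move=> k _; rewrite LAw mulrBr mulr_sumr.
rewrite ecf_shift; last by apply: measurable_sum => i; exact: measurable_funM.
rewrite (@ecf_indep _ _ _ _ _ (fun i w => L (B (e i)) w)) //; last first.
  apply: (levy_basis_indep hL) => // i; exact: fB.
have -> : \prod_i ecf P (fun w => ths (e i) * L (B (e i)) w) =
   cexp (\sum_i (fine (Leb2 (B (e i))))%:C * levy_exponent gamma 0 nu (ths (e i))).
  rewrite cexp_sum; apply: eq_bigr => i _; rewrite -charfun_ecf.
  exact: (levy_basis_law hL (fB _)).
rewrite -cexpD; congr cexp.
have [_ ->] := @weighted_count_integral (levy_C nu) C0.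
have [_ ->] := @weighted_count_integral (levy_D nu) D0.
rewrite /c; elim: (index_enum _) => [|i s IH]; first by rewrite !big_nil; simpc; rewrite ?oppr0.
rewrite !big_cons -!addrA.
move: IH; set X := \sum_(j <- s) _; set Y := \sum_(j <- s) _; set Z := \sum_(j <- s) _; set W := \sum_(j <- s) _.
case: X => x1 x2; rewrite psiE; simpc => -[h1 h2]; congr (_ +i* _).
  by rewrite h1.
by rewrite -h2; ring.
Qed.

End Atoms.

(** The real part of the characteristic function yields a finite second moment; then
    [E sin (z X) = z E X + O(z^2)] is compared with the explicit imaginary part as [z] tends to
    0. *)
Lemma levy_basis_mean (A : set (R * R)) (m : R) : fin_borel A ->
  nu.-integrable setT (EFin \o (fun x : R => x ^+ 2)) ->
  (forall z, levy_exponent gamma 0 nu z = (- levy_C nu z) +i* (m * z + levy_D nu z)) ->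
  fine ('E_P[L A])%E = m * fine (Leb2 A).
Proof.
move=> fA I2 psiE; set l := fine (Leb2 A); pose X := L A : T -> R.
have l0 : 0 <= l by rewrite fine_ge0// measure_ge0.
set M := \int[nu]_x (x ^+ 2).
have M0 : 0 <= M by apply: Rintegral_ge0 => // x _; exact: sqr_ge0.
have mX : measurable_fun setT X by exact: measurable_funPT.
pose C := levy_C nu; pose D := levy_D nu.
have C0 z : 0 <= C z by exact: levy_C_ge0.
have CM z : C z <= M * z ^+ 2 by apply: le_trans (levy_C_le I2 z); exact: ler_norm.
have DM z : `|D z| <= M * z ^+ 2 by exact: levy_D_le.
pose th z := l * (m * z + D z).
have Ez z : (\int[P]_w cos (z * X w) = expR (- (l * C z)) * cos (th z)) *
            (\int[P]_w sin (z * X w) = expR (- (l * C z)) * sin (th z)).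
  have := levy_basis_law hL fA z; rewrite charfun_ecf psiE.
  have -> : l%:C * ((- levy_C nu z) +i* (m * z + levy_D nu z)) = (- (l * C z)) +i* th z.
    by simpc; congr (_ +i* _); ring.
  by rewrite cexpE => -[-> ->].
pose K0 := l * (`|m| + M).
have thK (z : R) : 0 < z -> z <= 1 -> `|th z| <= K0 * z.
  move=> z0 z1; rewrite /th /K0 normrM (ger0_norm l0) -mulrA ler_wpM2l//.
  apply: le_trans (ler_normD _ _) _; rewrite normrM (gtr0_norm z0) mulrDl lerD2l.
  by apply: le_trans (DM z) _; rewrite expr2 ler_wpM2l// ler_piMr// ltW.
have th2 (z : R) : 0 < z -> z <= 1 -> (th z) ^+ 2 <= K0 ^+ 2 * z ^+ 2.
  move=> z0 z1; rewrite -exprMn -real_normK ?num_real// ler_sqr ?nnegrE ?thK//.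
  by rewrite !mulr_ge0 ?addr_ge0// ltW.
(* [l * M] accounts for the loss of modulus of the characteristic function, [K0 ^+ 2] for its phase
   [th z]. *)
pose K := l * M + K0 ^+ 2.
have lC z : 0 <= l * C z <= l * M * z ^+ 2 by rewrite mulr_ge0// -mulrA ler_wpM2l.
have lE z : 0 <= 1 - expR (- (l * C z)) <= l * M * z ^+ 2.
  have /andP[h1 h2] := lC z; rewrite (le_trans (onem_expRN_le h1))// andbT subr_ge0.
  by rewrite -expR0 ler_expR oppr_le0.
have V2 : (\int[P]_w (X w ^+ 2)%:E <= (8 * K)%:E)%E.
  apply: second_moment_le => // z z0 z1.
  have IC := integrable_cos_comp P (measurable_funM (measurable_cst z) mX).
  have I1 : P.-integrable setT (EFin \o cst (1 : R)) by exact: finite_measure_integrable_cst.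
  have -> : (\int[P]_t (1 - cos (z * X t))%:E = (1 - \int[P]_t cos (z * X t))%:E)%E.
    rewrite -[X in (X - _)%:E](Rintegral_prob_cst P 1) -RintegralB//.
    rewrite fineK//; apply: integrable_fin_num => //; exact: integrableB_real.
  rewrite lee_fin (Ez z).1.
  have -> : 1 - expR (- (l * C z)) * cos (th z) =
     (1 - expR (- (l * C z))) + expR (- (l * C z)) * (1 - cos (th z)) by ring.
  rewrite /K mulrDl; apply: lerD; first by have /andP[] := lE z.
  have /andP[e1 _] := lE z; apply: le_trans (th2 z z0 z1).
  apply: le_trans (_ : _ <= 1 * (1 - cos (th z))) _.
    by rewrite ler_wpM2r ?subr_ge0 ?cos_le1// -subr_ge0.
  by rewrite mul1r (le_trans (ler_norm _) (cosB1_le_sqr _)).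
have IX2 : P.-integrable setT (EFin \o (fun w => X w ^+ 2)).
  apply/integrableP; split; first by apply/measurable_EFinP; exact: measurable_funX.
  rewrite [ltLHS](_ : _ = \int[P]_w (X w ^+ 2)%:E)%E; first by apply: le_lt_trans V2 _; exact: ltry.
  by apply: eq_integral => w _ /=; rewrite ger0_norm ?sqr_ge0.
have I1 : P.-integrable setT (EFin \o cst (1 : R)) by exact: finite_measure_integrable_cst.
have IX : P.-integrable setT (EFin \o X).
  apply: (le_integrable_real _ mX (integrableD_real _ I1 IX2)) => // w _ /=.
  have := sqr_ge0 (`|X w| - 1); rewrite -[X in 1 + X]real_normK ?num_real//; have := normr_ge0 (X w); nra.
pose V := \int[P]_w (X w ^+ 2).
have V0 : 0 <= V by apply: Rintegral_ge0 => // w _; exact: sqr_ge0.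
rewrite expectationE -/(Rintegral P setT X).
have key (z : R) : 0 < z -> z <= 1 -> `|\int[P]_w X w - m * l| <= (V + K + l * M) * z.
  move=> z0 z1.
  have ISz := integrable_sin_comp P (measurable_funM (measurable_cst z) mX).
  have IXz : P.-integrable setT (EFin \o (fun w => z * X w)) by exact: integrableZl_real.
  have IV : P.-integrable setT (EFin \o (fun w => z ^+ 2 * X w ^+ 2)) by exact: integrableZl_real.
  have h1 : `|\int[P]_w sin (z * X w) - z * \int[P]_w X w| <= V * z ^+ 2.
    rewrite -RintegralZl// -RintegralB//.
    apply: le_trans (le_normr_Rintegral _ _) _ => //; first exact: integrableB_real.
    rewrite mulrC -RintegralZl//; apply: le_Rintegral => //.
    - exact: integrable_norm (integrableB_real _ ISz IXz).
    - by move=> w _; rewrite -exprMn; exact: sinB_le_sqr.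
  have h2 : `|expR (- (l * C z)) * sin (th z) - z * (m * l)| <= (K + l * M) * z ^+ 2.
    have -> : expR (- (l * C z)) * sin (th z) - z * (m * l) =
      - ((1 - expR (- (l * C z))) * sin (th z)) + ((sin (th z) - th z) + l * D z) by rewrite /th; ring.
    rewrite /K (_ : (_ + _) * _ = l * M * z ^+ 2 + (K0 ^+ 2 * z ^+ 2 + l * M * z ^+ 2)); last by ring.
    apply: le_trans (ler_normD _ _) _; apply: lerD; last first.
      apply: le_trans (ler_normD _ _) _; apply: lerD.
        exact: le_trans (sinB_le_sqr _) (th2 _ z0 z1).
      by rewrite normrM (ger0_norm l0) -mulrA ler_wpM2l.
    have /andP[e1 e2] := lE z.
    by rewrite normrN normrM (ger0_norm e1) (le_trans _ e2)// ler_piMr// sin_max.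
  rewrite (Ez z).2 in h1.
  have : `|z * (\int[P]_w X w - m * l)| <= (V + K + l * M) * z ^+ 2.
    have -> : z * (\int[P]_w X w - m * l) =
      (expR (- (l * C z)) * sin (th z) - z * (m * l)) -
      (expR (- (l * C z)) * sin (th z) - z * \int[P]_w X w) by ring.
    apply: le_trans (ler_normB _ _) _.
    rewrite [leRHS](_ : _ = (K + l * M) * z ^+ 2 + V * z ^+ 2); last by ring.
    exact: lerD.
  by rewrite normrM (gtr0_norm z0) expr2 mulrA [leRHS]mulrC ler_pM2l.
apply/eqP; rewrite -subr_eq0 -normr_le0; apply/ler_addgt0Pr => eps e0; rewrite add0r.
set Q := V + K + l * M in key.
have Q0 : 0 <= Q.
  have := mulr_ge0 l0 M0; have := sqr_ge0 K0; rewrite /Q /K; lra.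
have d0 : 0 < Q + 1 + eps by lra.
(* This [z] lies in []0, 1]] and makes [Q * z] at most [eps]. *)
apply: le_trans (key (eps / (Q + 1 + eps)) _ _) _.
- by rewrite divr_gt0.
- by rewrite ler_pdivrMr//; lra.
- by rewrite mulrCA ler_piMr ?(ltW e0)// ler_pdivrMr//; lra.
Qed.

End LevyBasisCharfun.

(** * From the second moment of the seed to that of the Lévy measure *)

Section SeedMoment.
Context {R : realType} d (T : measurableType d) (P : probability T R).
Variables (gamma : R) (nu : {measure set R -> \bar R}) (seed : {RV P >-> R}).
Hypothesis hnu : levy_measure nu.
Hypothesis hseed : has_log_charfun P seed (levy_exponent gamma 0 nu).
Hypothesis hseed2 : ('E_P[fun w => (`|seed w| ^+ 2)%R] < +oo)%E.

(** The modulus [exp (- C z)] of the characteristic function is at least [E cos (z L')], hence at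
    least [1 - M z^2]. So [C z] is of order [z^2], which bounds the second moment of [nu]. *)
Lemma levy_measure_square_integrable : nu.-integrable setT (EFin \o (fun x : R => x ^+ 2)).
Proof.
have mmin : measurable_fun [set: R] (fun x : R => Num.min 1 (x ^+ 2)).
  by apply: measurable_minr => //; exact: measurable_funX.
have min0 (x : R) : 0 <= Num.min 1 (x ^+ 2) by rewrite le_min ler01 sqr_ge0.
have Imin : nu.-integrable setT (EFin \o (fun x : R => Num.min 1 (x ^+ 2))).
  apply/integrableP; split; first by apply/measurable_EFinP.
  apply: le_lt_trans (levy_measure_fin hnu); rewrite le_eqVlt; apply/orP; left; apply/eqP.
  by apply: eq_integral => x _ /=; rewrite ger0_norm.
pose I := \int[nu]_x (Num.min 1 (x ^+ 2)).
have I0 : 0 <= I by exact: Rintegral_ge0.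
have mcz (z : R) : measurable_fun [set: R] (fun x => 1 - cos (z * x)).
  by apply: measurable_funB => //; apply: measurable_cos_comp; exact: measurable_funM.
have cle (z x : R) : `|1 - cos (z * x)| <= (2 + z ^+ 2) * Num.min 1 (x ^+ 2).
  rewrite minEle; case: ifP => _.
    rewrite mulr1; have := cos_geN1 (z * x); have := cos_le1 (z * x); have := sqr_ge0 z.
    move=> h1 h2 h3; rewrite ger0_norm; lra.
  apply: le_trans (cosB1_le_sqr _) _; rewrite exprMn ler_wpM2r ?sqr_ge0//; lra.
have IC (z : R) : nu.-integrable setT (EFin \o (fun x => 1 - cos (z * x))).
  by apply: (le_integrable_real _ (mcz z) (integrableZl_real (2 + z ^+ 2) _ Imin)).
pose C := levy_C nu.
have CI (z : R) : C z <= (2 + z ^+ 2) * I.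
  rewrite /C /levy_C /I -RintegralZl//; apply: le_Rintegral => //.
  - exact: integrableZl_real.
  - by move=> x _; apply: le_trans (cle z x); exact: ler_norm.
have C0 (z : R) : 0 <= C z by exact: levy_C_ge0.
have ReE (z : R) : complex.Re (levy_exponent gamma 0 nu z) = - C z.
  rewrite /levy_exponent /cintegral/= expr0n/= mulr0 mul0r oppr0 !add0r.
  rewrite /C /levy_C -[RHS]mulN1r -RintegralZl// [LHS]Rintegral_mkcond; apply: eq_Rintegral => x _.
  rewrite /patch; case: ifPn => [_|]; first by rewrite expR0; ring.
  by rewrite notin_setE/= => /contrapT ->; rewrite mulr0 cos0 subrr mulr0.
have mS : measurable_fun setT (seed : T -> R) by exact: measurable_funPT.
have IS2 : P.-integrable setT (EFin \o (fun w => seed w ^+ 2)).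
  apply/integrableP; split; first by apply/measurable_EFinP; exact: measurable_funX.
  move: hseed2; rewrite expectationE; apply: le_lt_trans; rewrite le_eqVlt; apply/orP; left; apply/eqP.
  by apply: eq_integral => w _ /=; rewrite normrX.
pose M := \int[P]_w (seed w ^+ 2).
have M0 : 0 <= M by apply: Rintegral_ge0 => // w _; exact: sqr_ge0.
have cosM (z : R) : 1 - M * z ^+ 2 <= \int[P]_w cos (z * seed w).
  have Ic := integrable_cos_comp P (measurable_funM (measurable_cst z) mS).
  have I1 : P.-integrable setT (EFin \o cst (1 : R)) by exact: finite_measure_integrable_cst.
  rewrite -{1}(Rintegral_prob_cst P 1) mulrC -RintegralZl// -RintegralB//; last exact: integrableZl_real.
  apply: le_Rintegral => //.
    by apply: integrableB_real => //; exact: integrableZl_real.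
  move=> w _; rewrite -exprMn; have := cosB1_le_sqr (z * seed w).
  by move=> /(le_trans (ler_norm _)); lra.
have expC (z : R) : 1 - M * z ^+ 2 <= expR (- C z).
  apply: le_trans (cosM z) _; have := hseed z; rewrite charfun_ecf.
  have := ReE z; case: (levy_exponent gamma 0 nu z) => x y /= ->; rewrite cexpE => -[-> _].
  by rewrite ler_piMr ?expR_ge0// cos_le1.
(* If [M z^2 <= 1 / 2], inverting the exponential gives [C z <= 2 M z^2]; otherwise
   [C z <= 3 I <= 6 I M z^2]. *)
pose K := 2 * M + 6 * I * M.
have CK (z : R) : 0 < z -> z <= 1 -> C z <= K * z ^+ 2.
  move=> z0 z1; have zz : 0 <= z ^+ 2 by exact: sqr_ge0.
  have z21 : z ^+ 2 <= 1 by rewrite expr_le1// ltW.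
  have [h|h] := leP (M * z ^+ 2) (1 / 2).
    have e1 := expC z; have e2 := expR_ge1Dx (C z).
    have e3 : expR (- C z) * expR (C z) = 1 by rewrite mulrC expRxMexpNx_1.
    have e4 : (1 - M * z ^+ 2) * (1 + C z) <= 1.
      rewrite -[leRHS]e3; apply: ler_pM => //; first by lra.
      by have := C0 z; lra.
    have cz := C0 z; have i0 : 0 <= I * M * z ^+ 2 by apply: mulr_ge0 => //; exact: mulr_ge0.
    rewrite /K mulrDl; nra.
  have := CI z; have i1 : (2 + z ^+ 2) * I <= 3 * I by rewrite ler_wpM2r//; lra.
  have i2 : 0 <= I * (M * z ^+ 2 - 1 / 2) by rewrite mulr_ge0//; lra.
  have i3 : 0 <= M * z ^+ 2 by rewrite mulr_ge0.
  rewrite /K; lra.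
have : (\int[nu]_x (x ^+ 2)%:E <= (8 * K)%:E)%E.
  apply: second_moment_le => // z z0 z1.
  rewrite -[leLHS]fineK ?lee_fin; first exact: CK.
  by apply: integrable_fin_num => //; exact: IC.
move=> H; apply/integrableP; split; first by apply/measurable_EFinP; exact: measurable_funX.
rewrite [ltLHS](_ : _ = \int[nu]_x (x ^+ 2)%:E)%E; first by apply: le_lt_trans H _; exact: ltry.
by apply: eq_integral => w _ /=; rewrite ger0_norm ?sqr_ge0.
Qed.

End SeedMoment.

(** * Grid counts and trawl sections *)

Local Close Scope complex_scope.

Section Counting.
Context {R : realType}.
Local Notation leb := (@lebesgue_measure R).

Definition clip (x M : R) : R := Num.max 0 (Num.min x M).

Definition grid_count (N : nat) (Delta g r : R) : R :=
  \sum_(k < N) (if (r <= k%:R * Delta) && (k%:R * Delta <= r + g) then 1 else 0).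

Lemma grid_count_ge0 N (Delta g r : R) : 0 <= grid_count N Delta g r.
Proof. by apply: sumr_ge0 => k _; case: ifP. Qed.

Lemma clip_le (x y M : R) : x <= y -> 0 <= clip y M - clip x M <= y - x.
Proof. by rewrite /clip !maxElt !minElt; repeat case: ifP; lra. Qed.

Lemma clip_scale (c x M : R) : 0 < c -> c * clip x M = clip (c * x) (c * M).
Proof. by move=> c0; rewrite /clip maxr_pMr ?(ltW c0)// minr_pMr ?(ltW c0)// mulr0. Qed.

(** The count is a non-strict count minus a strict one. The strict count at [x] lies between the
    non-strict ones at [x - 1] and [x], so two grid steps cover both errors. *)
Lemma grid_count_clip N (Delta g r : R) : 0 < Delta -> 0 <= g ->
  `|Delta * grid_count N Delta g r - (clip (r + g) (N%:R * Delta) - clip r (N%:R * Delta))| <= 2 * Delta.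
Proof.
move=> D0 g0.
pose s (x : R) : R := \sum_(k < N) (if k%:R <= x then 1 else 0).
pose s' (x : R) : R := \sum_(k < N) (if k%:R < x then 1 else 0).
have E : grid_count N Delta g r = s ((r + g) / Delta) - s' (r / Delta).
  rewrite /grid_count /s /s' -sumrB; apply: eq_bigr => k _.
  rewrite ler_pdivlMr// ltr_pdivlMr//.
  by case: (leP r (k%:R * Delta)) => h1; case: (leP (k%:R * Delta) (r + g)) => h2 //=; lra.
have [h1 h2] := count_le_bounds N ((r + g) / Delta); rewrite -/(s _) in h1 h2.
have [h3 h4] := count_le_bounds N (r / Delta); rewrite -/(s _) in h3 h4.
have [h5 h6] := count_le_bounds N (r / Delta - 1); rewrite -/(s _) in h5 h6.
have h7 : s' (r / Delta) <= s (r / Delta).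
  by apply: ler_sum => k _; case: (ltP k%:R (r / Delta)) => [/ltW ->//|_]; case: ifP.
have h8 : s (r / Delta - 1) <= s' (r / Delta).
  apply: ler_sum => k _; case: (leP k%:R (r / Delta - 1)) => h; last by case: ifP.
  by rewrite ifT//; lra.
have /andP[h9 h10] : 0 <= clip (r / Delta) N%:R - clip (r / Delta - 1) N%:R <= r / Delta - (r / Delta - 1).
  by apply: clip_le; lra.
have -> : clip (r + g) (N%:R * Delta) = Delta * clip ((r + g) / Delta) N%:R.
  by rewrite clip_scale// mulrCA divff ?gt_eqF// mulr1 (mulrC Delta).
have -> : clip r (N%:R * Delta) = Delta * clip (r / Delta) N%:R.
  by rewrite clip_scale// mulrCA divff ?gt_eqF// mulr1 (mulrC Delta).
rewrite E -!mulrBr normrM (gtr0_norm D0) mulrC ler_pM2r// ler_norml.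
rewrite /clip in h9 h10 *; lra.
Qed.

Lemma grid_count_le_length N (Delta g r : R) : 0 < Delta -> 0 <= g ->
  Delta * grid_count N Delta g r <= g + 2 * Delta.
Proof.
move=> D0 g0; have := grid_count_clip N r D0 g0; rewrite ler_norml => /andP[_ h].
have /andP[_] : 0 <= clip (r + g) (N%:R * Delta) - clip r (N%:R * Delta) <= r + g - r.
  by apply: clip_le; lra.
by move: h; lra.
Qed.

Lemma grid_count_eq0 N (Delta g r : R) : 0 < Delta -> r < - g \/ N%:R * Delta < r ->
  grid_count N Delta g r = 0.
Proof.
move=> D0 H; apply: big1 => k _; rewrite ifF//; apply/negbTE/negP => /andP[h1 h2].
have k0 : 0 <= k%:R * Delta by rewrite mulr_ge0// ltW.
have kN : k%:R * Delta <= N%:R * Delta by rewrite ler_pM2r// ler_nat ltnW.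
by case: H; lra.
Qed.

Lemma grid_count_indicator N (Delta g T v : R) : 0 < T ->
  grid_count N Delta g (T * v) =
  \sum_(k < N) \1_(`[(k%:R * Delta - g) / T, k%:R * Delta / T]%classic) v.
Proof.
move=> T0; apply: eq_bigr => k _; rewrite indicE.
have -> : (v \in `[(k%:R * Delta - g) / T, k%:R * Delta / T]%classic) =
    ((T * v <= k%:R * Delta) && (k%:R * Delta <= T * v + g)).
  rewrite mem_setE in_itv/= ler_pdivrMr// ler_pdivlMr// (mulrC v) andbC.
  by congr (_ && _); rewrite lerBlDr.
by case: ifP.
Qed.

Lemma grid_count_integral N (Delta g T : R) : 0 < T -> 0 <= g ->
  leb.-integrable setT (EFin \o (fun v => grid_count N Delta g (T * v))) /\
  \int[leb]_v grid_count N Delta g (T * v) = N%:R * (g / T).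
Proof.
move=> T0 g0.
pose J (k : nat) := `[(k%:R * Delta - g) / T, k%:R * Delta / T]%classic.
have IJ k : leb.-integrable setT (EFin \o (\1_(J k) : R -> R)) /\ \int[leb]_v \1_(J k) v = g / T.
  have le1 : (k%:R * Delta - g) / T <= k%:R * Delta / T.
    by rewrite ler_pM2r ?invr_gt0//; lra.
  have H : leb (J k) = (g / T)%:E.
    rewrite /J lebesgue_measure_itv/= lte_fin; case: ltP => h.
      by congr EFin; field; rewrite gt_eqF.
    congr EFin; apply/eqP; rewrite eq_sym; apply/eqP.
    by have := le_anti (_ : _ <= _ <= _); move=> _; have e : k%:R * Delta / T = (k%:R * Delta - g) / T
      by [apply/le_anti; rewrite h le1]; rewrite mulrBl in e; lra.
  have mJ : measurable (J k : set (measurableTypeR R)) by exact: measurable_itv.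
  have Hf : (leb (J k) < +oo)%E by rewrite H ltry.
  have [I1 I2] := @Rintegral_indicator R _ _ leb (J k) mJ Hf.
  by split; [exact: I1|exact: etrans I2 (congr1 fine H)].
have [IS ES] := @Rintegral_sum R _ _ leb setT _ (index_enum 'I_N) (fun (k : 'I_N) v => \1_(J k) v)
  measurableT (fun k => (IJ k).1).
have EE : (fun v => \sum_(k < N) \1_(J k) v) = (fun v => grid_count N Delta g (T * v)).
  by apply/funext => v; rewrite grid_count_indicator.
rewrite EE in IS ES; split; first exact: IS.
rewrite [LHS]ES (eq_bigr (fun=> g / T)); last by move=> k _; exact: (IJ k).2.
by rewrite sumr_const card_ord mulr_natl.
Qed.

Section Sections.
Variables (k0 : nat) (u : 'I_k0 -> R) (N : 'I_k0 -> nat) (Delta g T s : R).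
Hypotheses (D0 : 0 < Delta) (g0 : 0 <= g) (T0 : 0 < T) (s0 : 0 < s).

(** The normalised weighted count along a slice of the plane on which all trawl sets are intervals
    of length [g]; [v] is time divided by [T] and [s] the normalisation. *)
Definition section_sum (v : R) : R :=
  \sum_i u i * (Delta * grid_count (N i) Delta g (T * v) / s).

Lemma section_sum_le v : `|section_sum v| <= (\sum_i `|u i|) * ((g + 2 * Delta) / s).
Proof.
rewrite /section_sum mulr_suml; apply: le_trans (ler_norm_sum _ _ _) _; apply: ler_sum => i _.
rewrite normrM ler_wpM2l// ger0_norm ?mulr_ge0 ?invr_ge0 ?grid_count_ge0 ?(ltW D0) ?(ltW s0)//.
by rewrite ler_pM2r ?invr_gt0//; exact: grid_count_le_length.
Qed.

Lemma section_sum_measurable : measurable_fun [set: R] section_sum.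
Proof.
apply: measurable_sum => i; apply: measurable_funM => //; apply: measurable_funM => //.
apply: measurable_funM => //.
have [+ _] := grid_count_integral (N i) Delta T0 g0.
by move=> /(measurable_int _)/measurable_EFinP.
Qed.

(** Of the [p] powers of the count, [p - 1] are bounded by its supremum and one is integrated
    exactly, each grid point contributing an interval of length [g / T]. *)
Lemma section_integral_bound (f : R -> R) (K p : R) : continuous f -> 0 <= K -> 1 <= p ->
  (forall x, `|f x| <= K * `|x| `^ p) ->
  leb.-integrable setT (EFin \o (fun v => f (section_sum v))) /\
  `|\int[leb]_v f (section_sum v)| <=
    K * ((\sum_i `|u i|) * ((g + 2 * Delta) / s)) `^ (p - 1) *
    \sum_i `|u i| * ((N i)%:R * Delta / T * (g / s)).
Proof.
move=> cf K0 p1 fK; set B := (\sum_i _) * _.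
have B0 : 0 <= B by apply: le_trans (section_sum_le 0).
pose F v := \sum_i (`|u i| * (Delta / s)) * grid_count (N i) Delta g (T * v).
have [IF EF] := @Rintegral_sum R _ _ leb setT _ (index_enum 'I_k0)
  (fun i v => (`|u i| * (Delta / s)) * grid_count (N i) Delta g (T * v)) measurableT
  (fun i => integrableZl_real _ measurableT (grid_count_integral (N i) Delta T0 g0).1).
have IKF : leb.-integrable setT (EFin \o (fun v => K * B `^ (p - 1) * F v)) by exact: integrableZl_real.
have xF v : `|section_sum v| <= F v.
  apply: le_trans (ler_norm_sum _ _ _) _; apply: ler_sum => i _.
  rewrite normrM [X in _ * X]ger0_norm; last first.
    by rewrite !mulr_ge0 ?invr_ge0 ?grid_count_ge0 ?(ltW D0) ?(ltW s0).
  by rewrite le_eqVlt; apply/orP; left; apply/eqP; ring.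
have bound v : `|f (section_sum v)| <= K * B `^ (p - 1) * F v.
  apply: le_trans (fK _) _; rewrite -mulrA ler_wpM2l//.
  have [x0|x0] := eqVneq (section_sum v) 0.
    rewrite x0 normr0 powR0 ?gt_eqF//; last by lra.
    by rewrite mulr_ge0 ?powR_ge0// (le_trans _ (xF v)).
  have -> : `|section_sum v| `^ p = `|section_sum v| `^ (p - 1) * `|section_sum v|.
    by rewrite -{3}(powRr1 (normr_ge0 (section_sum v))) -powRD ?subrK// normr_eq0 x0 implybT.
  apply: ler_pM => //.
  by apply: ge0_ler_powR; rewrite ?nnegrE ?subr_ge0//; exact: section_sum_le.
have mf : measurable_fun [set: R] (fun v => f (section_sum v)).
  exact: (measurableT_comp (continuous_measurable_fun cf) section_sum_measurable).
have If : leb.-integrable setT (EFin \o (fun v => f (section_sum v))).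
  exact: (@le_integrable_real R _ _ leb setT (fun v => f (section_sum v)) _ measurableT mf IKF (fun v _ => bound v)).
split => //; apply: le_trans (le_normr_Rintegral _ If) _ => //.
apply: le_trans (_ : \int[leb]_v (K * B `^ (p - 1) * F v) <= _).
  by apply: le_Rintegral => //; exact: integrable_norm.
rewrite RintegralZl// ler_wpM2l ?mulr_ge0 ?powR_ge0// [X in X <= _]EF.
rewrite le_eqVlt; apply/orP; left; apply/eqP; apply: eq_bigr => i _.
rewrite RintegralZl//; last exact: (grid_count_integral (N i) Delta T0 g0).1.
by rewrite (grid_count_integral (N i) Delta T0 g0).2; field; rewrite !gt_eqF.
Qed.

End Sections.
End Counting.

(** * Tail of the trawl function and its generalised inverse *)

Section TrawlTail.
Context {R : realType}.
Local Notation leb := (@lebesgue_measure R).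

(** Beyond [s] the derivative is squeezed between two multiples of [y^(- kappa)], whose tail
    integrals are explicit. *)
Lemma trawl_tail (a a' : R -> R) (kappa c : R) : 1 < kappa ->
  (forall y : R, 0 <= y -> 0 < a' y) -> {within `[0, +oo[, continuous a'} ->
  y `^ kappa * a' y @[y --> +oo] --> c ->
  (forall s : R, 0 <= s -> (a s)%:E = (\int[leb]_(y in `[s, +oo[) (a' y)%:E)%E) ->
  a s * s `^ (kappa - 1) @[s --> +oo] --> c / (kappa - 1).
Proof.
move=> k1 a0 ca lim aE; have k0 : 0 < kappa - 1 by lra.
have mD (s : R) : measurable (`[s, +oo[%classic : set R) by exact: measurable_itv.
have ma (s : R) : 0 <= s -> measurable_fun (`[s, +oo[%classic : set R) a'.
  move=> s0; apply: measurable_funS (subspace_continuous_measurable_fun _ ca) => //.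
  by move=> y /=; rewrite !in_itv/= !andbT; exact: le_trans.
have bound (s b1 b2 : R) : 0 < s -> 0 <= b1 -> 0 <= b2 ->
   (forall y, s <= y -> b1 <= y `^ kappa * a' y <= b2) ->
   b1 / (kappa - 1) <= a s * s `^ (kappa - 1) <= b2 / (kappa - 1).
  move=> s0 b10 b20 H.
  have pw (y : R) : s <= y -> b1 * y `^ (- kappa) <= a' y <= b2 * y `^ (- kappa).
    move=> sy; have y0 : 0 < y by exact: lt_le_trans sy.
    have /andP[h1 h2] := H y sy; rewrite powRN.
    by rewrite ler_pdivrMr ?powR_gt0// ler_pdivlMr ?powR_gt0// (mulrC (a' y)) h1 h2.
  have I (b : R) : 0 <= b -> (\int[leb]_(y in `[s, +oo[) (b * y `^ (- kappa))%:E =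
      (b * (s `^ (- kappa + 1) / - (- kappa + 1)))%:E)%E.
    move=> b0; under eq_integral do rewrite EFinM.
    rewrite ge0_integralZl//; first by rewrite integral_powR_tail//; lra.
    - by apply/measurable_EFinP; apply: measurable_funTS.
    - by move=> y _; rewrite lee_fin powR_ge0.
  have e1 : - (- kappa + 1) = kappa - 1 by ring.
  have e2 : s `^ (- kappa + 1) = (s `^ (kappa - 1))^-1.
    by rewrite -powRN; congr (_ `^ _); ring.
  have sp : 0 < s `^ (kappa - 1) by exact: powR_gt0.
  have L1 : b1 * (s `^ (- kappa + 1) / - (- kappa + 1)) <= a s.
    rewrite -lee_fin -I// aE ?(ltW s0)//; apply: ge0_le_integral => //.
    - by move=> y _; rewrite lee_fin mulr_ge0// powR_ge0.
    - by apply/measurable_EFinP; apply: measurable_funM => //; apply: measurable_funTS.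
    - by apply/measurable_EFinP; apply: ma; exact: ltW.
    - by move=> y; rewrite /= in_itv/= andbT lee_fin => /pw/andP[].
  have L2 : a s <= b2 * (s `^ (- kappa + 1) / - (- kappa + 1)).
    rewrite -lee_fin -I// aE ?(ltW s0)//; apply: ge0_le_integral => //.
    - move=> y; rewrite /= in_itv/= andbT => sy; rewrite lee_fin ltW// a0//.
      by rewrite (le_trans _ sy)// ltW.
    - by apply/measurable_EFinP; apply: ma; exact: ltW.
    - by apply/measurable_EFinP; apply: measurable_funM => //; apply: measurable_funTS.
    - by move=> y; rewrite /= in_itv/= andbT lee_fin => /pw/andP[].
  rewrite -ler_pdivrMr// -[X in _ && X]ler_pdivlMr//.
  move: L1 L2; rewrite e1 e2 => L1 L2; apply/andP; split.
    by apply: le_trans L1; rewrite le_eqVlt; apply/orP; left; apply/eqP; ring.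
  by apply: le_trans L2 _; rewrite le_eqVlt; apply/orP; left; apply/eqP; ring.
have c0 : 0 <= c.
  rewrite leNgt; apply/negP => cn; have cn' : 0 < - c by rewrite oppr_gt0.
  have /cvgrPdist_lt/(_ _ cn') [M [_ HM]] := lim.
  have M1 : M < Num.max M 0 + 1 by rewrite ltr_pwDr// le_max lexx.
  have y0 : 0 <= Num.max M 0 + 1 by rewrite addr_ge0// le_max lexx orbT.
  have := HM _ M1; rewrite ltr_distl => /andP[+ _].
  have : 0 <= (Num.max M 0 + 1) `^ kappa * a' (Num.max M 0 + 1) by rewrite mulr_ge0 ?powR_ge0// ltW// a0.
  move: (_ * _) => F; lra.
apply/cvgrPdist_le => eps e0.
have e1 : 0 < eps * (kappa - 1) by rewrite mulr_gt0.
have /cvgrPdist_le/(_ _ e1) [M [_ HM]] := lim.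
near=> s; have sM : M < s by near: s; apply: nbhs_pinfty_gt; exact: num_real.
have s0 : 0 < s by near: s; apply: nbhs_pinfty_gt; exact: num_real.
(* The lower multiple is cut at 0 because integrals of nonnegative functions are compared. *)
have b0 : 0 <= Num.max 0 (c - eps * (kappa - 1)) by rewrite le_max lexx.
have b2 : 0 <= c + eps * (kappa - 1) by rewrite addr_ge0// ltW.
have /andP[h1 h2] : Num.max 0 (c - eps * (kappa - 1)) / (kappa - 1) <= a s * s `^ (kappa - 1) <=
    (c + eps * (kappa - 1)) / (kappa - 1).
  apply: bound => // y sy; have := HM y (lt_le_trans sM sy); rewrite ler_distl => /andP[g1 g2].
  have y0 : 0 <= y by rewrite (le_trans _ sy)// ltW.
  apply/andP; split; last by rewrite -lerBlDr.
  by rewrite ge_max lerBlDr g2 mulr_ge0 ?powR_ge0// ltW// a0.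
have h3 : (c - eps * (kappa - 1)) / (kappa - 1) <= a s * s `^ (kappa - 1).
  by apply: le_trans h1; rewrite ler_pM2r ?invr_gt0// le_max lexx orbT.
rewrite distrC ler_distl; apply/andP; split.
  apply: le_trans h3.
  by rewrite le_eqVlt; apply/orP; left; apply/eqP; field; rewrite gt_eqF.
apply: le_trans h2 _.
by rewrite le_eqVlt; apply/orP; left; apply/eqP; field; rewrite gt_eqF.
Unshelve. all: by end_near. Qed.

End TrawlTail.

Section TrawlInverse.
Context {R : realType}.
Local Notation leb := (@lebesgue_measure R).
Variables (a : R -> R) (al ell : R).
Hypotheses (ha : trawl_function a) (al1 : 1 < al) (ell0 : 0 < ell).
Hypothesis tail : a s * s `^ al @[s --> +oo] --> ell.

Definition trawl_inverse (y : R) : R := sup [set x : R | 0 <= x /\ y <= a x].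
Local Notation g := trawl_inverse.

(** The asymptotics handle large [s] and monotonicity the rest; [1 + s] makes one bound serve on the
    whole half-line. *)
Lemma trawl_bound : exists2 C : R, 0 < C & forall s : R, 0 <= s -> a s * (1 + s) `^ al <= C.
Proof.
have al1' := al1; have /cvgrPdist_le/(_ 1 ltr01) [M [_ HM]] := tail.
pose S : R := Num.max 1 M; have S1 : 1 <= S by rewrite le_max lexx.
have S0 : 0 < S by lra.
have a0 := trawl_ge0 ha (lexx 0).
exists (a 0 * (1 + S) `^ al + 2 `^ al * (ell + 1) + 1).
  by rewrite ltr_wpDl// addr_ge0// mulr_ge0 ?powR_ge0// addr_ge0 ?ltW.
move=> s s0; have [sS|sS] := leP s S.
  apply: le_trans (_ : a 0 * (1 + S) `^ al <= _).
    apply: ler_pM; rewrite ?powR_ge0 ?(trawl_ge0 ha)//; first exact: (trawl_nonincreasing ha).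
    by apply: ge0_ler_powR; rewrite ?nnegrE; lra.
  by rewrite -addrA lerDl addr_ge0// mulr_ge0 ?powR_ge0// addr_ge0 ?ltW.
have sM : M < s by apply: le_lt_trans sS; rewrite le_max lexx orbT.
have := HM s sM; rewrite ler_distl => /andP[+ _].
rewrite lerBlDr => h.
apply: le_trans (_ : 2 `^ al * (ell + 1) <= _); last first.
  by rewrite addrAC lerDr addr_ge0// mulr_ge0// powR_ge0.
apply: le_trans (_ : a s * (2 * s) `^ al <= _).
  rewrite ler_wpM2l ?(trawl_ge0 ha)//; apply: ge0_ler_powR; rewrite ?nnegrE; lra.
by rewrite powRM// mulrCA ler_wpM2l// powR_ge0.
Qed.

Lemma trawl_inverse_le (y : R) : 0 < y -> exists2 B : R, 0 < B & forall x : R, 0 <= x -> y <= a x -> x <= B.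
Proof.
move=> y0; have al1' := al1; have [C C0 HC] := trawl_bound.
exists (C / y + 1) => [|x x0 yx]; first by rewrite addr_gt0// divr_gt0.
rewrite leNgt; apply/negP => h.
have x1 : 1 + x <= (1 + x) `^ al.
  by clear h; rewrite -[leLHS](powRr1 (_ : 0 <= 1 + x)) ?ler_powR//; lra.
have : y * (1 + x) <= C.
  by apply: le_trans (HC x x0); apply: ler_pM; lra.
rewrite mulrC -ler_pdivlMr//; lra.
Qed.

(** Continuity of [a] makes the supremum attained, which gives an exact equivalence; all that
    follows uses the inverse through it. *)
Lemma trawl_inverseP (y x : R) : 0 < y <= a 0 -> 0 <= x -> (y <= a x) = (x <= g y).
Proof.
move=> /andP[y0 ya] x0; have [B B0 HB] := trawl_inverse_le y0.
set E := [set x : R | 0 <= x /\ y <= a x].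
have hs : has_sup E by split; [exists 0|exists B => z [z0 yz]; exact: HB].
apply/idP/idP => [yx|xg]; first by apply: ub_le_sup => //; case: hs.
rewrite leNgt; apply/negP => axy.
have g0 : 0 <= g y by apply: ub_le_sup => //; case: hs.
have [xg'|xg'] := ltP x (g y).
  have e0 : 0 < g y - x by rewrite subr_gt0.
  have [z [z0 yz] hz] := sup_adherent e0 hs.
  have xz : x <= z by apply: ltW; move: hz; rewrite -/(g y) opprB addrCA subrr addr0.
  by have := trawl_nonincreasing ha x0 xz; rewrite leNgt (lt_le_trans axy).
(* Only the endpoint is left: by continuity [a] stays below [y] near it, while the supremum has
   points of the set arbitrarily close. *)
have xE : x = g y by apply/le_anti; rewrite xg.
have [x00|x00] := eqVneq x 0; first by move: axy; rewrite x00 ltNge ya.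
have xp : 0 < x by rewrite lt_neqAle eq_sym x00.
have xD : `[0, +oo[%classic x by rewrite /= in_itv/= x0.
have /subspace_continuousP/(_ x xD) cx := trawl_continuous ha.
have : \forall z \near within `[0, +oo[ (nbhs x), a z < y.
  have e0 : 0 < y - a x by rewrite subr_gt0.
  have /cvgrPdist_lt/(_ _ e0) := cx; apply: filterS => z.
  by rewrite ltr_distlC => /andP[_]; rewrite addrCA subrr addr0.
rewrite /within/= => -[e /= e0 He].
pose e' := Num.min e x; have e'0 : 0 < e' by rewrite lt_min e0.
have [z [z0 yz] hz] := sup_adherent e'0 hs.
have zg : z <= g y by apply: ub_le_sup => //; case: hs.
have : a z < y.
  apply: He => /=; last by rewrite in_itv/= z0.
  rewrite xE ger0_norm ?subr_ge0//.
  have : e' <= e by rewrite ge_min lexx.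
  by move: hz; rewrite -/(g y); lra.
by rewrite ltNge yz.
Qed.

Lemma trawl_inverse_ge0 (y : R) : 0 < y <= a 0 -> 0 <= g y.
Proof. by move=> ya; rewrite -trawl_inverseP//; case/andP: ya. Qed.

(** The summand 1 on the left will absorb the grid error [2 Delta] at heights where the inverse
    itself is small. *)
Lemma trawl_inverse_bound : exists2 C : R, 0 < C &
  forall y : R, 0 < y <= a 0 -> 1 + g y <= C * y `^ (- al^-1).
Proof.
have al1' := al1; have al0 : 0 < al by lra.
have [C C0 HC] := trawl_bound.
exists (C `^ al^-1) => [|y ya]; first exact: powR_gt0.
have g0 := trawl_inverse_ge0 ya; have /andP[y0 _] := ya.
have yg : y <= a (g y) by rewrite trawl_inverseP.
have g1 : 0 <= 1 + g y by rewrite addr_ge0.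
have h : (1 + g y) `^ al <= C / y.
  rewrite ler_pdivlMr// mulrC; apply: le_trans (HC _ g0).
  by rewrite ler_wpM2r// powR_ge0.
have e : 1 + g y = ((1 + g y) `^ al) `^ al^-1 by rewrite -powRrM divff ?lt0r_neq0// powRr1.
have Cy : 0 <= C / y by rewrite divr_ge0 ?(ltW C0) ?(ltW y0).
rewrite e; apply: le_trans (_ : (C / y) `^ al^-1 <= _).
  by apply: ge0_ler_powR; rewrite ?nnegrE ?powR_ge0 ?invr_ge0 ?(ltW al0).
rewrite powRM ?(ltW C0) ?invr_ge0 ?(ltW y0)// powRN.
by rewrite -[y^-1]powR_inv1 ?(ltW y0)// -powRrM mulN1r powRN.
Qed.

(** Since [ell / x^al] is strictly decreasing, [y n] eventually separates the values of [a] at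
    [x1 s n] and [x2 s n] on both sides of [phi s n]; [trawl_inverseP] turns this into bounds on the
    inverse. *)
Lemma trawl_inverse_cvg (y s : nat -> R) (phi : R) : 0 < phi -> (forall n, 0 < y n) ->
  s n @[n --> \oo] --> +oo -> y n * s n `^ al @[n --> \oo] --> ell / phi `^ al ->
  g (y n) / s n @[n --> \oo] --> phi.
Proof.
have al1' := al1; have al0 : 0 < al by lra.
move=> phi0 y0 soo ylim.
have key (x : R) : 0 < x -> a (x * s n) * s n `^ al @[n --> \oo] --> ell / x `^ al.
  move=> x0.
  have xs : x * s n @[n --> \oo] --> +oo.
    exact: (cvg_comp s (fun r => x * r) soo (gt0_cvgMry x0 cvg_id)).
  have := cvg_comp _ _ xs tail => /= H.
  have H2 : (a (x * s n) * (x * s n) `^ al) / x `^ al @[n --> \oo] --> ell / x `^ al.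
    by apply: cvgMl H.
  apply: cvg_trans H2; apply: near_eq_cvg; near=> n.
  have sn : 0 <= s n by near: n; apply: (cvgryPge s).1 => //.
  rewrite powRM// ?(ltW x0)//; field.
  by rewrite gt_eqF// powR_gt0.
have pw (x1 x2 : R) : 0 < x1 -> x1 < x2 -> ell / x2 `^ al < ell / x1 `^ al.
  move=> x10 x12; have x20 : 0 < x2 by exact: lt_trans x12.
  rewrite ltr_pM2l// ltf_pV2 ?posrE ?powR_gt0//.
  by apply: gt0_ltr_powR; rewrite ?nnegrE ?ltW.
apply/cvgrPdist_le => eps e0.
(* [phi / 2] keeps the lower comparison point positive when [eps] is large. *)
pose x1 := Num.max (phi - eps) (phi / 2); pose x2 := phi + eps.
have x1p : x1 < phi by rewrite gt_max; apply/andP; split; lra.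
have x10 : 0 < x1 by rewrite lt_max divr_gt0 ?orbT.
have x2p : phi < x2 by rewrite ltrDl.
have x20 : 0 < x2 by exact: lt_trans x2p.
have sep (u v : nat -> R) (p q : R) : u n @[n --> \oo] --> p -> v n @[n --> \oo] --> q -> p < q ->
    \forall n \near \oo, u n < v n.
  move=> up vq pq; have e1 : 0 < (q - p) / 2 by rewrite divr_gt0// subr_gt0.
  have /cvgrPdist_lt/(_ _ e1) H1 := up; have /cvgrPdist_lt/(_ _ e1) H2 := vq.
  near=> n; have : `|p - u n| < (q - p) / 2 by near: n; exact: H1.
  have : `|q - v n| < (q - p) / 2 by near: n; exact: H2.
  by rewrite !ltr_distl => /andP[? ?] /andP[? ?]; lra.
have s1 := sep _ _ _ _ ylim (key _ x10) (pw _ _ x10 x1p).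
have s2 := sep _ _ _ _ (key _ x20) ylim (pw _ _ phi0 x2p).
near=> n.
have sn : 0 < s n by near: n; apply: (cvgryPgt s).1 => //.
have spos : 0 < s n `^ al by exact: powR_gt0.
have h1 : y n <= a (x1 * s n).
  by rewrite ltW// -(ltr_pM2r spos); near: n; exact: s1.
have h2 : a (x2 * s n) < y n.
  by rewrite -(ltr_pM2r spos); near: n; exact: s2.
have p1 : 0 <= x1 * s n by rewrite mulr_ge0 ?ltW.
have p2 : 0 <= x2 * s n by rewrite mulr_ge0 ?ltW.
have ya : 0 < y n <= a 0.
  by rewrite y0/= (le_trans h1)// (trawl_nonincreasing ha).
move: h1 h2; rewrite trawl_inverseP// ltNge trawl_inverseP// -ltNge => h1 h2.
have g1 : x1 <= g (y n) / s n by rewrite ler_pdivlMr.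
have g2 : g (y n) / s n < x2 by rewrite ltr_pdivrMr.
have : phi - eps <= x1 by rewrite le_max lexx.
by rewrite ler_distl /x2 in g2 *; move=> ?; apply/andP; split; lra.
Unshelve. all: by end_near. Qed.

Lemma trawl_set_atE (t r y : R) :
  trawl_set_at a t (r, y) <-> [/\ r <= t, 0 <= y & y <= a (t - r)].
Proof.
split=> [[[r' y'] [/= h1 /andP[h2 h3]] [<- <-]]|[h1 h2 h3]].
  by split; [lra|by []|rewrite (_ : t - _ = - r')//; ring].
exists (r - t, y); last by rewrite /= subrK.
by split=> /=; [lra|rewrite h2 opprB].
Qed.

Lemma trawl_sectionP (t r y : R) : 0 < y <= a 0 ->
  trawl_set_at a t (r, y) <-> r <= t <= r + g y.
Proof.
move=> ya; have /andP[y0 _] := ya; split=> [/trawl_set_atE[h1 _ h3]|/andP[h1 h2]].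
  by move: h3; rewrite h1/= trawl_inverseP// ?subr_ge0// lerBlDl.
apply/trawl_set_atE; split=> //; first exact: ltW.
by rewrite trawl_inverseP// ?subr_ge0// lerBlDl.
Qed.

Lemma trawl_section0 (t r y : R) : y < 0 \/ a 0 < y -> ~ trawl_set_at a t (r, y).
Proof.
move=> H /trawl_set_atE[h1 h2 h3].
have := trawl_nonincreasing ha (lexx 0) (_ : 0 <= t - r); rewrite subr_ge0 => /(_ h1).
by case: H; lra.
Qed.

Lemma trawl_set_at_measurable t : measurable (trawl_set_at a t).
Proof.
pose b (x : R) := a (Num.max 0 x).
have mb : measurable_fun [set: R] b.
  have mpos : measurable (`[0, +oo[%classic : set R) by exact: measurable_itv.
  have ma : measurable_fun (`[0, +oo[%classic : set R) a.
    exact: (subspace_continuous_measurable_fun mpos (trawl_continuous ha)).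
  apply: (measurable_comp mpos _ ma).
    by move=> x [z _ <-] /=; rewrite in_itv/= andbT le_max lexx.
  by apply: measurable_maxr.
have E : trawl_set_at a t = [set p | p.1 <= t] `&` [set p | 0 <= p.2] `&` [set p | p.2 <= b (t - p.1)].
  apply/seteqP; split => [[r y] /trawl_set_atE[h1 h2 h3]|[r y] [[/= h1 h2] h3]].
    by split; [split|rewrite /= /b (max_r (_ : 0 <= t - r)) ?subr_ge0].
  apply/trawl_set_atE; split=> //.
  by move: h3; rewrite /b (max_r (_ : 0 <= t - r)) ?subr_ge0.
rewrite E; apply: measurableI; first apply: measurableI.
- rewrite -[X in measurable X]setTI; apply: measurable_fun_ler => //.
- rewrite -[X in measurable X]setTI; apply: measurable_fun_ler => //.
- rewrite -[X in measurable X]setTI; apply: measurable_fun_ler => //.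
  by apply: (measurableT_comp mb); apply: measurable_funB.
Qed.

(** The area is the integral of the slice lengths over the heights up to [a 0], of order
    [y^(- 1 / al)] near 0, and integrable there because [al > 1]. *)
Lemma trawl_set_at_borel t : fin_borel (trawl_set_at a t).
Proof.
have mA := trawl_set_at_measurable t; split => //.
have al1' := al1; have al0 : 0 < al by lra.
have [C C0 HC] := trawl_inverse_bound.
have a0 := trawl_ge0 ha (lexx 0).
set A := trawl_set_at a t in mA *.
pose w (y : R) := if y <= 1 then y `^ (- al^-1) else y `^ (- 2).
have w0 y : 0 <= w y by rewrite /w; case: ifP => _; exact: powR_ge0.
have mw : measurable_fun [set: R] w.
  by apply: measurable_fun_ifT => //; apply: measurable_fun_ler.
have Iw : leb.-integrable `]0, +oo[ (EFin \o w).
  by apply: integrable_powR_split; [rewrite invf_lt1|lra].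
(* Heights between 1 and [a 0] have to fit under [y^(-2)], which costs at most the factor
   [a 0 ^+ 2]. *)
pose K := C * (1 + a 0 ^+ 2).
have K0 : 0 <= K by rewrite mulr_ge0 ?(ltW C0)// addr_ge0// sqr_ge0.
pose G y := (\int[leb]_r (\1_A (r, y))%:E)%E.
have mI : measurable_fun setT (EFin \o (\1_A : R * R -> R)) by apply/measurable_EFinP.
have I0 p : (0 <= (EFin \o (\1_A : R * R -> R)) p)%E by rewrite lee_fin indicE.
have -> : Leb2 A = (\int[leb]_y G y)%E.
  rewrite -(@fubini_tonelli2 _ _ _ _ R leb leb (EFin \o \1_A) mI I0).
  by rewrite integral_indic// setIT.
have mG : measurable_fun setT G by exact: (measurable_fun_fubini_tonelli_G (m1 := leb) _ mI I0).
have G0 y : (0 <= G y)%E by apply: integral_ge0 => r _; rewrite lee_fin indicE.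
have KW y : 0 <= K * w y * \1_(`]0, +oo[%classic) y.
  by apply: mulr_ge0; [exact: mulr_ge0|rewrite indicE].
(* Height 0 is excluded, as the slice there is a half-line; a single height is negligible. *)
have GK y : y != 0 -> (G y <= (K * w y * \1_(`]0, +oo[%classic) y)%:E)%E.
  move=> yn0.
  have [y0|y0] := ltP y 0.
    rewrite /G integral0_eq ?lee_fin// => r _.
    by rewrite indicE memNset//; apply: trawl_section0; left.
  have yp : 0 < y by rewrite lt_neqAle eq_sym yn0.
  have [ya|ya] := ltP (a 0) y.
    rewrite /G integral0_eq ?lee_fin// => r _.
    by rewrite indicE memNset//; apply: trawl_section0; right.
  have y1 : 0 < y <= a 0 by rewrite yp.
  have g0 := trawl_inverse_ge0 y1.
  have -> : G y = (g y)%:E.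
    have -> : G y = (\int[leb]_r (\1_(`[t - g y, t]%classic) r)%:E)%E.
      apply: eq_integral => r _; congr EFin; rewrite !indicE; congr (_%:R); congr nat_of_bool.
      apply/idP/idP; rewrite !inE/= in_itv/=.
        by move=> /(trawl_sectionP _ _ y1) /andP[-> h]; rewrite andbT lerBlDr.
      by move=> /andP[h1 h2]; apply/trawl_sectionP => //; rewrite h2 -lerBlDr.
    rewrite integral_indic// setIT.
    have H : leb `[t - g y, t]%classic = (g y)%:E.
      rewrite lebesgue_measure_itv/= lte_fin; case: ltP => h; first by congr EFin; ring.
      by congr EFin; lra.
    exact: H.
  rewrite lee_fin indicE mem_set/=; last by rewrite in_itv/= yp.
  rewrite mulr1; have h1 := HC y y1.
  apply: le_trans (_ : C * y `^ (- al^-1) <= _); first by lra.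
  rewrite /K -mulrA ler_wpM2l ?(ltW C0)// /w; case: (leP y 1) => y11.
    by rewrite ler_peMl ?powR_ge0// lerDl sqr_ge0.
  apply: le_trans (_ : 1 <= _).
    by rewrite -[leRHS](powRr0 y) ler_powR ?(ltW y11)// oppr_le0 invr_ge0 ltW.
  rewrite powRN (powR_mulrn 2 (ltW yp)) ler_pdivlMr ?exprn_gt0// mul1r.
  have : y ^+ 2 <= a 0 ^+ 2 by rewrite ler_sqr ?nnegrE// ltW.
  by lra.
have mH : measurable_fun setT (fun y => (K * w y * \1_(`]0, +oo[%classic) y)%:E).
  by apply/measurable_EFinP; apply: measurable_funM => //; apply: measurable_funM.
apply: (@le_lt_trans _ _ (\int[leb]_y (K * w y * \1_(`]0, +oo[%classic) y)%:E)%E).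
  apply: ae_ge0_le_integral => //.
  - by move=> y _; rewrite lee_fin; exact: KW.
  - exists [set 0]; split; [exact: measurable_set1|exact: lebesgue_measure_set1|].
    move=> y /= H; apply: contrapT => yn; apply: H => _; apply: GK; exact/eqP.
rewrite [ltLHS](_ : _ = (\int[leb]_(y in `]0%R, +oo[) (K * w y)%:E)%E); last first.
  rewrite [RHS]integral_mkcond; apply: eq_integral => y _; rewrite patchE indicE.
  by case: ifP => _; rewrite ?mulr1// mulr0.
have /integrableP[_] : leb.-integrable `]0, +oo[ (EFin \o (fun y => K * w y)) by exact: integrableZl_real.
apply: le_lt_trans; apply: ge0_le_integral => //.
- by move=> y _; rewrite lee_fin mulr_ge0.
- by apply/measurable_EFinP; apply: measurable_funTS; exact: measurable_funM.
- by apply: measurableT_comp => //; apply/measurable_EFinP; apply: measurable_funTS; exact: measurable_funM.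
- by move=> y _ /=; rewrite lee_fin ler_norm.
Qed.

End TrawlInverse.

Lemma integrable_fubini_G d1 d2 (T1 : measurableType d1) (T2 : measurableType d2) (R : realType)
    (m1 : {sigma_finite_measure set T1 -> \bar R}) (m2 : {sigma_finite_measure set T2 -> \bar R})
    (f : T1 * T2 -> \bar R) :
  (m1 \x m2)%E.-integrable setT f -> m2.-integrable setT (fubini_G m1 f).
Proof.
move=> If; have mf := measurable_int _ If.
have mG := measurable_fubini_G If.
apply/integrableP; split; first exact: mG.
have /(integrable21ltyP m1 m2 mf) := If; apply: le_lt_trans.
apply: ge0_le_integral => //.
- by apply: measurableT_comp.
- have ma : measurable_fun setT (abse \o f) by exact: measurableT_comp.
  by apply: (measurable_fun_fubini_tonelli_G (m1 := m1) _ ma) => z; exact: abse_ge0.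
- move=> y _; apply: le_abse_integral => //.
  exact: measurableT_comp.
Qed.

(** * Slices of the weighted count *)

Section SectionIntegrals.
Context {R : realType}.
Local Notation leb := (@lebesgue_measure R).
Local Notation leb2 := (leb \x leb)%E.
Variables (a : R -> R) (al ell : R).
Hypotheses (ha : trawl_function a) (al1 : 1 < al) (ell0 : 0 < ell).
Hypothesis tail : a s * s `^ al @[s --> +oo] --> ell.
Local Notation g := (trawl_inverse a).
Variables (k0 : nat) (u t : 'I_k0 -> R).

Lemma trawl_at0_gt0 : 0 < a 0.
Proof.
have /cvgrPdist_lt/(_ _ ell0) [M [_ HM]] := tail.
have M1 : M < Num.max M 0 + 1 by rewrite ltr_pwDr// le_max lexx.
have x0 : 0 <= Num.max M 0 + 1 by rewrite addr_ge0// le_max lexx orbT.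
apply: lt_le_trans (trawl_nonincreasing ha (lexx 0) x0).
rewrite lt_neqAle (trawl_ge0 ha)// andbT; apply/eqP => E.
by have := HM _ M1; rewrite /= -E mul0r subr0 gtr0_norm// ltxx.
Qed.

(** The test [y <= a 0] discards heights that no trawl set reaches, where [trawl_inverse] is the
    supremum of an empty set. *)
Definition section_integral (f : R -> R) (N : 'I_k0 -> nat) (Delta T s y : R) : R :=
  if y <= a 0 then \int[leb]_v f (section_sum u N Delta (g y) T s v) else 0.

(** The partial sums at the different times share one grid of [Nmax] points; the factor [(k < N i)]
    restricts the [i]-th of them to its first [N i] points. *)
Lemma weighted_count_section (N : 'I_k0 -> nat) (Nmax : nat) (Delta s r y : R) :
  (forall i, (N i <= Nmax)%N) -> 0 < y ->
  weighted_count (fun k : 'I_Nmax => trawl_set_at a (k%:R * Delta))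
    (fun k => \sum_i u i * (Delta / s) * (k < N i)%N%:R) (r, y) =
  if y <= a 0 then section_sum u N Delta (g y) 1 s r else 0.
Proof.
move=> NN y0; rewrite /weighted_count; case: ifP => ya; last first.
  apply: big1 => k _; rewrite indicE memNset ?mulr0//.
  by apply: (trawl_section0 ha); right; rewrite ltNge ya.
have y1 : 0 < y <= a 0 by rewrite y0.
rewrite (eq_bigr (fun k : 'I_Nmax => \sum_i u i * (Delta / s) * ((k < N i)%N%:R *
    (if (r <= k%:R * Delta) && (k%:R * Delta <= r + g y) then 1 else 0)))); last first.
  move=> k _; rewrite mulr_suml; apply: eq_bigr => i _; rewrite -!mulrA; congr (_ * (_ * _)).
  congr (_ * (_ * _)); rewrite indicE.
  have -> : ((r, y) \in trawl_set_at a (k%:R * Delta)) = (r <= k%:R * Delta <= r + g y).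
    by apply/idP/idP; rewrite inE/= => /(trawl_sectionP ha al1 ell0 tail _ _ y1).
  by case: ifP.
rewrite exchange_big/=; apply: eq_bigr => i _; rewrite -mulr_sumr mul1r.
have -> : u i * (Delta * grid_count (N i) Delta (g y) r / s) = u i * (Delta / s) * grid_count (N i) Delta (g y) r by ring.
congr (_ * _).
rewrite /grid_count -(big_mkord xpredT (fun k => (k < N i)%N%:R * (if (r <= k%:R * Delta) && (k%:R * Delta <= r + g y) then 1 else 0))).
rewrite (@big_cat_nat _ _ _ (N i))//= [X in _ + X]big_nat [X in _ + X]big1 ?addr0; last first.
  by move=> k /andP[nk _]; rewrite ltnNge nk mul0r.
by rewrite big_mkord; apply: eq_bigr => k _; rewrite ltn_ord mul1r.
Qed.

(** Fubini with the height outside, then [r = T v] along each slice and [y = rho eta] across them,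
    whence the factor [T * rho]. *)
Lemma weighted_count_rescale (f : R -> R) (N : 'I_k0 -> nat) (Nmax : nat) (Delta T s rho K p : R) :
  (forall i, (N i <= Nmax)%N) -> 0 < Delta -> 0 < T -> 0 < s -> 0 < rho ->
  continuous f -> f 0 = 0 -> 0 <= K -> 1 <= p -> (forall x, `|f x| <= K * `|x| `^ p) ->
  leb.-integrable `]0, +oo[ (EFin \o (fun eta => section_integral f N Delta T s (rho * eta))) /\
  \int[leb2]_z f (weighted_count (fun k : 'I_Nmax => trawl_set_at a (k%:R * Delta))
    (fun k => \sum_i u i * (Delta / s) * (k < N i)%N%:R) z) =
  T * rho * \int[leb]_(eta in `]0, +oo[) section_integral f N Delta T s (rho * eta).
Proof.
move=> NN D0 T0 s0 rho0 cf f0 K0 p1 fK.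
set A := fun k : 'I_Nmax => _; set th := fun k : 'I_Nmax => _.
have fA k : fin_borel (A k) by exact: (trawl_set_at_borel ha al1 ell0 tail).
have [IF _] := weighted_count_integral th fA f0.
pose F (z : R * R) : \bar R := (f (weighted_count A th z))%:E.
have IG := integrable_fubini_G IF.
have EG := @integral21_prod_meas1 _ _ _ _ R leb leb F IF.
pose H (y : R) := fubini_G leb F y.
have HT (y : R) : 0 < y -> H y = (T * section_integral f N Delta T s y)%:E.
  move=> y0; rewrite /H /fubini_G /F /section_integral.
  have [ya|ya] := leP y (a 0); last first.
    rewrite mulr0 integral0_eq// => r _.
    by rewrite (weighted_count_section _ _ _ NN)// leNgt ya/= f0.
  have g0 : 0 <= g y by apply: (trawl_inverse_ge0 ha al1 ell0 tail); rewrite y0.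
  have [I1 _] := section_integral_bound u N D0 g0 (@ltr01 R) s0 cf K0 p1 fK.
  have -> : (\int[leb]_r (f (weighted_count A th (r, y)))%:E =
     \int[leb]_r (f (section_sum u N Delta (g y) 1 s r))%:E)%E.
    by apply: eq_integral => r _; rewrite (weighted_count_section _ _ _ NN)// ya.
  have := Rintegral_lebesgue_scale T0 measurableT I1.
  rewrite (_ : [set x | [set: _] (T * x)] = setT); last by apply/seteqP.
  have -> : (fun x => f (section_sum u N Delta (g y) 1 s (T * x))) =
     (fun x => f (section_sum u N Delta (g y) T s x)).
    by apply/funext => x; rewrite /section_sum; under eq_bigr do rewrite mul1r.
  move=> ->; rewrite mulrA divff ?gt_eqF// mul1r fineK//.
  exact: integrable_fin_num I1.
have H0 (y : R) : y < 0 -> H y = 0%E.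
  move=> y0; rewrite /H /fubini_G integral0_eq// => r _; rewrite /F.
  rewrite /weighted_count big1 ?f0// => k _; rewrite indicE memNset ?mulr0//.
  by apply: (trawl_section0 ha); left.
have mpos : measurable (`]0, +oo[%classic : set (measurableTypeR R)) by exact: measurable_itv.
have IH : leb.-integrable `]0, +oo[ H by apply: integrableS IG.
have EH : (\int[leb]_y H y = \int[leb]_(y in `]0%R, +oo[) H y)%E.
  rewrite [RHS]integral_mkcond; apply: ae_eq_integral => //.
  - exact: measurable_int IG.
  - by apply/(measurable_restrictT _ mpos); exact: measurable_int IH.
  exists [set 0]; split; [exact: measurable_set1|exact: lebesgue_measure_set1|].
  move=> y /= h; apply: contrapT => yn; apply: h => _; rewrite patchE.
  case: ifPn => //; rewrite notin_setE/= in_itv/= andbT => /negP; rewrite -leNgt => y0.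
  by apply: H0; rewrite lt_neqAle y0 andbT; apply/eqP.
pose S y := section_integral f N Delta T s y.
have IS : leb.-integrable `]0, +oo[ (EFin \o S).
  have IT : leb.-integrable `]0, +oo[ (EFin \o (fun y => T * S y)).
    apply: eq_integrable IH => // y; rewrite inE/= in_itv/= andbT => y0.
    by rewrite HT.
  apply: (eq_integrable_real mpos _ (integrableZl_real T^-1 mpos IT)) => y _.
  by rewrite mulrA mulVf ?gt_eqF// mul1r.
have posE : [set x | `]0, +oo[%classic (rho * x)] = `]0, +oo[%classic.
  by apply/seteqP; split => x /=; rewrite !in_itv/= !andbT pmulr_rgt0.
have I2 := integrable_lebesgue_scale rho0 mpos IS.
have E2 := Rintegral_lebesgue_scale rho0 mpos IS.
rewrite posE in I2 E2; split; first exact: I2.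
rewrite [X in _ * _ * X]E2 mulrA mulfK ?gt_eqF// {1}/Rintegral.
rewrite -[X in fine X]EG EH -RintegralZl//; rewrite /Rintegral; congr fine.
by apply: eq_integral => y; rewrite inE/= in_itv/= andbT => y0; rewrite -/(H y) HT.
Qed.

(** * Dominated convergence of the slice integrals, common to both regimes *)

Section Convergence.
Variables (N : nat -> 'I_k0 -> nat) (Delta T s rho : nat -> R) (D0 L c : R).
Hypotheses (Delta_gt0 : forall n, 0 < Delta n) (Delta_le : forall n, Delta n <= D0).
Hypotheses (T_gt0 : forall n, 0 < T n) (s_gt0 : forall n, 0 < s n) (rho_gt0 : forall n, 0 < rho n).
Hypotheses (NT : forall n i, (N n i)%:R * Delta n <= t i * T n).
Hypotheses (L0 : 0 < L) (Lrho : forall n, L <= rho n * s n `^ al) (sT : forall n, s n <= c * T n).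
Variables (f_ : nat -> R -> R) (K p q : R).
Hypotheses (fc : forall n, continuous (f_ n)) (K0 : 0 <= K) (p1 : 1 <= p) (pal : p < al) (qal : al < q).
Hypotheses (fp : forall n x, `|f_ n x| <= K * `|x| `^ p) (fq : forall n x, `|f_ n x| <= K * `|x| `^ q).

Local Notation G n eta := (section_integral (f_ n) (N n) (Delta n) (T n) (s n) (rho n * eta)).

(** The lower bound [L] on [rho * s^al] is what makes the normalised slice length bounded by a power
    of [eta] uniformly in [n]. *)
Lemma trawl_scale_bound : exists2 C : R, 0 <= C & forall n (eta : R), 0 < eta -> rho n * eta <= a 0 ->
  (g (rho n * eta) + 2 * Delta n) / s n <= C * eta `^ (- al^-1).
Proof.
have al1' := al1; have al0 : 0 < al by lra.
have [C C0 HC] := trawl_inverse_bound ha al1 ell0 tail.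
have D00 : 0 < D0 by apply: lt_le_trans (Delta_le 0%N).
exists ((1 + 2 * D0) * C * L `^ (- al^-1)) => [|n eta eta0 ya].
  by rewrite mulr_ge0 ?powR_ge0// mulr_ge0 ?(ltW C0)//; lra.
have y0 : 0 < rho n * eta by rewrite mulr_gt0.
have y1 : 0 < rho n * eta <= a 0 by rewrite y0.
have g0 := trawl_inverse_ge0 ha al1 ell0 tail y1.
rewrite ler_pdivrMr//.
apply: le_trans (_ : (1 + 2 * D0) * (1 + g (rho n * eta)) <= _).
  by have := Delta_le n; have := mulr_ge0 (ltW D00) g0; lra.
rewrite -!mulrA; apply: ler_wpM2l; first lra.
apply: le_trans (HC _ y1) _; apply: ler_wpM2l; first exact: ltW.
rewrite powRM ?(ltW (rho_gt0 n)) ?(ltW eta0)//.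
rewrite [leRHS](_ : _ = L `^ (- al^-1) * s n * eta `^ (- al^-1)); last by ring.
rewrite ler_wpM2r ?powR_ge0// !powRN -[leLHS]mul1r ler_pdivrMr ?powR_gt0//.
rewrite -mulrA ler_pdivlMl ?powR_gt0// mulr1.
have -> : s n * rho n `^ al^-1 = (rho n * s n `^ al) `^ al^-1.
  rewrite powRM ?powR_ge0 ?(ltW (rho_gt0 n))// -powRrM divff ?lt0r_neq0// powRr1 ?(ltW (s_gt0 n))//.
  by rewrite mulrC.
apply: ge0_ler_powR; rewrite ?invr_ge0 ?(ltW al0) ?nnegrE ?(ltW L0)//.
exact: le_trans (ltW L0) (Lrho n).
Qed.

(** In [section_integral_bound] with exponent [r] the supremum and the integrated length together
    carry [r] factors [eta^(- 1 / al)]. The exponent [p < al] is used near 0, [q > al] near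
    infinity. *)
Lemma section_integral_dominated : exists2 C : R, 0 <= C & forall n (eta : R), 0 < eta ->
  `|G n eta| <= C * (if eta <= 1 then eta `^ (- (p / al)) else eta `^ (- (q / al))).
Proof.
have al1' := al1; have al0 : 0 < al by lra.
have p1' := p1; have pal' := pal; have qal' := qal.
have [C C0 HC] := trawl_scale_bound.
pose U1 := \sum_i `|u i|; pose U2 := \sum_i `|u i| * t i.
have U10 : 0 <= U1 by apply: sumr_ge0 => i _; exact: normr_ge0.
have t0 i : 0 <= t i.
  have := NT 0%N i; rewrite -ler_pdivrMr//; apply: le_trans.
  by rewrite divr_ge0 ?(ltW (T_gt0 _))// mulr_ge0// ltW.
have U20 : 0 <= U2 by apply: sumr_ge0 => i _; rewrite mulr_ge0.
pose Kr r := K * (U1 * C) `^ (r - 1) * (U2 * C).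
have Kr0 r : 0 <= Kr r by rewrite !mulr_ge0// powR_ge0.
have key r n (eta : R) : 1 <= r -> (forall n x, `|f_ n x| <= K * `|x| `^ r) -> 0 < eta ->
    `|G n eta| <= Kr r * eta `^ (- (r / al)).
  move=> r1 fr eta0; rewrite /section_integral; case: ifPn => ya; last first.
    by rewrite normr0 mulr_ge0// powR_ge0.
  have y0 : 0 < rho n * eta by rewrite mulr_gt0.
  have y1 : 0 < rho n * eta <= a 0 by rewrite y0.
  have g0 := trawl_inverse_ge0 ha al1 ell0 tail y1.
  have W := HC n eta eta0 ya; set w := _ / _ in W.
  have w0 : 0 <= w.
    by rewrite divr_ge0 ?(ltW (s_gt0 n))// addr_ge0// mulr_ge0// ltW.
  have [_] := section_integral_bound u (N n) (Delta_gt0 n) g0 (T_gt0 n) (s_gt0 n) (@fc n) K0 r1 (fr n).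
  rewrite -/U1 -/w => h.
  have gw : g (rho n * eta) / s n <= w.
    by rewrite /w ler_pM2r ?invr_gt0// lerDl mulr_ge0// ltW.
  clearbody w; apply: le_trans h _.
  have -> : Kr r * eta `^ (- (r / al)) =
      K * (U1 * (C * eta `^ (- al^-1))) `^ (r - 1) * (U2 * (C * eta `^ (- al^-1))).
    rewrite (mulrA U1) (powRM _ (mulr_ge0 U10 C0) (powR_ge0 _ _)) -powRrM /Kr.
    have -> : eta `^ (- (r / al)) = eta `^ (- al^-1 * (r - 1)) * eta `^ (- al^-1).
      rewrite -powRD; last by rewrite (gt_eqF eta0) implybT.
      by congr (_ `^ _); field; rewrite gt_eqF.
    by ring.
  apply: ler_pM.
  - by rewrite mulr_ge0// powR_ge0.
  - apply: sumr_ge0 => i _; rewrite mulr_ge0// mulr_ge0//.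
      by rewrite divr_ge0 ?(ltW (T_gt0 _))// mulr_ge0// ltW.
    by rewrite divr_ge0// ltW.
  - rewrite ler_wpM2l//; apply: ge0_ler_powR; rewrite ?subr_ge0// ?nnegrE ?mulr_ge0 ?powR_ge0//.
    by rewrite ler_wpM2l.
  rewrite mulr_suml; apply: ler_sum => i _; rewrite -[leRHS]mulrA; apply: ler_wpM2l => //.
  apply: ler_pM.
  - by rewrite divr_ge0 ?(ltW (T_gt0 _))// mulr_ge0// ltW.
  - by rewrite divr_ge0// ltW.
  - by rewrite ler_pdivrMr.
  exact: le_trans gw W.
exists (Kr p + Kr q) => [|n eta eta0]; first exact: addr_ge0.
case: ifP => _.
  apply: le_trans (key p n eta p1 fp eta0) _.
  by rewrite ler_wpM2r ?powR_ge0// lerDl.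
apply: le_trans (key q n eta _ fq eta0) _; first lra.
by rewrite ler_wpM2r ?powR_ge0// lerDr.
Qed.

Lemma section_integral_total_cvg (Ginf : R -> R) :
  (forall n, measurable_fun (`]0, +oo[%classic : set R) (fun eta : R => G n eta)) ->
  (forall eta : R, 0 < eta -> G n eta @[n --> \oo] --> Ginf eta) ->
  leb.-integrable `]0, +oo[ (EFin \o Ginf) /\
  \int[leb]_(eta in `]0, +oo[) G n eta @[n --> \oo] --> \int[leb]_(eta in `]0, +oo[) Ginf eta.
Proof.
move=> mG cG; have al1' := al1; have al0 : 0 < al by lra.
have [C C0 HC] := section_integral_dominated.
have mpos : measurable (`]0, +oo[%classic : set (measurableTypeR R)) by exact: measurable_itv.
have Iw := @integrable_powR_split R (p / al) (q / al) (_ : p / al < 1) (_ : 1 < q / al).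
have {}Iw := integrableZl_real C mpos (Iw _ _).
have mGi : measurable_fun (`]0, +oo[%classic : set R) Ginf.
  apply: (measurable_fun_cvg mG) => eta; rewrite /= in_itv/= andbT; exact: cG.
apply: (Rintegral_dominated_cvg mpos mG mGi _ (Iw _ _)).
- by apply: aeW => eta; rewrite /= in_itv/= andbT; exact: cG.
- by rewrite ltr_pdivrMr// mul1r.
- by rewrite ltr_pdivlMr// mul1r.
- by move=> n eta; rewrite /= in_itv/= andbT => eta0; exact: HC.
Qed.

(** At a fixed height the normalised counts are bounded and supported in a fixed interval, so almost
    everywhere convergence along the slice suffices. *)
Lemma section_integral_cvg (eta : R) (F : R -> R) : 0 < eta ->
  rho n @[n --> \oo] --> 0 -> measurable_fun setT F ->
  {ae leb, forall v, f_ n (section_sum u (N n) (Delta n) (g (rho n * eta)) (T n) (s n) v) @[n --> \oo] --> F v} ->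
  G n eta @[n --> \oo] --> \int[leb]_v F v.
Proof.
move=> eta0 rho00 mF cv; have al1' := al1; have al0 : 0 < al by lra.
have p1' := p1.
have [C C0 HC] := trawl_scale_bound.
pose W := C * eta `^ (- al^-1).
have W0 : 0 <= W by rewrite mulr_ge0// powR_ge0.
pose U1 := \sum_i `|u i|.
have U10 : 0 <= U1 by apply: sumr_ge0 => i _; exact: normr_ge0.
have t0 i : 0 <= t i.
  have := NT 0%N i; rewrite -ler_pdivrMr//; apply: le_trans.
  by rewrite divr_ge0 ?(ltW (T_gt0 _))// mulr_ge0// ltW.
have c0 : 0 <= c.
  have := sT 0%N; rewrite -ler_pdivrMr//; apply: le_trans.
  by rewrite divr_ge0 ?(ltW (T_gt0 _)) ?(ltW (s_gt0 _)).
pose tm := \sum_i t i.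
have tm0 : 0 <= tm by apply: sumr_ge0.
(* A trawl interval has length at most [W * s n], hence at most [c * W] in rescaled time, and the
   grid ends before [tm]: outside [B] the count is 0. *)
pose B := `[(- (c * W))%R, tm]%classic : set R.
pose dom v := K * (U1 * W) `^ p * \1_B v.
pose fn n v := if rho n * eta <= a 0 then
  f_ n (section_sum u (N n) (Delta n) (g (rho n * eta)) (T n) (s n) v) else 0.
have EG n : G n eta = \int[leb]_v fn n v.
  rewrite /section_integral /fn; case: ifP => // _.
  by rewrite Rintegral_cst// mul0r.
rewrite (eq_cvg _ _ EG).
have mB : measurable (B : set (measurableTypeR R)) by exact: measurable_itv.
have Bf : (leb B < +oo)%E.
  by rewrite lebesgue_measure_itv/=; case: ifP => _; rewrite -?EFinD ltry.
have [IB _] := @Rintegral_indicator R _ _ leb B mB Bf.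
have Idom : leb.-integrable setT (EFin \o dom) by exact: integrableZl_real.
have facts n : rho n * eta <= a 0 -> [/\ 0 < rho n * eta <= a 0, 0 <= g (rho n * eta) &
    (g (rho n * eta) + 2 * Delta n) / s n <= W].
  move=> ya; have y1 : 0 < rho n * eta <= a 0 by rewrite mulr_gt0.
  split=> //; [exact: (trawl_inverse_ge0 ha al1 ell0 tail y1)|exact: HC].
have mfn n : measurable_fun setT (fn n).
  rewrite /fn; case: (boolP (rho n * eta <= a 0)) => // ya.
  have [y1 g0 _] := facts n ya.
  apply: (measurableT_comp (continuous_measurable_fun (@fc n))).
  exact: section_sum_measurable.
have [||_ //] := @Rintegral_dominated_cvg R _ _ leb setT fn F dom measurableT mfn mF _ Idom _.
- have [Z [mZ Z0 ZP]] := cv; exists Z; split => // v /= Hv; apply: ZP => /= cvv; apply: Hv => _.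
  apply: cvg_trans cvv; apply: near_eq_cvg.
  have a00 := trawl_at0_gt0.
  have e0 : 0 < a 0 / eta by rewrite divr_gt0.
  have /cvgrPdist_lt/(_ _ e0) H := rho00.
  near=> n; rewrite /fn ifT// -ler_pdivlMr//.
  have : `|0 - rho n| < a 0 / eta by near: n; exact: H.
  by rewrite sub0r normrN gtr0_norm// => /ltW.
- move=> n v _; rewrite /dom /fn; case: ifP => [ya|_]; last first.
    by rewrite normr0 mulr_ge0 ?indicE// mulr_ge0// powR_ge0.
  have [y1 g0 hW] := facts n ya.
  have [vB|vB] := pselect (B v).
    rewrite indicE mem_set// mulr1; apply: le_trans (fp _ _) _.
    rewrite ler_wpM2l//; apply: ge0_ler_powR; rewrite ?nnegrE//; first lra.
      by rewrite mulr_ge0.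
    apply: le_trans (section_sum_le u (N n) (T n) (Delta_gt0 n) g0 (s_gt0 n) v) _.
    by rewrite ler_wpM2l.
  have Z : section_sum u (N n) (Delta n) (g (rho n * eta)) (T n) (s n) v = 0.
    apply: big1 => i _; rewrite grid_count_eq0 ?mulr0 ?mul0r ?mulr0//.
    have [vl|vl] := ltP v (- (c * W)).
      left; rewrite mulrC -ltr_pdivlMr//; apply: lt_le_trans vl _.
      rewrite mulNr lerN2 ler_pdivrMr//.
      apply: le_trans (_ : W * s n <= _).
        by rewrite -ler_pdivrMr//; apply: le_trans hW; rewrite ler_pM2r ?invr_gt0// lerDl mulr_ge0// ltW.
      rewrite [leRHS](_ : _ = W * (c * T n)); first exact: ler_wpM2l.
      by rewrite -mulrA mulrCA.
    right; have vt : tm < v.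
      by rewrite ltNge; apply/negP => vt; apply: vB; rewrite /B/= in_itv/= vl.
    apply: le_lt_trans (NT n i) _; rewrite mulrC ltr_pM2l//; apply: le_lt_trans vt.
    by rewrite /tm (bigD1 i)//= lerDl; apply: sumr_ge0.
  rewrite Z; apply: le_trans (fp _ _) _.
  by rewrite normr0 powR0 ?mulr0 ?mulr_ge0 ?indicE ?powR_ge0//; rewrite gt_eqF//; lra.
Unshelve. all: by end_near. Qed.

End Convergence.

Lemma clip_lipschitz (x x' M M' : R) : `|clip x M - clip x' M'| <= `|x - x'| + `|M - M'|.
Proof.
have h1 := ler_norm (x - x'); have h2 := ler_norm (M - M').
have h3 := ler_norm (x' - x); have h4 := ler_norm (M' - M).
rewrite distrC in h3; rewrite distrC in h4.
have n1 := normr_ge0 (x - x'); have n2 := normr_ge0 (M - M').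
move: (`|x - x'|) (`|M - M'|) h1 h2 h3 h4 n1 n2 => A B h1 h2 h3 h4 n1 n2.
rewrite ler_norml /clip !maxElt !minElt; repeat case: ifP; lra.
Qed.

Section PointwiseLimits.
Variables (N : nat -> nat) (Delta T s gn : nat -> R) (tt phi v : R).
Hypotheses (Delta_gt0 : forall n, 0 < Delta n) (T_gt0 : forall n, 0 < T n) (s_gt0 : forall n, 0 < s n).
Hypotheses (gn_ge0 : \forall n \near \oo, 0 <= gn n) (Ds : Delta n / s n @[n --> \oo] --> 0).
Hypotheses (Nt : (N n)%:R * Delta n / T n @[n --> \oo] --> tt) (gs : gn n / s n @[n --> \oo] --> phi).

Let X n := Delta n * grid_count (N n) (Delta n) (gn n) (T n * v) / s n.
(** [X n] with the grid replaced by a continuum, at distance at most [2 Delta n / s n] from it. *)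
Let Z n := (clip (v + gn n / T n) ((N n)%:R * Delta n / T n) - clip v ((N n)%:R * Delta n / T n)) * (T n / s n).

Let X_Z (l : R) : Z n @[n --> \oo] --> l -> X n @[n --> \oo] --> l.
Proof.
move=> Zl; have H : X n - Z n @[n --> \oo] --> 0.
  apply: norm_cvg0; apply: (squeeze_cvgr (f := fun=> 0) (h := fun n => 2 * (Delta n / s n))).
  - near=> n; rewrite normr_ge0/=.
    have g0 : 0 <= gn n by near: n.
    have h := grid_count_clip (N n) (T n * v) (Delta_gt0 n) g0.
    have -> : X n - Z n = (Delta n * grid_count (N n) (Delta n) (gn n) (T n * v) -
       (clip (T n * v + gn n) ((N n)%:R * Delta n) - clip (T n * v) ((N n)%:R * Delta n))) / s n.
      rewrite /X /Z.
      have e1 : T n * (v + gn n / T n) = T n * v + gn n by field; rewrite gt_eqF.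
      have e2 : T n * ((N n)%:R * Delta n / T n) = (N n)%:R * Delta n by field; rewrite gt_eqF.
      have f1 : clip (T n * v + gn n) ((N n)%:R * Delta n) =
          T n * clip (v + gn n / T n) ((N n)%:R * Delta n / T n) by rewrite clip_scale// e1 e2.
      have f2 : clip (T n * v) ((N n)%:R * Delta n) =
          T n * clip v ((N n)%:R * Delta n / T n) by rewrite clip_scale// e2.
      by rewrite f1 f2; ring.
    by rewrite normrM (gtr0_norm (_ : 0 < (s n)^-1)) ?invr_gt0// mulrA ler_pM2r ?invr_gt0.
  - exact: cvg_cst.
  - have H : 2 * (Delta n / s n) @[n --> \oo] --> (2 * 0 : R) by apply: cvgMr.
    by rewrite mulr0 in H.
have -> : l = 0 + l by rewrite add0r.
rewrite (eq_cvg _ _ (_ : X =1 (fun n => (X n - Z n) + Z n))); last by move=> n; rewrite subrK.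
exact: cvgD.
Unshelve. all: by end_near. Qed.

(** Trawl intervals as long as the observation window: the overlap of two intervals survives in the
    limit. *)
Lemma grid_count_cvg_same_scale : (forall n, s n = T n) ->
  X n @[n --> \oo] --> clip (v + phi) tt - clip v tt.
Proof.
move=> sT; apply: X_Z.
have ccl (x : nat -> R) (y : R) : x n @[n --> \oo] --> y ->
    clip (x n) ((N n)%:R * Delta n / T n) @[n --> \oo] --> clip y tt.
  move=> xy; have H : clip (x n) ((N n)%:R * Delta n / T n) - clip y tt @[n --> \oo] --> 0.
    apply: norm_cvg0; apply: (squeeze_cvgr (f := fun=> 0)
      (h := fun n => `|x n - y| + `|(N n)%:R * Delta n / T n - tt|)).
    - by near=> n; rewrite normr_ge0/= clip_lipschitz.
    - exact: cvg_cst.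
    - have nz (z : nat -> R) (l : R) : z n @[n --> \oo] --> l -> `|z n - l| @[n --> \oo] --> 0.
        move=> zl; have H : `|z n - l| @[n --> \oo] --> `|l - l|.
          by apply: cvg_norm; apply: cvgB => //; exact: cvg_cst.
        by rewrite subrr normr0 in H.
      by have H := cvgD (nz _ _ xy) (nz _ _ Nt); rewrite addr0 in H; exact: H.
  have -> : clip y tt = 0 + clip y tt by rewrite add0r.
  rewrite (eq_cvg _ _ (_ : _ =1 (fun n => (clip (x n) ((N n)%:R * Delta n / T n) - clip y tt) + clip y tt))).
    by apply: cvgD => //; exact: cvg_cst.
  by move=> n; rewrite subrK.
rewrite (eq_cvg _ _ (_ : Z =1 (fun n => clip (v + gn n / s n) ((N n)%:R * Delta n / T n) -
    clip v ((N n)%:R * Delta n / T n)))); last first.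
  by move=> n; rewrite /Z sT divff ?gt_eqF// mulr1.
apply: cvgB; apply: ccl; last exact: cvg_cst.
by apply: cvgD => //; exact: cvg_cst.
Unshelve. all: by end_near. Qed.

(** Trawl intervals short against the window: off the two ends such an interval eventually lies
    entirely inside or entirely outside it. *)
Lemma grid_count_cvg_small_scale : s n / T n @[n --> \oo] --> 0 -> 0 <= tt -> v != 0 -> v != tt ->
  X n @[n --> \oo] --> if 0 < v < tt then phi else 0.
Proof.
move=> sT tt0 v0 vt; apply: X_Z.
have gT : gn n / T n @[n --> \oo] --> 0.
  rewrite (eq_cvg _ _ (_ : _ =1 (fun n => (gn n / s n) * (s n / T n)))).
    by have H := cvgM gs sT; rewrite mulr0 in H; exact: H.
  by move=> n; field; rewrite !gt_eqF.
have cst0 (l : R) : (\forall n \near \oo, Z n = l) -> Z n @[n --> \oo] --> l.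
  by move=> H; exact: cvg_near_cst.
have [vn|vp] := ltP v 0.
  rewrite ltNge (ltW vn)/=; apply: cst0.
  have e0 : 0 < - v by rewrite oppr_gt0.
  have /cvgrPdist_lt/(_ _ e0) H := gT.
  near=> n; have : `|0 - gn n / T n| < - v by near: n; exact: H.
  rewrite sub0r normrN => /(le_lt_trans (ler_norm _)) h.
  rewrite /Z /clip (@max_l _ _ 0 (Num.min (v + _) _)); last by rewrite ge_min; apply/orP; left; lra.
  by rewrite (@max_l _ _ 0 (Num.min v _)) ?subrr ?mul0r// ge_min (ltW vn).
have vp' : 0 < v by rewrite lt_neqAle eq_sym v0.
rewrite vp'/=; have [vt1|vt1] := ltP v tt; last first.
  have vt2 : tt < v by rewrite lt_neqAle eq_sym vt.
  have e0 : 0 < v - tt by rewrite subr_gt0.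
  have /cvgrPdist_lt/(_ _ e0) H := Nt.
  apply: cst0; near=> n; have : `|tt - (N n)%:R * Delta n / T n| < v - tt by near: n; exact: H.
  rewrite ltr_distlC => /andP[_]; rewrite addrCA subrr addr0 => h.
  have g0 : 0 <= gn n / T n by rewrite divr_ge0 ?(ltW (T_gt0 n))//; near: n.
  rewrite /Z /clip (@min_r _ _ (v + _)); last by lra.
  by rewrite (@min_r _ _ v) ?subrr ?mul0r// ltW.
have e0 : 0 < (tt - v) / 2 by rewrite divr_gt0// subr_gt0.
have /cvgrPdist_lt/(_ _ e0) H1 := Nt; have /cvgrPdist_lt/(_ _ e0) H2 := gT.
apply: cvg_trans gs; apply: near_eq_cvg; near=> n.
have : `|tt - (N n)%:R * Delta n / T n| < (tt - v) / 2 by near: n; exact: H1.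
have : `|0 - gn n / T n| < (tt - v) / 2 by near: n; exact: H2.
rewrite sub0r normrN => /(le_lt_trans (ler_norm _)) h2.
rewrite ltr_distl => /andP[_ h1].
have g0 : 0 <= gn n / T n by rewrite divr_ge0 ?(ltW (T_gt0 n))//; near: n.
rewrite /Z /clip (@min_l _ _ (v + _)); last by lra.
rewrite (@min_l _ _ v); last by lra.
rewrite !max_r ?(ltW vp')//; last by lra.
by field; rewrite !gt_eqF.
Unshelve. all: by end_near. Qed.

End PointwiseLimits.

End SectionIntegrals.

(** * Power asymptotics of Lévy exponents *)

Section TailAsymptotics.
Context {R : realType}.
Local Notation leb := (@lebesgue_measure R).
Local Notation pos := (`]0, +oo[%classic : set R).

Lemma nonincreasing_pos_measurable (N : R -> R) :
  (forall x y : R, 0 < x -> x <= y -> N y <= N x) -> measurable_fun pos N.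
Proof.
move=> HN; have mpos : measurable pos by exact: measurable_itv.
apply: (@measurable_fun_cvg _ _ R pos (fun n (x : R) => N (Num.max n.+1%:R^-1 x)) N).
  move=> n; apply: nonincreasing_measurable => // x y xy; apply: HN.
    by rewrite lt_max invr_gt0 ltr0Sn.
  by rewrite ge_max le_max lexx/= le_max xy orbT.
move=> x; rewrite /= in_itv/= andbT => x0; apply: cvg_near_cst; near=> n.
rewrite max_r// -[leRHS]invrK lef_pV2 ?posrE ?invr_gt0//.
apply: ltW; apply: lt_le_trans (_ : n%:R <= _); last by rewrite ler_nat.
by near: n; exact: nbhs_infty_gtr.
Unshelve. all: by end_near. Qed.

(** Exhaustion by the origin and the sets of jumps of size at least [1 / m], finite by Markov's
    inequality; Fubini for [nu] rests on this. *)
Lemma levy_measure_sigma_finite (nu : {measure set R -> \bar R}) :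
  levy_measure nu -> sigma_finite setT nu.
Proof.
move=> [nu0 nufin].
have mmin : measurable_fun [set: R] (fun x : R => Num.min 1 (x ^+ 2)).
  by apply: measurable_minr => //; exact: measurable_funX.
exists (fun n : nat => if n is m.+1 then [set x : R | m.+1%:R^-1 <= `|x|] else [set 0]).
  apply/seteqP; split => x _ //.
  have [->|x0] := eqVneq x 0; first by exists 0%N.
  exists (Num.truncn `|x|^-1).+1 => //=.
  rewrite -[leRHS]invrK lef_pV2 ?posrE ?invr_gt0 ?normr_gt0//.
  exact/ltW/truncnS_gt.
case=> [|m]; first by split; [exact: measurable_set1|rewrite nu0].
set A := [set x : R | m.+1%:R^-1 <= `|x|].
have mA : measurable A.
  rewrite -[X in measurable X]setTI.
  by apply: (measurable_fun_ler (g := fun y : R => `|y|)) => //; exact: measurableT_comp.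
split => //; set e := m.+1%:R^-1 : R.
have e0 : 0 < e by rewrite invr_gt0.
have e1 : e <= 1 by rewrite invf_le1// ler1n.
have H : (nu A <= (e ^- 2)%:E * \int[nu]_x (Num.min 1 (x ^+ 2))%:E)%E.
  have EA : (\int[nu]_x (\1_A x)%:E = nu A)%E by rewrite integral_indic// setIT.
  rewrite -EA -ge0_integralZl; [|by []|by apply/measurable_EFinP|
    by move=> x _; rewrite lee_fin le_min ler01 sqr_ge0|by rewrite lee_fin invr_ge0 exprn_ge0// ltW].
  apply: ge0_le_integral => //.
  - by apply/measurable_EFinP.
  - by apply/measurable_EFinP; apply: measurable_funM.
  - move=> x _; rewrite -EFinM lee_fin indicE mulrC ler_pdivlMr ?exprn_gt0//.
    case: (boolP (x \in A)) => [|_]; last by rewrite mul0r le_min ler01 sqr_ge0.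
    rewrite inE/= mul1r => xe; rewrite le_min expr_le1 ?(ltW e0)// e1/=.
    by rewrite -[leRHS]real_normK ?num_real// ler_sqr ?nnegrE// ltW.
apply: le_lt_trans H _; rewrite lte_mul_pinfty// ?lee_fin ?invr_ge0 ?exprn_ge0//; exact: ltW.
Qed.

Variables (be Cn Kt : R) (k k' : R -> R) (N : R -> R).
Hypotheses (be1 : 1 < be) (be2 : be < 2).
Hypotheses (ck' : continuous k') (dk : forall x : R, is_derive x 1 k (k' x)) (k0 : k 0 = 0).
Hypothesis k'_le : forall y, `|k' y| <= 2 * Num.min 1 `|y|.
Hypotheses (N_ge0 : forall x : R, 0 < x -> 0 <= N x) (N_le : forall x : R, 0 < x -> x `^ be * N x <= Cn).
Hypothesis mN : measurable_fun pos N.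
Hypothesis N_lim : x `^ be * N x @[x --> 0^'+] --> Kt.

Let W (y : R) := if y <= 1 then y `^ (- (be - 1)) else y `^ (- be).

Let W0 y : 0 <= W y.
Proof. by rewrite /W; case: ifP => _; exact: powR_ge0. Qed.

Let IW : leb.-integrable pos (EFin \o W).
Proof. by have b1 := be1; have b2 := be2; apply: integrable_powR_split; lra. Qed.

Let k'W y : 0 < y -> `|k' y| * y `^ (- be) <= 2 * W y.
Proof.
move=> y0; apply: le_trans (_ : 2 * Num.min 1 `|y| * y `^ (- be) <= _).
  by rewrite ler_wpM2r ?powR_ge0.
rewrite -mulrA ler_wpM2l// (gtr0_norm y0) /W minEle; case: (leP 1 y) => y1.
  by rewrite mul1r; case: ifP => // y2; have -> : y = 1 by [apply/le_anti; rewrite y1 y2]; rewrite !powR1.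
rewrite (ltW y1) -{1}(powRr1 (ltW y0)) -powRD; last by rewrite (gt_eqF y0) implybT.
by rewrite le_eqVlt; apply/orP; left; apply/eqP; congr (_ `^ _); ring.
Qed.

Let Cn0 : 0 <= Cn.
Proof. by apply: le_trans (N_le ltr01); rewrite mulr_ge0 ?powR_ge0// N_ge0. Qed.

(** The identity behind both lemmas below: [N (y / z) z^(- be)] equals [y^(- be)] times
    [(y / z)^be N (y / z)], and the latter factor is bounded by [Cn]. *)
Let NW z y : 0 < z -> 0 < y -> `|k' y * N (y / z)| * z `^ (- be) <= 2 * Cn * W y.
Proof.
move=> z0 y0; have yz : 0 < y / z by rewrite divr_gt0.
rewrite normrM (ger0_norm (N_ge0 yz)).
have h := N_le yz.
have -> : `|k' y| * N (y / z) * z `^ (- be) = (`|k' y| * y `^ (- be)) * ((y / z) `^ be * N (y / z)).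
  rewrite (powRM _ (ltW y0)) ?invr_ge0 ?(ltW z0)// -(powR_inv1 (ltW z0)) -powRrM mulN1r.
  have : y `^ (- be) * y `^ be = 1.
    by rewrite -powRD ?(gt_eqF y0) ?implybT// addNr powRr0.
  move: (y `^ _) (y `^ _) => p q pq.
  by rewrite -[LHS]mul1r -pq; ring.
rewrite [leRHS](_ : _ = (2 * W y) * Cn); last by ring.
apply: ler_pM => //.
- by rewrite mulr_ge0// powR_ge0.
- by rewrite mulr_ge0 ?powR_ge0// N_ge0.
- exact: k'W.
Qed.

Let mpos : measurable (pos : set (measurableTypeR R)).
Proof. exact: measurable_itv. Qed.

Let mNz z : 0 < z -> measurable_fun pos (fun y => N (y / z)).
Proof.
move=> z0; apply: (measurable_comp (F := pos) _ _ mN) => //.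
  by move=> y [x + <-]; rewrite /= !in_itv/= !andbT => x0; rewrite divr_gt0.
by apply: measurable_funTS; exact: measurable_funM.
Qed.

Let mkN z : 0 < z -> measurable_fun pos (fun y => k' y * N (y / z)).
Proof.
move=> z0; apply: measurable_funM; last exact: mNz.
by apply: measurable_funTS; exact: continuous_measurable_fun.
Qed.

Let IkN z : 0 < z -> leb.-integrable pos (EFin \o (fun y => k' y * N (y / z))).
Proof.
move=> z0.
apply: (@le_integrable_real R _ _ leb pos _ (fun y => z `^ be * (2 * Cn * W y)) mpos (mkN z0)).
  by apply: integrableZl_real => //; exact: integrableZl_real.
move=> y; rewrite /= in_itv/= andbT => y0.
have := NW z0 y0; rewrite powRN ler_pdivrMr ?powR_gt0//.
by rewrite [leRHS]mulrC.
Qed.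

(** As [z] grows, [y / z] tends to 0 from the right, so the bounded factor [(y / z)^be N (y / z)]
    converges to [Kt] for every [y]. *)
Lemma tail_integral_cvg (z : nat -> R) : (forall n, 0 < z n) -> z n @[n --> \oo] --> +oo ->
  (\int[leb]_(y in pos) (k' y * N (y / z n))) / z n `^ be @[n --> \oo] -->
  Kt * \int[leb]_(y in pos) (k' y * y `^ (- be)).
Proof.
move=> z0 zoo; pose f n y := k' y * N (y / z n) * z n `^ (- be).
have E n : (\int[leb]_(y in pos) (k' y * N (y / z n))) / z n `^ be = \int[leb]_(y in pos) f n y.
  by rewrite -powRN -RintegralZr//; exact: IkN.
rewrite (eq_cvg _ _ E).
have mkb : measurable_fun pos (fun y => k' y * y `^ (- be)).
  by apply: measurable_funTS; apply: measurable_funM => //; exact: continuous_measurable_fun.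
have Ikb : leb.-integrable pos (EFin \o (fun y => k' y * y `^ (- be))).
  apply: (@le_integrable_real R _ _ leb pos _ (fun y => 2 * W y) mpos mkb); first exact: integrableZl_real.
  move=> y; rewrite /= in_itv/= andbT => y0; rewrite normrM (ger0_norm (powR_ge0 _ _)); exact: k'W.
have -> : Kt * \int[leb]_(y in pos) (k' y * y `^ (- be)) = \int[leb]_(y in pos) (Kt * (k' y * y `^ (- be))).
  by rewrite RintegralZl.
have [|||||_ //] := @Rintegral_dominated_cvg R _ _ leb pos f (fun y => Kt * (k' y * y `^ (- be)))
  (fun y => 2 * Cn * W y) mpos.
- by move=> n; apply: measurable_funM => //; exact: mkN.
- exact: measurable_funM.
- apply: aeW => y; rewrite /= in_itv/= andbT => y0.
  have yz : (y / z n) `^ be * N (y / z n) @[n --> \oo] --> Kt.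
    have /cvg_at_rightP := N_lim; apply; split.
      by move=> n; rewrite divr_gt0.
    have -> : (0 : R) = y * 0 by rewrite mulr0.
    by apply: cvgMr; apply/gtr0_cvgV0 => //; apply: nearW.
  have E2 n : f n y = (k' y * y `^ (- be)) * ((y / z n) `^ be * N (y / z n)).
    rewrite /f (powRM _ (ltW y0)) ?invr_ge0 ?(ltW (z0 n))// -(powR_inv1 (ltW (z0 n))) -powRrM mulN1r.
    have : y `^ (- be) * y `^ be = 1.
      by rewrite -powRD ?(gt_eqF y0) ?implybT// addNr powRr0.
    move: (y `^ _) (y `^ _) => p q pq.
    by rewrite -[LHS]mul1r -pq; ring.
  rewrite (eq_cvg _ _ E2) (mulrC Kt); apply: cvgMr; exact: yz.
- exact: integrableZl_real.
- move=> n y; rewrite /= in_itv/= andbT => y0.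
  by rewrite /f normrM (ger0_norm (powR_ge0 _ _)); exact: NW.
Qed.

Lemma tail_integral_le : exists C, forall z, 0 < z ->
  `|\int[leb]_(y in pos) (k' y * N (y / z))| <= C * z `^ be.
Proof.
exists (\int[leb]_(y in pos) (2 * Cn * W y)) => z z0.
apply: le_trans (le_normr_Rintegral _ (IkN z0)) _ => //.
rewrite -RintegralZr//; last exact: integrableZl_real.
apply: le_Rintegral => //.
- exact: integrable_norm (IkN z0).
- by apply: integrableZr_real => //; exact: integrableZl_real.
move=> y; rewrite /= in_itv/= andbT => y0.
have := NW z0 y0; rewrite powRN ler_pdivrMr ?powR_gt0//.
Qed.

Lemma tail_layer_cake d (T : measurableType d) (mu : {sigma_finite_measure set T -> \bar R}) (g : T -> R) :
  measurable_fun setT g -> (forall x, 0 < x -> mu [set t | (x < g t)%R] = (N x)%:E) ->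
  forall z, 0 < z -> mu.-integrable setT (EFin \o (fun t => k (z * Num.max 0 (g t)))) /\
    \int[mu]_t k (z * Num.max 0 (g t)) = \int[leb]_(y in pos) (k' y * N (y / z)).
Proof.
move=> mg HN z z0.
have posE : [set x | pos (z * x)] = pos.
  by apply/seteqP; split => x /=; rewrite !in_itv/= !andbT pmulr_rgt0.
have dkz (x : R) : is_derive x 1 (fun y => k (z * y)) (z * k' (z * x)).
  have D1 : is_derive x 1 (fun y : R => z * y) z.
    by apply: is_derive_eq; rewrite /GRing.scale/=; ring.
  have D := @is_derive1_comp R k _ x _ _ (dk (z * x)) D1.
  by apply: (is_derive_eq D); rewrite mulrC.
have ckz : continuous (fun y => z * k' (z * y)).
  move=> y; apply: cvgMr; apply: (cvg_comp (fun y : R => z * y) k'); last exact: ck'.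
  exact: mulrl_continuous.
have HN' (x : R) : 0 < x -> (\int[mu]_(t in [set t | (x < g t)%R]) 1%:E = (N x)%:E)%E.
  move=> x0; rewrite integral_cst ?mul1e; first exact: HN.
  by rewrite -[X in measurable X]setTI; apply: measurable_fun_ltr.
have E (y : R) : z * (k' (z * y) * N (z * y / z)) = z * k' (z * y) * N y.
  have -> : z * y / z = y by rewrite mulrAC divff ?mul1r// gt_eqF.
  by rewrite mulrA.
have I1 := integrable_lebesgue_scale z0 mpos (IkN z0); rewrite posE in I1.
have I2 : leb.-integrable pos (EFin \o (fun y => z * k' (z * y) * N y)).
  apply: (eq_integrable_real mpos _ (integrableZl_real z mpos I1)) => y _; exact: E.
have kz0 : k (z * 0) = 0 by rewrite mulr0.
have [J1 J2] := @layer_cake R _ _ mu g (cst 1) (fun y => k (z * y)) _ N mg (measurable_cst _)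
  (fun=> ler01) ckz dkz kz0 HN' I2.
have E1 : (fun t => k (z * Num.max 0 (g t)) * cst 1 t) = (fun t => k (z * Num.max 0 (g t))).
  by apply/funext => t; rewrite mulr1.
rewrite E1 in J1 J2; split; first exact: J1.
rewrite J2.
transitivity (\int[leb]_(y in pos) (z * (k' (z * y) * N (z * y / z)))).
  by apply: eq_Rintegral => y _; rewrite E.
rewrite RintegralZl//.
have := Rintegral_lebesgue_scale z0 mpos (IkN z0); rewrite posE => ->.
by rewrite mulrA divff ?mul1r// gt_eqF.
Qed.

End TailAsymptotics.

(** * Mixtures over the heights with a power weight *)

Section PowerMixture.
Context {R : realType}.
Local Notation leb := (@lebesgue_measure R).
Local Notation pos := (`]0, +oo[%classic : set R).
Variable al : R.
Hypotheses (al1 : 1 < al) (al2 : al < 2).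

(** It maps Lebesgue measure on the half-line to [x^(- 1 - al) dx], a stable Lévy density, since it
    exceeds [x] on an interval of length [x^(- al) / al]. *)
Definition power_weight (eta : R) : R := (al * eta) `^ (- al^-1).

Lemma power_weight_gt (x eta : R) : 0 < x -> 0 < eta ->
  (x < power_weight eta) = (eta < x `^ (- al) / al).
Proof.
have al1' := al1; have al0 : 0 < al by lra.
move=> x0 eta0.
have ae : 0 < (al * eta)^-1 by rewrite invr_gt0 mulr_gt0.
have -> : power_weight eta = (al * eta)^-1 `^ al^-1.
  rewrite /power_weight powRN -[in RHS](powR_inv1 (ltW (mulr_gt0 al0 eta0))) -powRrM mulN1r.
  by rewrite powRN.
have -> : (x < (al * eta)^-1 `^ al^-1) = (x `^ al < (al * eta)^-1).
  have e1 : x = (x `^ al) `^ al^-1 by rewrite -powRrM divff ?lt0r_neq0// powRr1// ltW.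
  rewrite {1}e1; apply/idP/idP => h.
    rewrite ltNge; apply/negP => h2; move: h; rewrite ltNge => /negP; apply.
    by apply: ge0_ler_powR; rewrite ?nnegrE ?powR_ge0 ?(ltW ae) ?invr_ge0 ?(ltW al0).
  by apply: gt0_ltr_powR; rewrite ?nnegrE ?powR_ge0 ?(ltW ae) ?invr_gt0.
have xp : 0 < x `^ al by exact: powR_gt0.
rewrite powRN -[LHS]ltf_pV2 ?posrE// invrK ltr_pdivlMr// mulrC.
by [].
Qed.

Lemma measurable_power_weight : measurable_fun [set: R] power_weight.
Proof.
apply: (measurableT_comp (measurable_powR (- al^-1))); exact: measurable_funM.
Qed.

(** [layer_cake] with the superlevel sets of the weight as [N]; a dilation by [c] then gives the
    homogeneity of degree [al]. *)
Lemma power_weight_layer (k k' : R -> R) : continuous k' -> (forall x : R, is_derive x 1 k (k' x)) ->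
  k 0 = 0 -> leb.-integrable pos (EFin \o (fun y => k' y * y `^ (- al))) ->
  forall c, 0 <= c -> leb.-integrable pos (EFin \o (fun eta => k (power_weight eta * c))) /\
    \int[leb]_(eta in pos) k (power_weight eta * c) =
    c `^ al * (al^-1 * \int[leb]_(y in pos) (k' y * y `^ (- al))).
Proof.
have al1' := al1; have al0 : 0 < al by lra.
move=> ck dk k0 Ik c; have mpos : measurable (pos : set (measurableTypeR R)) by exact: measurable_itv.
rewrite le_eqVlt => /orP[/eqP<-|c0].
  have E : (fun eta : R => k (power_weight eta * 0)) = (fun=> 0) by apply/funext => eta; rewrite mulr0 k0.
  rewrite E; split; first exact: integrable0.
  by rewrite Rintegral_cst// !mul0r powR0 ?mul0r// gt_eqF.
pose N (x : R) := x `^ (- al) / al.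
have posE : [set x | pos (c * x)] = pos.
  by apply/seteqP; split => x /=; rewrite !in_itv/= !andbT pmulr_rgt0.
have dkc (x : R) : is_derive x 1 (fun y => k (c * y)) (c * k' (c * x)).
  have D1 : is_derive x 1 (fun y : R => c * y) c.
    by apply: is_derive_eq; rewrite /GRing.scale/=; ring.
  have D := @is_derive1_comp R k _ x _ _ (dk (c * x)) D1.
  by apply: (is_derive_eq D); rewrite mulrC.
have ckc : continuous (fun y => c * k' (c * y)).
  move=> y; apply: cvgMr; apply: (cvg_comp (fun y : R => c * y) k'); last exact: ck.
  exact: mulrl_continuous.
have mw : measurable_fun [set: R] (\1_pos : R -> R) by [].
have w0 (t : R) : 0 <= \1_pos t :> R by rewrite indicE.
have E (x : R) : pos x -> c * k' (c * x) * N x = (c `^ al * al^-1 * c) * (k' (c * x) * (c * x) `^ (- al)).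
  rewrite /= in_itv/= andbT => x0; rewrite /N (powRM _ (ltW c0) (ltW x0)).
  have h : c `^ al * c `^ (- al) = 1 by rewrite -powRD ?(gt_eqF c0) ?implybT// subrr powRr0.
  by move: (c `^ al) (c `^ (- al)) h => p q h; rewrite -[LHS]mul1r -h; ring.
have I1 := integrable_lebesgue_scale c0 mpos Ik; rewrite posE in I1.
have IN : leb.-integrable pos (EFin \o (fun x => c * k' (c * x) * N x)).
  apply: (eq_integrable_real mpos _ (integrableZl_real (c `^ al * al^-1 * c) mpos I1)) => x.
  by rewrite inE => px; rewrite E.
have HN (x : R) : 0 < x -> (\int[leb]_(t in [set t | (x < power_weight t)%R]) (\1_pos t)%:E = (N x)%:E)%E.
  move=> x0; rewrite integral_indic//; last first.
    by rewrite -[X in measurable X]setTI; apply: measurable_fun_ltr => //; exact: measurable_power_weight.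
  have -> : pos `&` [set t | x < power_weight t] = `]0, (N x)[%classic.
    apply/seteqP; split => t /=; rewrite !in_itv/= ?andbT.
      by move=> [t0]; rewrite power_weight_gt// => ->; rewrite t0.
    by move=> /andP[t0 h]; rewrite power_weight_gt.
  have H : leb `]0, (N x)[%classic = (N x)%:E.
    by rewrite lebesgue_measure_itv/= lte_fin divr_gt0 ?powR_gt0// sube0.
  exact: H.
have k00 : k (c * 0) = 0 by rewrite mulr0.
have [J1 J2] := @layer_cake R _ _ leb power_weight (\1_pos) (fun y => k (c * y)) _ N
   measurable_power_weight mw w0 ckc dkc k00 HN IN.
have p0 (t : R) : 0 <= power_weight t by exact: powR_ge0.
have J3 : leb.-integrable pos (EFin \o (fun t => k (c * Num.max 0 (power_weight t)) * \1_pos t)).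
  by apply: integrableS J1.
have EE : {in pos, (fun t => k (c * Num.max 0 (power_weight t)) * \1_pos t) =1 (fun eta => k (power_weight eta * c))}.
  by move=> t tp; rewrite (max_r (p0 t)) indicE tp mulr1 mulrC.
split; first exact: (eq_integrable_real mpos EE J3).
transitivity (\int[leb]_t (k (c * Num.max 0 (power_weight t)) * \1_pos t)).
  rewrite [LHS]Rintegral_mkcond; apply: eq_Rintegral => t _; rewrite patchE indicE (max_r (p0 t)).
  by case: ifP; rewrite ?mulr1 ?mulr0// mulrC.
rewrite J2.
transitivity (\int[leb]_(x in pos) ((c `^ al * al^-1 * c) * (k' (c * x) * (c * x) `^ (- al)))).
  by apply: eq_Rintegral => x; rewrite inE => px; rewrite E.
rewrite RintegralZl//.
have := Rintegral_lebesgue_scale c0 mpos Ik; rewrite posE => ->.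
by field; rewrite !gt_eqF.
Qed.

Section Mixture.
Variables (nu : {sigma_finite_measure set R -> \bar R}) (k : R -> R) (m e : R).
Hypotheses (Inu : nu.-integrable setT (EFin \o (fun x : R => `|x| `^ al))) (ck : continuous k).
Hypotheses (k_ge0 : forall y : R, 0 <= y -> 0 <= k y) (e1 : `|e| = 1).
Hypothesis Ik : forall c, 0 <= c -> nu.-integrable setT (EFin \o (fun x : R => k (c * `|x|))).
Hypothesis km : forall c : R, 0 <= c -> leb.-integrable pos (EFin \o (fun eta => k (power_weight eta * c))) /\
    \int[leb]_(eta in pos) k (power_weight eta * c) = c `^ al * m.

(** With [e = 1] the kernel is even, with [e = -1] odd, so that [C] and [D] are treated at once. *)
Let sg (y : R) : R := if 0 <= y then 1 else e.

Lemma power_mixture (z : R) :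
  leb.-integrable pos (EFin \o (fun eta => \int[nu]_x (sg (z * x) * k (power_weight eta * `|z * x|)))) /\
  \int[leb]_(eta in pos) \int[nu]_x (sg (z * x) * k (power_weight eta * `|z * x|)) =
  m * `|z| `^ al * \int[nu]_x (sg (z * x) * `|x| `^ al).
Proof.
pose f (p : R * R) : R := sg (z * p.2) * k (power_weight p.1 * `|z * p.2|) * \1_pos p.1.
have mpos : measurable (pos : set (measurableTypeR R)) by exact: measurable_itv.
have sg1 y : `|sg y| = 1 by rewrite /sg; case: ifP; rewrite ?normr1.
have p0 (t : R) : 0 <= power_weight t by exact: powR_ge0.
have msg : measurable_fun [set: R] sg.
  by apply: measurable_fun_ifT => //; apply: measurable_fun_ler.
have mzx : measurable_fun [set: R] (fun x : R => z * x) by exact: measurable_funM.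
have mf : measurable_fun setT f.
  apply: measurable_funM; first apply: measurable_funM.
  - by apply: (measurableT_comp msg); exact: (measurableT_comp mzx).
  - apply: (measurableT_comp (continuous_measurable_fun ck)); apply: measurable_funM.
      exact: (measurableT_comp measurable_power_weight).
    by apply: measurableT_comp => //; exact: (measurableT_comp mzx).
  - by apply: (measurableT_comp (f := (\1_pos : R -> R))).
have mEf : measurable_fun setT (EFin \o f) by exact/measurable_EFinP.
have Ekp x : leb.-integrable setT (EFin \o (fun eta => k (power_weight eta * `|z * x|) * \1_pos eta)) /\
   \int[leb]_eta (k (power_weight eta * `|z * x|) * \1_pos eta) = `|z * x| `^ al * m.
  have [I1 I2] := km (normr_ge0 (z * x)); split.
    have /(integrable_restrict leb mpos measurableT) : leb.-integrable (setT `&` pos)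
        (EFin \o (fun eta => k (power_weight eta * `|z * x|))) by rewrite setTI.
    move=> H; apply: eq_integrable H => // eta _ /=; rewrite patchE indicE.
    by case: ifP; rewrite ?mulr1// mulr0.
  rewrite -I2 [RHS]Rintegral_mkcond; apply: eq_Rintegral => t _; rewrite patchE indicE.
  by case: ifP; rewrite ?mulr1// mulr0.
have ab eta x : `|f (eta, x)| = k (power_weight eta * `|z * x|) * \1_pos eta.
  rewrite /f/= normrM normrM sg1 mul1r (ger0_norm (k_ge0 (mulr_ge0 (p0 eta) (normr_ge0 _)))).
  by rewrite ger0_norm// indicE.
have Imal : nu.-integrable setT (EFin \o (fun x => `|z * x| `^ al * m)).
  apply: (eq_integrable_real _ _ (integrableZl_real (`|z| `^ al * m) measurableT Inu)) => // x _.
  by rewrite normrM powRM//; ring.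
have If : (leb \x nu)%E.-integrable setT (EFin \o f).
  apply/(@integrable21ltyP _ _ _ _ R leb nu (EFin \o f) mEf).
  have -> : (\int[nu]_y \int[leb]_x `|(EFin \o f) (x, y)| = \int[nu]_x (`|z * x| `^ al * m)%:E)%E.
    apply: eq_integral => x _; have [I1 I2] := Ekp x.
    rewrite -I2 /Rintegral fineK; last exact: integrable_fin_num I1.
    by apply: eq_integral => eta _ /=; rewrite -ab.
  have m0 (x : R) : 0 <= `|z * x| `^ al * m.
    have [_ <-] := Ekp x; apply: Rintegral_ge0 => // eta _; rewrite -ab; exact: normr_ge0.
  have /integrableP[_] := Imal; apply: le_lt_trans; apply: ge0_le_integral => //.
  - by move=> x _; rewrite lee_fin.
  - exact: measurable_int Imal.
  - by apply: measurableT_comp => //; exact: measurable_int Imal.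
  - by move=> x _ /=; rewrite lee_fin ler_norm.
have E1 := @integral12_prod_meas1 _ _ _ _ R leb nu _ If.
have E2 := @integral21_prod_meas1 _ _ _ _ R leb nu _ If.
have IF := @integrable_fubini_F _ _ _ _ R leb nu _ If.
pose H (eta : R) : R := \int[nu]_x (sg (z * x) * k (power_weight eta * `|z * x|)).
have HF eta : pos eta -> fubini_F nu (EFin \o f) eta = (H eta)%:E.
  move=> pe.
  have -> : fubini_F nu (EFin \o f) eta =
      (\int[nu]_x (sg (z * x) * k (power_weight eta * `|z * x|))%:E)%E.
    by apply: eq_integral => x _; rewrite /f/= indicE mem_set// mulr1.
  rewrite /H /Rintegral fineK//; apply: integrable_fin_num => //.
  have Ik' := Ik (mulr_ge0 (p0 eta) (normr_ge0 z)).
  apply: (le_integrable_real _ _ Ik') => // [|x _].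
    apply: measurable_funM; first exact: (measurableT_comp msg mzx).
    apply: (measurableT_comp (continuous_measurable_fun ck)); apply: measurable_funM => //.
    exact: measurableT_comp.
  by rewrite !normrM sg1 mul1r mulrA ger0_norm// k_ge0// !mulr_ge0.
have HF0 eta : ~ pos eta -> fubini_F nu (EFin \o f) eta = 0%E.
  by move=> pe; rewrite /fubini_F integral0_eq// => x _; rewrite /f/= indicE memNset// mulr0.
have IH : leb.-integrable pos (EFin \o H).
  have : leb.-integrable pos (fubini_F nu (EFin \o f)) by apply: integrableS IF.
  apply: eq_integrable => // eta; rewrite inE => pe; exact: HF.
split; first exact: IH.
have F1 : (\int[leb]_(eta in pos) (H eta)%:E = \int[leb]_x fubini_F nu (EFin \o f) x)%E.
  rewrite integral_mkcond; apply: eq_integral => eta _; rewrite patchE.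
  case: ifPn => [|]; first by rewrite inE => pe; rewrite HF.
  by rewrite notin_setE => pe; rewrite HF0.
rewrite {1}/Rintegral F1 E1 -E2.
have Isg : nu.-integrable setT (EFin \o (fun x => sg (z * x) * `|x| `^ al)).
  apply: (le_integrable_real _ _ Inu) => // [|x _].
    apply: measurable_funM; first exact: (measurableT_comp msg mzx).
    exact: (measurableT_comp (measurable_powR al)).
  by rewrite normrM sg1 mul1r ger0_norm// powR_ge0.
rewrite -RintegralZl// /Rintegral; congr fine; apply: eq_integral => x _.
have [I1 I2] := Ekp x.
rewrite (_ : m * `|z| `^ al * (sg (z * x) * `|x| `^ al) = sg (z * x) * (`|z * x| `^ al * m)); last first.
  by rewrite normrM powRM//; ring.
rewrite -I2 -RintegralZl// /Rintegral fineK.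
  by apply: eq_integral => eta _; rewrite /f/= mulrA.
by apply: integrable_fin_num => //; exact: integrableZl_real.
Qed.

End Mixture.
End PowerMixture.

(** A copy of [mu] to which the proof of sigma-finiteness can attach the structure that Fubini
    expects. *)
Definition sigma_finite_copy d (T : measurableType d) (R : realType)
    (mu : {measure set T -> \bar R}) (_ : sigma_finite setT mu) : set T -> \bar R := mu.

HB.instance Definition _ d (T : measurableType d) (R : realType)
    (mu : {measure set T -> \bar R}) (sf : sigma_finite setT mu) :=
  Measure.copy (sigma_finite_copy sf) mu.

HB.instance Definition _ d (T : measurableType d) (R : realType)
    (mu : {measure set T -> \bar R}) (sf : sigma_finite setT mu) :=
  Measure_isSigmaFinite.Build _ _ _ (sigma_finite_copy sf) sf.

Section StableExponent.
Context {R : realType}.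

(** A shift of the angle by [pi / 2] converts the cosine and tangent of the stable exponent into the
    constants of [stable_integrals]. *)
Lemma stable_exponentE (be Kp Km z : R) : 1 < be -> be < 2 -> 0 <= Kp -> 0 <= Km ->
  let A := Gamma (2 - be) / (be - 1) * sin ((be - 1) * (pi / 2)) in
  let B := Gamma (2 - be) / (be - 1) * cos ((be - 1) * (pi / 2)) in
  stable_exponent be Kp Km z =
  ((- (A / be * (Kp + Km) * `|z| `^ be)) +i* (- (B / be * (Kp - Km) * (Num.sg z * `|z| `^ be))))%C.
Proof.
move=> b1 b2 Kp0 Km0 A B.
have p0 := @pi_gt0 R.
have E1 : (be - 1) * (pi / 2) = pi * be / 2 - pi / 2 by field.
have hs : sin ((be - 1) * (pi / 2)) = - cos (pi * be / 2).
  by rewrite E1 sinB cos_pihalf sin_pihalf; ring.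
have hc : cos ((be - 1) * (pi / 2)) = sin (pi * be / 2).
  by rewrite E1 cosB cos_pihalf sin_pihalf; ring.
have cneg : cos (pi * be / 2) != 0.
  rewrite -[cos _]opprK -hs oppr_eq0 gt_eqF// sin_gt0_pi//; apply/andP; split.
    by rewrite mulr_gt0 ?subr_gt0// divr_gt0.
  by rewrite -{2}(mul1r pi) -[X in _ < X]mulr1; nra.
(* If the denominator is 0, so are [Kp] and [Km], and the quotient is 0 by convention. *)
have KK : (Kp + Km) * ((Kp - Km) / (Kp + Km)) = Kp - Km.
  have [K0|K0] := eqVneq (Kp + Km) 0; last by field.
  have -> : Kp - Km = 0 by have : Kp = 0 by [lra]; have : Km = 0 by [lra]; move=> -> ->; rewrite subrr.
  by rewrite mul0r mulr0.
rewrite /stable_exponent /stable_scale /stable_skewness /A /B hs hc /tan.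
move: (Gamma _) (sin _) (cos _) cneg (`|z| `^ be) (Num.sg z) => G s c c0 P S.
have n1 : be != 0 by rewrite gt_eqF//; lra.
have n2 : 1 - be != 0 by rewrite lt_eqF//; lra.
have n3 : be - 1 != 0 by rewrite gt_eqF//; lra.
simpc; congr (_ +i* _)%C.
  by field; rewrite n1 n2 n3.
have -> : G / (be * (1 - be)) * c * (Kp + Km) * P * ((Kp - Km) / (Kp + Km) * S * (s / c)) =
  G / (be * (1 - be)) * c * P * S * (s / c) * ((Kp + Km) * ((Kp - Km) / (Kp + Km))) by ring.
by rewrite KK; field; rewrite c0 n1 n2 n3.
Qed.

End StableExponent.

Section PositivePower.
Context {R : realType}.

(** At the origin the difference quotient is at most [|h|^(p - 1)]. This extends the power to a
    differentiable kernel on the whole line, as [layer_cake] asks. *)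
Lemma positive_power_derive (p x : R) : 1 < p ->
  is_derive x 1 (fun y : R => Num.max 0 y `^ p) (p * Num.max 0 x `^ (p - 1)).
Proof.
move=> p1; have p0 : 0 < p by lra.
have p1' : 0 < p - 1 by rewrite subr_gt0.
have [x0|[x0|x0]] : x < 0 \/ 0 < x \/ x = 0.
  by case: (ltrgtP x 0) => h; [left|right; left|right; right].
- rewrite (_ : Num.max 0 x = 0); last by rewrite max_l// ltW.
  rewrite powR0 ?mulr0; last by rewrite gt_eqF.
  apply: (@near_eq_is_derive _ _ _ (cst 0)).
    near=> y; rewrite max_l ?powR0 ?gt_eqF//.
    by near: y; exact: lt_le_nbhsl.
- rewrite (_ : Num.max 0 x = x); last by rewrite max_r// ltW.
  apply: (@near_eq_is_derive _ _ _ (fun y => y `^ p)); last exact: is_derive_powR.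
  near=> y; rewrite max_r//.
  by near: y; exact: lt_le_nbhsr.
- rewrite {x}x0 maxxx powR0 ?mulr0; last by rewrite gt_eqF.
  have H : (fun h : R => h^-1 *: ((fun y : R => Num.max 0 y `^ p) (h *: (1 : R) + 0) - Num.max 0 0 `^ p)) @ 0^' --> (0 : R).
    apply/cvgrPdist_le => eps e0.
    have d0 : 0 < eps `^ (p - 1)^-1 by exact: powR_gt0.
    near=> h; rewrite sub0r normrN addr0 maxxx powR0 ?gt_eqF// subr0 /GRing.scale/= mulr1 normrM.
    have h0 : h != 0 by near: h; exact: nbhs_dnbhs_neq.
    have hn : 0 < `|h| by rewrite normr_gt0.
    have hd : `|h| <= eps `^ (p - 1)^-1.
      near: h; apply: nbhs_dnbhs; have : \forall h \near nbhs (0 : R), `|0 - h| < eps `^ (p - 1)^-1.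
        by exists (eps `^ (p - 1)^-1) => //=.
      by apply: filterS => h; rewrite sub0r normrN => /ltW.
    rewrite normfV mulrC ler_pdivrMr// ger0_norm ?powR_ge0//.
    apply: le_trans (_ : `|h| `^ p <= _).
      apply: ge0_ler_powR; rewrite ?nnegrE ?(ltW p0)//; first by rewrite le_max lexx.
      by rewrite ge_max normr_ge0 ler_norm.
    have -> : `|h| `^ p = `|h| `^ (p - 1) * `|h|.
      by rewrite -{3}(powRr1 (ltW hn)) -powRD ?subrK// (gt_eqF hn) implybT.
    rewrite ler_pM2r//; have -> : eps = (eps `^ (p - 1)^-1) `^ (p - 1).
      by rewrite -powRrM mulVf ?gt_eqF// powRr1// ltW.
    by apply: ge0_ler_powR; rewrite ?nnegrE ?(ltW p1') ?powR_ge0.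
  by apply: DeriveDef; [apply/cvg_ex; exists 0; exact: H|exact: cvg_lim H].
Unshelve. all: by end_near. Qed.

End PositivePower.

(** * The overlap of two intervals and the constant of the second regime *)

Section OverlapIntegral.
Context {R : realType}.
Local Notation leb := (@lebesgue_measure R).
Local Notation pos := (`]0, +oo[%classic : set R).

Lemma integral_powR_0b (p b : R) : -1 < p -> 0 < b ->
  leb.-integrable `]0, b] (EFin \o (fun x => x `^ p)) /\
  \int[leb]_(x in `]0, b]) x `^ p = b `^ (p + 1) / (p + 1).
Proof.
move=> p1 b0; have m1 : measurable (`]0, b]%classic : set (measurableTypeR R)) by exact: measurable_itv.
have mp : measurable_fun (`]0, b]%classic : set R) (fun x : R => (x `^ p)%:E).
  by apply/measurable_EFinP; apply: measurable_funTS.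
have H := @ge0_lebesgue_scale R b `]0, b] (fun x => (x `^ p)%:E) b0 m1 mp.
have E : [set x | `]0, b]%classic (b * x)] = `]0, 1]%classic.
  have e (x : R) : (b * x <= b) = (x <= 1) by rewrite -{2}(mulr1 b) ler_pM2l.
  by apply/seteqP; split => x /=; rewrite !in_itv/= pmulr_rgt0// e.
rewrite E in H.
have I : (\int[leb]_(x in `]0%R, b]) (x `^ p)%:E = (b `^ (p + 1) / (p + 1))%:E)%E.
  have {}H := H (fun x _ => powR_ge0 x p).
  have : (\int[leb]_(x in `]0%R, 1%R]) ((b * x) `^ p)%:E = (b `^ p * (p + 1)^-1)%:E)%E.
    rewrite EFinM -integral_powR_01// -ge0_integralZl//.
    - apply: eq_integral => x; rewrite inE/= in_itv/= => /andP[x0 _].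
      by rewrite -EFinM powRM// ltW.
    - by apply/measurable_EFinP; apply: measurable_funTS.
    - by move=> x _; rewrite lee_fin powR_ge0.
    - by rewrite lee_fin powR_ge0.
  rewrite H => H2.
  have : (b%:E * (b^-1%:E * \int[leb]_(x in `]0%R, b]) (x `^ p)%:E) = b%:E * (b `^ p * (p + 1)^-1)%:E)%E by rewrite H2.
  rewrite muleA -EFinM divff ?gt_eqF// mul1e -EFinM => ->; congr EFin.
  rewrite mulrA; congr (_ / _); rewrite -{1}(powRr1 (ltW b0)) -powRD ?(gt_eqF b0) ?implybT//.
  by rewrite addrC.
split; last by rewrite /Rintegral I.
apply/integrableP; split; first exact: mp.
rewrite [ltLHS](_ : _ = \int[leb]_(x in `]0%R, b]) (x `^ p)%:E)%E; first by rewrite I ltry.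
by apply: eq_integral => x _ /=; rewrite ger0_norm// powR_ge0.
Qed.

Variables (al be : R).
Hypotheses (al1 : 1 < al) (ab : al < be) (be2 : be < 2).

(** For [w >= 0] this is the length of the intersection of [[v, v + w]] with [[0, 1]]. *)
Definition overlap (v w : R) : R := clip (v + w) 1 - clip v 1.

Lemma overlap_gt (v w x : R) : 0 <= w -> 0 < x -> x < 1 ->
  (x < overlap v w) = (x < w) && (x - w < v < 1 - x).
Proof.
move=> w0 x0 x1.
have lo (y : R) : y <= 0 -> clip y 1 = 0.
  by move=> y0; rewrite /clip (min_l (le_trans y0 ler01)) max_l.
have hi (y : R) : 1 <= y -> clip y 1 = 1 by move=> y1; rewrite /clip (min_r y1) max_r.
have mid (y : R) : 0 <= y -> y <= 1 -> clip y 1 = y.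
  by move=> y0 y1; rewrite /clip (min_l y1) max_r.
have eq3 (o : R) : (x < o -> [/\ x < w, x - w < v & v < 1 - x]) ->
    (x < w -> x - w < v -> v < 1 - x -> x < o) -> (x < o) = (x < w) && (x - w < v < 1 - x).
  by move=> h1 h2; apply/idP/and3P => [/h1|[]].
rewrite /overlap; have [v0|v0] := leP v 0.
  rewrite (lo _ v0); have [z0|z0] := leP (v + w) 0.
    by rewrite (lo _ z0); apply: eq3 => [?|? ? ?]; [split|]; lra.
  have [z1|z1] := leP (v + w) 1.
    by rewrite (mid _ (ltW z0) z1); apply: eq3 => [?|? ? ?]; [split|]; lra.
  by rewrite (hi _ (ltW z1)); apply: eq3 => [?|? ? ?]; [split|]; lra.
have [v1|v1] := leP v 1.
  rewrite (mid _ (ltW v0) v1); have [z1|z1] := leP (v + w) 1.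
    have z0 : 0 <= v + w by lra.
    by rewrite (mid _ z0 z1); apply: eq3 => [?|? ? ?]; [split|]; lra.
  by rewrite (hi _ (ltW z1)); apply: eq3 => [?|? ? ?]; [split|]; lra.
have z1 : 1 <= v + w by lra.
by rewrite (hi _ (ltW v1)) (hi _ z1); apply: eq3 => [?|? ? ?]; [split|]; lra.
Qed.

Lemma overlap_ge0 (v w : R) : 0 <= w -> 0 <= overlap v w.
Proof. by move=> w0; have /andP[] : 0 <= overlap v w <= v + w - v by apply: clip_le; lra. Qed.

Lemma overlap_out (v w : R) : 0 <= w -> ~~ (- w <= v <= 1) -> overlap v w = 0.
Proof.
move=> w0 vD; have [vl|vl] := ltP v (- w).
  have v0 : v <= 0 by lra.
  have v1 : v <= 1 by lra.
  have v2 : v + w <= 0 by lra.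
  have v3 : v + w <= 1 by lra.
  by rewrite /overlap /clip (min_l v3) (min_l v1) (max_l v0) (max_l v2) subrr.
have vr : 1 <= v by move: vD; rewrite vl -ltNge => /ltW.
have vr1 : 1 <= v + w by lra.
by rewrite /overlap /clip (min_r vr1) (min_r vr) subrr.
Qed.

Lemma overlap_le1 (v w : R) : overlap v w <= 1.
Proof. by rewrite /overlap /clip !maxElt !minElt; repeat case: ifP; lra. Qed.

Lemma measurable_overlap d (T : measurableType d) (V W : T -> R) :
  measurable_fun setT V -> measurable_fun setT W ->
  measurable_fun setT (fun t => overlap (V t) (W t)).
Proof.
move=> mV mW.
have mc (f : T -> R) : measurable_fun setT f -> measurable_fun setT (fun p => clip (f p) 1).
  by move=> mf; apply: measurable_maxr => //; exact: measurable_minr.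
by apply: measurable_funB; apply: mc => //; exact: measurable_funD.
Qed.

Lemma overlap_integrable (w : R) : 0 <= w ->
  leb.-integrable setT (EFin \o (fun v => overlap v w `^ be)).
Proof.
move=> w0; have al1' := al1; have ab' := ab; have be0 : 0 < be by lra.
pose D := `[(- w)%R, 1]%classic : set R.
have mD : measurable (D : set (measurableTypeR R)) by exact: measurable_itv.
have Df : (leb D < +oo)%E.
  by rewrite lebesgue_measure_itv/=; case: ifP => _; rewrite -?EFinD ltry.
have [ID _] := @Rintegral_indicator R _ _ leb D mD Df.
have mo : measurable_fun [set: R] (fun v => overlap v w `^ be).
  apply: (measurableT_comp (measurable_powR be)).
  exact: measurable_overlap.
apply: (@le_integrable_real R _ _ leb setT _ (\1_D) measurableT mo ID) => v _.
rewrite ger0_norm ?powR_ge0//.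
have ov := overlap_ge0 v w0.
rewrite indicE; case: (boolP (v \in D)) => [_|].
  have /(@ge0_ler_powR R _ (ltW be0) _ _) : overlap v w <= 1 := overlap_le1 _ _.
  by rewrite powR1; apply; rewrite nnegrE.
rewrite notin_setE /D /= in_itv/= => /negP vD; rewrite (overlap_out w0 vD) powR0 ?gt_eqF//.
Qed.

(** The area of the pairs [(eta, v)] with overlap above [x]: for each [eta < x^(- al)] the set of
    [v] is an interval of length [1 - 2 x + eta^(- 1 / al)], and this is its integral. *)
Let N (x : R) : R :=
  if x < 1 then (1 - 2 * x) * x `^ (- al) + al / (al - 1) * x `^ (1 - al) else 0.

Let phi (eta : R) : R := eta `^ (- al^-1).

Let phi_gt (x eta : R) : 0 < x -> 0 < eta -> (x < phi eta) = (eta < x `^ (- al)).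
Proof.
have al1' := al1; have al0 : 0 < al by lra.
move=> x0 eta0.
have key (y z r : R) : 0 < r -> 0 < y -> 0 < z -> (y `^ (- r) < z `^ (- r)) = (z < y).
  move=> r0 y0 z0; rewrite !powRN ltf_pV2 ?posrE ?powR_gt0//.
  apply/idP/idP => h; last by apply: gt0_ltr_powR; rewrite ?nnegrE ?(ltW y0) ?(ltW z0).
  rewrite ltNge; apply/negP => yz; move: h; rewrite ltNge => /negP; apply.
  by apply: ge0_ler_powR; rewrite ?nnegrE ?(ltW r0) ?(ltW y0) ?(ltW z0).
have e1 : x = (x `^ (- al)) `^ (- al^-1).
  by rewrite -powRrM mulrNN divff ?gt_eqF// powRr1// ltW.
by rewrite {1}e1 key ?invr_gt0// powR_gt0.
Qed.

Let mphi : measurable_fun [set: R] phi.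
Proof. exact: measurable_powR. Qed.

Let phi0 eta : 0 <= phi eta.
Proof. exact: powR_ge0. Qed.

Let HN (x : R) : 0 < x ->
  (\int[leb \x leb]_(p in [set p : R * R | (x < overlap p.2 (phi p.1))%R]) (\1_pos p.1)%:E = (N x)%:E)%E.
Proof.
have al1' := al1; have al0 : 0 < al by lra.
move=> x0; rewrite /N; case: ltP => x1; last first.
  rewrite integral0_eq// => p /= h.
  by have := lt_le_trans h (overlap_le1 p.2 (phi p.1)); rewrite ltNge x1.
pose S := [set p : R * R | x < overlap p.2 (phi p.1)].
have mov : measurable_fun setT (fun p : R * R => overlap p.2 (phi p.1)).
  by apply: measurable_overlap => //; exact: (measurableT_comp mphi).
have mS : measurable S.
  by rewrite -[X in measurable X]setTI; apply: measurable_fun_ltr.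
rewrite integral_mkcond.
pose f (p : R * R) : \bar R := (\1_pos p.1 * \1_S p)%:E.
have mf : measurable_fun setT f.
  apply/measurable_EFinP; apply: measurable_funM => //.
  by apply: (measurableT_comp (f := (\1_pos : R -> R))).
have f0 p : (0 <= f p)%E by rewrite lee_fin mulr_ge0 ?indicE.
rewrite (_ : (\int[leb \x leb]_z _ = \int[leb \x leb]_z f z)%E); last first.
  apply: eq_integral => p _; rewrite patchE /f [X in _ * X]indicE.
  by case: ifP => _; rewrite ?mulr1// mulr0.
rewrite (@fubini_tonelli1 _ _ _ _ R leb leb f mf f0).
set b := x `^ (- al); have b0 : 0 < b by exact: powR_gt0.
have E eta : fubini_F leb f eta = (((1 - 2 * x + phi eta) * \1_(`]0, b[%classic) eta)%:E).
  rewrite /fubini_F /f/= !indicE mem_setE in_itv/= andbT.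
  case: (ltP 0 eta) => eta0; last first.
    rewrite memNset/=; last by rewrite in_itv/= ltNge eta0.
    by rewrite mulr0 integral0_eq// => v _; rewrite mul0r.
  under eq_integral do rewrite mul1r.
  have [eb|eb] := ltP eta b; last first.
    rewrite memNset/=; last by rewrite in_itv/= eta0 ltNge eb.
    rewrite mulr0 integral0_eq// => v _; rewrite indicE memNset// /S/= overlap_gt//.
    by rewrite phi_gt// ltNge eb.
  rewrite mem_set/= ?in_itv/= ?eta0// mulr1.
  have xp : x < phi eta by rewrite phi_gt.
  have -> : (\int[leb]_v (\1_S (eta, v))%:E = \int[leb]_v (\1_(`]x - phi eta, 1 - x[%classic) v)%:E)%E.
    apply: eq_integral => v _; congr EFin; rewrite !indicE; congr (_%:R); congr nat_of_bool.
    have -> : ((eta, v) \in S) = (x < overlap v (phi eta)) by apply/idP/idP; rewrite inE.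
    by rewrite overlap_gt// xp mem_setE in_itv.
  rewrite integral_indic// setIT.
  have H : leb `]x - phi eta, 1 - x[%classic = (1 - 2 * x + phi eta)%:E.
    rewrite lebesgue_measure_itv/= lte_fin; case: ltP => h; first by congr EFin; ring.
    by congr EFin; lra.
  exact: H.
have al' : - 1 < - al^-1 by rewrite ltrN2 invf_lt1.
have [I1 I2] := integral_powR_0b al' b0.
have mb : measurable (`]0, b]%classic : set (measurableTypeR R)) by exact: measurable_itv.
have Hb : leb `]0, b]%classic = b%:E by rewrite lebesgue_measure_itv/= lte_fin b0 sube0.
have Ic : leb.-integrable `]0, b] (EFin \o cst (1 - 2 * x)).
  have n10 : - 1 < 0 :> R by lra.
  have [I0 _] := integral_powR_0b n10 b0.
  by apply: (eq_integrable_real mb _ (integrableZl_real (1 - 2 * x) mb I0)) => y _; rewrite powRr0 mulr1.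
have Iall : leb.-integrable `]0, b] (EFin \o (fun eta => 1 - 2 * x + phi eta)) by exact: integrableD_real.
rewrite (_ : (\int[leb]_eta _ = \int[leb]_(eta in `]0%R, b[) (1 - 2 * x + phi eta)%:E)%E); last first.
  rewrite [RHS]integral_mkcond; apply: eq_integral => eta _; rewrite patchE.
  transitivity ((1 - 2 * x + phi eta) * \1_(`]0, b[%classic) eta)%:E; first exact: (E eta).
  rewrite indicE; by case: ifP => _; rewrite ?mulr1// mulr0.
rewrite integral_itv_bndo_bndc; last first.
  by apply/measurable_EFinP; apply: measurable_funTS; apply: measurable_funD.
rewrite -[LHS]fineK; last exact: integrable_fin_num Iall.
rewrite -/(Rintegral leb _ _) RintegralD// I2 Rintegral_cst// [X in fine X]Hb/=.
congr EFin; rewrite /b -powRrM.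
have -> : - al * (- al^-1 + 1) = 1 - al by field; rewrite gt_eqF.
by field; apply/andP; split; rewrite ?gt_eqF//; lra.
Qed.

(** Cavalieri in both variables at once reduces the double integral to that of [be x^(be - 1) N x]
    over []0, 1[], a sum of two powers. *)
Lemma overlap_integral :
  leb.-integrable pos (EFin \o (fun eta => \int[leb]_v overlap v (phi eta) `^ be)) /\
  \int[leb]_(eta in pos) \int[leb]_v overlap v (phi eta) `^ be =
  be / (be - al) + be * (al / (al - 1) - 2) / (be - al + 1).
Proof.
have al1' := al1; have ab' := ab; have be2' := be2; have al0 : 0 < al by lra.
have be0 : 0 < be by lra.
have mpos : measurable (pos : set (measurableTypeR R)) by exact: measurable_itv.
have m01 : measurable (`]0, 1]%classic : set (measurableTypeR R)) by exact: measurable_itv.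
pose k (y : R) := Num.max 0 y `^ be; pose k' (y : R) := be * Num.max 0 y `^ (be - 1).
have k0 : k 0 = 0 by rewrite /k maxxx powR0// gt_eqF.
have b1 : 1 < be by lra.
have dk (x : R) : is_derive x 1 k (k' x) by exact: positive_power_derive.
have ck' : continuous k'.
  have bb : 0 < be - 1 by lra.
  move=> x; apply: cvgMr.
  have [x0|x0] := ltP 0 x.
    apply: cvg_trans (@continuous_powR_gt0 R (be - 1) x x0); apply: near_eq_cvg; near=> y.
    by rewrite max_r//; near: y; exact: lt_le_nbhsr.
  rewrite powR0 ?gt_eqF//.
  apply/cvgrPdist_le => eps e0; have d0 : 0 < eps `^ (be - 1)^-1 by exact: powR_gt0.
  near=> y; rewrite sub0r normrN ger0_norm ?powR_ge0//.
  have yd : Num.max 0 y <= eps `^ (be - 1)^-1.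
    rewrite ge_max (ltW d0)/=; near: y; apply: lt_le_nbhsl.
    exact: le_lt_trans d0.
  have -> : eps = (eps `^ (be - 1)^-1) `^ (be - 1).
    by rewrite -powRrM mulVf ?gt_eqF// powRr1// ltW.
  by apply: ge0_ler_powR; rewrite ?nnegrE ?(ltW bb) ?powR_ge0// le_max lexx.
have mov : measurable_fun setT (fun p : R * R => overlap p.2 (phi p.1)).
  by apply: measurable_overlap => //; exact: (measurableT_comp mphi).
have mw : measurable_fun setT (fun p : R * R => \1_pos p.1 : R).
  by apply: (measurableT_comp (f := (\1_pos : R -> R))).
have w0 (p : R * R) : 0 <= \1_pos p.1 :> R by rewrite indicE.
have E (x : R) : pos x -> k' x * N x = (fun x => be * x `^ (be - al - 1) + be * (al / (al - 1) - 2) * x `^ (be - al)) x * \1_(`]0, 1[%classic) x.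
  rewrite /= in_itv/= andbT => x0; rewrite /k' /N (max_r (ltW x0)) indicE mem_setE in_itv/= x0/=.
  case: ifP => _; last by rewrite !mulr0.
  rewrite mulr1.
  have e1 : x `^ (be - al - 1) = x `^ (be - 1) * x `^ (- al).
    by rewrite -powRD ?(gt_eqF x0) ?implybT//; congr (_ `^ _); ring.
  have e2 : x `^ (be - al) = x `^ (be - 1) * x `^ (1 - al).
    by rewrite -powRD ?(gt_eqF x0) ?implybT//; congr (_ `^ _); ring.
  have e3 : x * x `^ (- al) = x `^ (1 - al).
    by rewrite -{1}(powRr1 (ltW x0)) -powRD ?(gt_eqF x0) ?implybT.
  rewrite e1 e2 -e3; ring.
have h1 : - 1 < be - al - 1 by lra.
have h2 : - 1 < be - al by lra.
have [Ia Ea] := integral_powR_0b h1 (@ltr01 R); have [Ib Eb] := integral_powR_0b h2 (@ltr01 R).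
pose F (x : R) := be * x `^ (be - al - 1) + be * (al / (al - 1) - 2) * x `^ (be - al).
have I1a : leb.-integrable `]0, 1] (EFin \o (fun x => be * x `^ (be - al - 1))) by exact: integrableZl_real.
have I1b : leb.-integrable `]0, 1] (EFin \o (fun x => be * (al / (al - 1) - 2) * x `^ (be - al))) by exact: integrableZl_real.
have IF : leb.-integrable `]0, 1] (EFin \o F) by exact: integrableD_real.
have EF : \int[leb]_(x in `]0, 1]) F x = be / (be - al) + be * (al / (al - 1) - 2) / (be - al + 1).
  rewrite RintegralD// !RintegralZl// Ea Eb !powR1 subrK.
  have d0 : 0 < be - al by rewrite subr_gt0.
  have d1 : 0 < be - al + 1 by exact: addr_gt0.
  by field; rewrite !gt_eqF// subr_gt0.
have sub : `]0, 1[%classic `<=` (`]0, 1]%classic : set R).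
  by move=> x /=; rewrite !in_itv/= => /andP[-> /ltW].
have m01o : measurable (`]0, 1[%classic : set (measurableTypeR R)) by exact: measurable_itv.
have IF' : leb.-integrable `]0, 1[ (EFin \o F) by apply: integrableS IF.
have posI : pos `&` `]0, 1[%classic = `]0, 1[%classic.
  apply/seteqP; split => x /=; rewrite !in_itv/= ?andbT; first by move=> [].
  by move=> /andP[-> ->].
have IN : leb.-integrable pos (EFin \o (fun x => k' x * N x)).
  have : leb.-integrable (pos `&` `]0, 1[) (EFin \o F) by rewrite posI.
  move=> /(integrable_restrict leb m01o mpos) H; apply: eq_integrable H => // x; rewrite inE => px /=.
  by rewrite E// patchE indicE; case: ifP => _; rewrite ?mulr1// mulr0.
have EN : \int[leb]_(x in pos) (k' x * N x) = be / (be - al) + be * (al / (al - 1) - 2) / (be - al + 1).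
  rewrite -EF.
  transitivity (\int[leb]_(x in `]0, 1[) F x).
    rewrite [RHS]Rintegral_mkcond [LHS]Rintegral_mkcond; apply: eq_Rintegral => x _; rewrite !patchE.
    case: ifPn => [|]; first by rewrite inE => px; rewrite E// indicE; case: ifP => _; rewrite ?mulr1// mulr0.
    rewrite notin_setE => px; rewrite memNset// => h; apply: px; move: h; rewrite /= !in_itv/= andbT.
    by case/andP.
  rewrite /Rintegral; congr fine; apply: integral_itv_bndo_bndc.
  exact: measurable_int IF'.
pose mu2 : {measure set (measurableTypeR R * measurableTypeR R) -> \bar R} := (leb \x leb)%E.
have sf2 : sigma_finite setT mu2.
  exists (fun n => `[- n%:R, n%:R]%classic `*` `[- n%:R, n%:R]%classic).
    apply/esym/seteqP; split=> // p _; exists (Num.bound (`|p.1| + `|p.2|)) => //=.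
    have := archi_boundP (addr_ge0 (normr_ge0 p.1) (normr_ge0 p.2)).
    by move=> /ltW h; split; rewrite in_itv/= -ler_norml; apply: le_trans h; rewrite (lerDl, lerDr).
  move=> n; have mn : measurable (`[- n%:R, n%:R]%classic : set (measurableTypeR R)) by exact: measurable_itv.
  split; first exact: measurableX.
  have fn : (leb `[(- n%:R)%R, n%:R] < +oo)%E.
    by rewrite lebesgue_measure_itv/=; case: ifP => _; rewrite -?EFinD ltry.
  have E2 := @product_measure1E _ _ _ _ R leb leb _ _ mn mn.
  apply: (@le_lt_trans _ _ (leb `[(- n%:R)%R, n%:R] * leb `[(- n%:R)%R, n%:R])%E); first by rewrite -E2.
  by apply: lte_mul_pinfty => //; rewrite ge0_fin_numE.
have [J1 J2] := @layer_cake R _ (measurableTypeR R * measurableTypeR R)%type (sigma_finite_copy sf2) (fun p : R * R => overlap p.2 (phi p.1))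
  (fun p => \1_pos p.1) k k' N mov mw w0 ck' dk k0 HN IN.
rewrite EN in J2.
pose f (p : R * R) := k (Num.max 0 (overlap p.2 (phi p.1))) * \1_pos p.1.
have kE eta v : k (Num.max 0 (overlap v (phi eta))) = overlap v (phi eta) `^ be.
  by rewrite /k !(max_r (overlap_ge0 _ (phi0 _))).
have JF := @integrable_fubini_F _ _ _ _ R leb leb _ J1.
have E1 := @integral12_prod_meas1 _ _ _ _ R leb leb _ J1.
pose H (eta : R) : R := \int[leb]_v overlap v (phi eta) `^ be.
have Iov eta : leb.-integrable setT (EFin \o (fun v => overlap v (phi eta) `^ be)).
  exact: overlap_integrable.
have HF eta : pos eta -> fubini_F leb (EFin \o f) eta = (H eta)%:E.
  move=> pe; rewrite /H /Rintegral fineK; last exact: integrable_fin_num (Iov eta).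
  by apply: eq_integral => v _; rewrite /f/= kE indicE mem_set// mulr1.
have HF0 eta : ~ pos eta -> fubini_F leb (EFin \o f) eta = 0%E.
  by move=> pe; rewrite /fubini_F integral0_eq// => x _; rewrite /f/= indicE memNset// mulr0.
have IH : leb.-integrable pos (EFin \o H).
  have : leb.-integrable pos (fubini_F leb (EFin \o f)) by apply: integrableS JF.
  apply: eq_integrable => // eta; rewrite inE => pe; exact: HF.
split; first exact: IH.
rewrite -J2 /Rintegral; congr fine; rewrite -[RHS]E1 integral_mkcond; apply: eq_integral => eta _.
rewrite patchE; case: ifPn => [|]; first by rewrite inE => pe; exact/esym/HF.
by rewrite notin_setE => pe; exact/esym/HF0.
Unshelve. all: by end_near. Qed.

End OverlapIntegral.

(** Quadratic bounds below 1 and bounds of order at most one above it; any power between 1 and 2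
    interpolates. *)
Lemma trig_le_powR {R : realType} (p y : R) : 1 <= p -> p <= 2 ->
  `|1 - cos y| <= 2 * `|y| `^ p /\ `|sin y - y| <= 2 * `|y| `^ p.
Proof.
move=> p1 p2; have p0 : 0 < p by lra.
have [->|yN0] := eqVneq y 0.
  by rewrite normr0 powR0 ?gt_eqF// mulr0 cos0 sin0 !subrr normr0.
have y0 : 0 < `|y| by rewrite normr_gt0.
have [y1|y1] := leP `|y| 1.
  have H : y ^+ 2 <= 2 * `|y| `^ p.
    rewrite -real_normK ?num_real// -(powR_mulrn _ (ltW y0)).
    have : `|y| `^ 2 <= `|y| `^ p by rewrite ger_powR// y0.
    have := powR_ge0 `|y| p; lra.
  by split; apply: le_trans H; [exact: cosB1_le_sqr|exact: sinB_le_sqr].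
have H : `|y| <= `|y| `^ p by rewrite -{1}(powRr1 (ltW y0)) ler_powR// ltW.
split.
  have := cos_geN1 y; have := cos_le1 y; move=> h1 h2; rewrite ger0_norm; lra.
by apply: le_trans (sinB_le y) _; lra.
Qed.

Section TrigKernels.
Context {R : realType}.
Implicit Types x : R.

Lemma is_derive_onem_cos x : is_derive x 1 (fun y : R => 1 - cos y) (sin x).
Proof.
have D := is_deriveB (is_derive_cst (1 : R) x 1) (is_derive_cos x).
by apply: (is_derive_eq D); rewrite sub0r opprK.
Qed.

Lemma is_derive_idB_sin x : is_derive x 1 (fun y : R => y - sin y) (1 - cos x).
Proof. exact: (is_deriveB (is_derive_id x 1) (is_derive_sin x)). Qed.

Lemma cos_norm x : cos `|x| = cos x.
Proof. by case: (ger0P x) => // _; rewrite cosN. Qed.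

Lemma sinB_norm x : sin x - x = - ((if 0 <= x then 1 else -1) * (`|x| - sin `|x|)).
Proof.
have [x0|x0] := leP 0 x; first by rewrite ger0_norm// mul1r opprB.
by rewrite ltr0_norm// sinN mulN1r opprK opprK addrC.
Qed.

Lemma onem_cos_split (y x : R) :
  1 - cos (y * x) = (1 - cos (`|y| * Num.max 0 x)) + (1 - cos (`|y| * Num.max 0 (- x))).
Proof.
rewrite -cos_norm normrM; have [x0|x0] := leP 0 x.
  by rewrite (ger0_norm x0) max_l ?oppr_le0// mulr0 cos0 subrr addr0.
by rewrite (ltr0_norm x0) max_r ?oppr_ge0 ?(ltW x0)// mulr0 cos0 subrr add0r.
Qed.

Lemma sinB_split (y x : R) : sin (y * x) - y * x =
  - Num.sg y * ((`|y| * Num.max 0 x - sin (`|y| * Num.max 0 x)) -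
                (`|y| * Num.max 0 (- x) - sin (`|y| * Num.max 0 (- x)))).
Proof.
have [yn|yp|->] := ltgtP y 0; last by rewrite sgr0 oppr0 !mul0r sin0 subrr.
  rewrite ltr0_sg// ltr0_norm//; have [x0|x0] := leP 0 x.
    by rewrite max_l ?oppr_le0// mulr0 sin0 (mulNr y x) sinN; ring.
  by rewrite max_r ?oppr_ge0 ?(ltW x0)// mulr0 sin0 mulrNN; ring.
rewrite gtr0_sg// gtr0_norm//; have [x0|x0] := leP 0 x.
  by rewrite max_l ?oppr_le0// mulr0 sin0; ring.
by rewrite max_r ?oppr_ge0 ?(ltW x0)// mulr0 sin0 mulrN sinN; ring.
Qed.

Lemma continuous_onem_cos : continuous (fun y : R => 1 - cos y).
Proof. by move=> y; apply: is_derive_continuous (is_derive_onem_cos y). Qed.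

Lemma continuous_idB_sin : continuous (fun y : R => y - sin y).
Proof. by move=> y; apply: is_derive_continuous (is_derive_idB_sin y). Qed.

Lemma idB_sin_ge0 x : 0 <= x -> 0 <= x - sin x.
Proof. by move=> x0; rewrite subr_ge0 sin_le_id. Qed.

End TrigKernels.

(** * Moments, mixtures and tails of Lévy exponents *)

Section LevyAsymptotics.
Context {R : realType} (nu : {measure set R -> \bar R}).
Local Notation leb := (@lebesgue_measure R).
Local Notation pos := (`]0, +oo[%classic : set R).
Hypotheses (I2 : nu.-integrable setT (EFin \o (fun x : R => x ^+ 2))).

(** Small jumps are controlled by the exponent [b], large ones by the second moment. *)
Lemma power_moment (b q : R) :
  (\int[nu]_(x in [set x : R | (`|x| <= 1)%R]) (`|x| `^ b)%R%:E < +oo)%E ->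
  0 < b -> b <= q -> q <= 2 -> nu.-integrable setT (EFin \o (fun x : R => `|x| `^ q)).
Proof.
move=> Hb b0 bq q2; pose B := [set x : R | `|x| <= 1].
have mB : measurable B.
  rewrite [B](_ : _ = `[-1, 1]%classic); first exact: measurable_itv.
  by apply/seteqP; split => x; rewrite /B /= in_itv/= ler_norml.
have mpow (r : R) : measurable_fun [set: R] (fun x : R => `|x| `^ r).
  by apply: (measurableT_comp (measurable_powR r)).
have IB : nu.-integrable setT (EFin \o (fun x : R => `|x| `^ b * \1_B x)).
  have : nu.-integrable B (EFin \o (fun x : R => `|x| `^ b)).
    apply/integrableP; split; first by apply/measurable_EFinP; exact: measurable_funTS.
    rewrite (eq_integral (fun x : R => (`|x| `^ b)%:E))// => x _ /=.
    by rewrite ger0_norm ?powR_ge0.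
  move=> /(integrable_mkcond _ mB); apply: eq_integrable => // x _ /=.
  by rewrite patchE indicE; case: (x \in B); rewrite ?mulr1 ?mulr0.
apply: (le_integrable_real measurableT (mpow q) (integrableD_real measurableT IB I2)) => x _.
rewrite ger0_norm ?powR_ge0// indicE.
have [->|xN0] := eqVneq x 0.
  by rewrite normr0 powR0 ?gt_eqF ?(lt_le_trans b0)// addr_ge0 ?sqr_ge0// mulr_ge0 ?powR_ge0.
have x0 : 0 < `|x| by rewrite normr_gt0.
have [x1|x1] := leP `|x| 1.
  rewrite mem_set// mulr1; have : `|x| `^ q <= `|x| `^ b by rewrite ger_powR// x0.
  by have := sqr_ge0 x; lra.
rewrite memNset; last by apply/negP; rewrite -ltNge.
by rewrite mulr0 add0r -real_normK ?num_real// -powR_mulrn// ler_powR// ltW.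
Qed.

Lemma levy_le_powR (p : R) : 1 <= p -> p <= 2 ->
  nu.-integrable setT (EFin \o (fun x : R => `|x| `^ p)) ->
  let K := 2 * \int[nu]_x `|x| `^ p in
  forall z, `|levy_C nu z| <= K * `|z| `^ p /\ `|levy_D nu z| <= K * `|z| `^ p.
Proof.
move=> p1 p2 Ip K z.
have mz : measurable_fun [set: R] (fun x : R => z * x) by exact: mulrl_measurable.
have Iz : nu.-integrable setT (EFin \o (fun x : R => 2 * `|z| `^ p * `|x| `^ p)).
  exact: integrableZl_real.
have E : K * `|z| `^ p = \int[nu]_x (2 * `|z| `^ p * `|x| `^ p).
  by rewrite RintegralZl// /K; ring.
have b (x : R) : 2 * `|z * x| `^ p = 2 * `|z| `^ p * `|x| `^ p.
  by rewrite normrM powRM// mulrA.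
split; rewrite E.
  have IC := levy_C_integrable I2 z.
  apply: (le_trans (le_normr_Rintegral measurableT IC)).
  apply: le_Rintegral => //.
    exact: integrable_norm.
  by move=> x _ /=; rewrite -b; exact: (trig_le_powR _ p1 p2).1.
have ID := levy_D_integrable I2 z.
apply: (le_trans (le_normr_Rintegral measurableT ID)).
apply: le_Rintegral => //.
  exact: integrable_norm.
by move=> x _ /=; rewrite -b; exact: (trig_le_powR _ p1 p2).2.
Qed.

Lemma Rintegral_sign_split (g : R -> R) : g 0 = 0 -> nu.-integrable setT (EFin \o g) ->
  \int[nu]_x g x = \int[nu]_(x in `]0, +oo[) g x + \int[nu]_(x in `]-oo, 0[) g x.
Proof.
move=> g0 Ig.
have m1 : measurable (`]-oo, 0[%classic : set R) by exact: measurable_itv.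
have m2 : measurable (`]0, +oo[%classic : set R) by exact: measurable_itv.
rewrite -Rintegral_setU//.
- rewrite [RHS]Rintegral_mkcond; apply: eq_Rintegral => x _; rewrite patchE.
  case: ifPn => //; rewrite notin_setE/= !in_itv/= andbT => /not_orP[/negP h1 /negP h2].
  have -> : x = 0; last by [].
  by apply/le_anti; rewrite !leNgt h1 h2.
- apply: integrableS Ig => //; exact: measurableU.
- rewrite disj_set2E; apply/eqP/seteqP; split => // x [] /=; rewrite !in_itv/= andbT => h1 h2.
  by have := lt_trans h1 h2; rewrite ltxx.
Qed.

Section StableMixture.
Hypothesis hnu : levy_measure nu.
Variable al : R.
Hypotheses (al1 : 1 < al) (al2 : al < 2).
Hypothesis Ial : nu.-integrable setT (EFin \o (fun x : R => `|x| `^ al)).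
Local Notation A := (Gamma (2 - al) / (al - 1) * sin ((al - 1) * (pi / 2))).
Local Notation B := (Gamma (2 - al) / (al - 1) * cos ((al - 1) * (pi / 2))).
Let Kp := \int[nu]_(x in `]0, +oo[) (x `^ al).
Let Km := \int[nu]_(x in `]-oo, 0[) (`|x| `^ al).
Let sf := levy_measure_sigma_finite hnu.

Let signed_moment (e c : R) : `|e| = 1 ->
  c != 0 -> \int[nu]_x ((if 0 <= c * x then 1 else e) * `|x| `^ al) =
  if 0 < c then Kp + e * Km else e * Kp + Km.
Proof.
move=> e1 c0; have al0 : 0 < al by have := al1; lra.
have m1 : measurable (`]-oo, 0[%classic : set R) by exact: measurable_itv.
have m2 : measurable (`]0, +oo[%classic : set R) by exact: measurable_itv.
have mw : measurable_fun [set: R] (fun x : R => if 0 <= c * x then 1 else e).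
  apply: measurable_fun_ifT => //.
  by apply: measurable_fun_ler => //; exact: mulrl_measurable.
have mp : measurable_fun [set: R] (fun x : R => `|x| `^ al).
  by apply: (measurableT_comp (measurable_powR al)).
have Ig : nu.-integrable setT (EFin \o (fun x : R => (if 0 <= c * x then 1 else e) * `|x| `^ al)).
  apply: (le_integrable_real measurableT _ Ial); first exact: measurable_funM.
  move=> x _; rewrite normrM (ger0_norm (powR_ge0 _ _)); case: ifP => _; rewrite ?e1 ?normr1 mul1r//.
rewrite Rintegral_sign_split//; last by rewrite normr0 powR0 ?mulr0 ?gt_eqF.
have I1 : nu.-integrable `]0, +oo[ (EFin \o (fun x : R => `|x| `^ al)) by apply: integrableS Ial.
have I1' : nu.-integrable `]-oo, 0[ (EFin \o (fun x : R => `|x| `^ al)) by apply: integrableS Ial.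
have KpE : Kp = \int[nu]_(x in `]0, +oo[) (`|x| `^ al).
  by apply: eq_Rintegral => x; rewrite inE/= in_itv/= andbT => x0; rewrite gtr0_norm.
have EZ (x : R) : x * Km = \int[nu]_(y in `]-oo, 0[) (x * `|y| `^ al) by rewrite RintegralZl.
have EZ' (x : R) : x * Kp = \int[nu]_(y in `]0, +oo[) (x * `|y| `^ al) by rewrite KpE RintegralZl.
have [cp|cn|c00] := ltgtP 0 c; last by rewrite c00 eqxx in c0.
- rewrite KpE EZ; congr (_ + _); apply: eq_Rintegral => x; rewrite inE/= in_itv/= ?andbT => x0.
    by rewrite mulr_ge0 ?(ltW cp) ?(ltW x0)// mul1r.
  by rewrite leNgt pmulr_rlt0// x0.
- rewrite EZ'; congr (_ + _); apply: eq_Rintegral => x; rewrite inE/= in_itv/= ?andbT => x0.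
    by rewrite leNgt nmulr_rlt0// x0.
  by rewrite mulr_le0 ?(ltW cn) ?(ltW x0)// mul1r.
Qed.

(** For each jump [x] the integral over the heights is [|z x|^al] times a stable constant, and
    integration over [nu] leaves the moments [Kp] and [Km]. *)
Lemma levy_C_mixture (z : R) :
  leb.-integrable pos (EFin \o (fun eta => levy_C nu (power_weight al eta * z))) /\
  \int[leb]_(eta in pos) levy_C nu (power_weight al eta * z) = A / al * (Kp + Km) * `|z| `^ al.
Proof.
have al0 : 0 < al by have := al1; lra.
have al12 : 1 < al < 2 by rewrite al1 al2.
have [I1 _ V1 _] := stable_integrals al12.
have k0 : 1 - cos 0 = 0 :> R by rewrite cos0 subrr.
have km := power_weight_layer al1 (@continuous_sin R) is_derive_onem_cos k0 I1.
have kg (y : R) : 0 <= y -> 0 <= 1 - cos y by rewrite subr_ge0 cos_le1.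
have Ik (c : R) : 0 <= c -> nu.-integrable setT (EFin \o (fun x : R => 1 - cos (c * `|x|))).
  move=> c0; have := levy_C_integrable I2 c; apply: eq_integrable => // x _ /=; congr (_%:E).
  by rewrite -{2}(ger0_norm c0) -normrM cos_norm.
have [J1 J2] := @power_mixture R al (sigma_finite_copy sf) _ _ 1 Ial continuous_onem_cos kg (normr1 R) Ik km z.
have E eta : levy_C nu (power_weight al eta * z) =
  \int[nu]_x ((if 0 <= z * x then 1 else 1) * (1 - cos (power_weight al eta * `|z * x|))).
  apply: eq_Rintegral => x _; have p0 : 0 <= power_weight al eta by exact: powR_ge0.
  rewrite -[in LHS]cos_norm -mulrA normrM (ger0_norm p0).
  by case: ifP; rewrite mul1r.
split.
  by apply: eq_integrable J1 => // eta _ /=; rewrite E.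
under eq_Rintegral do rewrite E.
rewrite J2 V1.
have [->|z0] := eqVneq z 0; first by rewrite normr0 powR0 ?gt_eqF// !mulr0 mul0r.
have S := signed_moment (normr1 R) z0.
transitivity (al^-1 * A * `|z| `^ al * (if 0 < z then Kp + 1 * Km else 1 * Kp + Km)).
  by congr (_ * _); exact: S.
rewrite !mul1r; by case: ifP => _; field; rewrite !gt_eqF// subr_gt0.
Qed.

Lemma levy_D_mixture (z : R) :
  leb.-integrable pos (EFin \o (fun eta => levy_D nu (power_weight al eta * z))) /\
  \int[leb]_(eta in pos) levy_D nu (power_weight al eta * z) = - (B / al * (Kp - Km) * (Num.sg z * `|z| `^ al)).
Proof.
have al0 : 0 < al by have := al1; lra.
have al12 : 1 < al < 2 by rewrite al1 al2.
have [_ I1 _ V1] := stable_integrals al12.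
have k0 : 0 - sin 0 = 0 :> R by rewrite sin0 subrr.
have km := power_weight_layer al1 continuous_onem_cos is_derive_idB_sin k0 I1.
have Ik (c : R) : 0 <= c -> nu.-integrable setT (EFin \o (fun x : R => c * `|x| - sin (c * `|x|))).
  move=> c0; have := integrable_norm (levy_D_integrable I2 c); apply: eq_integrable => // x _ /=; congr (_%:E).
  rewrite sinB_norm normrN normrM (_ : `|if _ then _ else _| = 1); last by case: ifP; rewrite ?normrN1 ?normr1.
  by rewrite mul1r normrM (ger0_norm c0) ger0_norm// idB_sin_ge0// mulr_ge0.
have [J1 J2] := @power_mixture R al (sigma_finite_copy sf) _ _ (-1) Ial continuous_idB_sin idB_sin_ge0 (normrN1 R) Ik km z.
have pw eta : 0 < eta -> 0 < power_weight al eta by move=> e0; rewrite powR_gt0// mulr_gt0.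
(* For a positive weight the sign of the argument is that of [z * x]; the odd kernel becomes this
   sign times the nonnegative [y - sin y] at absolute values, up to the factor -1. *)
have E eta : 0 < eta -> levy_D nu (power_weight al eta * z) =
  - 1 * \int[nu]_x ((if 0 <= z * x then 1 else -1) * (power_weight al eta * `|z * x| - sin (power_weight al eta * `|z * x|))).
  move=> /pw p0; have e1 (x : R) : sin (power_weight al eta * z * x) - power_weight al eta * z * x =
      - 1 * ((if 0 <= z * x then 1 else -1) * (power_weight al eta * `|z * x| - sin (power_weight al eta * `|z * x|))).
    by rewrite sinB_norm mulN1r -mulrA pmulr_rge0// normrM (gtr0_norm p0).
  have ID := levy_D_integrable I2 (power_weight al eta * z).
  rewrite -RintegralZl//; first by apply: eq_Rintegral => x _; exact: e1.
  apply: eq_integrable (integrableZl_real (-1) measurableT ID) => // x _.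
  by rewrite /=; congr (_%:E); rewrite e1 2!mulN1r opprK.
have mpos : measurable (pos : set (measurableTypeR R)) by exact: measurable_itv.
split.
  have := @integrableZl_real _ _ _ leb pos _ (-1) mpos J1.
  by apply: (@eq_integrable_real _ _ _ leb pos _ _ mpos) => eta; rewrite inE/= in_itv/= andbT => /E ->.
transitivity (\int[leb]_(eta in pos) (- 1 * \int[nu]_x ((if 0 <= z * x then 1 else -1) * (power_weight al eta * `|z * x| - sin (power_weight al eta * `|z * x|))))).
  by apply: eq_Rintegral => eta; rewrite inE/= in_itv/= andbT => /E ->.
rewrite RintegralZl// J2 V1.
have [->|z0] := eqVneq z 0; first by rewrite normr0 powR0 ?gt_eqF// !mulr0 !mul0r !mulr0 oppr0.
have S := signed_moment (normrN1 R) z0.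
transitivity (-1 * (al^-1 * B * `|z| `^ al * (if 0 < z then Kp + - 1 * Km else - 1 * Kp + Km))).
  by congr (_ * (_ * _)); exact: S.
move: z0; rewrite neq_lt => /orP[zn|zp].
  by rewrite ltNge (ltW zn)/= ltr0_sg//; field; rewrite !gt_eqF// subr_gt0.
by rewrite zp gtr0_sg//; field; rewrite !gt_eqF// subr_gt0.
Qed.
End StableMixture.

Section OneSidedTail.
Hypothesis hnu : levy_measure nu.
Variables (g : R -> R) (be Kt : R).
Hypotheses (mg : measurable_fun setT g) (gE : forall x, `|g x| = `|x|).
Hypotheses (be1 : 1 < be) (be2 : be < 2).
(** With [g] the identity or the opposite this is the right or the left tail of [nu]. *)
Let N (x : R) : R := fine (nu [set t | x < g t]).
Hypothesis N_lim : x `^ be * N x @[x --> 0^'+] --> Kt.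
Let M : R := \int[nu]_x (x ^+ 2).

Let mS (x : R) : measurable [set t : R | x < g t].
Proof.
rewrite -[X in measurable X]setTI; exact: (measurable_fun_ltr (f := cst x)).
Qed.

Let chebyshev (x : R) : 0 < x -> ((x ^+ 2)%:E * nu [set t | (x < g t)%R] <= M%:E)%E.
Proof.
move=> x0.
rewrite -integral_cst//; apply: (@le_trans _ _ (\int[nu]_(t in [set t | (x < g t)%R]) (t ^+ 2)%:E)%E).
  apply: ge0_le_integral => //.
  - by move=> t _; rewrite lee_fin sqr_ge0.
  - apply/measurable_EFinP; apply: measurable_funTS.
    by apply: measurable_funX.
  - move=> t /= xt; rewrite lee_fin -(real_normK (num_real t)) -gE.
    by rewrite ler_pXn2r// ?nnegrE ?(ltW x0)// (le_trans (ltW xt)) ?ler_norm.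
apply: (@le_trans _ _ (\int[nu]_t (t ^+ 2)%:E)%E).
  apply: ge0_subset_integral => //; first exact: measurable_int I2.
  by move=> t _; rewrite lee_fin sqr_ge0.
by rewrite /M /Rintegral fineK//; exact: integrable_fin_num I2.
Qed.

Let N_fin (x : R) : 0 < x -> nu [set t | (x < g t)%R] = (N x)%:E.
Proof.
move=> x0; rewrite /N fineK// ge0_fin_numE//.
have := chebyshev x0; case: (nu _) => [r _||]; rewrite ?ltry ?ltNyr//.
by rewrite gt0_muley ?lte_fin ?exprn_gt0// leNgt ltry.
Qed.

Let N0 (x : R) : 0 <= N x. Proof. exact: fine_ge0. Qed.

Let N_cheb (x : R) : 0 < x -> x ^+ 2 * N x <= M.
Proof. by move=> x0; have := chebyshev x0; rewrite N_fin// -EFinM lee_fin. Qed.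

Let mN : measurable_fun pos N.
Proof.
apply: nonincreasing_pos_measurable => x y x0 xy.
rewrite -lee_fin -!N_fin ?(lt_le_trans x0)//; apply: le_measure; rewrite ?inE//.
by move=> t /=; exact: le_lt_trans.
Qed.

(** Near 0 the assumed limit bounds the product; away from 0 the Chebyshev bound [M / x^2] does,
    because [be < 2]. *)
Let N_le : exists Cn, forall x, 0 < x -> x `^ be * N x <= Cn.
Proof.
have M0 : 0 <= M by apply: Rintegral_ge0 => // x _; exact: sqr_ge0.
have [dl /= d0 Hd] : \forall x \near 0^'+, `|Kt - x `^ be * N x| <= 1.
  by move/cvgrPdist_le : N_lim; exact.
exists (Num.max (Kt + 1) (dl `^ (be - 2) * M)) => x x0.
have [xd|dx] := ltP x dl.
  have := Hd x; rewrite /= sub0r normrN gtr0_norm// => /(_ xd x0).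
  by rewrite ler_norml le_max => /andP[h _]; apply/orP; left; lra.
rewrite le_max; apply/orP; right.
have -> : x `^ be * N x = x `^ (be - 2) * (x ^+ 2 * N x).
  by rewrite mulrA -powR_mulrn ?(ltW x0)// -powRD ?(gt_eqF x0) ?implybT// subrK.
apply: ler_pM; rewrite ?powR_ge0 ?mulr_ge0 ?sqr_ge0 ?N_cheb ?(ltW x0)//.
rewrite -(opprB 2 be) !powRN lef_pV2 ?posrE ?powR_gt0//.
by apply: ge0_ler_powR; rewrite ?nnegrE ?subr_ge0 ?(ltW be2) ?(ltW d0) ?(ltW x0).
Qed.

Variables (k k' : R -> R).
Hypotheses (ck' : continuous k') (dk : forall x : R, is_derive x 1 k (k' x)) (k0 : k 0 = 0).
Hypothesis k'_le : forall y, `|k' y| <= 2 * Num.min 1 `|y|.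

Lemma one_sided_tail :
  [/\ forall w, 0 < w -> nu.-integrable setT (EFin \o (fun x => k (w * Num.max 0 (g x)))),
      exists C, forall w, 0 < w -> `|\int[nu]_x k (w * Num.max 0 (g x))| <= C * w `^ be &
      forall z : nat -> R, (forall n, 0 < z n) -> z n @[n --> \oo] --> +oo ->
        (\int[nu]_x k (z n * Num.max 0 (g x))) / z n `^ be @[n --> \oo] -->
        Kt * \int[leb]_(y in pos) (k' y * y `^ (- be))].
Proof.
have [Cn NC] := N_le.
have H := @tail_layer_cake R be Cn k k' N be1 be2 ck' dk k0 k'_le (fun x _ => N0 x) NC mN _ R
  (sigma_finite_copy (levy_measure_sigma_finite hnu)) g mg N_fin.
split; first by move=> w /H[].
  have [C HC] := tail_integral_le be1 be2 ck' k'_le (fun x _ => N0 x) NC mN.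
  by exists C => w w0; have [_ E] := H w w0; have := HC _ w0; rewrite -E.
move=> z z0 zoo.
have := tail_integral_cvg be1 be2 ck' k'_le (fun x _ => N0 x) NC mN N_lim z0 zoo.
apply: cvg_trans; apply: near_eq_cvg; near=> n.
by have [_ <-] := H _ (z0 n).
Unshelve. all: by end_near. Qed.
End OneSidedTail.

Section StableTails.
Hypothesis hnu : levy_measure nu.
Variables (be Ktp Ktm : R).
Hypotheses (be1 : 1 < be) (be2 : be < 2).
Hypothesis Np_lim : x `^ be * fine (nu `]x, +oo[%classic) @[x --> 0^'+] --> Ktp.
Hypothesis Nm_lim : x `^ be * fine (nu `]-oo, (- x)[%classic) @[x --> 0^'+] --> Ktm.
Local Notation A := (Gamma (2 - be) / (be - 1) * sin ((be - 1) * (pi / 2))).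
Local Notation B := (Gamma (2 - be) / (be - 1) * cos ((be - 1) * (pi / 2))).

Let be12 : 1 < be < 2. Proof. by rewrite be1 be2. Qed.

Let Np_lim' : x `^ be * fine (nu [set t | x < t]) @[x --> 0^'+] --> Ktp.
Proof.
suff E (x : R) : [set t | x < t] = `]x, +oo[%classic by under eq_fun do rewrite E.
by apply/seteqP; split => t; rewrite /= in_itv/= andbT.
Qed.

Let Nm_lim' : x `^ be * fine (nu [set t | x < - t]) @[x --> 0^'+] --> Ktm.
Proof.
suff E (x : R) : [set t | x < - t] = `]-oo, (- x)[%classic by under eq_fun do rewrite E.
by apply/seteqP; split => t; rewrite /= in_itv/= ltrNr.
Qed.

Let sin_bound (y : R) : `|sin y| <= 2 * Num.min 1 `|y|.
Proof.
have h1 := norm_sin_le y; have h2 : `|sin y| <= 1 by exact: sin_max.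
have h3 := normr_ge0 y; case: (leP 1 `|y|) => h; lra.
Qed.

Let onem_cos_bound (y : R) : `|1 - cos y| <= 2 * Num.min 1 `|y|.
Proof.
have h1 := cosB1_le y; have h2 := cos_geN1 y; have h3 := cos_le1 y; have h4 := normr_ge0 y.
case: (leP 1 `|y|) => h; last lra.
by rewrite ger0_norm; lra.
Qed.

(** Reduces [z] to its sign: [|z|] goes into the sequence and comes back as [|z|^be] from the
    normalisation. *)
Let homogeneous (f : R -> R) (l z : R) (zn : nat -> R) : f 0 = 0 ->
  (forall wn : nat -> R, (forall n, 0 < wn n) -> wn n @[n --> \oo] --> +oo ->
    f (Num.sg z * wn n) / wn n `^ be @[n --> \oo] --> l) ->
  (forall n, 0 < zn n) -> zn n @[n --> \oo] --> +oo ->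
  f (z * zn n) / zn n `^ be @[n --> \oo] --> l * `|z| `^ be.
Proof.
move=> f0 H zn0 znoo; have be0 : 0 < be by have := be1; lra.
have [->|zN0] := eqVneq z 0.
  rewrite normr0 powR0 ?gt_eqF// mulr0.
  by under eq_fun do rewrite mul0r f0 mul0r; exact: cvg_cst.
have z0 : 0 < `|z| by rewrite normr_gt0.
have wn0 n : 0 < `|z| * zn n by rewrite mulr_gt0.
have woo : `|z| * zn n @[n --> \oo] --> +oo.
  exact: (cvg_comp zn (fun r => `|z| * r) znoo (gt0_cvgMry z0 cvg_id)).
have H' : f (Num.sg z * (`|z| * zn n)) / (`|z| * zn n) `^ be * `|z| `^ be @[n --> \oo] --> l * `|z| `^ be.
  by apply: cvgMl; exact: H.
apply: cvg_trans H'; apply: near_eq_cvg; near=> n.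
rewrite mulrA -numEsg powRM ?(ltW z0) ?(ltW (zn0 n))//.
by field; rewrite !gt_eqF ?powR_gt0.
Unshelve. all: by end_near. Qed.

Lemma levy_C_tail :
  (exists K, forall y, `|levy_C nu y| <= K * `|y| `^ be) /\
  forall (z : R) (zn : nat -> R), (forall n, 0 < zn n) -> zn n @[n --> \oo] --> +oo ->
    levy_C nu (z * zn n) / zn n `^ be @[n --> \oo] --> A * (Ktp + Ktm) * `|z| `^ be.
Proof.
have [_ _ V _] := stable_integrals be12; have be0 : 0 < be by have := be1; lra.
have k0 : 1 - cos 0 = 0 :> R by rewrite cos0 subrr.
have [Ip [Cp Bp] Lp] := one_sided_tail hnu (@measurable_id _ R setT) (fun=> erefl) be1 be2 Np_lim'
  (@continuous_sin R) is_derive_onem_cos k0 sin_bound.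
have [Im [Cm Bm] Lm] := one_sided_tail hnu (@oppr_measurable R setT) (@normrN _ R) be1 be2 Nm_lim'
  (@continuous_sin R) is_derive_onem_cos k0 sin_bound.
have E (y : R) : y != 0 -> levy_C nu y = \int[nu]_x (1 - cos (`|y| * Num.max 0 x)) +
    \int[nu]_x (1 - cos (`|y| * Num.max 0 (- x))).
  move=> y0; have ny : 0 < `|y| by rewrite normr_gt0.
  rewrite -RintegralD//; [|exact: Ip|exact: Im].
  by apply: eq_Rintegral => x _; exact: onem_cos_split.
split.
  exists (Cp + Cm) => y; have [->|y0] := eqVneq y 0.
    by rewrite (levy_C0 I2) !normr0 powR0 ?gt_eqF// mulr0.
  have ny : 0 < `|y| by rewrite normr_gt0.
  by rewrite E// mulrDl; apply: (le_trans (ler_normD _ _)); apply: lerD; [exact: Bp|exact: Bm].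
move=> z zn zn0 znoo.
have [->|zN0] := eqVneq z 0.
  rewrite normr0 powR0 ?gt_eqF// mulr0.
  by under eq_fun do rewrite mul0r (levy_C0 I2) mul0r; exact: cvg_cst.
apply: homogeneous => //; first exact: levy_C0.
move=> wn wn0 woo.
have H : (\int[nu]_x (1 - cos (wn n * Num.max 0 x))) / wn n `^ be +
    (\int[nu]_x (1 - cos (wn n * Num.max 0 (- x)))) / wn n `^ be @[n --> \oo] --> A * (Ktp + Ktm).
  rewrite (_ : A * _ = Ktp * A + Ktm * A); last by ring.
  by rewrite -V; apply: cvgD; [exact: Lp|exact: Lm].
apply: cvg_trans H; apply: near_eq_cvg; near=> n.
have w0 : Num.sg z * wn n != 0 by apply: mulf_neq0; rewrite ?sgr_eq0// gt_eqF.
rewrite (E _ w0) normrM normr_sg zN0 mul1r (gtr0_norm (wn0 n)).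
by rewrite mulrDl.
Unshelve. all: by end_near. Qed.

Lemma levy_D_tail :
  (exists K, forall y, `|levy_D nu y| <= K * `|y| `^ be) /\
  forall (z : R) (zn : nat -> R), (forall n, 0 < zn n) -> zn n @[n --> \oo] --> +oo ->
    levy_D nu (z * zn n) / zn n `^ be @[n --> \oo] --> - (B * (Ktp - Ktm) * (Num.sg z * `|z| `^ be)).
Proof.
have [_ _ _ V] := stable_integrals be12; have be0 : 0 < be by have := be1; lra.
have k0 : 0 - sin 0 = 0 :> R by rewrite sin0 subrr.
have [Ip [Cp Bp] Lp] := one_sided_tail hnu (@measurable_id _ R setT) (fun=> erefl) be1 be2 Np_lim'
  continuous_onem_cos is_derive_idB_sin k0 onem_cos_bound.
have [Im [Cm Bm] Lm] := one_sided_tail hnu (@oppr_measurable R setT) (@normrN _ R) be1 be2 Nm_lim'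
  continuous_onem_cos is_derive_idB_sin k0 onem_cos_bound.
pose k (y : R) := y - sin y.
have E (y : R) : y != 0 -> levy_D nu y = - Num.sg y * (\int[nu]_x k (`|y| * Num.max 0 x) -
    \int[nu]_x k (`|y| * Num.max 0 (- x))).
  move=> y0; have ny : 0 < `|y| by rewrite normr_gt0.
  have Ip' := Ip _ ny; have Im' := Im _ ny.
  rewrite -RintegralB// -RintegralZl//; last exact: integrableB_real.
  by apply: eq_Rintegral => x _; exact: sinB_split.
split.
  exists (Cp + Cm) => y; have [->|y0] := eqVneq y 0.
    by rewrite (levy_D0 I2) !normr0 powR0 ?gt_eqF// mulr0.
  have ny : 0 < `|y| by rewrite normr_gt0.
  rewrite E// normrM normrN normr_sg y0 mul1r mulrDl; apply: (le_trans (ler_normB _ _)); apply: lerD; [exact: Bp|exact: Bm].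
move=> z zn zn0 znoo.
have [->|zN0] := eqVneq z 0.
  rewrite normr0 powR0 ?gt_eqF// !mulr0 oppr0.
  by under eq_fun do rewrite mul0r (levy_D0 I2) mul0r; exact: cvg_cst.
rewrite (_ : - _ = - Num.sg z * ((Ktp - Ktm) * B) * `|z| `^ be); last by ring.
apply: homogeneous => //; first exact: levy_D0.
move=> wn wn0 woo.
have H' : - Num.sg z * ((\int[nu]_x k (wn n * Num.max 0 x)) / wn n `^ be -
    (\int[nu]_x k (wn n * Num.max 0 (- x))) / wn n `^ be) @[n --> \oo] --> - Num.sg z * ((Ktp - Ktm) * B).
  rewrite (_ : (Ktp - Ktm) * B = Ktp * B - Ktm * B); last by ring.
  by rewrite -V; apply: cvgMr; apply: cvgB; [exact: Lp|exact: Lm].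
apply: cvg_trans H'; apply: near_eq_cvg; near=> n.
have w0 : Num.sg z * wn n != 0 by apply: mulf_neq0; rewrite ?sgr_eq0// gt_eqF.
rewrite (E _ w0) normrM normr_sg zN0 mul1r (gtr0_norm (wn0 n)).
by rewrite sgrM sgr_id (gtr0_sg (wn0 n)) mulr1 -mulrA mulrBl.
Unshelve. all: by end_near. Qed.
End StableTails.

End LevyAsymptotics.

(** * Limits of the partial sums *)

Section PartialSums.
Context {R : realType} d (T : measurableType d) (P : probability T R).
Variables (gamma m : R) (nu : {measure set R -> \bar R}) (L : set (R * R) -> {RV P >-> R}).
Hypotheses (hL : levy_basis gamma 0 nu L) (I2 : nu.-integrable setT (EFin \o (fun x : R => x ^+ 2))).
Hypothesis psiE : forall z,
  levy_exponent gamma 0 nu z = ((- levy_C nu z) +i* (m * z + levy_D nu z))%C.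
Variables (a : R -> R) (al ell : R).
Hypotheses (ha : trawl_function a) (al1 : 1 < al) (ell0 : 0 < ell).
Hypothesis tail : a s * s `^ al @[s --> +oo] --> ell.
Local Notation leb2 := (@lebesgue_measure R \x @lebesgue_measure R)%E.

(** Exchanging the sums over times and grid points gives each grid point the total weight of the
    partial sums that contain it; expectations are [m] times areas, as [levy_basis_sum_ecf]
    requires. *)
Lemma partial_sum_ecf k0 (u t : 'I_k0 -> R) (Delta : nat -> R) n (s : R) (Nmax : nat) :
  (forall i, (Num.truncn (n%:R * t i) <= Nmax)%N) ->
  let wc := weighted_count (fun k : 'I_Nmax => trawl_set_at a (k%:R * Delta n))
    (fun k => \sum_i u i * (Delta n / s) * (k < Num.truncn (n%:R * t i))%N%:R) in
  ecf P (fun w => \sum_i u i * (Delta n / s * partial_sum (trawl_process a L) Delta n (t i) w)) =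
  cexp ((- \int[leb2]_p levy_C nu (wc p)) +i* (\int[leb2]_p levy_D nu (wc p)))%C.
Proof.
move=> Nle wc; pose A (k : 'I_Nmax) := trawl_set_at a (k%:R * Delta n).
have fA k : fin_borel (A k) by exact: (trawl_set_at_borel ha al1 ell0 tail).
rewrite -(levy_basis_sum_ecf hL _ fA psiE (levy_C0 I2) (levy_D0 I2)).
congr (ecf P _); apply/funext => w.
pose Z (k : nat) : R := L (trawl_set_at a (k%:R * Delta n)) w - m * fine (Leb2 (trawl_set_at a (k%:R * Delta n))).
have pE i : partial_sum (trawl_process a L) Delta n (t i) w =
    \sum_(k < Nmax) (k < Num.truncn (n%:R * t i))%N%:R * Z k.
  transitivity (\sum_(0 <= k < Num.truncn (n%:R * t i)) Z k).
    apply: eq_bigr => k _; rewrite /Z /trawl_process (levy_basis_mean hL _ I2 psiE)//.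
    exact: (trawl_set_at_borel ha al1 ell0 tail).
  rewrite big_mkord (big_ord_widen _ Z (Nle i)) big_mkcond/=.
  by apply: eq_bigr => k _; case: ifP => _; rewrite ?mul0r// mul1r.
under eq_bigr => i _ do rewrite pE mulrA mulr_sumr.
rewrite exchange_big/=; apply: eq_bigr => k _; rewrite mulr_suml.
by apply: eq_bigr => i _; rewrite mulrA.
Qed.

End PartialSums.

Lemma measurable_partial_sum {R : realType} d (T : measurableType d) (P : probability T R)
    (X : R -> {RV P >-> R}) (Delta : nat -> R) n (t : R) :
  measurable_fun setT (partial_sum X Delta n t).
Proof.
by apply: measurable_sum => k; apply: measurable_funB.
Qed.

(** * The regime of the stable Lévy process *)

Section StableRegime.
Context {R : realType}.
Local Notation leb := (@lebesgue_measure R).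
Local Notation leb2 := (leb \x leb)%E.
Local Notation pos := (`]0, +oo[%classic : set R).
Variables (a : R -> R) (al c : R) (Delta : nat -> R).
Hypotheses (ha : trawl_function a) (al1 : 1 < al) (al2 : al < 2) (c0 : 0 < c).
Hypothesis tail : a s * s `^ al @[s --> +oo] --> c / al.
Hypotheses (Delta_gt0 : forall n, 0 < Delta n) (Delta_dec : forall m n, (m <= n)%N -> Delta n <= Delta m).
Hypotheses (Delta_0 : Delta n @[n --> \oo] --> 0) (nDelta : n%:R * Delta n @[n --> \oo] --> +oo).
Variables (k0 : nat) (u t : 'I_k0 -> R) (t0 : forall i, 0 <= t i).
Variables (f Lam : R -> R) (K p : R).
Hypotheses (fc : continuous f) (f0 : f 0 = 0) (p1 : 1 <= p) (pal : p < al).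
Hypotheses (fp : forall x, `|f x| <= K * `|x| `^ p) (f2 : forall x, `|f x| <= K * `|x| `^ 2).
Hypothesis LamE : forall x, leb.-integrable pos (EFin \o (fun eta => f (power_weight al eta * x))) /\
  \int[leb]_(eta in pos) f (power_weight al eta * x) = Lam x.

Let N n i := Num.truncn (n%:R * t i).
Let s n : R := (c * n%:R * Delta n) `^ al^-1.

(** Heights are rescaled by [rho = 1 / T], so that [T * rho = 1] and [rho * s^al = c]. For each
    [eta] the limit is an integral over time; exchanging it with the integral over [eta] produces
    [Lam]. *)
Lemma stable_regime_cvg :
  \int[leb2]_z f (weighted_count (fun k : 'I_(\max_i N n i) => trawl_set_at a (k%:R * Delta n))
    (fun k => \sum_i u i * (Delta n / s n) * (k < N n i)%N%:R) z) @[n --> \oo] -->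
  \int[leb]_(v in `[0, +oo[) Lam (step_sum u t v).
Proof.
have al1' := al1; have c0' := c0; have al0 : 0 < al by lra.
have ell0 : 0 < c / al by rewrite divr_gt0.
have K0 : 0 <= K by have := fp 1; rewrite normr1 powR1 mulr1; exact: le_trans.
(* The uniform bounds are stated for all [n], whereas [T] is 0 at [n = 0]; the sequences are shifted
   until [T >= 1]. *)
have [n0 _ Hn0] : \forall n \near \oo, 1 <= n%:R * Delta n.
  by move/cvgryPge : nDelta; exact.
pose T n : R := (n + n0)%:R * Delta (n + n0)%N.
have T1 n : 1 <= T n by apply: Hn0; rewrite /= leq_addl.
have Tgt n : 0 < T n by exact: lt_le_trans (T1 n).
have Dgt n : 0 < Delta (n + n0)%N by [].
have Dle n : Delta (n + n0)%N <= Delta 0%N by exact: Delta_dec.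
have sE n : s (n + n0)%N = (c * T n) `^ al^-1 by rewrite /s -mulrA.
have sgt n : 0 < s (n + n0)%N by rewrite sE powR_gt0// mulr_gt0.
have sal n : s (n + n0)%N `^ al = c * T n.
  by rewrite sE -powRrM mulVf ?gt_eqF// powRr1// mulr_ge0 ?ltW.
have rgt n : 0 < (T n)^-1 by rewrite invr_gt0.
have NT n i : (N (n + n0)%N i)%:R * Delta (n + n0)%N <= t i * T n.
  rewrite /T mulrA ler_pM2r// mulrC truncn_le mulr_ge0//.
have Lr n : c <= (T n)^-1 * s (n + n0)%N `^ al.
  by rewrite sal mulrC mulfK ?gt_eqF.
(* A root of order [al] is below [c T] when [c T >= 1], and below 1, hence below [T], otherwise. *)
have sT n : s (n + n0)%N <= (1 + c) * T n.
  have h := T1 n; have h' : 0 < c * T n by rewrite mulr_gt0.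
  have [h1|h1] := leP 1 (c * T n).
    rewrite sE; apply: (@le_trans _ _ (c * T n)); last by lra.
    by rewrite -[leRHS]powRr1 ?(ltW h')// ler_powR// invf_le1 ?(ltW al1').
  rewrite sE; apply: (@le_trans _ _ 1); last by lra.
  have : (c * T n) `^ al^-1 <= 1 `^ al^-1.
    by apply: ge0_ler_powR; rewrite ?nnegrE ?invr_ge0 ?(ltW al0) ?(ltW h') ?(ltW h1).
  by rewrite powR1.
have shiftoo (x : nat -> R) l : x n @[n --> \oo] --> l -> x (n + n0)%N @[n --> \oo] --> l.
  by rewrite -(cvg_shiftn n0).
have Too : T n @[n --> \oo] --> +oo by have := nDelta; rewrite -(cvg_shiftn n0).
have D0 : Delta (n + n0)%N @[n --> \oo] --> 0 by exact: shiftoo.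
have r0 : (T n)^-1 @[n --> \oo] --> 0 by apply/gtr0_cvgV0; [exact: nearW|exact: Too].
have cToo : c * T n @[n --> \oo] --> +oo.
  exact: (cvg_comp T (fun r => c * r) Too (gt0_cvgMry c0 cvg_id)).
have powT0 (q : R) : q < 0 -> (c * T n) `^ q @[n --> \oo] --> (0 : R).
  by move=> q0; exact: (cvg_comp _ _ cToo (powR_cvgy0 q0)).
have aV : 0 < al^-1 by rewrite invr_gt0.
have sV0 : (s (n + n0)%N)^-1 @[n --> \oo] --> 0.
  have aV' : - al^-1 < 0 by rewrite oppr_lt0.
  by under eq_fun do rewrite sE -powRN; exact: powT0.
have soo : s (n + n0)%N @[n --> \oo] --> +oo.
  by apply/gtr0_cvgV0 => //; exact: nearW.
have sT0 : s (n + n0)%N / T n @[n --> \oo] --> 0.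
  have q0 : al^-1 - 1 < 0 by rewrite subr_lt0 invf_lt1.
  have H : c * (c * T n) `^ (al^-1 - 1) @[n --> \oo] --> c * 0 by apply: cvgMr; exact: powT0.
  rewrite mulr0 in H; apply: cvg_trans H; apply: near_eq_cvg; near=> n.
  have h' : 0 < c * T n by rewrite mulr_gt0.
  rewrite sE powRD ?(gt_eqF h') ?implybT// -(opprK 1) powRN opprK powRr1 ?(ltW h')//.
  by field; rewrite !gt_eqF.
have Ds : Delta (n + n0)%N / s (n + n0)%N @[n --> \oo] --> 0.
  have H : Delta (n + n0)%N * (s (n + n0)%N)^-1 @[n --> \oo] --> (0 * 0 : R) by apply: cvgM.
  by rewrite mulr0 in H; exact: H.
have Nt i : (N (n + n0)%N i)%:R * Delta (n + n0)%N / T n @[n --> \oo] --> t i.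
  apply: (@squeeze_cvgr _ _ _ _ (fun n => t i - Delta (n + n0)%N) (cst (t i))); last exact: cvg_cst; last first.
    by rewrite -[X in _ --> X]subr0; apply: cvgB => //; exact: cvg_cst.
  apply: nearW => n; rewrite ler_pdivrMr// NT andbT ler_pdivlMr//.
  have h1 := truncnS_gt ((n + n0)%:R * t i); have h2 := T1 n; have h3 := Dgt n.
  have h4 : (n + n0)%:R * t i * Delta (n + n0)%N <= (N (n + n0)%N i)%:R * Delta (n + n0)%N + Delta (n + n0)%N.
    by rewrite -{3}[Delta _]mul1r -mulrDl ler_pM2r// natr1 ltW.
  have h5 : Delta (n + n0)%N <= Delta (n + n0)%N * T n by rewrite ler_peMr// ltW.
  have h6 : t i * T n = (n + n0)%:R * t i * Delta (n + n0)%N by rewrite /T; ring.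
  rewrite mulrBl h6; lra.
pose phi (eta : R) : R := power_weight al eta.
have phi_gt0 (eta : R) : 0 < eta -> 0 < phi eta by move=> e0; rewrite powR_gt0// mulr_gt0.
have [tau [tau0 tauD tauE]] := sorted_grid t0.
pose G n (eta : R) : R := section_integral a u f (N (n + n0)%N) (Delta (n + n0)%N) (T n) (s (n + n0)%N) ((T n)^-1 * eta).
pose Ginf (eta : R) : R := \sum_(j < k0) (tau j.+1 - tau j) * f (phi eta * step_sum u t (tau j)).
have Gcvg (eta : R) : 0 < eta -> G n eta @[n --> \oo] --> Ginf eta.
  move=> e0; have F0 : f (phi eta * 0) = 0 by rewrite mulr0.
  have [IF EF] := @step_sum_grid R k0 u t tau (fun x => f (phi eta * x)) F0 tau0 tauD tauE.
  rewrite /Ginf -EF Rintegral_mkcond.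
  have m0 : measurable (`[0%R, +oo[%classic : set (measurableTypeR R)) by exact: measurable_itv.
  apply: (section_integral_cvg ha al1 ell0 tail Dgt Dle Tgt sgt rgt NT c0 Lr sT (fun=> fc) K0 p1 (fun=> fp) e0 r0).
    have /measurable_EFinP mF := measurable_int _ IF.
    exact: (measurable_restrictT _ m0).1 mF.
  (* The ends of the observation windows, where the count need not converge to the step function. *)
  pose Z : set R := [set 0] `|` range t.
  have cZ : countable Z.
    apply: finite_set_countable; rewrite finite_setU; split; first exact: finite_set1.
    by apply: finite_image; exact: finite_finset.
  exists Z; split; [exact: countable_measurable|exact: countable_lebesgue_measure0|].
  move=> v /= Hv; apply: contrapT => Zv; apply: Hv.
  have v0 : v != 0 by apply/eqP => v0; apply: Zv; left.
  have vt i : v != t i by apply/eqP => vt; apply: Zv; right; exists i.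
  set gn := fun n => trawl_inverse a ((T n)^-1 * eta).
  have gn0 : \forall n \near \oo, 0 <= gn n.
    have H : (T n)^-1 * eta @[n --> \oo] --> 0 * eta by apply: cvgMl.
    rewrite mul0r in H.
    have a0 := trawl_at0_gt0 ha ell0 tail.
    have h : \forall n \near \oo, (T n)^-1 * eta < a 0 by apply: (cvgr_lt _ H).
    near=> n.
    apply: (trawl_inverse_ge0 ha al1 ell0 tail); rewrite mulr_gt0//=; apply: ltW; near: n; exact: h.
  have gs : gn n / s (n + n0)%N @[n --> \oo] --> phi eta.
    apply: (trawl_inverse_cvg ha al1 ell0 tail (phi_gt0 _ e0) _ soo); first by move=> n; rewrite mulr_gt0.
    (* The origin of [power_weight]: the height [eta / T] times [s^al] is [c eta], and the tail
       constant is [c / al], so the limiting length [phi] has [phi^al = 1 / (al eta)]. *)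
    have -> : c / al / phi eta `^ al = c * eta.
      rewrite /phi /power_weight -powRrM mulNr mulVf ?gt_eqF// powR_inv1 ?mulr_ge0 ?ltW// invrK.
      by field; rewrite gt_eqF.
    have E n : (T n)^-1 * eta * s (n + n0)%N `^ al = c * eta.
      by rewrite sal; field; rewrite gt_eqF.
    by under eq_fun do rewrite E; exact: cvg_cst.
  have Hsum : section_sum u (N (n + n0)%N) (Delta (n + n0)%N) (gn n) (T n) (s (n + n0)%N) v @[n --> \oo] -->
      \sum_i u i * (if 0 < v < t i then phi eta else 0).
    apply: cvg_big => [|i _]; first exact: add_continuous.
    apply: cvgMr.
    exact: (@grid_count_cvg_small_scale R (fun n => N (n + n0)%N i) (fun n => Delta (n + n0)%N) T (fun n => s (n + n0)%N)
      gn (t i) (phi eta) v Dgt Tgt sgt gn0 Ds (Nt i) gs sT0 (t0 i) v0 (vt i)).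
  have -> : ((fun v => f (phi eta * step_sum u t v)) \_ `[0, +oo[) v =
      f (\sum_i u i * (if 0 < v < t i then phi eta else 0)).
    rewrite patchE mem_setE in_itv/= andbT.
    case: ltgtP v0 => //= vv _; last first.
      by rewrite big1 ?f0// => i _; rewrite mulr0.
    congr (f _); rewrite /step_sum mulr_sumr; apply: eq_bigr => i _.
    by case: ifP => _; ring.
  exact: (cvg_comp _ f Hsum (@fc _)).
have resc n := @weighted_count_rescale _ _ _ _ ha al1 ell0 tail k0 u f (N (n + n0)%N) (\max_i N (n + n0)%N i)
  (Delta (n + n0)%N) (T n) (s (n + n0)%N) (T n)^-1 K p (fun i => leq_bigmax i) (Dgt n) (Tgt n) (sgt n) (rgt n)
  fc f0 K0 p1 fp.
have mG n : measurable_fun pos (G n).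
  by have [H _] := resc n; have /measurable_EFinP := measurable_int _ H.
have [_ TC] := section_integral_total_cvg ha al1 ell0 tail Dgt Dle Tgt sgt rgt NT c0 Lr (fun=> fc) K0 p1 pal al2
  (fun=> fp) (fun=> f2) mG Gcvg.
rewrite -(cvg_shiftn n0).
have E n : \int[leb2]_z f (weighted_count (fun k : 'I_(\max_i N (n + n0)%N i) => trawl_set_at a (k%:R * Delta (n + n0)%N))
    (fun k => \sum_i u i * (Delta (n + n0)%N / s (n + n0)%N) * (k < N (n + n0)%N i)%N%:R) z) =
    \int[leb]_(eta in pos) G n eta.
  by have [_ ->] := resc n; rewrite mulfV ?gt_eqF// mul1r.
under eq_fun do rewrite E.
suff -> : \int[leb]_(v in `[0, +oo[) Lam (step_sum u t v) = \int[leb]_(eta in pos) Ginf eta by exact: TC.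
have Lam0 : Lam 0 = 0.
  have [_ <-] := LamE 0; rewrite /Rintegral integral0_eq// => eta _.
  by rewrite mulr0 f0.
have [_ ->] := @step_sum_grid R k0 u t tau Lam Lam0 tau0 tauD tauE.
have mpos : measurable (pos : set (measurableTypeR R)) by exact: measurable_itv.
have If (j : 'I_k0) : leb.-integrable pos (EFin \o (fun eta => (tau j.+1 - tau j) * f (phi eta * step_sum u t (tau j)))).
  by apply: integrableZl_real => //; exact: (LamE _).1.
have [_ ->] := @Rintegral_sum R _ _ leb pos 'I_k0 (index_enum 'I_k0) _ mpos If.
apply: eq_bigr => j _; rewrite RintegralZl//; last exact: (LamE _).1.
by rewrite (LamE _).2.
Unshelve. all: by end_near. Qed.

End StableRegime.

(** * The regime governed by small jumps *)

Section JumpRegime.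
Context {R : realType}.
Local Notation leb := (@lebesgue_measure R).
Local Notation leb2 := (leb \x leb)%E.
Local Notation pos := (`]0, +oo[%classic : set R).
Variables (a : R -> R) (al be ell : R) (Delta : nat -> R).
Hypotheses (ha : trawl_function a) (al1 : 1 < al) (albe : al < be) (be2 : be < 2) (ell0 : 0 < ell).
Hypothesis tail : a s * s `^ al @[s --> +oo] --> ell.
Hypotheses (Delta_gt0 : forall n, 0 < Delta n) (Delta_dec : forall m n, (m <= n)%N -> Delta n <= Delta m).
Hypotheses (Delta_0 : Delta n @[n --> \oo] --> 0) (nDelta : n%:R * Delta n @[n --> \oo] --> +oo).
Variables (f : R -> R) (z K Lam : R).
Hypotheses (fc : continuous f) (f0 : f 0 = 0) (fb : forall x, `|f x| <= K * `|x| `^ be).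
Hypothesis f_lim : forall zn : nat -> R, (forall n, 0 < zn n) -> zn n @[n --> \oo] --> +oo ->
  f (z * zn n) / zn n `^ be @[n --> \oo] --> Lam.

Let T n : R := n%:R * Delta n.
Let s n : R := T n * (a (T n) * T n) `^ be^-1.

(** Here [rho = a T] and counts are divided by [T]. The remaining scale [zn = (a T * T)^(- 1 / be)]
    tends to infinity, and [zn^be] cancels the factor [T * rho]. *)
Lemma jump_regime_cvg :
  \int[leb2]_p f (weighted_count (fun k : 'I_n => trawl_set_at a (k%:R * Delta n))
    (fun k => \sum_(i < 1) z * (Delta n / s n) * (k < n)%N%:R) p) @[n --> \oo] -->
  Lam * \int[leb]_(eta in pos) \int[leb]_v overlap v (eta `^ (- al^-1)) `^ be.
Proof.
have al1' := al1; have ab' := albe; have be2' := be2; have al0 : 0 < al by lra.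
have ell0' := ell0; have be0 : 0 < be by lra.
have be1 : 1 < be by lra.
have K0 : 0 <= K by have := fb 1; rewrite normr1 powR1 mulr1; exact: le_trans.
have tailT : a (T n) * T n `^ al @[n --> \oo] --> ell by exact: (cvg_comp _ _ nDelta tail).
have [n1 _ Hn1] : \forall n \near \oo, 1 <= T n.
  by move/cvgryPge : nDelta; exact.
have [n2 _ Hn2] : \forall n \near \oo, ell / 2 < a (T n) * T n `^ al.
  by apply: (cvgr_gt _ tailT); lra.
pose n0 := (n1 + n2)%N; pose T' n := T (n + n0)%N.
have T1 n : 1 <= T' n by apply: Hn1 => /=; rewrite /n0; lia.
have Tgt n : 0 < T' n by exact: lt_le_trans (T1 n).
have Lr n : ell / 2 <= a (T' n) * T' n `^ al by apply/ltW/Hn2 => /=; rewrite /n0; lia.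
have L0 : 0 < ell / 2 by lra.
have rgt n : 0 < a (T' n).
  have : 0 < a (T' n) * T' n `^ al by exact: lt_le_trans L0 (Lr n).
  by rewrite pmulr_lgt0// powR_gt0.
have Dgt n : 0 < Delta (n + n0)%N by [].
have Dle n : Delta (n + n0)%N <= Delta 0%N by exact: Delta_dec.
have NT n (i : 'I_1) : (n + n0)%:R * Delta (n + n0)%N <= 1 * T' n by rewrite mul1r.
have sT n : T' n <= 1 * T' n by rewrite mul1r.
have Too : T' n @[n --> \oo] --> +oo by have := nDelta; rewrite -(cvg_shiftn n0).
have D0 : Delta (n + n0)%N @[n --> \oo] --> 0 by have := Delta_0; rewrite -(cvg_shiftn n0).
have tail' : a (T' n) * T' n `^ al @[n --> \oo] --> ell by exact: (cvg_comp _ _ Too tail).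
have ToV : (T' n)^-1 @[n --> \oo] --> 0 by apply/gtr0_cvgV0; [exact: nearW|exact: Too].
have aTp (q : R) : q < al -> a (T' n) * T' n `^ q @[n --> \oo] --> 0.
  move=> qal; have q0 : q - al < 0 by lra.
  have H : (a (T' n) * T' n `^ al) * T' n `^ (q - al) @[n --> \oo] --> ell * 0.
    by apply: cvgM => //; exact: (cvg_comp _ _ Too (powR_cvgy0 q0)).
  rewrite mulr0 in H; apply: cvg_trans H; apply: near_eq_cvg; near=> n.
  by rewrite -mulrA -powRD ?(gt_eqF (Tgt n)) ?implybT//; congr (_ * _ `^ _); ring.
have r0 : a (T' n) @[n --> \oo] --> 0.
  have := aTp _ al0; apply: cvg_trans; apply: near_eq_cvg; near=> n.
  by rewrite powRr0 mulr1.
have aT0 : a (T' n) * T' n @[n --> \oo] --> 0.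
  have := aTp _ al1; apply: cvg_trans; apply: near_eq_cvg; near=> n.
  by rewrite powRr1// ltW.
have Ds : Delta (n + n0)%N / T' n @[n --> \oo] --> 0.
  have H : Delta (n + n0)%N * (T' n)^-1 @[n --> \oo] --> (0 * 0 : R) by apply: cvgM.
  by rewrite mulr0 in H; exact: H.
pose w n : R := (a (T' n) * T' n) `^ be^-1.
have aTgt n : 0 < a (T' n) * T' n by rewrite mulr_gt0.
have wgt n : 0 < w n by rewrite powR_gt0.
have wbe n : w n `^ be = a (T' n) * T' n.
  by rewrite /w -powRrM mulVf ?gt_eqF// powRr1// ltW.
have w0 : w n @[n --> \oo] --> 0.
  apply/cvgr0Pnorm_le => e e0.
  have h : \forall n \near \oo, a (T' n) * T' n < e `^ be by apply: (cvgr_lt _ aT0); exact: powR_gt0.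
  near=> n; rewrite gtr0_norm//.
  have -> : e = (e `^ be) `^ be^-1 by rewrite -powRrM mulfV ?gt_eqF// powRr1// ltW.
  by apply: ge0_ler_powR; rewrite ?nnegrE ?invr_ge0 ?powR_ge0 ?(ltW be0) ?(ltW (aTgt n))//; apply: ltW; near: n; exact: h.
pose zn n : R := (w n)^-1.
have zgt n : 0 < zn n by rewrite invr_gt0.
have zoo : zn n @[n --> \oo] --> +oo.
  have zV : (zn n)^-1 @[n --> \oo] --> 0 by under eq_fun do rewrite /zn invrK.
  by apply/gtr0_cvgV0 => //; exact: nearW.
have znbe n : zn n `^ be = (a (T' n) * T' n)^-1.
  by rewrite /zn -powR_inv1 ?(ltW (wgt n))// -powRrM mulrC powRrM powR_inv1 ?powR_ge0 ?wbe.
(* Truncation at 1 turns the bound of order [be] into one of order 1 as well, which supplies the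
   exponent below [al]. *)
pose f_ n (x : R) : R := f (z * (zn n * Num.min 1 `|x|)) / zn n `^ be.
have fc' n : continuous (f_ n).
  move=> x; apply: cvgMl; apply: (cvg_comp _ f _ (@fc _)).
  apply: cvgMr; apply: cvgMr.
  apply: (@continuous_min R R (cst 1) (fun x => `|x|)); [exact: cvg_cst|exact: norm_continuous].
pose K' := K * `|z| `^ be.
have K'0 : 0 <= K' by rewrite mulr_ge0// powR_ge0.
have min0 (x : R) : 0 <= Num.min 1 `|x| by rewrite le_min ler01 normr_ge0.
have minbe (x : R) : Num.min 1 `|x| `^ be <= Num.min 1 `|x|.
  have [->|x0] := eqVneq x 0; first by rewrite normr0 min_r// powR0// gt_eqF.
  have m0 : 0 < Num.min 1 `|x| by rewrite lt_min ltr01 normr_gt0.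
  rewrite -[leRHS]powRr1 ?(ltW m0)// ger_powR ?(ltW be1)//.
  by rewrite m0 ge_min lexx.
have fmin n x : `|f_ n x| <= K' * Num.min 1 `|x| `^ be.
  rewrite normrM normfV (ger0_norm (powR_ge0 _ _)) ler_pdivrMr ?powR_gt0//.
  apply: (le_trans (fb _)); rewrite !normrM (gtr0_norm (zgt n)) (ger0_norm (min0 x)).
  rewrite !powRM ?normr_ge0 ?mulr_ge0 ?(ltW (zgt n))// /K'.
  by rewrite le_eqVlt; apply/orP; left; apply/eqP; ring.
have fq n x : `|f_ n x| <= K' * `|x| `^ be.
  apply: le_trans (fmin n x) _; apply: ler_wpM2l => //.
  by apply: ge0_ler_powR; rewrite ?nnegrE ?(ltW be0)// ge_min lexx orbT.
have fp n x : `|f_ n x| <= K' * `|x| `^ 1.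
  apply: le_trans (fmin n x) _; apply: ler_wpM2l => //; rewrite powRr1//.
  by apply: le_trans (minbe x) _; rewrite ge_min lexx orbT.
have f_0 n : f_ n 0 = 0 by rewrite /f_ normr0 min_r// !mulr0 f0 mul0r.
pose phi (eta : R) : R := eta `^ (- al^-1).
pose u1 (i : 'I_1) : R := 1.
pose N n (i : 'I_1) : nat := (n + n0)%N.
pose G n (eta : R) : R := section_integral a u1 (f_ n) (N n) (Delta (n + n0)%N) (T' n) (T' n) (a (T' n) * eta).
pose Ginf (eta : R) : R := \int[leb]_v (Lam * overlap v (phi eta) `^ be).
have Gcvg (eta : R) : 0 < eta -> G n eta @[n --> \oo] --> Ginf eta.
  move=> e0; have p0 : 0 < phi eta by exact: powR_gt0.
  apply: (section_integral_cvg (t := fun=> 1) ha al1 ell0 tail Dgt Dle Tgt Tgt rgt NT L0 Lr sT fc' K'0 (lexx 1) fp e0 r0).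
    apply: measurable_funM => //; apply: (measurableT_comp (measurable_powR be)).
    exact: measurable_overlap.
  apply: aeW => v /=.
  set gn := fun n => trawl_inverse a (a (T' n) * eta).
  have gn0 : \forall n \near \oo, 0 <= gn n.
    have H : a (T' n) * eta @[n --> \oo] --> 0 * eta by apply: cvgMl.
    rewrite mul0r in H.
    have a0 := trawl_at0_gt0 ha ell0 tail.
    have h : \forall n \near \oo, a (T' n) * eta < a 0 by apply: (cvgr_lt _ H).
    near=> n.
    by apply: (trawl_inverse_ge0 ha al1 ell0 tail); rewrite mulr_gt0//=; apply: ltW; near: n; exact: h.
  have gs : gn n / T' n @[n --> \oo] --> phi eta.
    apply: (trawl_inverse_cvg ha al1 ell0 tail p0 _ Too); first by move=> n; rewrite mulr_gt0.
    have -> : ell / phi eta `^ al = ell * eta.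
      by rewrite /phi -powRrM mulNr mulVf ?gt_eqF// powR_inv1 ?ltW// invrK.
    have H : a (T' n) * T' n `^ al * eta @[n --> \oo] --> ell * eta by apply: cvgMl.
    by apply: cvg_trans H; apply: near_eq_cvg; near=> n; ring.
  have Nt : (n + n0)%:R * Delta (n + n0)%N / T' n @[n --> \oo] --> (1 : R).
    have E n : (n + n0)%:R * Delta (n + n0)%N / T' n = 1 by apply: divff; rewrite gt_eqF// Tgt.
    by under eq_fun do rewrite E; exact: cvg_cst.
  have Hcnt := @grid_count_cvg_same_scale R (fun n => n + n0)%N (fun n => Delta (n + n0)%N) T' T'
      gn 1 (phi eta) v Dgt Tgt Tgt gn0 Ds Nt gs (fun=> erefl).
  pose x n : R := section_sum u1 (N n) (Delta (n + n0)%N) (gn n) (T' n) (T' n) v.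
  have xE n : x n = Delta (n + n0)%N * grid_count (n + n0) (Delta (n + n0)%N) (gn n) (T' n * v) / T' n.
    by rewrite /x /section_sum big_ord1 mul1r.
  pose o := overlap v (phi eta).
  have o0 : 0 <= o by apply: overlap_ge0; exact: ltW.
  have o1 : o <= 1 := overlap_le1 _ _.
  have xo : x n @[n --> \oo] --> o by under eq_fun do rewrite xE.
  pose y n : R := Num.min 1 `|x n|.
  have yo : y n @[n --> \oo] --> o.
    have -> : o = Num.min 1 `|o| by rewrite ger0_norm// min_r.
    apply: (@cvg_comp _ _ _ x (fun x => Num.min 1 `|x|)); first exact: xo.
    apply: (@continuous_min R R (cst 1) (fun x => `|x|)); [exact: cvg_cst|exact: norm_continuous].
  (* Without overlap the arguments of [f] need not tend to infinity, and the power bound takes the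
     place of [f_lim]. *)
  have [oz|op] := eqVneq o 0.
    have -> : Lam * overlap v (phi eta) `^ be = 0 by rewrite -/o oz powR0 ?mulr0// gt_eqF.
    apply/norm_cvg0P; apply: (@squeeze_cvgr _ _ _ _ (cst 0) (fun n => K' * y n)); [|exact: cvg_cst|].
      apply: nearW => n; rewrite normr_ge0/=; apply: le_trans (fmin n _) _; exact: ler_wpM2l.
    by rewrite -(mulr0 K') -oz; apply: cvgMr.
  have {}op : 0 < o by rewrite lt_neqAle eq_sym op.
  (* The value 1 replaces a vanishing [y n], since [f_lim] asks for positive terms throughout;
     eventually [y n] is positive. *)
  pose wn n : R := zn n * (if 0 < y n then y n else 1).
  have wn0 n : 0 < wn n by rewrite mulr_gt0//; case: ifP.
  have ypos : \forall n \near \oo, o / 2 < y n by apply: (cvgr_gt _ yo); lra.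
  have wnoo : wn n @[n --> \oo] --> +oo.
    have H : o / 2 * zn n @[n --> \oo] --> +oo.
      by apply: (cvg_comp zn (fun r => o / 2 * r) zoo); apply: gt0_cvgMry => //; lra.
    apply: ger_cvgy H; near=> n; rewrite mulrC ler_pM2l//.
    have h : o / 2 < y n by near: n; exact: ypos.
    by case: ifP => _; lra.
  have HL := f_lim wn0 wnoo.
  have Hy : y n `^ be @[n --> \oo] --> o `^ be by exact: (cvg_comp _ _ yo (continuous_powR_gt0 op)).
  have H : f (z * wn n) / wn n `^ be * y n `^ be @[n --> \oo] --> Lam * o `^ be by apply: cvgM.
  apply: cvg_trans H; apply: near_eq_cvg; near=> n.
  have h : o / 2 < y n by near: n; exact: ypos.
  have yn : 0 < y n by lra.
  rewrite /f_ -/(x n) -/(y n) /wn yn powRM ?ltW//.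
  by field; rewrite !gt_eqF ?powR_gt0.
have resc n := @weighted_count_rescale _ _ _ _ ha al1 ell0 tail 1 u1 (f_ n) (N n) (n + n0)%N
  (Delta (n + n0)%N) (T' n) (T' n) (a (T' n)) K' 1 (fun i => leqnn _) (Dgt n) (Tgt n) (Tgt n) (rgt n)
  (fc' n) (f_0 n) K'0 (lexx 1) (fp n).
have mG n : measurable_fun pos (G n).
  by have [H _] := resc n; have /measurable_EFinP := measurable_int _ H.
have [_ TC] := section_integral_total_cvg (t := fun=> 1) ha al1 ell0 tail Dgt Dle Tgt Tgt rgt NT L0 Lr fc' K'0 (lexx 1) al1 albe
  fp fq mG Gcvg.
rewrite -(cvg_shiftn n0).
pose A n (k : 'I_(n + n0)) := trawl_set_at a (k%:R * Delta (n + n0)%N).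
have fA n k : fin_borel (A n k) by exact: (trawl_set_at_borel ha al1 ell0 tail).
have E n : \int[leb2]_p f (weighted_count (A n)
    (fun k => \sum_(i < 1) z * (Delta (n + n0)%N / s (n + n0)%N) * (k < n + n0)%N%:R) p) =
    \int[leb]_(eta in pos) G n eta.
  pose th1 (k : 'I_(n + n0)) : R := \sum_(i < 1) u1 i * (Delta (n + n0)%N / T' n) * (k < n + n0)%N%:R.
  (* There are [n + n0] sets of weight [Delta / T] each, of total weight 1: the truncation in [f_]
     does not alter the actual count. *)
  have wc1 p : 0 <= weighted_count (A n) th1 p <= 1.
    rewrite /weighted_count; apply/andP; split.
      apply: sumr_ge0 => k _; rewrite mulr_ge0//.
      by rewrite /th1 big_ord1 /u1 mul1r ltn_ord mulr1 divr_ge0// ltW.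
    apply: (@le_trans _ _ (\sum_(k < n + n0) Delta (n + n0)%N / T' n)); last first.
      rewrite sumr_const card_ord -[leLHS]mulr_natl mulrA divff// gt_eqF//; exact: Tgt.
    apply: ler_sum => k _; rewrite /th1 big_ord1 /u1 mul1r ltn_ord mulr1 indicE.
    by rewrite ler_piMr ?divr_ge0 ?(ltW (Tgt n)) ?(ltW (Dgt n))// lern1 leq_b1.
  have e1 p : f (weighted_count (A n)
      (fun k => \sum_(i < 1) z * (Delta (n + n0)%N / s (n + n0)%N) * (k < n + n0)%N%:R) p) =
      zn n `^ be * f_ n (weighted_count (A n) th1 p).
    have /andP[h0 h1] := wc1 p.
    rewrite /f_ (ger0_norm h0) (min_r h1) [RHS]mulrC divfK ?gt_eqF ?powR_gt0//; congr (f _).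
    rewrite /weighted_count !mulr_sumr; apply: eq_bigr => k _; rewrite /th1 !big_ord1 /u1 mul1r.
    rewrite /s -/(T' n) -/(w n) /zn invfM; ring.
  under eq_Rintegral do rewrite e1.
  have [I1 _] := weighted_count_integral th1 (fA n) (f_0 n).
  rewrite RintegralZl//; have [_] := resc n; rewrite -/th1 => ->.
  by rewrite znbe (mulrC (T' n)) mulrA mulVf ?mul1r ?gt_eqF.
under eq_fun do rewrite E.
suff -> : Lam * \int[leb]_(eta in pos) \int[leb]_v overlap v (eta `^ (- al^-1)) `^ be =
  \int[leb]_(eta in pos) Ginf eta by exact: TC.
have mpos : measurable (pos : set (measurableTypeR R)) by exact: measurable_itv.
have [Io _] := overlap_integral al1 albe be2.
rewrite -RintegralZl//; apply: eq_Rintegral => eta _.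
by rewrite /Ginf RintegralZl//; exact: (overlap_integrable al1 albe (powR_ge0 _ _)).
Unshelve. all: by end_near. Qed.

End JumpRegime.

Lemma ecf_cexp_cvg {R : realType} d (T : measurableType d) (P : probability T R)
    d' (T' : measurableType d') (Q : probability T' R) (X : nat -> T -> R) (Y : T' -> R)
    (c th : nat -> R) (c0 th0 : R) :
  (forall n, ecf P (X n) = cexp ((c n) +i* (th n))%C) -> ecf Q Y = cexp (c0 +i* th0)%C ->
  c n @[n --> \oo] --> c0 -> th n @[n --> \oo] --> th0 ->
  \int[P]_w cos (X n w) @[n --> \oo] --> \int[Q]_w cos (Y w) /\
  \int[P]_w sin (X n w) @[n --> \oo] --> \int[Q]_w sin (Y w).
Proof.
move=> EX EY cc cth.
have ce : expR (c n) @[n --> \oo] --> expR c0 by exact: (cvg_comp _ _ cc (@continuous_expR R c0)).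
have ccos : cos (th n) @[n --> \oo] --> cos th0 by exact: (cvg_comp _ _ cth (@continuous_cos R th0)).
have csin : sin (th n) @[n --> \oo] --> sin th0 by exact: (cvg_comp _ _ cth (@continuous_sin R th0)).
have [YC YS] : \int[Q]_w cos (Y w) = expR c0 * cos th0 /\ \int[Q]_w sin (Y w) = expR c0 * sin th0.
  by move: EY; rewrite /ecf cexpE => -[].
have XE n : \int[P]_w cos (X n w) = expR (c n) * cos (th n) /\ \int[P]_w sin (X n w) = expR (c n) * sin (th n).
  by move: (EX n); rewrite /ecf cexpE => -[].
rewrite YC YS; split.
  by under eq_fun do rewrite (XE _).1; exact: cvgM.
by under eq_fun do rewrite (XE _).2; exact: cvgM.
Qed.

Section PowerContinuity.
Context {R : realType}.
Variable p : R.
Hypothesis p1 : 1 < p.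

Let cpos : continuous (fun z : R => Num.max 0 z `^ p).
Proof. by move=> z; apply: is_derive_continuous (positive_power_derive z p1). Qed.

Let cneg : continuous (fun z : R => Num.max 0 (- z) `^ p).
Proof. move=> z; have H : - y @[y --> z] --> - z by apply: cvgN; exact: cvg_id.
exact: (cvg_comp _ (fun y : R => Num.max 0 y `^ p) H (@cpos (- z))). Qed.

Lemma continuous_norm_powR : continuous (fun z : R => `|z| `^ p).
Proof.
have p0 : 0 < p by exact: lt_trans p1.
have -> : (fun z : R => `|z| `^ p) = (fun z => Num.max 0 z `^ p + Num.max 0 (- z) `^ p).
  apply/funext => z; have [z0|z0] := leP 0 z.
    by rewrite ger0_norm// max_l ?oppr_le0// powR0 ?addr0 ?gt_eqF.
  by rewrite ltr0_norm// max_r ?oppr_ge0 ?(ltW z0)// powR0 ?add0r ?gt_eqF.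
by move=> z; apply: cvgD; [exact: cpos|exact: cneg].
Qed.

Lemma continuous_sg_powR : continuous (fun z : R => Num.sg z * `|z| `^ p).
Proof.
have p0 : 0 < p by exact: lt_trans p1.
have -> : (fun z : R => Num.sg z * `|z| `^ p) = (fun z => Num.max 0 z `^ p - Num.max 0 (- z) `^ p).
  apply/funext => z; have [z0|z0|<-] := ltgtP 0 z; last by rewrite sgr0 oppr0 maxxx mul0r subrr.
    by rewrite gtr0_sg// mul1r gtr0_norm// max_l ?oppr_le0 ?(ltW z0)// powR0 ?subr0 ?gt_eqF.
  by rewrite ltr0_sg// mulN1r ltr0_norm// max_r ?oppr_ge0 ?(ltW z0)// powR0 ?sub0r ?gt_eqF.
by move=> z; apply: cvgB; [exact: cpos|exact: cneg].
Qed.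

End PowerContinuity.

(** The second moment puts 2 into the set whose infimum is the index, so some admissible [b] lies
    below [al]; it is raised to 1 because the trigonometric bounds start there. *)
Lemma blumenthal_getoor_moment {R : realType} (nu : {measure set R -> \bar R}) (al : R) :
  nu.-integrable setT (EFin \o (fun x : R => x ^+ 2)) ->
  1 < al -> al < 2 -> blumenthal_getoor nu < al ->
  exists p, [/\ 1 <= p, p < al, nu.-integrable setT (EFin \o (fun x : R => `|x| `^ p)) &
    nu.-integrable setT (EFin \o (fun x : R => `|x| `^ al))].
Proof.
move=> I2 al1 al2 bal.
have [|b [b0 Hb] bl] := inf_lt _ bal.
  exists 2; split => //; pose B := [set x : R | `|x| <= 1].
  have mB : measurable B.
    rewrite [B](_ : _ = `[-1, 1]%classic); first exact: measurable_itv.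
    by apply/seteqP; split => x; rewrite /B /= in_itv/= ler_norml.
  apply: (@le_lt_trans _ _ (\int[nu]_x (x ^+ 2)%:E)%E); last first.
    have /integrableP[_] := I2; apply: le_lt_trans; apply: ge0_le_integral => //.
    - by move=> x _; rewrite lee_fin sqr_ge0.
    - exact: measurable_int I2.
    - by apply: measurableT_comp => //; exact: measurable_int I2.
    - by move=> x _; rewrite /= lee_fin ler_norm.
  have E (x : R) : `|x| `^ 2 = x ^+ 2 by rewrite powR_mulrn// real_normK ?num_real.
  under eq_integral do rewrite E.
  apply: ge0_subset_integral => //; first exact: measurable_int I2.
  by move=> x _; rewrite lee_fin sqr_ge0.
have pm (q : R) : b <= q -> q <= 2 -> nu.-integrable setT (EFin \o (fun x : R => `|x| `^ q)).
  exact: (power_moment I2 Hb b0).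
exists (Num.max b 1); split.
- by rewrite le_max lexx orbT.
- by rewrite gt_max bl.
- by apply: pm; rewrite ?le_max ?lexx// ge_max ler1n andbT (le_trans (ltW bl))// ltW.
- by apply: pm; exact: ltW.
Qed.

(** Both sides are the same rational function of [al] and [be] once the power integrals are
    evaluated; the point 0 is removed to expand the product of powers. *)
Lemma rho_constant {R : realType} (al be : R) : 1 < al -> al < be -> be < 2 ->
  (al - 1)^-1 + al * (\int[lebesgue_measure]_(s in `[0, 1]) ((1 - s) * s `^ (be - al - 1))) +
    2 * (\int[lebesgue_measure]_(s in `[0, 1]) (s `^ (be - al))) =
  be / (be - al) + be * (al / (al - 1) - 2) / (be - al + 1) :> R.
Proof.
move=> al1 ab be2.
have m01 : measurable (`]0, 1]%classic : set (measurableTypeR R)) by exact: measurable_itv.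
have h1 : - 1 < be - al - 1 by lra.
have h2 : - 1 < be - al by lra.
have [Ia Ea] := integral_powR_0b h1 (@ltr01 R); have [Ib Eb] := integral_powR_0b h2 (@ltr01 R).
have E (g : R -> R) : lebesgue_measure.-integrable `]0, 1] (EFin \o g) ->
    \int[lebesgue_measure]_(s in `[0, 1]) g s = \int[lebesgue_measure]_(s in `]0, 1]) g s.
  move=> Ig; rewrite /Rintegral; congr fine; apply: esym; apply: integral_itv_obnd_cbnd.
  exact: measurable_int Ig.
have e (s : R) : `]0, 1]%classic s -> s `^ (be - al - 1) - s `^ (be - al) = (1 - s) * s `^ (be - al - 1).
  rewrite /= in_itv/= => /andP[s0 _].
  have -> : s `^ (be - al) = s `^ (be - al - 1) * s.
    by rewrite -[X in _ * X](powRr1 (ltW s0)) -powRD ?(gt_eqF s0) ?implybT// subrK.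
  by ring.
have Iab := integrableB_real m01 Ia Ib.
have Ic : lebesgue_measure.-integrable `]0, 1] (EFin \o (fun s : R => (1 - s) * s `^ (be - al - 1))).
  by apply: eq_integrable Iab => // s; rewrite inE => /e /= ->.
rewrite E// E// Eb.
have -> : \int[lebesgue_measure]_(s in `]0, 1]) ((1 - s) * s `^ (be - al - 1)) =
    \int[lebesgue_measure]_(s in `]0, 1]) (s `^ (be - al - 1) - s `^ (be - al)).
  by apply: eq_Rintegral => s; rewrite inE => /e ->.
rewrite RintegralB// Ea Eb !powR1 subrK.
have d0 : 0 < be - al by rewrite subr_gt0.
have d1 : 0 < be - al + 1 by exact: addr_gt0.
by field; rewrite !gt_eqF// subr_gt0.
Qed.

Theorem theorem4 (R : realType)
  (d : measure_display) (T : measurableType d) (P : probability T R)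
  (gamma b : R) (nu : {measure set R -> \bar R})
  (L : set (R * R) -> {RV P >-> R})
  (d0 : measure_display) (T0 : measurableType d0) (P0 : probability T0 R)
  (seed : {RV P0 >-> R})
  (a a' : R -> R) (kappa c_a : R) (Delta : nat -> R)
  (hL : levy_basis gamma b nu L)
  (hnu : nu setT <> 0%E)
  (hseed : has_log_charfun P0 seed (levy_exponent gamma b nu))
  (ha : trawl_function a)
  (hkappa : 2 < kappa < 3)
  (hca : 0 < c_a)
  (ha'_gt0 : forall y : R, 0 <= y -> 0 < a' y)
  (ha'_cont : {within `[0, +oo[, continuous a'})
  (ha'_lim : y `^ kappa * a' y @[y --> +oo] --> c_a)
  (ha_a' : forall s : R, 0 <= s ->
     (a s)%:E = (\int[lebesgue_measure]_(y in `[s, +oo[) (a' y)%:E)%E)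
  (hb : b = 0)
  (hseed2 : ('E_P0[fun w => (`|seed w| ^+ 2)%R] < +oo)%E)
  (hDelta_gt0 : forall n, 0 < Delta n)
  (hDelta_dec : forall m n, (m <= n)%N -> Delta n <= Delta m)
  (hDelta_0 : Delta n @[n --> \oo] --> 0)
  (hnDelta : n%:R * Delta n @[n --> \oo] --> +oo) :
  let beta_nu := blumenthal_getoor nu in
  let S := partial_sum (trawl_process a L) Delta in
  (beta_nu < kappa - 1 ->
   let Kp := \int[nu]_(x in `]0, +oo[) (x `^ (kappa - 1)) in
   let Km := \int[nu]_(x in `]-oo, 0[) (`|x| `^ (kappa - 1)) in
   forall (d1 : measure_display) (T1 : measurableType d1)
     (Q : probability T1 R) (Y : R -> {RV Q >-> R}),
   levy_process Y ->
   has_log_charfun Q (Y 1) (stable_exponent (kappa - 1) Kp Km) ->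
   cvg_fd P Q
     (fun n t w =>
        Delta n / (c_a * n%:R * Delta n) `^ (kappa - 1)^-1 * S n t w)
     Y) /\
  (kappa - 1 < beta_nu < 2 ->
   forall Ktp Ktm : R, 0 <= Ktp -> 0 <= Ktm -> 0 < Ktp + Ktm ->
   x `^ beta_nu * fine (nu `]x, +oo[%classic) @[x --> 0^'+] --> Ktp ->
   x `^ beta_nu * fine (nu `]-oo, (- x)[%classic) @[x --> 0^'+] --> Ktm ->
   let rho_a :=
     (kappa - 2)^-1 +
     (kappa - 1) * (\int[lebesgue_measure]_(s in `[0, 1])
                      ((1 - s) * s `^ (beta_nu - kappa))) +
     2 * (\int[lebesgue_measure]_(s in `[0, 1])
                      (s `^ (beta_nu - kappa + 1))) in
   forall (d1 : measure_display) (T1 : measurableType d1)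
     (Q : probability T1 R) (xi : {RV Q >-> R}),
   has_log_charfun Q xi
     (stable_exponent beta_nu (rho_a * beta_nu * Ktp)
                              (rho_a * beta_nu * Ktm)) ->
   cvg_in_distribution P Q
     (fun n w => S n 1 w /
        (n%:R * (a (n%:R * Delta n) * (n%:R * Delta n)) `^ beta_nu^-1))
     xi).
Proof.
subst b; move=> beta_nu S.
have /andP[k2 k3] := hkappa; pose al := kappa - 1.
have al1 : 1 < al by rewrite /al; lra.
have al2 : al < 2 by rewrite /al; lra.
have al0 : 0 < al by lra.
have k1 : 1 < kappa by lra.
have hLM := levy_basis_nu hL.
have I2 := levy_measure_square_integrable hLM hseed hseed2.
have [m psiE] := levy_exponentE I2 gamma.
have tail : a s * s `^ al @[s --> +oo] --> c_a / al := trawl_tail k1 ha'_gt0 ha'_cont ha'_lim ha_a'.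
have ell0 : 0 < c_a / al by rewrite divr_gt0.
have cC := levy_C_continuous I2; have cD := levy_D_continuous I2.
have C0 := levy_C0 I2; have D0 := levy_D0 I2.
split.
- move=> bal Kp Km d1 T1 Q Y YL Y1 k t t0.
  have [p [p1 pal Ip Ial]] := blumenthal_getoor_moment I2 al1 al2 bal.
  have p2 : p <= 2 by apply: ltW; exact: lt_trans al2.
  have Kp0 : 0 <= Kp by apply: Rintegral_ge0 => // x _; exact: powR_ge0.
  have Km0 : 0 <= Km by apply: Rintegral_ge0 => // x _; exact: powR_ge0.
  pose A := Gamma (2 - al) / (al - 1) * sin ((al - 1) * (pi / 2)).
  pose B := Gamma (2 - al) / (al - 1) * cos ((al - 1) * (pi / 2)).
  pose LC (z : R) : R := A / al * (Kp + Km) * `|z| `^ al.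
  pose LD (z : R) : R := - (B / al * (Kp - Km) * (Num.sg z * `|z| `^ al)).
  have hC z := levy_C_mixture I2 hLM al1 al2 Ial z.
  have hD z := levy_D_mixture I2 hLM al1 al2 Ial z.
  have Y1' : has_log_charfun Q (Y 1) (fun z => ((- LC z) +i* LD z)%C).
    by move=> z; rewrite Y1 (stable_exponentE z al1 al2 Kp0 Km0).
  have cLC : continuous (fun z => - LC z).
    by move=> z; apply: cvgN; apply: cvgMr; exact: continuous_norm_powR.
  have cLD : continuous LD.
    by move=> z; apply: cvgN; apply: cvgMr; exact: continuous_sg_powR.
  have LC0 : LC 0 = 0 by rewrite /LC normr0 powR0 ?mulr0// gt_eqF.
  have LD0 : LD 0 = 0 by rewrite /LD sgr0 mul0r mulr0 oppr0.
  have LC0' : - LC 0 = 0 by rewrite LC0 oppr0.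
  (* One constant for the exponents [p] and 2 and for both [C] and [D]. *)
  pose M := \int[nu]_x (x ^+ 2); pose K := Num.max (2 * \int[nu]_x `|x| `^ p) M.
  have bp (f : R -> R) : (forall z, `|f z| <= 2 * \int[nu]_x `|x| `^ p * `|z| `^ p) -> forall z : R, `|f z| <= K * `|z| `^ p.
    move=> h z; apply: (le_trans (h z)); rewrite ler_wpM2r ?powR_ge0// /K le_max lexx//.
  have b2 (f : R -> R) : (forall z, `|f z| <= M * z ^+ 2) -> forall z : R, `|f z| <= K * `|z| `^ 2.
    move=> h z; apply: (le_trans (h z)); rewrite powR_mulrn// real_normK ?num_real//.
    by rewrite ler_wpM2r ?sqr_ge0// /K le_max lexx orbT.
  have bC := levy_le_powR I2 p1 p2 Ip.
  have key (u : 'I_k -> R) :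
    \int[P]_w cos (\sum_i u i * (Delta n / (c_a * n%:R * Delta n) `^ (kappa - 1)^-1 * S n (t i) w)) @[n --> \oo] -->
      \int[Q]_w cos (\sum_i u i * Y (t i) w) /\
    \int[P]_w sin (\sum_i u i * (Delta n / (c_a * n%:R * Delta n) `^ (kappa - 1)^-1 * S n (t i) w)) @[n --> \oo] -->
      \int[Q]_w sin (\sum_i u i * Y (t i) w).
    have CL := stable_regime_cvg (u := u) ha al1 al2 hca tail hDelta_gt0 hDelta_dec hDelta_0 hnDelta t0 cC C0 p1 pal
      (bp _ (fun z => (bC z).1)) (b2 _ (levy_C_le I2)) hC.
    have DL := stable_regime_cvg (u := u) ha al1 al2 hca tail hDelta_gt0 hDelta_dec hDelta_0 hnDelta t0 cD D0 p1 pal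
      (bp _ (fun z => (bC z).2)) (b2 _ (levy_D_le I2)) hD.
    have EX n := partial_sum_ecf hL I2 psiE ha al1 ell0 tail u Delta ((c_a * n%:R * Delta n) `^ (kappa - 1)^-1)
      (fun i => @leq_bigmax _ (fun i => Num.truncn (n%:R * t i)) i).
    have EY := levy_process_fdd_ecf YL cLC cLD LC0' LD0 Y1' u t0.
    apply: (ecf_cexp_cvg EX EY); last exact: DL.
    suff -> : \int[lebesgue_measure]_(v in `[0, +oo[) - LC (step_sum u t v) =
        - \int[lebesgue_measure]_(v in `[0, +oo[) LC (step_sum u t v) by apply: cvgN; exact: CL.
    have [tau [tau0 tauD tauE]] := sorted_grid t0.
    have [ILC _] := @step_sum_grid R k u t tau LC LC0 tau0 tauD tauE.
    by rewrite -mulN1r -RintegralZl//; apply: eq_Rintegral => v _; rewrite mulN1r.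
  apply: (levy_continuity (X := fun n i w => Delta n / (c_a * n%:R * Delta n) `^ (kappa - 1)^-1 * S n (t i) w)
    (Y := fun i => Y (t i))).
  + move=> n i; apply: measurable_funM => //; exact: measurable_partial_sum.
  + by move=> i.
  + by move=> u; exact: (key u).1.
  + by move=> u; exact: (key u).2.
- move=> /andP[bal b2] Ktp Ktm Ktp0 Ktm0 _ hp hm rho_a d1 T1 Q xi hxi.
  have bal' : al < beta_nu by [].
  have be1 : 1 < beta_nu by exact: lt_trans al1 bal'.
  have be0 : 0 < beta_nu by lra.
  pose A := Gamma (2 - beta_nu) / (beta_nu - 1) * sin ((beta_nu - 1) * (pi / 2)).
  pose B := Gamma (2 - beta_nu) / (beta_nu - 1) * cos ((beta_nu - 1) * (pi / 2)).
  pose O : R := beta_nu / (beta_nu - al) + beta_nu * (al / (al - 1) - 2) / (beta_nu - al + 1).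
  have rhoE : rho_a = O.
    rewrite /O -(rho_constant al1 bal' b2) /rho_a /al.
    have e1 : kappa - 1 - 1 = kappa - 2 by ring.
    have e2 : beta_nu - (kappa - 1) - 1 = beta_nu - kappa by ring.
    have e3 : beta_nu - (kappa - 1) = beta_nu - kappa + 1 by ring.
    by rewrite e1 e2 e3.
  have [_ OE] := overlap_integral al1 bal' b2.
  have O0 : 0 <= O.
    rewrite /O -OE; apply: Rintegral_ge0 => // eta _; apply: Rintegral_ge0 => // v _; exact: powR_ge0.
  have [[KC bC] LC] := levy_C_tail I2 hLM be1 b2 hp hm.
  have [[KD bD] LD] := levy_D_tail I2 hLM be1 b2 hp hm.
  pose X n w : R := S n 1 w / (n%:R * (a (n%:R * Delta n) * (n%:R * Delta n)) `^ beta_nu^-1).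
  have mX n : measurable_fun setT (X n).
    by apply: measurable_funM => //; exact: measurable_partial_sum.
  have key (z : R) : \int[P]_w cos (z * X n w) @[n --> \oo] --> \int[Q]_w cos (z * xi w) /\
      \int[P]_w sin (z * X n w) @[n --> \oo] --> \int[Q]_w sin (z * xi w).
    have CL := jump_regime_cvg ha al1 bal' b2 ell0 tail hDelta_gt0 hDelta_dec hDelta_0 hnDelta cC C0 bC (LC z).
    have DL := jump_regime_cvg ha al1 bal' b2 ell0 tail hDelta_gt0 hDelta_dec hDelta_0 hnDelta cD D0 bD (LD z).
    rewrite OE -/O in CL DL.
    (* The stated normalisation multiplied by [Delta n], since slices measure counts in units of
       time. *)
    pose s n : R := (n%:R * Delta n) * (a (n%:R * Delta n) * (n%:R * Delta n)) `^ beta_nu^-1.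
    have tn n : Num.truncn (n%:R * 1 : R) = n by rewrite mulr1 natrK.
    have Nle n (i : 'I_1) : (Num.truncn (n%:R * 1 : R) <= n)%N by rewrite tn.
    have EX n : ecf P (fun w => z * X n w) = cexp ((- \int[(lebesgue_measure \x lebesgue_measure)%E]_p levy_C nu
          (weighted_count (fun k : 'I_n => trawl_set_at a (k%:R * Delta n))
            (fun k => \sum_(i < 1) z * (Delta n / s n) * (k < n)%N%:R) p)) +i*
        (\int[(lebesgue_measure \x lebesgue_measure)%E]_p levy_D nu
          (weighted_count (fun k : 'I_n => trawl_set_at a (k%:R * Delta n))
            (fun k => \sum_(i < 1) z * (Delta n / s n) * (k < n)%N%:R) p)))%C.
      have thE : (fun k : 'I_n => \sum_(i < 1) z * (Delta n / s n) * (k < n)%N%:R) =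
          (fun k => \sum_(i < 1) z * (Delta n / s n) * (k < Num.truncn (n%:R * 1 : R))%N%:R) by rewrite tn.
      rewrite thE.
      have := partial_sum_ecf (t := fun=> 1) hL I2 psiE ha al1 ell0 tail (fun=> z) Delta (s n) (Nle n).
      move=> /= <-; congr (ecf P _); apply/funext => w; rewrite big_ord1; congr (z * _).
      rewrite /X /s [LHS]mulrC; congr (_ * _); set W := _ `^ _.
      have -> : n%:R * Delta n * W = Delta n * (n%:R * W) by ring.
      by rewrite [(Delta n * _)^-1]invfM mulrA mulfV ?mul1r// gt_eqF.
    have EY : ecf Q (fun w => z * xi w) = cexp ((- (A * (Ktp + Ktm) * `|z| `^ beta_nu * O)) +i*
        (- (B * (Ktp - Ktm) * (Num.sg z * `|z| `^ beta_nu)) * O))%C.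
      rewrite -charfun_ecf hxi stable_exponentE ?mulr_ge0 ?rhoE ?(ltW be0)//.
      (* The factor [beta_nu] in the stable parameters cancels the division by the index in
         [stable_exponentE]. *)
      have e1 (g e o p q x : R) : 0 < e -> - (g / e * (o * e * p + o * e * q) * x) = - (g * (p + q) * x * o).
        by move=> e0; field; rewrite gt_eqF.
      have e2 (g e o p q x : R) : 0 < e -> - (g / e * (o * e * p - o * e * q) * x) = - (g * (p - q) * x) * o.
        by move=> e0; field; rewrite gt_eqF.
      by rewrite (e1 _ _ _ _ _ _ be0) (e2 _ _ _ _ _ _ be0).
    apply: (ecf_cexp_cvg EX EY); last exact: DL.
    by apply: cvgN; exact: CL.
  apply: cvg_in_distribution_real => //.
  + by move=> z; exact: (key z).1.
  + by move=> z; exact: (key z).2.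
Qed.
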